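(* Let $d_1,d_2\ge 1$ be integers and let $d=\gcd(d_1,d_2)$. There is a Zariski open, dense subset $U\subset \Omega_2(d_1,d_2)$ such that for every mapping $F\in U$ the discriminant $\Delta(F)=F(C(F))\subset\mathbb{C}^2$ has only cusps and nodes as singularities, the number of cusps is equal to $$c(F)=d_1^2+d_2^2+3d_1d_2-6d_1-6d_2+7,$$ and the number of nodes is equal to $$d(F)=\frac{1}{2}\left[(d_1d_2-4)\big((d_1+d_2-2)^2-2\big)-(d-5)(d_1+d_2-2)-6\right].$$
   Context: $\Omega_2(d_1,d_2)$ is the affine space of polynomial mappings $F=(f,g):\mathbb{C}^2\to\mathbb{C}^2$ with $\deg f\le d_1$, $\deg g\le d_2$. $C(F)=\{f_xg_y-f_yg_x=0\}\subset\mathbb{C}^2$ is the set of critical points of $F$. Cusps of the plane curve $\Delta(F)$ are ordinary (simple) cusps, i.e. points where the curve germ is analytically equivalent to $\{u^2=v^3\}$ at $0$; nodes are points where the curve has exactly two branches, both smooth and meeting transversally. The singularities here are those of the affine curve $\Delta(F)$, not points at infinity. *)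

(* Defs.v *)
From HB Require Import structures.
From mathcomp Require Import all_boot all_order all_algebra.
From mathcomp Require Import all_classical all_reals all_analysis.
From mathcomp Require Import complex.
From mathcomp Require Import -(notations) mpoly.

Set Implicit Arguments.
Unset Strict Implicit.
Unset Printing Implicit Defensive.

Import Order.TTheory GRing.Theory Num.Theory.
Import numFieldNormedType.Exports.

Local Open Scope classical_set_scope.
Local Open Scope ring_scope.

(* Packaging R[i] as a numClosedFieldType makes the norm topology that
   MathComp-Analysis puts on every numFieldType available on it. *)
Definition Cplx (R : realType) : numClosedFieldType := R[i].

(* C^2 as a normed C-module: [differentiable] on it is C-differentiability. *)
Notation plane R := (Cplx R * Cplx R)%type.

(* Polynomials over C in n variables.  mpoly is imported without its
   notations, which clash with those of MathComp-Analysis. *)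
Notation cpoly R n := (mpoly.mpoly n (Cplx R)).

Section PolynomialMappings.
Variable R : realType.
Local Notation C := (Cplx R).

Definition peval (f : cpoly R 2) (p : plane R) : C :=
  mpoly.meval (fun i : 'I_2 => if i == ord0 then p.1 else p.2) f.

Definition polymap := (cpoly R 2 * cpoly R 2)%type.

Definition pmap_eval (F : polymap) (p : plane R) : plane R :=
  (peval F.1 p, peval F.2 p).

(* msize is 1 + the total degree, and 0 for the zero polynomial. *)
Definition Omega2 (d1 d2 : nat) : set polymap :=
  [set F | (mpoly.msize F.1 <= d1.+1)%N /\ (mpoly.msize F.2 <= d2.+1)%N].

Definition jacobian_det (F : polymap) : cpoly R 2 :=
  mpoly.mderiv ord0 F.1 * mpoly.mderiv ord_max F.2
  - mpoly.mderiv ord_max F.1 * mpoly.mderiv ord0 F.2.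

Definition critical_set (F : polymap) : set (plane R) :=
  [set p | peval (jacobian_det F) p = 0].

Definition discriminant (F : polymap) : set (plane R) :=
  pmap_eval F @` critical_set F.

(* The affine coordinates of Omega2 d1 d2 are the coefficients of the monomials
   of total degree < d1.+1 in f and < d2.+1 in g. *)
Definition coef_index (d1 d2 : nat) : finType :=
  (mpoly.bmultinom 2 d1.+1 + mpoly.bmultinom 2 d2.+1)%type.

Definition coef_vector (d1 d2 : nat) (F : polymap) (i : 'I_#|coef_index d1 d2|)
    : C :=
  match enum_val i with
  | inl m => mpoly.mcoeff m F.1
  | inr m => mpoly.mcoeff m F.2
  end.

Definition zariski_closed (d1 d2 : nat) (Z : set polymap) : Prop :=
  exists S : set (cpoly R #|coef_index d1 d2|),
    Z = [set F | Omega2 d1 d2 F /\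
           forall P, S P -> mpoly.meval (@coef_vector d1 d2 F) P = 0].

Definition zariski_open (d1 d2 : nat) (U : set polymap) : Prop :=
  U `<=` Omega2 d1 d2 /\ zariski_closed d1 d2 (Omega2 d1 d2 `\` U).

Definition zariski_dense (d1 d2 : nat) (U : set polymap) : Prop :=
  forall W, zariski_open d1 d2 W -> W !=set0 -> (U `&` W) !=set0.

End PolynomialMappings.

Section PlaneCurves.
Variable R : realType.
Local Notation C := (Cplx R).
Implicit Types (X B : set (plane R)) (p : plane R).

(* The curve may be empty: h is allowed to be a nonzero constant. *)
Definition plane_curve X : Prop :=
  exists h : cpoly R 2, h != 0 /\ X = [set p | peval h p = 0].

Definition holomorphic_near (V W : normedModType C) (f : V -> W) (x : V) :
    Prop :=
  \forall z \near x, differentiable f z.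

(* The germ of X at p is a one-dimensional complex submanifold, with local
   equation h = 0 and tangent line the kernel of 'd h p. *)
Definition smooth_equation X p (h : plane R -> C) : Prop :=
  [/\ holomorphic_near h p,
      h p = 0,
      (exists v : plane R, 'd h p v != 0) &
      \forall z \near p, X z <-> h z = 0].

Definition smooth_point X p : Prop := exists h, smooth_equation X p h.

(* B1 and B2 are the two branches of X at p; their tangent lines meet only
   at 0. *)
Definition node X p : Prop :=
  exists B1 B2 h1 h2,
    [/\ smooth_equation B1 p h1,
        smooth_equation B2 p h2,
        (forall v : plane R, 'd h1 p v = 0 -> 'd h2 p v = 0 -> v = 0) &
        \forall z \near p, X z <-> B1 z \/ B2 z].

(* The germs (X, p) and (Y, q) correspond under a germ of biholomorphism phi,
   with inverse psi. *)
Definition analytically_equivalent X p (Y : set (plane R)) (q : plane R) :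
    Prop :=
  exists phi psi : plane R -> plane R,
    [/\ holomorphic_near phi p /\ holomorphic_near psi q,
        phi p = q /\ psi q = p,
        (\forall z \near p, psi (phi z) = z),
        (\forall w \near q, phi (psi w) = w) &
        \forall z \near p, X z <-> Y (phi z)].

Definition cusp X p : Prop :=
  analytically_equivalent X p [set w | w.1 ^+ 2 = w.2 ^+ 3] 0.

End PlaneCurves.

Definition cusp_number (d1 d2 : nat) : rat :=
  d1%:R ^+ 2 + d2%:R ^+ 2 + 3 * d1%:R * d2%:R - 6 * d1%:R - 6 * d2%:R + 7.

Definition node_number (d1 d2 : nat) : rat :=
  2^-1 * ((d1%:R * d2%:R - 4) * ((d1%:R + d2%:R - 2) ^+ 2 - 2)
          - ((gcdn d1 d2)%:R - 5) * (d1%:R + d2%:R - 2) - 6).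

(* Main.v *)
(* For F = (f, g) outside a hypersurface of the coefficient space, the critical
  curve J = f_x g_y - f_y g_x = 0 is smooth and transverse to the line at
  infinity, F is an immersion of it except at finitely many points where its
  jet is that of t |-> (t^2, t^3), and it is injective up to finitely many
  transverse double points.  Each failure is a family of linear conditions on
  the coefficients, one more than the parameters (points of the plane) on which
  they depend; independence is witnessed by explicit test polynomials.
  The discriminant is the zero set of h, the characteristic polynomial of
  multiplication by g on C[x, y] / (J), which is free over C[f].  Bezout on J = 0
  counts the cusps as zeros of the derivatives of f and g along J; the nodes
  follow by comparing this with the total order of h_y(f, g) on J = 0, whose
  behaviour at infinity depends on the top forms through gcd(d1, d2).
  At a node h splits by a square root of its discriminant; at a cusp h = 0 is
  w1^2 = w2^3 in polynomial coordinates, inverted by minimizing |F - w|^2.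
  Smooth points, nodes and cusps exclude each other by their tangent lines and
  because a loop winding once around 0 has no closed square root. *)
Require Import Defs.
From HB Require Import structures.
From mathcomp Require Import all_boot all_order all_algebra.
From mathcomp Require Import ring zify boolp spectral perm cyclic separable cyclotomic lra.
From mathcomp Require Import -(notations) mpoly.
Set Implicit Arguments.
Unset Strict Implicit.
Unset Printing Implicit Defensive.
Import Order.TTheory GRing.Theory Num.Theory.
Local Open Scope ring_scope.

(** The curve J = 0 is not parametrised: the bracket with J is a derivation tangent to it, and
    orders of vanishing are read from its iterates. Intersection numbers are orders of determinants
    of multiplication on C[x, y]/(J), so counting points becomes an identity between norms. The gcd
    d enters at infinity. With weights d1 and d2 for x and y, the part of h of highest weight is a
    constant times the d-th power of a product with one factor for each point at infinity of J = 0.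
    So h_y(f, g) contains d - 1 copies of this product, and modulo J each loses exactly one degree,
    leaving D d1 d2 - d2 - (d - 1) with D = d1 + d2 - 2. Along J = 0 the order of h_y(f, g) is one
    at a zero of T = {f, J}, plus one at a preimage of a node, plus two at a cusp. The obstacle to
    genericity is small degree: the test polynomials have degree up to 5. Exchanging f and g allows
    d1 <= d2. *)

Module Algebra.
Notation cField := numClosedFieldType.
Notation spair := surjective_pairing.

(** * Polynomials in two variables: bracket, degrees and top forms *)

Section PlanePolys.
Variable C : cField.
Local Notation P2 := (mpoly 2 C).
Implicit Types (a b : P2) (c : C) (p q : C * C).

Definition pev p a : C := meval (fun i : 'I_2 => if i == ord0 then p.1 else p.2) a.
Definition dx a : P2 := mderiv ord0 a.
Definition dy a : P2 := mderiv ord_max a.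
Definition bra a b : P2 := dx a * dy b - dy a * dx b.
Definition mx : P2 := mpolyX C (mnm1 ord0).
Definition my : P2 := mpolyX C (mnm1 ord_max).
Definition cst (c : C) : P2 := mpolyC 2 c.

Lemma pevD p a b : pev p (a + b) = pev p a + pev p b. Proof. exact: mevalD. Qed.
Lemma pevN p a : pev p (- a) = - pev p a. Proof. exact: mevalN. Qed.
Lemma pevB p a b : pev p (a - b) = pev p a - pev p b. Proof. exact: mevalB. Qed.
Lemma pevM p a b : pev p (a * b) = pev p a * pev p b. Proof. exact: mevalM. Qed.
Lemma pev0 p : pev p 0 = 0. Proof. exact: meval0. Qed.
Lemma pev1 p : pev p 1 = 1. Proof. exact: meval1. Qed.
Lemma pevC p c : pev p (cst c) = c. Proof. exact: mevalC. Qed.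
Lemma pevZ p c a : pev p (c *: a) = c * pev p a. Proof. exact: mevalZ. Qed.
Lemma pevx p : pev p mx = p.1. Proof. by rewrite /pev mevalXU. Qed.
Lemma pevy p : pev p my = p.2. Proof. by rewrite /pev mevalXU. Qed.
Lemma pevX p a n : pev p (a ^+ n) = pev p a ^+ n.
Proof. by elim: n => [|n IH]; rewrite ?pev1 // !exprS pevM IH. Qed.
Lemma pev_sum p I r (P : pred I) (F : I -> P2) :
 pev p (\sum_(i <- r | P i) F i) = \sum_(i <- r | P i) pev p (F i).
Proof. by apply: (big_morph (pev p) (pevD p) (pev0 p)). Qed.
Lemma pev_prod p I r (P : pred I) (F : I -> P2) :
 pev p (\prod_(i <- r | P i) F i) = \prod_(i <- r | P i) pev p (F i).
Proof. by apply: (big_morph (pev p) (pevM p) (pev1 p)). Qed.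
Definition pevE := (pevD, pevN, pevM, pev0, pev1, pevC, pevZ, pevx, pevy, pevX).

Lemma dxD a b : dx (a + b) = dx a + dx b. Proof. exact: mderivD. Qed.
Lemma dyD a b : dy (a + b) = dy a + dy b. Proof. exact: mderivD. Qed.
Lemma dxN a : dx (- a) = - dx a. Proof. exact: mderivN. Qed.
Lemma dyN a : dy (- a) = - dy a. Proof. exact: mderivN. Qed.
Lemma dxM a b : dx (a * b) = dx a * b + a * dx b. Proof. exact: mderivM. Qed.
Lemma dyM a b : dy (a * b) = dy a * b + a * dy b. Proof. exact: mderivM. Qed.
Lemma dxC c : dx (cst c) = 0. Proof. exact: mderivC. Qed.
Lemma dyC c : dy (cst c) = 0. Proof. exact: mderivC. Qed.
Lemma dx0 : dx 0 = 0. Proof. exact: mderiv0. Qed.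
Lemma dy0 : dy 0 = 0. Proof. exact: mderiv0. Qed.
Lemma dxZ c a : dx (c *: a) = c *: dx a. Proof. exact: mderivZ. Qed.
Lemma dyZ c a : dy (c *: a) = c *: dy a. Proof. exact: mderivZ. Qed.
Lemma cstD c1 c2 : cst (c1 + c2) = cst c1 + cst c2. Proof. exact: mpolyCD. Qed.
Lemma cstN c1 : cst (- c1) = - cst c1. Proof. exact: mpolyCN. Qed.
Lemma cstM c1 c2 : cst (c1 * c2) = cst c1 * cst c2. Proof. exact: mpolyCM. Qed.
Lemma cst0 : cst 0 = 0. Proof. exact: mpolyC0. Qed.
Lemma scale_cst c a : c *: a = cst c * a. Proof. by rewrite mul_mpolyC. Qed.
Lemma dx1 : dx 1 = 0. Proof. by rewrite dxC. Qed.
Lemma dy1 : dy 1 = 0. Proof. by rewrite dyC. Qed.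

Definition mn (i j : nat) : multinom 2 := Multinom [tuple i; j].
Lemma I2P (i : 'I_2) : i = ord0 \/ i = ord_max.
Proof. by case: i => [[|[|//]] Hi]; [left|right]; apply: val_inj. Qed.
Lemma mn0 i j : mn i j ord0 = i. Proof. by rewrite multinomE. Qed.
Lemma mn1 i j : mn i j ord_max = j. Proof. by rewrite multinomE. Qed.
Lemma mnE (m : multinom 2) : m = mn (m ord0) (m ord_max).
Proof. by apply/mnmP => i; case: (I2P i) => ->; rewrite ?mn0. Qed.
Lemma lift00 : lift ord0 (ord0 : 'I_1) = ord_max :> 'I_2. Proof. exact: val_inj. Qed.
Lemma mdeg_mn i j : mdeg (mn i j) = (i + j)%N.
Proof. by rewrite mdegE big_ord_recl big_ord1 mn0. Qed.
Lemma mdeg2 (m : multinom 2) : mdeg m = (m ord0 + m ord_max)%N.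
Proof. by rewrite {1}(mnE m) mdeg_mn. Qed.
Lemma mn_inj i j k l : mn i j = mn k l -> i = k /\ j = l.
Proof. by move=> H; move: (congr1 (fun m : multinom 2 => (m ord0, m ord_max)) H); rewrite !mn0 => -[]. Qed.

Lemma mpolyX_mn i j : mpolyX C (mn i j) = mx ^+ i * my ^+ j.
Proof.
rewrite !mpolyXn -mpolyXD; congr (mpolyX _ _); apply/mnmP => k.
rewrite mnmDE !mulmnE !mnm1E.
by case: (I2P k) => ->; rewrite ?mul1n ?addn0.
Qed.

Lemma P2_ind (Q : P2 -> Prop) :
 (forall c, Q (cst c)) -> Q mx -> Q my ->
 (forall a b, Q a -> Q b -> Q (a + b)) -> (forall a b, Q a -> Q b -> Q (a * b)) ->
 forall a, Q a.
Proof.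
move=> Qc Qx Qy QD QM a.
have QX b n : Q b -> Q (b ^+ n).
 by move=> Qb; elim: n => [|n IH]; [rewrite expr0; exact: Qc|rewrite exprS; exact: QM].
rewrite [a]mpolyE; apply: big_ind; [by rewrite -cst0; apply: Qc|exact: QD|move=> m _].
by rewrite scale_cst (mnE m) mpolyX_mn; apply: (QM) => //; apply: (QM); apply: QX.
Qed.

Lemma dxx : dx mx = 1.
Proof. by rewrite /dx mderivX mnm1E scale1r; rewrite (_ : mnm_sub _ _ = @mnm0 2) ?mpolyX0 //; apply/mnmP=> i; rewrite mnmBE subnn mnm0E. Qed.
Lemma dyy : dy my = 1.
Proof. by rewrite /dy mderivX mnm1E scale1r; rewrite (_ : mnm_sub _ _ = @mnm0 2) ?mpolyX0 //; apply/mnmP=> i; rewrite mnmBE subnn mnm0E. Qed.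
Lemma dxy : dx my = 0.
Proof. by rewrite /dx mderivX mnm1E scale0r. Qed.
Lemma dyx : dy mx = 0.
Proof. by rewrite /dy mderivX mnm1E scale0r. Qed.
Lemma dxydyx a : dx (dy a) = dy (dx a). Proof. exact: mderiv_comm. Qed.
Definition dE := (dxD, dyD, dxN, dyN, dxM, dyM, dxC, dyC, dx0, dy0, dx1, dy1, dxx, dyy, dxy, dyx).

Lemma pev_taylor1 p a : exists a1 a2, a = cst (pev p a) + (mx - cst p.1) * a1 + (my - cst p.2) * a2.
Proof.
elim/P2_ind: a => [c|||a b [a1 [a2 Ha]] [b1 [b2 Hb]]|a b [a1 [a2 Ha]] [b1 [b2 Hb]]].
- by exists 0, 0; rewrite pevC !mulr0 !addr0.
- by exists 1, 0; rewrite pevx; ring.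
- by exists 0, 1; rewrite pevy; ring.
- by exists (a1 + b1), (a2 + b2); rewrite {1}Ha {1}Hb pevD; ring.
- exists (a1 * b + cst (pev p a) * b1), (a2 * b + cst (pev p a) * b2).
 by rewrite {1}Ha 2!mulrDl {1}Hb; ring.
Qed.

Lemma braDl a b (c : P2) : bra (a + b) c = bra a c + bra b c. Proof. by rewrite /bra; ring. Qed.
Lemma braDr a b (c : P2) : bra c (a + b) = bra c a + bra c b. Proof. by rewrite /bra; ring. Qed.
Lemma braMl a b (c : P2) : bra (a * b) c = a * bra b c + bra a c * b. Proof. by rewrite /bra !dE; ring. Qed.
Lemma braMr a b (c : P2) : bra c (a * b) = a * bra c b + bra c a * b. Proof. by rewrite /bra !dE; ring. Qed.
Lemma braC a b : bra a b = - bra b a. Proof. by rewrite /bra; ring. Qed.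
Lemma braxx a : bra a a = 0. Proof. by rewrite /bra; ring. Qed.
Lemma bra_cstl k a : bra (cst k) a = 0. Proof. by rewrite /bra !dE; ring. Qed.
Lemma bra_cstr k a : bra a (cst k) = 0. Proof. by rewrite /bra !dE; ring. Qed.

(* top forms, read in the chart (1, s) *)
Definition tf (m : nat) a : {poly C} := \poly_(i < m.+1) mcoeff (mn (m - i) i) a.
(** The substitution x = T, y = s T, with T the outer variable: the power of T records total degree,
    so degrees and top forms of products are read from univariate products. *)
Definition psi a : {poly {poly C}} :=
 mmap (polyC \o polyC) (fun i : 'I_2 => if i == ord0 then 'X else 'X%:P * 'X) a.

Lemma psiD a b : psi (a + b) = psi a + psi b. Proof. exact: mmapD. Qed.
Lemma psiM a b : psi (a * b) = psi a * psi b. Proof. exact: rmorphM. Qed.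
Lemma psi0 : psi 0 = 0. Proof. exact: mmap0. Qed.

Lemma psi_coef a j : (psi a)`_j = tf j a.
Proof.
rewrite coef_sum; apply/polyP => i; rewrite coef_sum coef_poly.
transitivity (\sum_(m <- msupp a | m == mn (j - i) i) if (i < j.+1)%N then mcoeff m a else 0).
 rewrite [RHS]big_mkcond; apply: eq_bigr => m _; rewrite /mmap1 big_ord_recl big_ord1 lift00 /=.
 have -> : 'X ^+ m ord0 * ('X%:P * 'X) ^+ m ord_max = ('X ^+ m ord_max)%:P * 'X ^+ (mdeg m) :> {poly {poly C}}.
  by rewrite exprMn -polyC_exp mulrCA -exprD -mdeg2.
 have E : (('X ^+ m ord_max)%:P * 'X ^+ mdeg m : {poly {poly C}})`_j = if j == mdeg m then 'X ^+ m ord_max else 0.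
  by rewrite coefCM coefXn mulr_natr mulrb.
 rewrite coefCM E coefCM.
 case: (altP (m =P _)) => [->|Hm].
  rewrite mdeg_mn mn1; case: ltnP => Hi.
   by rewrite subnK // eqxx coefXn eqxx mulr1.
  have -> : (j == (j - i + i)%N) = false by apply/eqP; lia.
  by rewrite coef0 mulr0.
 case: eqP => [Hj|]; last by rewrite coef0 mulr0.
 rewrite coefXn; case: eqP => [Hi|]; last by rewrite mulr0.
 case/eqP: Hm; rewrite (mnE m) Hj Hi; congr mn; rewrite mdeg2; lia.
rewrite -big_filter; case: ltnP => Hi; last by rewrite big1.
rewrite big_filter big_mkcond /=; case: (boolP (mn (j-i) i \in msupp a)) => H.
 rewrite (bigD1_seq (mn (j - i) i)) //= eqxx big1 ?addr0 // => k /negbTE -> //.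
rewrite (memN_msupp_eq0 H) big1_seq // => k /andP[_ Hk]; case: eqP => // E.
by rewrite -E Hk in H.
Qed.

Lemma size_tf m a : (size (tf m a) <= m.+1)%N. Proof. exact: size_poly. Qed.
Lemma coef_tf m a i : (tf m a)`_i = if (i <= m)%N then mcoeff (mn (m - i) i) a else 0.
Proof. by rewrite coef_poly. Qed.
Lemma mcoeff_tf a m : mcoeff m a = (tf (mdeg m) a)`_(m ord_max).
Proof. by rewrite coef_tf mdeg2 leq_addl addnK -mnE. Qed.

Lemma tfD m a b : tf m (a + b) = tf m a + tf m b. Proof. by rewrite -!psi_coef psiD coefD. Qed.
Lemma tf0 m : tf m 0 = 0. Proof. by rewrite -!psi_coef psi0 coef0. Qed.
Lemma psiN a : psi (- a) = - psi a. Proof. exact: mmapN. Qed.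
Lemma tfN m a : tf m (- a) = - tf m a. Proof. by rewrite -!psi_coef psiN coefN. Qed.
Lemma tfB m a b : tf m (a - b) = tf m a - tf m b. Proof. by rewrite tfD tfN. Qed.
Lemma tf_sum m I r (P : pred I) (F : I -> P2) :
 tf m (\sum_(i <- r | P i) F i) = \sum_(i <- r | P i) tf m (F i).
Proof. by apply: (big_morph (tf m) (tfD m) (tf0 m)). Qed.
Lemma psi_inj a b : psi a = psi b -> a = b.
Proof. by move=> H; apply/mpolyP => m; rewrite !mcoeff_tf -!psi_coef H. Qed.

(* dgl m a : total degree at most m *)
Definition dgl (m : nat) a := forall j, (m < j)%N -> tf j a = 0.
Lemma dgl_msize m a : dgl m a <-> (msize a <= m.+1)%N.
Proof.
split=> [H|H j Hj].
 rewrite msizeE; apply/bigmax_leqP_seq => k Hk _; rewrite ltnS leqNgt; apply/negP => Hm.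
 by move: Hk; rewrite mcoeff_msupp mcoeff_tf H // coef0 eqxx.
apply/polyP => i; rewrite coef_tf coef0; case: ifP => // Hi; apply: memN_msupp_eq0.
apply: msize_mdeg_ge; rewrite mdeg_mn subnK //; exact: leq_trans Hj.
Qed.
Lemma dglP m a : dgl m a <-> (size (psi a) <= m.+1)%N.
Proof.
split=> [H|/leq_sizeP H j Hj]; first by apply/leq_sizeP => j Hj; rewrite psi_coef H.
by rewrite -psi_coef H.
Qed.
Lemma dgl_bound a : exists m, dgl m a.
Proof. by exists (msize a); apply/dgl_msize. Qed.
Lemma dgl_mono m n a : (m <= n)%N -> dgl m a -> dgl n a.
Proof. by move=> H Ha j Hj; apply: Ha; apply: leq_ltn_trans Hj. Qed.
Lemma dglD m a b : dgl m a -> dgl m b -> dgl m (a + b).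
Proof. by move=> Ha Hb j Hj; rewrite tfD Ha ?Hb ?addr0. Qed.
Lemma dglN m a : dgl m a -> dgl m (- a).
Proof. by move=> Ha j Hj; rewrite tfN Ha ?oppr0. Qed.
Lemma dglB m a b : dgl m a -> dgl m b -> dgl m (a - b).
Proof. by move=> Ha Hb; apply: dglD => //; apply: dglN. Qed.
Lemma dgl0 m : dgl m 0. Proof. by move=> j _; rewrite tf0. Qed.
Lemma dgl_sum m I r (P : pred I) F :
 (forall i, P i -> dgl m (F i)) -> dgl m (\sum_(i <- r | P i) F i).
Proof. by move=> H; elim/big_ind: _ => //; [exact: dgl0|exact: dglD]. Qed.
Lemma tfM m n a b : dgl m a -> dgl n b -> tf (m + n) (a * b) = tf m a * tf n b.
Proof.
move=> Ha Hb; rewrite -!psi_coef psiM coefM.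
rewrite (bigD1 (inord m)) //= inordK ?leq_addr // addKn big1 ?addr0 // => i Hi.
have [Hlt|Hle] := ltnP i m; first by rewrite [(psi b)`_ _]psi_coef Hb ?mulr0 //; lia.
rewrite psi_coef Ha ?mul0r // ltn_neqAle Hle andbT; apply: contra Hi => /eqP E.
by apply/eqP; apply: val_inj; rewrite /= inordK ?leq_addr.
Qed.
Lemma dglM m n a b : dgl m a -> dgl n b -> dgl (m + n) (a * b).
Proof.
move=> /dglP Ha /dglP Hb; apply/dglP; rewrite psiM.
by apply: leq_trans (size_polyMleq _ _) _; lia.
Qed.
Lemma dglX m a k : dgl m a -> dgl (k * m) (a ^+ k).
Proof.
move=> Ha; elim: k => [|k IH]; last by rewrite exprS; apply: dglM.
by apply/dgl_msize; rewrite msize1.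
Qed.
Lemma dgl_cst c : dgl 0 (cst c).
Proof. by apply/dgl_msize; rewrite msizeC leq_b1. Qed.
Lemma tf_cst c : tf 0 (cst c) = c%:P.
Proof.
apply/polyP => i; rewrite coef_tf coefC leqn0; case: eqP => // ->.
by rewrite mcoeffC (_ : mn _ _ == _) ?mulr1 //; apply/eqP/mnmP=> j; case: (I2P j) => ->; rewrite mnm0E.
Qed.
Lemma tfX m a k : dgl m a -> tf (k * m) (a ^+ k) = tf m a ^+ k.
Proof.
move=> Ha; elim: k => [|k IH]; first by rewrite tf_cst.
by rewrite !exprS tfM ?IH //; apply: dglX.
Qed.
Lemma dgl_mx : dgl 1 mx. Proof. by apply/dgl_msize; rewrite msizeX mdeg1. Qed.
Lemma dgl_my : dgl 1 my. Proof. by apply/dgl_msize; rewrite msizeX mdeg1. Qed.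
Lemma tf_dy m a : tf m (dy a) = (tf m.+1 a)^`().
Proof.
apply/polyP => i; rewrite coef_deriv !coef_tf ltnS; case: ifP => Hi; last by rewrite mul0rn.
rewrite mcoeff_deriv subSS; congr (mcoeff _ _ *+ _).
by apply/mnmP=> j; rewrite mnmDE mnm1E; case: (I2P j) => ->; rewrite ?addn0 ?addn1.
Qed.
(** Euler's identity for the form of degree m + 1, dehomogenised at x = 1. *)
Lemma tf_dx m a : tf m (dx a) = (m.+1)%:R *: tf m.+1 a - 'X * (tf m.+1 a)^`().
Proof.
apply/polyP => i; rewrite coefB coefZ coefXM !coef_tf.
have -> : (if i == 0%N then 0 else ((tf m.+1 a)^`())`_i.-1) = (tf m.+1 a)`_i *+ i.
 by case: i => [|i]; rewrite coef_deriv.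
rewrite coef_tf; case: (ltngtP i m.+1) => Hi.
- rewrite -ltnS Hi mcoeff_deriv mn0 mulr_natl -mulrnBr ?(ltnW Hi) // -subSn //.
 congr (mcoeff _ _ *+ _).
 by apply/mnmP=> j; rewrite mnmDE mnm1E; case: (I2P j) => ->; rewrite ?addn0 ?addn1 // subSn.
- by rewrite leqNgt (ltnW Hi) mulr0 mul0rn subrr.
- by rewrite Hi ltnn mulr_natl subrr.
Qed.
Lemma dgl_dx m a : dgl m.+1 a -> dgl m (dx a).
Proof. by move=> H j Hj; rewrite tf_dx H // deriv0 scaler0 mulr0 subrr. Qed.
Lemma dgl_dy m a : dgl m.+1 a -> dgl m (dy a).
Proof. by move=> H j Hj; rewrite tf_dy H // deriv0. Qed.
Lemma dgl_bra m n a b : dgl m.+1 a -> dgl n.+1 b -> dgl (m + n) (bra a b).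
Proof. by move=> Ha Hb; apply: dglB; apply: dglM; (apply: dgl_dx || apply: dgl_dy). Qed.
Lemma tf_bra m n a b : dgl m.+1 a -> dgl n.+1 b ->
 tf (m + n) (bra a b) = (m.+1)%:R *: tf m.+1 a * (tf n.+1 b)^`() - (tf m.+1 a)^`() * ((n.+1)%:R *: tf n.+1 b).
Proof.
move=> Ha Hb; rewrite tfB !tfM ?tf_dx ?tf_dy; try by [apply: dgl_dx| apply: dgl_dy].
by ring.
Qed.

(* the form of degree m with a given dehomogenisation *)
Definition fm (m : nat) (c : {poly C}) : P2 := \sum_(i < m.+1) c`_i *: mpolyX C (mn (m - i) i).
Lemma tf_fm m j (c : {poly C}) : (size c <= m.+1)%N -> tf j (fm m c) = if j == m then c else 0.
Proof.
move=> Hc; rewrite tf_sum; apply/polyP => i; rewrite coef_sum.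
have E (k : 'I_m.+1) : (tf j (c`_k *: mpolyX C (mn (m - k) k)))`_i = if (j == m) && (i == k :> nat) then c`_k else 0.
 rewrite coef_tf; case: ifP => Hi.
  rewrite mcoeffZ mcoeffX; case: eqP => [/mn_inj[E1 E2]|N].
   by have := ltn_ord k; rewrite mulr1 E2 eqxx => Hk; rewrite (_ : j == m) //; apply/eqP; lia.
  rewrite mulr0; case: andP => // -[/eqP Ej /eqP Ei]; case: N.
  by rewrite Ej Ei.
 by case: andP => // -[/eqP Ej /eqP Ei]; move: Hi (ltn_ord k); rewrite Ej Ei -ltnS => ->.
rewrite (eq_bigr _ (fun k _ => E k)); case: eqP => Hj /=; last by rewrite big1 // coef0.
case: (ltnP i m.+1) => Hi.
 rewrite (bigD1 (Ordinal Hi)) //= eqxx big1 ?addr0 // => k; rewrite -val_eqE eq_sym => /negbTE -> //.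
rewrite nth_default ?(leq_trans Hc) // big1 // => k _.
by case: eqP => // E1; move: (ltn_ord k); rewrite -E1 ltnNge Hi.
Qed.
Lemma dgl_fm m (c : {poly C}) : (size c <= m.+1)%N -> dgl m (fm m c).
Proof. by move=> Hc j Hj; rewrite tf_fm // gtn_eqF. Qed.
End PlanePolys.

Lemma size_polyM_le (F : fieldType) (p q : {poly F}) m k :
 (k <= m)%N -> (size p <= k.+1)%N -> (size q <= m - k)%N -> (size (p * q)%R <= m)%N.
Proof. by move=> H Hp Hq; apply: leq_trans (size_polyMleq _ _) _; lia. Qed.

(** * Graded complement of the ideal of two coprime binary forms *)

Section GradedBasis.
Variables (F : fieldType) (J0 u0 : {poly F}) (D e : nat).
Hypotheses (HJ0 : size J0 = D.+1) (Hu0 : (size u0 <= e.+1)%N) (Hcop : coprimep J0 u0).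

Definition mulband (r : {poly F}) (k m : nat) : 'M[F]_(k, m) :=
 lin1_mx (poly_rV \o r \o* rVpoly).
Lemma mul_mulband r k m v : v *m mulband r k m = poly_rV (rVpoly v * r).
Proof. by rewrite mul_rV_lin1. Qed.

(** Its row space is the degree-m part of the ideal generated by the two forms. The truncated
    subtractions make a block empty in degrees below that of its generator. *)
Definition relmx m : 'M[F]_(_, m.+1) :=
 col_mx (mulband J0 (m.+1 - D) m.+1) (mulband u0 (m.+1 - e) m.+1).

Lemma J0neq0 : J0 != 0. Proof. by rewrite -size_poly_gt0 HJ0. Qed.

Lemma sizeJb k m (v : 'rV[F]_k) : k = (m.+1 - D)%N -> (size (rVpoly v * J0)%R <= m.+1)%N.
Proof.
move=> Hk; have := size_poly k (fun k0 : nat => if insub k0 is Some i then v 0 i else 0).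
rewrite -/(rVpoly v) => Hs; have [->|Hv] := eqVneq (rVpoly v) 0; first by rewrite mul0r size_poly0.
have : (0 < size (rVpoly v))%N by rewrite size_poly_gt0.
rewrite mulrC => H; apply: (@size_polyM_le _ _ _ _ D); rewrite ?HJ0; lia.
Qed.
Lemma sizeub k m (v : 'rV[F]_k) : k = (m.+1 - e)%N -> (size (rVpoly v * u0)%R <= m.+1)%N.
Proof.
move=> Hk; have := size_poly k (fun k0 => if insub k0 is Some i then v 0 i else 0).
rewrite -/(rVpoly v) => Hs; have [->|Hv] := eqVneq (rVpoly v) 0; first by rewrite mul0r size_poly0.
have : (0 < size (rVpoly v))%N by rewrite size_poly_gt0.
rewrite mulrC => H; apply: (@size_polyM_le _ _ _ _ e); lia.
Qed.
Lemma size_rVpoly k (v : 'rV[F]_k) : (size (rVpoly v) <= k)%N.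
Proof. exact: size_poly. Qed.

Lemma relmx_mul m v w :
 rVpoly (row_mx v w *m relmx m) = rVpoly v * J0 + rVpoly w * u0.
Proof.
rewrite mul_row_col !mul_mulband linearD /= !poly_rV_K //; first exact: sizeub.
exact: sizeJb.
Qed.

(** Coprimality makes J0 divide the cofactor of u0, whose degree is below D in this range: the first
    syzygy between the forms is in degree D + e. *)
Lemma relmx_free m : (m < D + e)%N -> row_free (relmx m).
Proof.
move=> Hm; apply: inj_row_free => z; rewrite -[z]hsubmxK => Hz.
have := relmx_mul (lsubmx z) (rsubmx z); rewrite Hz linear0 => /esym H.
have Hw0 : rVpoly (rsubmx z) = 0.
 apply/eqP; apply/negPn/negP => Hw.
 have : (J0 %| rVpoly (rsubmx z)).
  rewrite -(Gauss_dvdpl _ Hcop); apply/dvdpP; exists (- rVpoly (lsubmx z)).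
  by apply/eqP; rewrite mulNr -subr_eq0 opprK addrC; apply/eqP.
 move/(dvdp_leq Hw); rewrite HJ0 => H1.
 by have := leq_trans H1 (size_rVpoly _); lia.
have Hv0 : rVpoly (lsubmx z) = 0.
 by move: H; rewrite Hw0 mul0r addr0 => /eqP; rewrite mulf_eq0 (negbTE J0neq0) orbF => /eqP.
by rewrite -[lsubmx z]rVpolyK -[rsubmx z]rVpolyK Hv0 Hw0 !linear0 row_mx0.
Qed.

(** A Bezout identity writes any form in the ideal. Reducing the cofactor of u0 modulo J0 keeps it
    below degree D, and this bounds the other cofactor. *)
Lemma relmx_full m : (D + e <= m.+1)%N -> row_full (relmx m).
Proof.
move=> Hm; rewrite -sub1mx; apply/row_subP => i; set r := row i _.
have [[s t] /= Hst] := Bezout_eq1_coprimepP _ _ Hcop.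
pose b' : {poly F} := (rVpoly r * t) %% J0.
have Hb' : (size b' <= D)%N by rewrite -ltnS -HJ0 ltn_modp J0neq0.
pose b : {poly F} := (rVpoly r * t) %/ J0 * u0 + rVpoly r * s.
have Hr : rVpoly r = b * J0 + b' * u0.
 have E := divp_eq (rVpoly r * t) J0; rewrite -/b' in E.
 rewrite -[LHS]mulr1 -Hst /b mulrDr [_ * (t * u0)]mulrA [X in _ + X = _](congr1 (fun z => z * u0) E); ring.
have Hb : (size b <= m.+1 - D)%N.
 have [->|Hb0] := eqVneq b 0; first by rewrite size_poly0.
 have E : b * J0 = rVpoly r - b' * u0 by rewrite Hr addrK.
 have H1 : (size (b * J0)%R <= m.+1)%N.
  rewrite E; apply: leq_trans (size_polyD _ _) _; rewrite geq_max size_rVpoly size_polyN /=.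
  rewrite mulrC; apply: (@size_polyM_le _ _ _ _ e) => //; [lia|apply: leq_trans Hb' _; lia].
 move: H1; rewrite size_mul ?J0neq0 // HJ0 addnS => H1; rewrite leq_subRL ?[(D + _)%N]addnC //; apply: leq_trans Hm; exact: leq_addr.
apply/submxP; exists (row_mx (poly_rV b) (poly_rV b')).
apply: (can_inj (@rVpolyK F m.+1)).
rewrite relmx_mul !poly_rV_K //; apply: leq_trans Hb' _; lia.
Qed.

Definition gr_rank m := \rank (relmx m)^C%MS.
Definition gr_basis m : 'M[F]_(gr_rank m, m.+1) := row_base (relmx m)^C%MS.
Definition gr_vec m (i : 'I_(gr_rank m)) : {poly F} := rVpoly (row i (gr_basis m)).

Lemma gr_rankE m : gr_rank m = (if m < D + e then m.+1 - (m.+1 - D) - (m.+1 - e) else 0)%N.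
Proof.
rewrite /gr_rank mxrank_compl; case: ltnP => Hm.
 by move/eqP: (relmx_free Hm) => ->; rewrite subnDA.
have /eqP -> : row_full (relmx m) by apply: relmx_full; lia.
by rewrite subnn.
Qed.

Lemma rVpoly_mul m k x (B : 'M[F]_(k, m)) :
 rVpoly (x *m B) = \sum_i x 0 i *: rVpoly (row i B).
Proof. by rewrite mulmx_sum_row linear_sum; apply: eq_bigr => i _; rewrite linearZ. Qed.

Lemma gr_span m (c : {poly F}) : (size c <= m.+1)%N ->
 exists (x : 'I_(gr_rank m) -> F) (b b' : {poly F}),
 [/\ (size b <= m.+1 - D)%N, (size b' <= m.+1 - e)%N &
  c = \sum_i x i *: gr_vec i + J0 * b + u0 * b'].
Proof.
move=> Hc; have : (poly_rV c <= relmx m + (relmx m)^C)%MS.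
 by apply: submx_full; apply: addsmx_compl_full.
move/sub_addsmxP => [[z y] /= Hzy].
have : (y *m (relmx m)^C <= gr_basis m)%MS by rewrite eq_row_base submxMl.
move/submxP => [x Hx].
exists (x 0), (rVpoly (lsubmx z)), (rVpoly (rsubmx z)); split; try exact: size_rVpoly.
rewrite -(poly_rV_K Hc) Hzy linearD /= Hx -{1}[z]hsubmxK relmx_mul rVpoly_mul.
by rewrite addrC addrA; congr (_ + _ + _); rewrite mulrC.
Qed.

Lemma gr_indep m (x : 'I_(gr_rank m) -> F) (b b' : {poly F}) :
 (size b <= m.+1 - D)%N -> (size b' <= m.+1 - e)%N ->
 \sum_i x i *: gr_vec i = J0 * b + u0 * b' -> forall i, x i = 0.
Proof.
move=> Hb Hb' H.
have E : (\row_i x i) *m gr_basis m = row_mx (poly_rV b) (poly_rV b') *m relmx m.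
 apply: (can_inj (@rVpolyK F m.+1)); rewrite relmx_mul rVpoly_mul !poly_rV_K //.
 by rewrite mulrC [_ * u0]mulrC -H; apply: eq_bigr => i _; rewrite mxE.
have : ((\row_i x i) *m gr_basis m <= relmx m :&: (relmx m)^C)%MS.
 rewrite sub_capmx {1}E submxMl; apply: submx_trans (submxMl _ _) _.
 by rewrite eq_row_base.
rewrite capmx_compl submx0 => /eqP H0 i.
have : \row_i x i = 0 by apply: (row_free_inj (row_base_free _)); rewrite mul0mx.
by move/rowP/(_ i); rewrite !mxE.
Qed.

(** The Hilbert function of a complete intersection: raising e by one adds one dimension in each of
    the D degrees e, ..., e + D - 1. *)
Lemma gr_total : (\sum_(m < D + e) gr_rank m)%N = (D * e)%N.
Proof.
transitivity (\sum_(m < D + e) (m.+1 - (m.+1 - D) - (m.+1 - e)))%N.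
 by apply: eq_bigr => m _; rewrite gr_rankE ltn_ord.
move: e => e1; elim: e1 => [|e' IH].
 by rewrite muln0 big1 // => i _; lia.
rewrite addnS big_ord_recr /= mulnSr -IH.
have -> : ((D + e').+1 - ((D + e').+1 - D) - ((D + e').+1 - e'.+1) = 0)%N by lia.
rewrite addn0.
transitivity (\sum_(i < D + e') ((i.+1 - (i.+1 - D) - (i.+1 - e')) + (e' <= i)))%N.
 by apply: eq_bigr => i _; have := ltn_ord i; case: leqP => ?; lia.
rewrite big_split /=; congr (_ + _)%N.
rewrite -(big_mkord xpredT (fun i => (e' <= i) : nat)) (big_cat_nat (n := e')) //= ?leq_addl //.
rewrite big_nat_cond big1 => [|i /andP[/andP[_ Hi] _]]; last by rewrite leqNgt Hi.
rewrite big_nat_cond (eq_bigr (fun _ => 1%N)) => [|i /andP[/andP[Hi _] _]]; last by rewrite Hi.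
by rewrite -big_nat_cond sum_nat_const_nat; lia.
Qed.

Theorem graded_basis : exists (w : 'I_(D * e) -> nat) (ep : 'I_(D * e) -> {poly F}),
 [/\ forall k, (size (ep k) <= (w k).+1)%N,
  forall m (c : {poly F}), (size c <= m.+1)%N -> exists (x : 'I_(D * e) -> F) (b b' : {poly F}),
   [/\ (size b <= m.+1 - D)%N, (size b' <= m.+1 - e)%N &
   c = \sum_(k | w k == m) x k *: ep k + J0 * b + u0 * b'] &
  forall m (x : 'I_(D * e) -> F) (b b' : {poly F}), (size b <= m.+1 - D)%N -> (size b' <= m.+1 - e)%N ->
   \sum_(k | w k == m) x k *: ep k = J0 * b + u0 * b' -> forall k, w k = m -> x k = 0].
Proof.
pose K := {m : 'I_(D + e) & 'I_(gr_rank m)}.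
have HK : #|{: K}| = (D * e)%N.
 rewrite card_tagged sumnE big_map big_enum /= -gr_total.
 by apply: eq_bigr => m _; rewrite card_ord.
have sum1 m y : (m < D + e)%N ->
 \sum_(k : K | nat_of_ord (tag k) == m) y (nat_of_ord (tagged k)) *: gr_vec (tagged k) = \sum_(i < gr_rank m) y i *: gr_vec i.
 move=> Hm; rewrite (eq_bigl (fun k : K => ((fun i => i == Ordinal Hm) (tag k)) && true)); last first.
  by move=> k; rewrite andbT.
 rewrite -(sig_big_dep (fun i => i == Ordinal Hm) (fun _ _ => true)
   (fun m (i : 'I_(gr_rank m)) => y i *: gr_vec i)) /=.
 by rewrite big_pred1_eq.
rewrite -HK.
exists (fun k => nat_of_ord (tag (enum_val k))), (fun k => gr_vec (tagged (enum_val k))); split.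
- by move=> k; apply: size_rVpoly.
- move=> m c /gr_span [x [b [b' [Hb Hb' Hc]]]].
 (* Coordinates are extended by 0 to all of nat, which removes the dependence of their index on the
    degree. *)
 pose y j := if insub j is Some i then x i else 0.
 exists (fun k => y (nat_of_ord (tagged (enum_val k : K)))), b, b'; split=> //; rewrite Hc; congr (_ + _ + _).
 rewrite [RHS](reindex_onto (@enum_rank K) (fun k => enum_val k)); last by move=> i _; rewrite enum_valK.
 rewrite (eq_big (fun k : K => nat_of_ord (tag k) == m) (fun k => y (nat_of_ord (tagged k)) *: gr_vec (tagged k))); last first.
 + by move=> k _; rewrite enum_rankK.
 + by move=> k; rewrite enum_rankK eqxx andbT.
 case: (ltnP m (D + e)) => Hm.
  rewrite sum1 //; apply: eq_bigr => i _; congr (_ *: _); rewrite /y insubT //= => Hi.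
  by congr x; apply: val_inj.
 have Hr0 : gr_rank m = 0%N by rewrite gr_rankE ltnNge Hm.
 rewrite [LHS]big1 => [|i _]; last by have := ltn_ord i; rewrite {2}Hr0.
 by rewrite big1 // => k /eqP Hk; exfalso; have := ltn_ord (tag k); rewrite Hk ltnNge Hm.
- move=> m x b b' Hb Hb' H k Hk.
 have Hm : (m < D + e)%N by rewrite -Hk.
 pose kk (i : 'I_(gr_rank m)) : K := Tagged (fun m : 'I_(D+e) => 'I_(gr_rank m)) (i : 'I_(gr_rank (Ordinal Hm))).
 have H2 : \sum_i x (enum_rank (kk i)) *: gr_vec i = J0 * b + u0 * b'.
  pose y j := if insub j is Some i then x (enum_rank (kk i)) else 0.
  rewrite -H [RHS](reindex_onto (@enum_rank K) (fun k => enum_val k)); last by move=> i _; rewrite enum_valK.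
  rewrite (eq_big (fun k : K => nat_of_ord (tag k) == m) (fun k => y (nat_of_ord (tagged k)) *: gr_vec (tagged k))); last first.
  + move=> [i j] /andP[/eqP Hi _]; rewrite enum_rankK /= in Hi *.
   have Ei : i = Ordinal Hm by apply: val_inj.
   subst i; congr (_ *: _); rewrite /y insubT //= => Hj.
   by congr (x (enum_rank _)); rewrite /kk; congr existT; apply: val_inj.
  + by move=> i; rewrite enum_rankK eqxx andbT.
  rewrite sum1 //; apply: eq_bigr => i _; congr (_ *: _); rewrite /y insubT //= => Hi.
  by congr (x (enum_rank _)); rewrite /kk; congr existT; apply: val_inj.
 have := gr_indep Hb Hb' H2; rewrite -[k]enum_valK; move: (enum_val k) Hk => [i j] /= Hi.
 have Ei : i = Ordinal Hm by apply: val_inj.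
 by subst i => /(_ j).
Qed.
End GradedBasis.

(** * C[x, y]/(J) as a free module over C[u], and its multiplication matrices *)

Section Frames.
Variable C : cField.
Local Notation P2 := (mpoly 2 C).
Implicit Types (a b : P2) (c : {poly C}) (p q : C * C).

Definition cu (u : P2) (c : {poly C}) : P2 := (map_poly (@mpolyC 2 C) c).[u].
Lemma cuD u c1 c2 : cu u (c1 + c2) = cu u c1 + cu u c2.
Proof. by rewrite /cu rmorphD hornerD. Qed.
Lemma cuN u c : cu u (- c) = - cu u c.
Proof. by rewrite /cu rmorphN hornerN. Qed.
Lemma cuB u c1 c2 : cu u (c1 - c2) = cu u c1 - cu u c2.
Proof. by rewrite cuD cuN. Qed.
Lemma cuM u c1 c2 : cu u (c1 * c2) = cu u c1 * cu u c2.
Proof. by rewrite /cu rmorphM hornerM. Qed.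
Lemma cu_polyC u k : cu u k%:P = cst k.
Proof. by rewrite /cu map_polyC hornerC. Qed.
Lemma cuX u : cu u 'X = u. Proof. by rewrite /cu map_polyX hornerX. Qed.
Lemma cu0 u : cu u 0 = 0. Proof. by rewrite /cu rmorph0 horner0. Qed.
Lemma cu1 u : cu u 1 = 1. Proof. by rewrite /cu rmorph1 hornerC. Qed.
Lemma cuE u c n : (size c <= n)%N -> cu u c = \sum_(i < n) cst c`_i * u ^+ i.
Proof.
move=> Hc; rewrite /cu (@horner_coef_wide _ n) ?size_map_poly //.
by apply: eq_bigr => i _; rewrite coef_map.
Qed.
Lemma pev_cu p u c : pev p (cu u c) = c.[pev p u].
Proof.
rewrite (cuE u (leqnn _)) horner_coef pev_sum.
by apply: eq_bigr => i _; rewrite pevM pevC pevX.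
Qed.

Lemma dgl_cu u c e j : dgl e u -> (size c <= j.+1)%N -> dgl (j * e) (cu u c).
Proof.
move=> Hu Hc; rewrite (cuE u Hc); apply: dgl_sum => i _.
rewrite -[(j * e)%N]add0n; apply: dglM; first exact: dgl_cst.
have H1 : (i * e <= j * e)%N by rewrite leq_mul2r -ltnS ltn_ord orbT.
exact: (dgl_mono H1 (dglX Hu)).
Qed.
Lemma tf_cu u c e j : (0 < e)%N -> dgl e u -> (size c <= j.+1)%N ->
 tf (j * e) (cu u c) = c`_j *: tf e u ^+ j.
Proof.
move=> He Hu Hc; rewrite (cuE u Hc) big_ord_recr /= tfD tf_sum big1 => [|i _].
 rewrite add0r -[X in tf X]add0n tfM ?tf_cst ?tfX ?mul_polyC //; [exact: dgl_cst|exact: dglX].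
have H : dgl (i * e) (cst c`_i * u ^+ i).
 by rewrite -[(i * e)%N]add0n; apply: dglM; [exact: dgl_cst|exact: dglX].
by rewrite H // ltn_pmul2r.
Qed.

(** A basis of C[x, y]/(J) over C[t], where t acts as u. The coordinates [fcd] and the multiple [fq]
    of J are chosen functions, so that no quotient ring has to be formed. *)
Record frame (J u : P2) (n : nat) := Frame {
 fe : 'I_n -> P2;
 fcd : P2 -> 'I_n -> {poly C};
 fq : P2 -> P2;
 fspan : forall a, a = \sum_k cu u (fcd a k) * fe k + J * fq a;
 find : forall (c : 'I_n -> {poly C}) b, \sum_k cu u (c k) * fe k = J * b -> forall k, c k = 0 }.

Lemma fcd_uniq J u n (fr : frame J u n) a (c : 'I_n -> {poly C}) b :
 a = \sum_k cu u (c k) * fe fr k + J * b -> fcd fr a =1 c.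
Proof.
move=> H k; apply/eqP; rewrite -subr_eq0; apply/eqP.
apply: (@find _ _ _ fr (fun k => fcd fr a k - c k) (b - fq fr a)).
transitivity (\sum_k cu u (fcd fr a k) * fe fr k - \sum_k cu u (c k) * fe fr k).
 by rewrite -sumrB; apply: eq_bigr => i _; rewrite cuB mulrBl.
have := fspan fr a; set q := fq fr a; set S1 := \sum_i cu u (fcd fr a i) * _; set S2 := \sum_i _.
rewrite {1}H => E; have -> : S1 = S2 + J * b - J * q by rewrite E addrK.
ring.
Qed.

Section Build.
Variables (J u : P2) (D e : nat).
Hypotheses (HJ : dgl D J) (Hu : dgl e u) (He : (0 < e)%N).
Hypotheses (HJ0 : size (tf D J) = D.+1) (Hcop : coprimep (tf D J) (tf e u)).

Lemma tf_Jmul N b : dgl N (J * b) -> exists2 c : {poly C}, (size c <= N.+1 - D)%N & tf N (J * b) = tf D J * c.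
Proof.
move=> HN; have HJn : psi J != 0.
 by apply: contraTneq isT => E; move: HJ0; rewrite -psi_coef E coef0 size_poly0.
have [->|Hb] := eqVneq b 0.
 by exists 0; rewrite ?size_poly0 // !mulr0 tf0.
have Hb' : psi b != 0 by apply: contra Hb => /eqP E; apply/eqP; apply: psi_inj; rewrite psi0.
have HsJ : size (psi J) = D.+1.
 apply/eqP; rewrite eqn_leq; apply/andP; split; first by apply/dglP.
 rewrite ltnNge; apply/negP => /leq_sizeP/(_ D (leqnn _)); rewrite psi_coef => E.
 by move: HJ0; rewrite E size_poly0.
have Hs : (D + size (psi b) <= N.+1)%N.
 by move/dglP: HN; rewrite psiM size_mul // HsJ.
have Hdb : dgl (N - D) b by apply/dglP; move: Hs; lia.
have HDN : (D <= N)%N.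
 by move: Hb' Hs; rewrite -size_poly_gt0; lia.
exists (tf (N - D) b); first by apply: leq_trans (size_tf _ _) _; lia.
by rewrite -tfM // subnKC.
Qed.

Variables (w : 'I_(D * e) -> nat) (ep : 'I_(D * e) -> {poly C}).
Hypothesis Hep : forall k, (size (ep k) <= (w k).+1)%N.
Hypothesis Hsp : forall m (c : {poly C}), (size c <= m.+1)%N -> exists (x : 'I_(D * e) -> C) (b b' : {poly C}),
   [/\ (size b <= m.+1 - D)%N, (size b' <= m.+1 - e)%N &
   c = \sum_(k | w k == m) x k *: ep k + tf D J * b + tf e u * b'].
Hypothesis Hin : forall m (x : 'I_(D * e) -> C) (b b' : {poly C}),
 (size b <= m.+1 - D)%N -> (size b' <= m.+1 - e)%N ->
 \sum_(k | w k == m) x k *: ep k = tf D J * b + tf e u * b' -> forall k, w k = m -> x k = 0.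

Definition bve k : P2 := fm (w k) (ep k).
Lemma dgl_bve k : dgl (w k) (bve k). Proof. exact: dgl_fm. Qed.
Lemma tf_bve k m : tf m (bve k) = if m == w k then ep k else 0. Proof. exact: tf_fm. Qed.

(** Induction on degree: the top form is a combination of basis forms modulo J0 and u0. The J0 part
    is removed by a multiple of J; the cofactor of u0 is expanded again and its coordinates are
    multiplied by t. No term exceeds the degree of a, which the bound on the coefficients
    records. *)
Lemma span_deg N a : (forall j, (N <= j)%N -> tf j a = 0) ->
 exists (c : 'I_(D * e) -> {poly C}) b,
  a = \sum_k cu u (c k) * bve k + J * b /\
  forall k j, (c k)`_j != 0 -> (j * e + w k < N)%N.
Proof.
have [M] := ubnP N; elim: M N a => // M IH N a HN Ha.
case: N Ha HN => [|N] Ha HN.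
 exists (fun _ => 0), 0; split; last by move=> k j; rewrite coef0 eqxx.
 rewrite mulr0 addr0 big1 => [|k _]; last by rewrite cu0 mul0r.
 by apply: psi_inj; apply/polyP => j; rewrite psi0 coef0 psi_coef Ha.
have [x [b [b' [Hb Hb' Hc]]]] := Hsp (size_tf N a).
pose X k := if w k == N then x k else 0.
have HX k : X k != 0 -> w k = N by rewrite /X; case: (w k =P N) => // _; rewrite eqxx.
have Hszf d c : (size c <= N.+1 - d)%N -> c != 0 -> (d <= N)%N /\ (size c <= (N - d).+1)%N.
 by rewrite -size_poly_gt0; move: (size c) => s; lia.
have Hfb d r c : dgl d r -> (size c <= N.+1 - d)%N ->
  dgl N (r * fm (N - d) c) /\ tf N (r * fm (N - d) c) = tf d r * c.
 move=> Hr Hs; have [->|H0] := eqVneq c 0.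
  have -> : fm (N - d) 0 = 0 :> P2.
   by apply: psi_inj; apply/polyP => j; rewrite psi_coef tf_fm ?size_poly0 // if_same psi0 coef0.
  by rewrite !mulr0 tf0; split=> //; apply: dgl0.
 have [H1 H2] := Hszf _ _ Hs H0; split.
  by rewrite -(subnKC H1); apply: dglM => //; rewrite addKn; apply: dgl_fm.
 by rewrite -{1}(subnKC H1) tfM ?tf_fm ?eqxx // ; apply: dgl_fm.
have [HJb1 HJb2] := Hfb _ _ _ HJ Hb.
have [Hub1 Hub2] := Hfb _ _ _ Hu Hb'.
pose a' := a - \sum_k cst (X k) * bve k - J * fm (N - D) b - u * fm (N - e) b'.
have Ha' : forall j, (N <= j)%N -> tf j a' = 0.
 move=> j Hj; rewrite 3!tfB tf_sum.
 have E k : tf j (cst (X k) * bve k) = if j == N then (if w k == N then x k *: ep k else 0) else 0.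
  have H : dgl (w k) (cst (X k) * bve k).
   by rewrite -[w k]add0n; apply: dglM; [exact: dgl_cst|exact: dgl_bve].
  rewrite /X in H *; case: (altP (w k =P N)) H => [Hw|Hk] H.
   case: (altP (j =P N)) => [->|Hne].
    by rewrite -Hw -[X in tf X]add0n tfM ?tf_cst ?tf_bve ?eqxx ?mul_polyC //; [exact: dgl_cst|exact: dgl_bve].
   by rewrite H // Hw ltn_neqAle eq_sym Hne.
  by rewrite mul0r tf0 if_same.
 rewrite (eq_bigr _ (fun k _ => E k)).
 case: (ltngtP j N) Hj => [//|Hj _|-> _].
  by rewrite big1 // Ha ?HJb1 ?Hub1 ?subr0.
 by rewrite -big_mkcond HJb2 Hub2 Hc; ring.
have [c1 [b1 [E1 D1]]] := IH N a' HN Ha'.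
(* [N - e] is a true degree only when e <= N, which a nonzero cofactor guarantees; the zero cofactor
   is handled apart. *)
have [Hb'0|Hb'0] := eqVneq b' 0.
 exists (fun k => c1 k + (X k)%:P), (b1 + fm (N - D) b); split.
  have Efm : fm (N - e) b' = 0 :> P2.
   by apply: psi_inj; apply/polyP => j; rewrite psi_coef Hb'0 tf_fm ?size_poly0 // if_same psi0 coef0.
  transitivity (a' + \sum_k cst (X k) * bve k + J * fm (N - D) b).
   by rewrite /a' Efm; ring.
  have -> : \sum_k cu u (c1 k + (X k)%:P) * bve k = \sum_k cu u (c1 k) * bve k + \sum_k cst (X k) * bve k.
   by rewrite -big_split; apply: eq_bigr => k _; rewrite cuD cu_polyC mulrDl.
  by rewrite {1}E1; ring.
 move=> k j; rewrite coefD coefC; case: (eqVneq (c1 k)`_j 0) => [->|/D1]; last by lia.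
 rewrite add0r; case: (eqVneq j 0%N) => [->|_]; last by rewrite eqxx.
 by move/HX => ->; rewrite mul0n.
have [HeN Hsb'] := Hszf _ _ Hb' Hb'0.
have [c2 [b2 [E2 D2]]] := IH (N - e).+1 (fm (N - e) b') ltac:(lia) (fun j Hj => dgl_fm Hsb' Hj).
exists (fun k => c1 k + (X k)%:P + 'X * c2 k), (b1 + fm (N - D) b + u * b2); split.
 transitivity (a' + \sum_k cst (X k) * bve k + J * fm (N - D) b + u * fm (N - e) b').
  by rewrite /a'; ring.
 have -> : \sum_k cu u (c1 k + (X k)%:P + 'X * c2 k) * bve k =
   \sum_k cu u (c1 k) * bve k + \sum_k cst (X k) * bve k + u * \sum_k cu u (c2 k) * bve k.
  rewrite mulr_sumr -!big_split; apply: eq_bigr => k _; rewrite /= !cuD cu_polyC cuM cuX; ring.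
 by rewrite {1}E1 {1}E2; ring.
move=> k j; rewrite !coefD coefC coefXM.
case: (eqVneq (c1 k)`_j 0) => [->|/D1]; last by lia.
rewrite add0r; case: (eqVneq j 0%N) => [->|Hj].
 by rewrite addr0 => /HX ->; rewrite mul0n.
by rewrite add0r => /D2; case: j Hj => //= j _; rewrite mulSn; lia.
Qed.

(** The terms without a factor u0 vanish by independence modulo the two forms. The rest is divisible
    by u0, which coprimality allows to cancel, and the degree drops by e. *)
Lemma graded_free m (x : 'I_(D * e) -> C) jj (b : {poly C}) :
 (forall k, x k != 0 -> (jj k * e + w k)%N = m) ->
 \sum_k x k *: (tf e u ^+ jj k * ep k) = tf D J * b -> forall k, x k = 0.
Proof.
have HJn : tf D J != 0 by rewrite -size_poly_gt0 HJ0.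
have [M] := ubnP m; elim: M m x jj b => // M IH m x jj b HM Hx Hs.
have Hsz k m' : (jj k * e + w k = m')%N -> (size (tf e u ^+ jj k * ep k)%R <= m'.+1)%N.
 move=> <-; have : dgl (jj k * e + w k) (u ^+ jj k * bve k) by apply: dglM; [exact: dglX|exact: dgl_bve].
 move=> _; have <- : tf (jj k * e + w k) (u ^+ jj k * bve k) = tf e u ^+ jj k * ep k.
  by rewrite tfM ?tfX ?tf_bve ?eqxx //; [exact: dglX|exact: dgl_bve].
 exact: size_tf.
have Hb : (size b <= m.+1 - D)%N.
 have [->|Hb0] := eqVneq b 0; first by rewrite size_poly0.
 have : (size (tf D J * b)%R <= m.+1)%N.
  rewrite -Hs; apply: leq_trans (size_sum _ _ _) _; apply/bigmax_leqP => k _.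
  have [->|H] := eqVneq (x k) 0; first by rewrite scale0r size_poly0.
  by apply: leq_trans (size_scale_leq _ _) _; apply: Hsz; apply: Hx.
 by rewrite size_mul // HJ0 => H; rewrite leq_subRL //; apply: leq_trans H; exact: leq_addr.
pose S := \sum_(k | (0 < jj k)%N) x k *: (tf e u ^+ (jj k).-1 * ep k).
pose x0 k := if jj k == 0%N then x k else 0.
have Hsplit : \sum_(k | w k == m) x0 k *: ep k = tf D J * b + tf e u * (- S).
 rewrite -Hs [\sum_k x k *: (_ * _)](bigID (fun k => (0 < jj k)%N)) /= mulrN.
 have -> : \sum_(k | (0 < jj k)%N) x k *: (tf e u ^+ jj k * ep k) = tf e u * S.
  rewrite mulr_sumr; apply: eq_bigr => k Hk.
  by rewrite -scalerAr mulrA -exprS prednK.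
 rewrite [_ * S + _]addrC addrK.
 rewrite big_mkcond [RHS]big_mkcond; apply: eq_bigr => k _; rewrite /x0 -leqNgt leqn0.
 case: (jj k =P 0%N) => Hj; last by rewrite scale0r if_same.
 rewrite Hj mul1r; case: (w k =P m) => // Hw.
 by have [->|/Hx] := eqVneq (x k) 0; rewrite ?scale0r // Hj => Hw'; case: Hw; rewrite -Hw'.
have HSsz : (size (- S) <= m.+1 - e)%N.
 rewrite size_polyN; apply: leq_trans (size_sum _ _ _) _; apply/bigmax_leqP => k Hk.
 have [->|H] := eqVneq (x k) 0; first by rewrite scale0r size_poly0.
 apply: leq_trans (size_scale_leq _ _) _.
 have := Hx _ H => Hm; have -> : tf e u ^+ (jj k).-1 * ep k = tf ((jj k).-1 * e + w k) (u ^+ (jj k).-1 * bve k).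
  by rewrite tfM ?tfX ?tf_bve ?eqxx //; [exact: dglX|exact: dgl_bve].
 by apply: leq_trans (size_tf _ _) _; case: (jj k) Hk Hm => // j _; rewrite mulSn; lia.
have Hx0 k : jj k = 0%N -> x k = 0.
 move=> Hj; have [//|/Hx] := eqVneq (x k) 0; rewrite Hj add0n => Hw.
 by have := Hin Hb HSsz Hsplit Hw; rewrite /x0 Hj.
have HS : tf D J * b = tf e u * S.
 have : \sum_(k | w k == m) x0 k *: ep k = 0.
  by rewrite big1 // => k _; rewrite /x0; case: (jj k =P 0%N) => [/Hx0 ->|_]; rewrite scale0r.
 by rewrite Hsplit mulrN => /eqP; rewrite subr_eq0 => /eqP.
have HdS : (tf D J %| S).
 by rewrite -(Gauss_dvdpr _ Hcop); apply/dvdpP; exists b; rewrite -HS mulrC.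
have [b1 Hb1] := dvdpP _ _ HdS.
case: (leqP e m) => Hem; last first.
 move=> k; have [//|H] := eqVneq (x k) 0; have := Hx _ H => Hm.
 by apply: Hx0; case: (jj k) Hm => // j; rewrite mulSn; lia.
move=> k; have [/Hx0//|Hj] := eqVneq (jj k) 0%N.
suff: (if jj k == 0%N then 0 else x k) = 0 by rewrite (negbTE Hj).
apply: (IH (m - e)%N (fun k => if jj k == 0%N then 0 else x k) (fun k => (jj k).-1) b1).
- by move: HM He Hem; lia.
- move=> k'; case: (jj k' =P 0%N) => [_|/eqP]; first by rewrite eqxx.
 by case: (jj k') (Hx k') => // j H _ /H; rewrite mulSn; lia.
- rewrite mulrC -Hb1 [RHS]big_mkcond; apply: eq_bigr => k' _; rewrite lt0n.
 by case: (jj k' =P 0%N) => //= _; rewrite scale0r.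
Qed.

(** In a relation the terms of highest degree [mu] have leading forms that satisfy a relation modulo
    J0, excluded by [graded_free]. *)
Lemma cu_free (c : 'I_(D * e) -> {poly C}) b :
 \sum_k cu u (c k) * bve k = J * b -> forall k, c k = 0.
Proof.
move=> H k0; apply/eqP/negPn/negP => Hk0.
pose mu k := ((size (c k)).-1 * e + w k)%N.
case: (@arg_maxnP _ k0 (fun k => c k != 0) mu Hk0) => k1 Hk1 Hmax.
have Hsz k : (size (c k) <= (size (c k)).-1.+1)%N by lia.
have Hterm k : dgl (mu k) (cu u (c k) * bve k).
 by apply: dglM; [exact: dgl_cu|exact: dgl_bve].
have Hterm2 k : dgl (mu k1) (cu u (c k) * bve k).
 have [->|Hk] := eqVneq (c k) 0; first by rewrite cu0 mul0r; exact: dgl0.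
 exact: dgl_mono (Hmax k Hk) (Hterm k).
have HJb : dgl (mu k1) (J * b) by rewrite -H; apply: dgl_sum.
have [r _ Hr] := tf_Jmul HJb.
pose x k := if (c k != 0) && (mu k == mu k1) then lead_coef (c k) else 0.
have : x k1 = 0.
 apply: (@graded_free (mu k1) x (fun k => (size (c k)).-1) r).
  by move=> k; rewrite /x; case: andP => [[_ /eqP Hk] _|]; [exact: Hk|rewrite eqxx].
 rewrite -Hr -H tf_sum; apply: eq_bigr => k _; rewrite /x.
 have [->|Hk] := eqVneq (c k) 0; first by rewrite cu0 mul0r tf0 scale0r.
 case: (altP (mu k =P mu k1)) => [E|Hne] /=.
  rewrite -E tfM ?tf_cu ?tf_bve ?eqxx ?scalerAl //; [exact: dgl_cu|exact: dgl_bve].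
 by rewrite scale0r Hterm // ltn_neqAle Hne; exact: Hmax.
by rewrite /x Hk1 eqxx => /eqP; rewrite lead_coef_eq0 (negbTE Hk1).
Qed.
End Build.

Definition hom (m : nat) a := forall j, j != m -> tf j a = 0.

(* The basis depends only on the top forms of J and u, so that the behaviour at
  infinity of multiplication operators can be read off the homogeneous pair. *)
Theorem frame_uniform (J0 u0 : {poly C}) D e : (0 < e)%N ->
 size J0 = D.+1 -> (size u0 <= e.+1)%N -> coprimep J0 u0 ->
 exists (w : 'I_(D * e) -> nat) (be : 'I_(D * e) -> P2), (forall k, hom (w k) (be k)) /\
  forall J u, dgl D J -> dgl e u -> tf D J = J0 -> tf e u = u0 ->
  exists fr : frame J u (D * e), fe fr = be /\
   forall N a, dgl N a -> forall k j, (fcd fr a k)`_j != 0 -> (j * e + w k <= N)%N.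
Proof.
move=> He HJ0 Hu0 Hcop; have [w [ep [Hep Hsp Hin]]] := graded_basis HJ0 Hu0 Hcop.
exists w, (bve w ep); split; first by move=> k j Hj; rewrite tf_bve // (negbTE Hj).
move=> J u HJ Hu EJ Eu; subst J0 u0.
have Hex a : exists cb : ('I_(D * e) -> {poly C}) * P2, a = \sum_k cu u (cb.1 k) * bve w ep k + J * cb.2.
 have [N HN] := dgl_bound a.
 have [c [b [Hc _]]] := span_deg HJ Hu He HJ0 Hcop Hep Hsp HN.
 by exists (c, b).
have [g Hg] := boolp.choice Hex.
exists (Frame Hg (cu_free HJ Hu He HJ0 Hcop Hep Hin)); split=> //.
move=> N a HN k j; have [c [b [Hc Hd]]] := span_deg HJ Hu He HJ0 Hcop Hep Hsp HN.
by rewrite (fcd_uniq (fr := Frame Hg _) Hc) => /Hd.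
Qed.

Corollary frame_exists J u D e : dgl D J -> dgl e u -> (0 < e)%N ->
 size (tf D J) = D.+1 -> coprimep (tf D J) (tf e u) -> inhabited (frame J u (D * e)).
Proof.
move=> HJ Hu He HJ0 Hcop.
by have [w [be [_ /(_ J u HJ Hu erefl erefl) [fr _]]]] := frame_uniform He HJ0 (size_tf e u) Hcop.
Qed.

Section FrameTheory.
Variables (J u : P2) (n : nat) (fr : frame J u n).
Local Notation ee := (fe fr).
Local Notation cd := (fcd fr).

Definition rho a : 'M[{poly C}]_n := \matrix_(k, l) cd (a * ee l) k.

Lemma cdD a b : cd (a + b) =1 (fun k => cd a k + cd b k).
Proof.
apply: (@fcd_uniq _ _ _ _ _ _ (fq fr a + fq fr b)).
rewrite {1}(fspan fr a) {1}(fspan fr b) mulrDr addrACA; congr (_ + _).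
by rewrite -big_split; apply: eq_bigr => k _; rewrite cuD mulrDl.
Qed.
Lemma cd_cu c a : cd (cu u c * a) =1 (fun k => c * cd a k).
Proof.
apply: (@fcd_uniq _ _ _ _ _ _ (cu u c * fq fr a)).
rewrite {1}(fspan fr a) mulrDr mulr_sumr mulrCA; congr (_ + _).
by apply: eq_bigr => k _; rewrite cuM mulrA.
Qed.
Lemma cdJ a b : cd (a + J * b) =1 cd a.
Proof.
apply: (@fcd_uniq _ _ _ _ _ _ (fq fr a + b)).
by rewrite {1}(fspan fr a) mulrDr addrA.
Qed.
Lemma cd0 k : cd 0 k = 0.
Proof.
apply: (@fcd_uniq _ _ _ fr 0 (fun _ => 0) 0).
by rewrite mulr0 addr0 big1 // => i _; rewrite cu0 mul0r.
Qed.
Lemma cd_sum I r (F : I -> P2) k :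
 cd (\sum_(i <- r) F i) k = \sum_(i <- r) cd (F i) k.
Proof.
apply: (big_morph (fun a => cd a k) (fun a b => cdD a b k)); exact: cd0.
Qed.
Lemma cdM a b k : cd (a * b) k = \sum_l rho a k l * cd b l.
Proof.
rewrite {1}(fspan fr b) mulrDr mulrCA cdJ mulr_sumr cd_sum.
by apply: eq_bigr => l _; rewrite mxE mulrCA cd_cu mulrC.
Qed.
Lemma rhoM a b : rho (a * b) = rho a *m rho b.
Proof.
apply/matrixP => k l; rewrite !mxE -mulrA cdM.
by apply: eq_bigr => i _; rewrite [rho b _ _]mxE.
Qed.
Lemma cd_ee k l : cd (ee l) k = (k == l)%:R.
Proof.
apply: (@fcd_uniq _ _ _ fr (ee l) (fun k => (k == l)%:R) 0).
rewrite mulr0 (bigD1 l) //= eqxx cu1 mul1r big1 ?addr0 // => i /negbTE ->.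
by rewrite cu0 mul0r.
Qed.
Lemma rhoD a b : rho (a + b) = rho a + rho b.
Proof. by apply/matrixP => k l; rewrite !mxE mulrDl cdD. Qed.
Lemma rho_cu c : rho (cu u c) = c%:M.
Proof. by apply/matrixP => k l; rewrite !mxE cd_cu cd_ee mulr_natr. Qed.
Lemma rho_cst (c : C) : rho (cst c) = (c%:P)%:M.
Proof. by rewrite -(cu_polyC u) rho_cu. Qed.
Lemma rho1 : rho 1 = 1%:M. Proof. by rewrite rho_cst. Qed.
Lemma rho_u : rho u = 'X%:M. Proof. by rewrite -[in LHS](cuX u) rho_cu. Qed.
Lemma rhoN a : rho (- a) = - rho a.
Proof. by rewrite -mulN1r -cstN rhoM rho_cst polyCN mul_scalar_mx scaleN1r. Qed.
Lemma rhoB a b : rho (a - b) = rho a - rho b. Proof. by rewrite rhoD rhoN. Qed.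
Lemma rho_0 : rho 0 = 0. Proof. by rewrite -(subrr 1) rhoB subrr. Qed.
Lemma rhoJ b : rho (J * b) = 0.
Proof.
apply/matrixP => k l; rewrite !mxE -mulrA -[J * _]add0r cdJ; exact: cd0.
Qed.
Lemma rhoDJ a b : rho (a + J * b) = rho a. Proof. by rewrite rhoD rhoJ addr0. Qed.

Definition rhot (t : C) a : 'M[C]_n := map_mx (fun c : {poly C} => c.[t]) (rho a).
Lemma rhotM t a b : rhot t (a * b) = rhot t a *m rhot t b.
Proof. by rewrite /rhot rhoM -!(map_mxM (horner_eval t)). Qed.
Lemma rhotD t a b : rhot t (a + b) = rhot t a + rhot t b.
Proof. by apply/matrixP => k l; rewrite /rhot rhoD !mxE hornerD. Qed.
Lemma rhot_cst t (c : C) : rhot t (cst c) = c%:M.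
Proof. by apply/matrixP => k l; rewrite /rhot rho_cst !mxE hornerMn hornerC. Qed.
Lemma rhot_u t : rhot t u = t%:M.
Proof. by apply/matrixP => k l; rewrite /rhot rho_u !mxE hornerMn hornerX. Qed.
Lemma rhotJ t b : rhot t (J * b) = 0.
Proof. by apply/matrixP => k l; rewrite /rhot rhoJ !mxE horner0. Qed.
Lemma det_rhot t a : \det (rhot t a) = (\det (rho a)).[t].
Proof. by rewrite -/(horner_eval t _) -det_map_mx. Qed.
Lemma rhotC t a b : rhot t a *m rhot t b = rhot t b *m rhot t a.
Proof. by rewrite -!rhotM mulrC. Qed.

(* zeros of a over the fibre u = t *)
Definition onf (t : C) p := (pev p J == 0) && (pev p u == t).

(** Evaluation at a point of the fibre factors through the quotient, hence is a left eigenvector of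
    every multiplication matrix. *)
Lemma ev_eigen t p a : onf t p ->
 (\row_k pev p (ee k)) *m rhot t a = pev p a *: \row_k pev p (ee k).
Proof.
move=> /andP[/eqP HJ /eqP Hu]; apply/rowP => l; rewrite !mxE.
rewrite -pevM {1}(fspan fr (a * ee l)) pevD pevM HJ mul0r addr0 pev_sum.
by apply: eq_bigr => k _; rewrite !mxE pevM pev_cu Hu mulrC.
Qed.
Lemma ev_neq0 t p : onf t p -> \row_k pev p (ee k) != 0.
Proof.
move=> /andP[/eqP HJ /eqP Hu]; apply/eqP => /rowP H.
have /eqP := congr1 (pev p) (fspan fr 1); rewrite pev1 pevD pevM HJ mul0r addr0 pev_sum big1 ?oner_eq0 // => k _.
by have := H k; rewrite !mxE pevM => ->; rewrite mulr0.
Qed.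
Lemma rhot_zero t p a : onf t p -> pev p a = 0 -> \det (rhot t a) = 0.
Proof.
move=> Hp Ha; apply/eqP/det0P; exists (\row_k pev p (ee k)); first exact: ev_neq0 Hp.
by rewrite (ev_eigen _ Hp) Ha scale0r.
Qed.

Lemma rhot_eigen t (v : 'rV[C]_n) x y a : v *m rhot t (mx C) = x *: v -> v *m rhot t (my C) = y *: v ->
 v *m rhot t a = pev (x, y) a *: v.
Proof.
move=> Hx Hy; elim/P2_ind: a => [c|||a b Ha Hb|a b Ha Hb].
- by rewrite rhot_cst pevC mul_mx_scalar.
- by rewrite pevx.
- by rewrite pevy.
- by rewrite rhotD mulmxDr Ha Hb pevD scalerDl.
- by rewrite rhotM mulmxA Ha -scalemxAl Hb scalerA pevM.
Qed.

(** The left kernel of the matrix of a is stable under the commuting matrices of x and y. The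
    eigenvalues of a common eigenvector there are the coordinates of a point: this plays the role of
    the Nullstellensatz on the fibre. *)
Lemma rhot_sing t a : \det (rhot t a) = 0 -> exists2 p, onf t p & pev p a = 0.
Proof.
move=> /eqP/det0P [v0 Hv0 Hv0a].
pose K := kermx (rhot t a).
have HKst b : stablemx K (rhot t b).
 by apply/sub_kermxP; rewrite -mulmxA rhotC mulmxA mulmx_ker mul0mx.
have HKr : (0 < \rank K)%N.
 rewrite lt0n mxrank_eq0; apply: contra Hv0 => /eqP HK0.
 have : (v0 <= K)%MS by apply/sub_kermxP.
 by rewrite HK0 submx0.
have Hcomm : restrictmx K (rhot t (mx C)) *m restrictmx K (rhot t (my C)) =
       restrictmx K (rhot t (my C)) *m restrictmx K (rhot t (mx C)).
 by rewrite -!conjmxM ?inE ?stablemx_row_base // rhotC.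
have [v Hv /andP[/eigenvectorP [x Hx] /eigenvectorP [y Hy]]] := common_eigenvector2 HKr Hcomm.
pose w := v *m row_base K.
have Hw : w != 0 by rewrite mulmx_free_eq0 ?row_base_free.
have Hst b z : (v <= eigenspace (restrictmx K (rhot t b)) z)%MS -> w *m rhot t b = z *: w.
 move/eigenspaceP => H.
 have HH : row_base K *m rhot t b = restrictmx K (rhot t b) *m row_base K.
  by rewrite mulmxKpV //; apply: (submx_trans (submxMr _ _) (submx_trans (HKst b) _)); rewrite eq_row_base.
 by rewrite -mulmxA HH mulmxA H -scalemxAl.
have Hwx := Hst _ _ Hx; have Hwy := Hst _ _ Hy.
have Ev b := rhot_eigen b Hwx Hwy.
have Z z : z *: w = 0 -> z = 0.
 by move=> /eqP; rewrite scaler_eq0 (negbTE Hw) orbF => /eqP.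
exists (x, y).
 apply/andP; split; apply/eqP.
  by apply: Z; rewrite -Ev -[J]mulr1 rhotJ mulmx0.
 apply/eqP; rewrite -subr_eq0; apply/eqP; apply: Z.
 by rewrite scalerBl -Ev rhot_u mul_mx_scalar subrr.
apply: Z; rewrite -Ev; apply/sub_kermxP.
by rewrite /w; apply: submx_trans (submxMl _ _) _; rewrite eq_row_base.
Qed.
End FrameTheory.
End Frames.

Section Avoid.
Variable C : cField.
Lemma avoid (l : seq C) : exists s, s \notin l.
Proof.
exists (1 + \sum_(x <- l) `|x|); apply/negP => H.
have H1 : `|1 + \sum_(x <- l) `|x| : C| <= \sum_(x <- l) `|x|.
 by rewrite [leRHS](big_rem _ H) lerDl sumr_ge0.
have H2 : (1 : C) + \sum_(x <- l) `|x| <= \sum_(x <- l) `|x|.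
 by apply: le_trans H1; rewrite ger0_norm // addr_ge0 // sumr_ge0.
by move: H2; rewrite gerDr ler10.
Qed.
Lemma avoid_lin (l : seq (C * C)) : (forall x, x \in l -> (x.1 != 0) || (x.2 != 0)) ->
 exists s, forall x, x \in l -> x.1 + s * x.2 != 0.
Proof.
move=> H; have [s Hs] := avoid [seq - x.1 / x.2 | x <- l].
exists s => x Hx; have [H2|H2] := eqVneq x.2 0.
 by rewrite H2 mulr0 addr0; move: (H x Hx); rewrite H2 eqxx orbF.
apply: contra Hs => /eqP E; apply/mapP; exists x => //.
by apply: (mulIf H2); rewrite divfK //; apply/eqP; rewrite -addr_eq0 addrC E.
Qed.
End Avoid.

(** * Orders of vanishing along the curve J = 0 *)

Section Orders.
Variable C : cField.
Local Notation P2 := (mpoly 2 C).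
Variable J : P2.
Implicit Types (a b : P2) (p q : C * C).

(** The bracket with J is a derivation that kills J and is tangent to J = 0. At a smooth point it is
    a nonvanishing vector field on the curve, so the first nonzero iterate gives the order of
    vanishing of the restriction. *)
Definition dl k a : P2 := iter k (fun a => bra a J) a.
Definition vo p k a := forall i, (i < k)%N -> pev p (dl i a) = 0.
Definition exo p k a := vo p k a /\ pev p (dl k a) != 0.

Lemma dlS k a : dl k.+1 a = dl k (bra a J). Proof. exact: iterSr. Qed.
Lemma dlD k a b : dl k (a + b) = dl k a + dl k b.
Proof. by elim: k a b => // k IH a b; rewrite !dlS braDl. Qed.
Lemma dlJ k b : dl k (J * b) = J * dl k b.
Proof. by elim: k b => // k IH b; rewrite !dlS braMl braxx mul0r addr0. Qed.
Lemma vo0 p a : vo p 0 a. Proof. by []. Qed.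
Lemma voS p k a : vo p k.+1 a -> vo p k (bra a J).
Proof. by move=> H i Hi; rewrite -dlS; apply: H. Qed.
Lemma vo_le p k l a : (l <= k)%N -> vo p k a -> vo p l a.
Proof. by move=> H Ha i Hi; apply: Ha; apply: leq_trans H. Qed.
Lemma voSP p k a : vo p k.+1 a <-> vo p k a /\ pev p (dl k a) = 0.
Proof.
split=> [H|[H1 H2] i]; first by split; [exact: vo_le H|exact: H].
by rewrite ltnS leq_eqVlt => /orP[/eqP ->|/H1].
Qed.
(** In the Leibniz expansion only the term with i derivatives on a and j on b survives; its binomial
    coefficient is nonzero in characteristic 0, which makes orders additive. *)
Lemma vo_lead p i j a b : vo p i a -> vo p j b ->
 pev p (dl (i + j) (a * b)) = 'C(i + j, i)%:R * (pev p (dl i a) * pev p (dl j b)).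
Proof.
have [m] := ubnP (i + j)%N; elim: m i j a b => // m IH i j a b Hm Ha Hb.
case: i Ha Hm => [|i] Ha Hm; case: j Hb Hm => [|j] Hb Hm.
- by rewrite mul1r pevM.
- rewrite add0n dlS braMl dlD pevD mul1r.
 rewrite (IH 0%N j) ?bin0 ?mul1r -?dlS //; last exact: voS.
 rewrite -{1}[j]add0n (IH 0%N j) ?bin0 ?mul1r //; last exact: vo_le Hb.
 by rewrite (Hb j) // !mulr0 addr0.
- rewrite addn0 dlS braMl dlD pevD binn mul1r.
 rewrite -{2}[i]addn0 (IH i 0%N) ?addn0 ?binn ?mul1r -?dlS //; last exact: voS.
  rewrite -{1}[i]addn0 (IH i 0%N) ?addn0 ?binn ?mul1r //; last exact: vo_le Ha.
   by rewrite (Ha i) // !mul0r add0r.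
  by rewrite -ltnS; lia.
 by lia.
- rewrite addSn dlS braMl dlD pevD.
 have -> : pev p (dl (i + j.+1) (a * bra b J)) =
   'C(i + j.+1, i.+1)%:R * (pev p (dl i.+1 a) * pev p (dl j.+1 b)).
  by rewrite -addSnnS (IH i.+1 j) ?dlS //; [lia|exact: voS].
 rewrite (IH i j.+1) //; last exact: voS.
 by rewrite -dlS natrD mulrDl.
Qed.

Lemma vo_mul p i j a b : vo p i a -> vo p j b -> vo p (i + j) (a * b).
Proof.
move=> Ha Hb k Hk.
have [H|H] := ltnP k i.
 by rewrite -[k]addn0 vo_lead ?(Ha k) ?mul0r ?mulr0 //; apply: vo_le Ha; apply: ltnW.
rewrite -(subnKC H) vo_lead ?(Hb (k - i)%N) ?mulr0 //; first by lia.
by apply: vo_le Hb; lia.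
Qed.
Lemma exo_mul p i j a b : exo p i a -> exo p j b -> exo p (i + j) (a * b).
Proof.
move=> [Ha Ha'] [Hb Hb']; split; first exact: vo_mul.
by rewrite vo_lead // !mulf_neq0 // pnatr_eq0 -lt0n bin_gt0 leq_addr.
Qed.
Lemma exo_vo p i k a : exo p i a -> vo p k a -> (k <= i)%N.
Proof. by move=> [_ H] Hk; rewrite leqNgt; apply: contra H => /Hk ->. Qed.
Lemma vo_or_exo p k a : vo p k a \/ exists2 i, (i < k)%N & exo p i a.
Proof.
elim: k => [|k [IH|[i Hi Hx]]]; first by left.
 have [E|E] := eqVneq (pev p (dl k a)) 0; first by left; apply/voSP.
 by right; exists k.
by right; exists i => //; apply: ltnW.
Qed.
Lemma vo_div p k j a b : exo p j b -> vo p (k + j) (a * b) -> vo p k a.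
Proof.
move=> Hb Hab; case: (vo_or_exo p k a) => // -[i Hi Ha].
by have := exo_vo (exo_mul Ha Hb) Hab; rewrite leq_add2r leqNgt Hi.
Qed.
Lemma exo_div p k j a b : exo p j b -> exo p (k + j) (a * b) -> exo p k a.
Proof.
move=> Hb [Hab1 Hab2]; have Ha := vo_div Hb Hab1; split=> //.
apply: contra Hab2 => /eqP E; rewrite vo_lead //; last exact: Hb.1.
by rewrite E mul0r mulr0.
Qed.
Lemma exo0 p a : pev p a != 0 -> exo p 0 a. Proof. by []. Qed.
Lemma exo_addJ p k a b : pev p J = 0 -> exo p k (a + J * b) <-> exo p k a.
Proof.
move=> HJ; have E i : pev p (dl i (a + J * b)) = pev p (dl i a) by rewrite dlD dlJ pevD pevM HJ mul0r addr0.
by rewrite /exo E; split => -[H ?]; split=> // i Hi; move: (H i Hi); rewrite E.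
Qed.
Lemma vo_addJ p k a b : pev p J = 0 -> vo p k (a + J * b) <-> vo p k a.
Proof.
move=> HJ; have E i : pev p (dl i (a + J * b)) = pev p (dl i a) by rewrite dlD dlJ pevD pevM HJ mul0r addr0.
by split=> H i Hi; move: (H i Hi); rewrite E.
Qed.

(** Cramer's rule on the linear expansions of a, b and J at p; the denominator c takes the Jacobian
    of b and J as its value. If that is nonzero, b generates the maximal ideal of the local ring of
    the curve. *)
Lemma local_div p a b : pev p J = 0 -> pev p a = 0 -> pev p b = 0 ->
 exists c d r, c * a = d * b + J * r /\ pev p c = pev p (bra b J).
Proof.
move=> HJ Ha Hb.
have [a1 [a2]] := pev_taylor1 p a; rewrite Ha add0r => Ea.
have [b1 [b2]] := pev_taylor1 p b; rewrite Hb add0r => Eb.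
have [J1 [J2]] := pev_taylor1 p J; rewrite HJ add0r => EJ.
exists (b1 * J2 - b2 * J1), (a1 * J2 - a2 * J1), (a2 * b1 - a1 * b2); split.
 by rewrite {1}Ea {1}Eb {1}EJ; ring.
rewrite /bra Eb EJ !dE !pevE !subrr; ring.
Qed.

Section SemiLocal.
Variables (ps : seq (C * C)).
Hypotheses (Hps : uniq ps) (HJ : forall p, p \in ps -> pev p J = 0).
Hypothesis (Hsm : forall p, p \in ps -> (pev p (dx J) != 0) || (pev p (dy J) != 0)).

(** A linear function through p whose slope avoids the tangent of J = 0 at p and the directions of
    the other points. *)
Lemma uniformizer p : p \in ps -> exists b,
 [/\ pev p b = 0, pev p (bra b J) != 0 & forall q, q \in ps -> q != p -> pev q b != 0].
Proof.
move=> Hp.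
have [|s Hs] := @avoid_lin C ((pev p (dy J), - pev p (dx J)) :: [seq (q.1 - p.1, q.2 - p.2) | q <- ps & q != p]).
 move=> x; rewrite inE => /orP[/eqP ->|/mapP[q]]; first by rewrite oppr_eq0 orbC Hsm.
 rewrite mem_filter => /andP[Hq _] ->; rewrite !subr_eq0.
 by apply: contraNT Hq; rewrite negb_or !negbK => /andP[/eqP E1 /eqP E2]; rewrite [q]spair E1 E2 -spair.
exists ((mx C - cst p.1) + cst s * (my C - cst p.2)); split.
- by rewrite !pevE !subrr mulr0 addr0.
- have := Hs _ (mem_head _ _) => /=; congr (_ != 0); rewrite /bra !dE !pevE; ring.
- move=> q Hq Hqp; have := Hs (q.1 - p.1, q.2 - p.2); rewrite !pevE; apply.
 by rewrite inE; apply/orP; right; apply/mapP; exists q; rewrite // mem_filter Hqp.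
Qed.

Definition unif p : P2 := if pselect (p \in ps) is left H then projT1 (cid (uniformizer H)) else 0.
Lemma unifP p : p \in ps -> [/\ pev p (unif p) = 0, pev p (bra (unif p) J) != 0 &
  forall q, q \in ps -> q != p -> pev q (unif p) != 0].
Proof. by rewrite /unif; case: pselect => // H _; case: cid. Qed.
Lemma exo_unif p q : p \in ps -> q \in ps -> exo q (q == p) (unif p).
Proof.
move=> Hp Hq; have [H1 H2 H3] := unifP Hp; case: eqP => [->|/eqP N]; last by apply: exo0; apply: H3.
by split=> // -[|//] _.
Qed.

(** The denominator from [local_div] is a unit at p only. Adding a multiple of the uniformizer to
    it, and the same multiple of a to the quotient, makes it a unit at every point of the list. *)
Lemma semilocal_div p a : p \in ps -> pev p a = 0 ->
 exists c d r, c * a = d * unif p + J * r /\ forall q, q \in ps -> pev q c != 0.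
Proof.
move=> Hp Ha; have [H1 H2 H3] := unifP Hp.
have [c [d [r [E Hc]]]] := local_div (HJ Hp) Ha H1.
have [|s Hs] := @avoid_lin C [seq (pev q c, pev q (unif p)) | q <- ps].
 move=> x /mapP[q Hq ->] /=; have [->|N] := eqVneq q p; first by rewrite Hc H2.
 by rewrite (H3 q Hq N) orbT.
exists (c + cst s * unif p), (d + cst s * a), r; split.
 by rewrite mulrDl E; ring.
move=> q Hq; rewrite !pevE; apply: (Hs (pev q c, pev q (unif p))).
by apply/mapP; exists q.
Qed.

Definition unifprod (m : C * C -> nat) : P2 := \prod_(p <- ps) unif p ^+ m p.

(** Factorisation in the semilocal ring of the curve at the points [ps], with the unit denominator c
    kept instead of localising; b is a unit where the prescribed order is exact. *)
Lemma semilocal_factor m a : (forall p, p \in ps -> vo p (m p) a) ->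
 exists c b r, c * a = b * unifprod m + J * r /\
  (forall q, q \in ps -> pev q c != 0) /\
  (forall q, q \in ps -> exo q (m q) a -> pev q b != 0).
Proof.
have [N] := ubnP (\sum_(p <- ps) m p)%N; elim: N m a => // N IH m a HN Hm.
have [/hasP [p Hp Hmp]|/hasPn Hno] := boolP (has (fun p => m p != 0%N) ps); last first.
 exists 1, a, 0; split; last split.
 - rewrite mulr0 addr0 mulrC; congr (_ * _); rewrite /unifprod big1_seq // => p Hp.
  by have := Hno p Hp; rewrite negbK => /eqP ->.
 - by move=> q _; rewrite pev1 oner_eq0.
 - by move=> q Hq; have := Hno q Hq; rewrite negbK => /eqP -> [].
have Ha : pev p a = 0 by apply: (Hm p Hp 0%N); rewrite lt0n.
have [c1 [d [r [E Hc1]]]] := semilocal_div Hp Ha.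
pose m' q := if q == p then (m p).-1 else m q.
have Em q : m q = (m' q + (q == p))%N.
 by rewrite /m'; case: eqP => [->|_]; rewrite ?addn0 // addn1 prednK // lt0n.
have Hd q : q \in ps -> vo q (m' q) d.
 move=> Hq; apply: (vo_div (exo_unif Hp Hq)); rewrite -Em.
 have : vo q (m q) (c1 * a) by rewrite -[m q]add0n; apply: vo_mul => //; apply: Hm.
 by rewrite E => /(vo_addJ (m q) (d * unif p) r (HJ Hq)).
have HN' : (\sum_(p <- ps) m' p < N)%N.
 move: HN; rewrite (eq_bigr _ (fun q _ => Em q)) big_split /= ltnS.
 apply: leq_trans; rewrite -addn1 leq_add2l (big_rem p Hp) eqxx; exact: leq_addr.
have [c [b [r' [E' [Hc Hb]]]]] := IH m' d HN' Hd.
exists (c * c1), b, (r' * unif p + c * r); split; last split.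
- have -> : unifprod m = unifprod m' * unif p.
  rewrite /unifprod (eq_bigr (fun q => unif q ^+ m' q * unif q ^+ (q == p))); last first.
   by move=> q _; rewrite -exprD -Em.
  rewrite big_split; congr (_ * _); rewrite (big_rem p Hp) /= eqxx big1_seq ?mulr1 // => q.
  by rewrite mem_rem_uniq // => /andP[_ /andP[/negbTE -> _]]; rewrite expr0.
 by rewrite -mulrA E mulrDr [c * (d * _)]mulrA E'; ring.
- by move=> q Hq; rewrite pevM mulf_neq0 ?Hc ?Hc1.
- move=> q Hq Hex; apply: Hb => //; apply: (exo_div (exo_unif Hp Hq)); rewrite -Em.
 have : exo q (m q) (c1 * a) by rewrite -[m q]add0n; apply: exo_mul => //; apply: exo0; apply: Hc1.
 by rewrite E => /(exo_addJ (m q) (d * unif p) r (HJ Hq)).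
Qed.
End SemiLocal.
End Orders.

(** * Norms and the number of points in a fibre *)

Section Rank.
Variable C : cField.
Local Notation P2 := (mpoly 2 C).
Variables (J u : P2) (n : nat) (fr : frame J u n) (t : C).
Implicit Types (a b : P2) (p q : C * C).
Local Notation onft := (onf J u t).

Lemma separator (ps : seq (C * C)) p : uniq ps -> p \in ps ->
 exists a, pev p a != 0 /\ forall q, q \in ps -> q != p -> pev q a = 0.
Proof.
move=> Hu Hp; pose l q : P2 := if p.1 == q.1 then my C - cst q.2 else mx C - cst q.1.
exists (\prod_(q <- ps | q != p) l q); split.
 rewrite pev_prod prodf_seq_neq0; apply/allP => q _; apply/implyP => Hq; rewrite /l; case: (p.1 =P q.1) => E.
  rewrite !pevE subr_eq0; apply: contra Hq => /eqP E2.
  by rewrite [q]spair -E -E2 -spair.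
 by rewrite !pevE subr_eq0; apply/eqP.
move=> q Hq Hqp; rewrite pev_prod (big_rem q Hq) /= Hqp.
by rewrite /l; case: (p.1 == q.1); rewrite !pevE subrr mul0r.
Qed.

Lemma pev_cd p a : onft p -> pev p a = \sum_k (fcd fr a k).[t] * pev p (fe fr k).
Proof.
move=> /andP[/eqP HJ /eqP Hu]; rewrite {1}(fspan fr a) pevD pevM HJ mul0r addr0 pev_sum.
by apply: eq_bigr => k _; rewrite pevM pev_cu Hu.
Qed.

Lemma left_kernel (F : fieldType) m k (A : 'M[F]_(m, k)) : (k < m)%N ->
 exists2 v : 'rV_m, v != 0 & v *m A = 0.
Proof.
move=> H; have : kermx A != 0.
 by rewrite kermx_eq0; apply: contraL H => /eqP <-; rewrite -leqNgt rank_leq_col.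
case/rowV0Pn => v Hv Hn; exists v => //; exact/sub_kermxP.
Qed.

(** A relation between the evaluations on the basis extends to all polynomials, and separating
    polynomials refute it. *)
Lemma ev_free (ps : seq (C * C)) : uniq ps -> {in ps, forall p, onft p} ->
 row_free (\matrix_(i < size ps, k < n) pev (nth (0, 0) ps i) (fe fr k)).
Proof.
move=> Hu Hon; apply: inj_row_free => v Hv0.
have Hz a : \sum_(i < size ps) v 0 i * pev (nth (0, 0) ps i) a = 0.
 under eq_bigr => i _ do rewrite (pev_cd a (Hon _ (mem_nth (0,0) (ltn_ord i)))) mulr_sumr.
 rewrite exchange_big big1 //= => k _; under eq_bigr => i _ do rewrite mulrCA.
 rewrite -mulr_sumr; have /rowP/(_ k) := Hv0; rewrite !mxE.
 by under eq_bigr => i _ do rewrite mxE; move=> ->; rewrite mulr0.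
apply/rowP => i; rewrite mxE.
have Hi := mem_nth (0, 0) (ltn_ord i).
have [a [Ha Ha0]] := separator Hu Hi.
have := Hz a; rewrite (bigD1 i) //= big1 ?addr0 => [/eqP|j Hj]; last first.
 by rewrite Ha0 ?mulr0 ?mem_nth // nth_uniq.
by rewrite mulf_eq0 (negbTE Ha) orbF => /eqP.
Qed.

Lemma fibre_bound (ps : seq (C * C)) : uniq ps -> {in ps, forall p, onft p} -> (size ps <= n)%N.
Proof. by move=> Hu /(ev_free Hu) /eqP <-; apply: rank_leq_col. Qed.

Lemma fibre_finite : exists2 ps : seq (C * C), uniq ps & forall p, (p \in ps) = onft p.
Proof.
pose P k := `[< exists ps : seq (C * C), [/\ uniq ps, {in ps, forall p, onft p} & size ps = k] >].
have P0 : exists k, P k by exists 0%N; apply/asboolP; exists [::].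
have Pb k : P k -> (k <= n)%N.
 by move/asboolP => [ps [H1 H2 <-]]; apply: fibre_bound.
case: (ex_maxnP P0 Pb) => k /asboolP [ps [H1 H2 H3]] Hmax.
exists ps => // p; apply/idP/idP => [/H2//|Hp]; apply/negPn/negP => Hn.
have : P k.+1.
 apply/asboolP; exists (p :: ps); split; rewrite /= ?Hn ?H3 //.
 by move=> q; rewrite inE => /orP[/eqP ->|/H2].
by move/Hmax; rewrite ltnn.
Qed.

Lemma rhot_nz a : (forall p, onft p -> pev p a != 0) -> \det (rhot fr t a) != 0.
Proof.
move=> H; apply/negP => /eqP/rhot_sing [p Hp /eqP]; exact/negP/H.
Qed.

Variables (ps : seq (C * C)) (e : C * C -> nat).
Hypotheses (Hps : uniq ps) (Hon : forall p, (p \in ps) = onft p).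
Hypothesis (Hsm : forall p, p \in ps -> (pev p (dx J) != 0) || (pev p (dy J) != 0)).
Hypothesis (He : forall p, p \in ps -> exo J p (e p) (u - cst t)).

Let HJ p : p \in ps -> pev p J = 0.
Proof. by rewrite Hon => /andP[/eqP]. Qed.

Lemma e_gt0 p : p \in ps -> (0 < e p)%N.
Proof.
move=> Hp; rewrite lt0n; apply/eqP => E; have := (He Hp).2; rewrite E !pevE.
by move: Hp; rewrite Hon => /andP[_ /eqP ->]; rewrite subrr eqxx.
Qed.

(** If n exceeded the number of vanishing conditions, some nonzero combination b of the basis with
    constant coefficients would vanish to order e(p) at every point of the fibre. Up to units b
    would be a multiple of u - t, so its matrix on the fibre would be 0, and its coordinates too. *)
Lemma rank_upper : (n <= \sum_(p <- ps) e p)%N.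
Proof.
rewrite leqNgt; apply/negP => Hn.
pose fs := [seq (p, i) | p <- ps, i <- iota 0 (e p)].
have Hsz : size fs = (\sum_(p <- ps) e p)%N.
 by rewrite size_allpairs_dep sumnE big_map; apply: eq_bigr => p _; rewrite size_iota.
have [v Hv Hv0] := left_kernel (\matrix_(k < n, j < size fs)
  pev (nth ((0, 0), 0%N) fs j).1 (dl J (nth ((0, 0), 0%N) fs j).2 (fe fr k))) (eq_ind_r (fun x => x < n)%N Hn Hsz).
pose b : P2 := \sum_k cst (v 0 k) * fe fr k.
have dl_b i : dl J i b = \sum_k cst (v 0 k) * dl J i (fe fr k).
 elim: i => [//|i IH]; rewrite /dl iterS -/(dl J i b) IH.
 rewrite (big_morph (fun a => bra a J) (fun a b => braDl a b J) (_ : bra 0 J = 0)).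
  by apply: eq_bigr => k _; rewrite braMl bra_cstl mul0r addr0.
 by rewrite bra_cstl.
have Hvo p : p \in ps -> vo J p (e p) b.
 move=> Hp i Hi; have Hfs : (p, i) \in fs.
  by apply/allpairsPdep; exists p, i; rewrite mem_iota.
 have Hlt : (index (p, i) fs < size fs)%N by rewrite index_mem.
 have /rowP/(_ (Ordinal Hlt)) := Hv0; rewrite !mxE => <-; rewrite dl_b pev_sum.
 by apply: eq_bigr => k _; rewrite mxE nth_index // pevM pevC.
have [c [b' [r [E [Hc _]]]]] := semilocal_factor Hps HJ Hsm Hvo.
have [c1 [b1 [r1 [E1 [Hc1 Hb1]]]]] := semilocal_factor Hps HJ Hsm (fun p Hp => (He Hp).1).
have Hd : \det (rhot fr t (b1 * c)) != 0.
 by apply: rhot_nz => p; rewrite -Hon => Hp; rewrite pevM; apply: mulf_neq0; [exact: Hb1 Hp (He Hp)|exact: Hc].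
have Hz : rhot fr t (b1 * c * b) = 0.
 have -> : b1 * c * b = b' * c1 * (u - cst t) + J * (b1 * r - b' * r1).
  transitivity (b' * (c1 * (u - cst t)) + J * (b1 * r - b' * r1)); last by ring.
  by rewrite E1 -mulrA E; ring.
 rewrite rhotD rhotJ addr0 rhotM.
 suff -> : rhot fr t (u - cst t) = 0 by rewrite mulmx0.
 by rewrite -cstN rhotD rhot_u rhot_cst -raddfD subrr raddf0.
have Hb0 : rhot fr t b = 0.
 have Hun : rhot fr t (b1 * c) \in unitmx by rewrite unitmxE unitfE.
 by rewrite -[LHS](mulKmx Hun) -rhotM Hz mulmx0.
case/eqP: Hv; apply/rowP => k; rewrite mxE.
have Hcd l : fcd fr b l = (v 0 l)%:P.
 apply: (@fcd_uniq _ _ _ _ fr b (fun l => (v 0 l)%:P) 0).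
 by rewrite mulr0 addr0; apply: eq_bigr => i _; rewrite cu_polyC.
have : (fcd fr (b * 1) k).[t] = 0.
 rewrite cdM horner_sum big1 // => l _; rewrite hornerM.
 have /matrixP/(_ k l) := Hb0; rewrite [LHS]mxE [RHS]mxE => ->; by rewrite mul0r.
by rewrite mulr1 Hcd hornerC.
Qed.

Lemma det_rho_ut : \det (rho fr (u - cst t)) = ('X - t%:P) ^+ n.
Proof. by rewrite rhoB rho_u rho_cst -raddfB det_scalar. Qed.
Lemma det_rhoM a b : \det (rho fr (a * b)) = \det (rho fr a) * \det (rho fr b).
Proof. by rewrite rhoM det_mulmx. Qed.
Lemma det_rho_prod m (F : C * C -> P2) :
 \det (rho fr (\prod_(p <- ps) F p ^+ m p)) = \prod_(p <- ps) \det (rho fr (F p)) ^+ m p.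
Proof.
rewrite (big_morph (fun a => \det (rho fr a)) det_rhoM (_ : _ = 1)); last by rewrite rho1 det1.
apply: eq_bigr => p _; elim: (m p) => [|k IH]; first by rewrite rho1 det1.
by rewrite !exprS det_rhoM IH.
Qed.
Lemma det_root a : root (\det (rho fr a)) t = (\det (rhot fr t a) == 0).
Proof. by rewrite det_rhot. Qed.

Lemma mup_prod m (F : C * C -> {poly C}) (l : seq (C * C)) :
 (forall p, p \in l -> F p != 0) ->
 mup t (\prod_(p <- l) F p ^+ m p) = (\sum_(p <- l) m p * mup t (F p))%N /\ \prod_(p <- l) F p ^+ m p != 0.
Proof.
elim: l => [|p l IH] H; first by rewrite !big_nil oner_neq0 mupNroot // root1.
have [IH1 IH2] := IH (fun q Hq => H q (mem_behead (s := p :: l) Hq)).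
have Hp := H p (mem_head _ _).
have [E1 E2] : mup t (F p ^+ m p) = (m p * mup t (F p))%N /\ F p ^+ m p != 0.
 elim: (m p) => [|k [IHk1 IHk2]]; first by rewrite mupNroot ?root1 // oner_neq0.
 by rewrite exprS mupM // IHk1 mulf_neq0.
by rewrite !big_cons mupM // E1 IH1 mulf_neq0.
Qed.

(** By factoring into uniformizers, the norm of a has order sum of m(p) mu(p) at t, where mu(p) >= 1
    is the order of the norm of the uniformizer at p. For a = u - t the norm is (X - t)^n, so n =
    sum of e(p) mu(p); as n <= sum of e(p), every mu(p) is 1. *)
Lemma rank_and_order : n = (\sum_(p <- ps) e p)%N /\
 forall m a, (forall p, p \in ps -> exo J p (m p) a) ->
  \det (rho fr a) != 0 /\ mup t (\det (rho fr a)) = (\sum_(p <- ps) m p)%N.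
Proof.
have Xn0 : ('X - t%:P) ^+ n != 0 by rewrite expf_neq0 // polyXsubC_eq0.
pose h p := \det (rho fr (unif Hsm p)).
have Hfac m a : (forall p, p \in ps -> exo J p (m p) a) ->
  exists c b, \det (rho fr c) * \det (rho fr a) = \det (rho fr b) * \prod_(p <- ps) h p ^+ m p /\
   ~~ root (\det (rho fr c)) t /\ ~~ root (\det (rho fr b)) t.
 move=> Ha; have [c [b [r [E [Hc Hb]]]]] := semilocal_factor Hps HJ Hsm (fun p Hp => (Ha p Hp).1).
 exists c, b; split.
  by rewrite -det_rhoM E rhoDJ det_rhoM det_rho_prod.
 split; rewrite det_root; apply: rhot_nz => p; rewrite -Hon => Hp; first exact: Hc.
 by apply: Hb => //; apply: Ha.
have nr0 c : ~~ root c t -> c != 0 by apply: contraNneq => ->; rewrite root0.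
have [c0 [b0 [E0 [Hc0 Hb0]]]] := Hfac e _ He.
have Hh p : p \in ps -> h p != 0.
 move=> Hp; apply: contraTneq isT => Ep; move/eqP: E0; rewrite det_rho_ut (big_rem p Hp) /= Ep expr0n.
 rewrite (gtn_eqF (e_gt0 Hp)) mul0r mulr0 mulf_eq0 (negbTE (nr0 _ Hc0)) /=.
 by rewrite (negbTE Xn0).
have Hh1 p : p \in ps -> (0 < mup t (h p))%N.
 move=> Hp; rewrite -XsubC_dvd ?Hh // dvdp_XsubCl det_root; apply/eqP.
 by apply: (rhot_zero fr (p := p)); rewrite -?Hon; have [] := unifP Hsm Hp.
have Hmup m a : (forall p, p \in ps -> exo J p (m p) a) ->
  \det (rho fr a) != 0 /\ mup t (\det (rho fr a)) = (\sum_(p <- ps) m p * mup t (h p))%N.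
 move=> Ha; have [c [b [E [Hc Hb]]]] := Hfac m a Ha.
 have [Hm1 Hm2] := mup_prod m Hh.
 have Hnz : \det (rho fr a) != 0.
  apply: contraTneq isT => Ea; move/eqP: E; rewrite Ea mulr0 eq_sym mulf_eq0 (negbTE (nr0 _ Hb)) /=.
  by rewrite (negbTE Hm2).
 split=> //; have := congr1 (mup t) E.
 by rewrite mupM ?(nr0 _ Hc) // mupM ?(nr0 _ Hb) // (mupNroot Hc) (mupNroot Hb) Hm1.
have [_ Hn] := Hmup e _ He; rewrite det_rho_ut mup_XsubCX eqxx in Hn.
have Hle : (\sum_(p <- ps) e p * mup t (h p) <= \sum_(p <- ps) e p)%N by rewrite -Hn rank_upper.
have Hone p : p \in ps -> mup t (h p) = 1%N.
 move=> Hp; have := Hh1 p Hp; rewrite leq_eqVlt => /orP[/eqP <- //|Hlt].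
 exfalso; move: Hle; apply/negP; rewrite -ltnNge (big_rem p Hp) [X in (_ < X)%N](big_rem p Hp) /=.
 have H1 : (e p < e p * mup t (h p))%N by rewrite ltn_Pmulr // e_gt0.
 rewrite -addSn; apply: leq_add => //; rewrite big_seq [X in (_ <= X)%N]big_seq.
 by apply: leq_sum => q /mem_rem Hq; rewrite leq_pmulr // Hh1.
split.
 rewrite Hn big_seq [RHS]big_seq; apply: eq_bigr => p Hp; by rewrite Hone // muln1.
move=> m a Ha; have [H1 ->] := Hmup m a Ha; split=> //.
by rewrite big_seq [RHS]big_seq; apply: eq_bigr => p Hp; rewrite Hone // muln1.
Qed.
End Rank.

(* Bezout: total order of vanishing on J = 0 of a polynomial a of degree e whose top form is prime to that of J *)
Section Bezout.
Variable C : cField.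
Local Notation P2 := (mpoly 2 C).
Implicit Types (J a : P2) (p : C * C).
Theorem bezout J a D e : dgl D J -> dgl e a ->
 size (tf D J) = D.+1 -> coprimep (tf D J) (tf e a) ->
 (forall p, pev p J = 0 -> pev p a = 0 -> (pev p (dx J) != 0) || (pev p (dy J) != 0)) ->
 exists2 ps : seq (C * C), uniq ps & (forall p, (p \in ps) = (pev p J == 0) && (pev p a == 0)) /\
  forall m : C * C -> nat, (forall p, p \in ps -> exo J p (m p) a) -> (\sum_(p <- ps) m p = D * e)%N.
Proof.
move=> HJ Ha HJ0 Hcop Hsm.
case: (posnP e) Ha Hcop => [->|He] Ha Hcop.
 have [k' Ec] : exists k', a = cst k' by eexists; apply: msize1_polyC; apply/dgl_msize.
 have [D0|D0] := eqVneq D 0%N.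
  exists [::]; split=> [p|]; last by move=> m _; rewrite big_nil muln0.
  have [k EJ] : exists k, J = cst k by eexists; apply: msize1_polyC; apply/dgl_msize; rewrite -D0.
  rewrite EJ pevC; apply/esym/negbTE; rewrite negb_and; apply/orP; left.
  by move: HJ0; rewrite D0 EJ tf_cst size_polyC; case: (k == 0).
 exists [::]; split=> [p|]; last by move=> m _; rewrite big_nil muln0.
 rewrite Ec pevC; apply/esym/negbTE; rewrite negb_and; apply/orP; right.
 move: Hcop; rewrite Ec tf_cst; apply: contraTneq => ->; rewrite coprimep0.
 by rewrite -size_poly_eq1 HJ0.
have [fr] := frame_exists HJ Ha He HJ0 Hcop.
have [ps Hu Hon] := fibre_finite fr 0.
exists ps => //; split=> [//|m Hm].
have Hsm' p : p \in ps -> (pev p (dx J) != 0) || (pev p (dy J) != 0).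
 by rewrite Hon => /andP[/eqP H1 /eqP H2]; apply: Hsm.
have Hm' p : p \in ps -> exo J p (m p) (a - cst 0) by rewrite subr0; apply: Hm.
by have [<- _] := rank_and_order fr Hu Hon Hsm' Hm'.
Qed.
End Bezout.

(** * Composition, and the equation of the image curve *)

Section Composition.
Variable C : cField.
Local Notation P2 := (mpoly 2 C).
Implicit Types (a b f g h : P2) (p q : C * C).

Definition comp2 f g h : P2 := mmap (@mpolyC 2 C) (fun i : 'I_2 => if i == ord0 then f else g) h.
Lemma comp2D f g a b : comp2 f g (a + b) = comp2 f g a + comp2 f g b.
Proof. exact: mmapD. Qed.
Lemma comp2N f g a : comp2 f g (- a) = - comp2 f g a.
Proof. exact: mmapN. Qed.
Lemma comp2M f g a b : comp2 f g (a * b) = comp2 f g a * comp2 f g b.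
Proof. exact: rmorphM. Qed.
Lemma comp2_cst f g c : comp2 f g (cst c) = cst c. Proof. exact: mmapC. Qed.
Lemma comp2_0 f g : comp2 f g 0 = 0. Proof. exact: mmap0. Qed.
Lemma comp2_1 f g : comp2 f g 1 = 1. Proof. by rewrite comp2_cst. Qed.
Lemma comp2_x f g : comp2 f g (mx C) = f.
Proof. by rewrite /comp2 mmapX mmap1U. Qed.
Lemma comp2_y f g : comp2 f g (my C) = g.
Proof. by rewrite /comp2 mmapX mmap1U. Qed.
Lemma comp2X f g a k : comp2 f g (a ^+ k) = comp2 f g a ^+ k.
Proof. by elim: k => [|k IH]; rewrite ?comp2_1 // !exprS comp2M IH. Qed.
Definition comp2E := (comp2D, comp2N, comp2M, comp2_cst, comp2_0, comp2_1, comp2_x, comp2_y, comp2X).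
Lemma comp2_sum f g I r (P : pred I) (F : I -> P2) :
 comp2 f g (\sum_(i <- r | P i) F i) = \sum_(i <- r | P i) comp2 f g (F i).
Proof. by apply: (big_morph (comp2 f g) (comp2D f g) (comp2_0 f g)). Qed.
Lemma pev_comp2 p f g h : pev p (comp2 f g h) = pev (pev p f, pev p g) h.
Proof.
elim/P2_ind: h => [c|||a b Ha Hb|a b Ha Hb]; rewrite !comp2E ?pevE //=.
 by rewrite Ha Hb.
by rewrite Ha Hb.
Qed.
Lemma bra_comp2 f g h a : bra (comp2 f g h) a = comp2 f g (dx h) * bra f a + comp2 f g (dy h) * bra g a.
Proof.
elim/P2_ind: h => [c|||u v Hu Hv|u v Hu Hv]; rewrite ?dE !comp2E.
- by rewrite bra_cstl !mul0r addr0.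
- by rewrite mul1r mul0r addr0.
- by rewrite mul1r mul0r add0r.
- by rewrite braDl Hu Hv !mulrDl addrACA.
- rewrite braMl Hu Hv; move: (comp2 f g u) (comp2 f g v) (comp2 f g (dx u)) (comp2 f g (dy u)) (comp2 f g (dx v)) (comp2 f g (dy v)) (bra f a) (bra g a) => *; ring.
Qed.

(* restriction of a polynomial to the line s |-> (s, c(s)) *)
Definition lin (c : {poly C}) h : {poly C} := mmap (@polyC C) (fun i : 'I_2 => if i == ord0 then 'X else c) h.
Lemma linD c a b : lin c (a + b) = lin c a + lin c b. Proof. exact: mmapD. Qed.
Lemma linN c a : lin c (- a) = - lin c a. Proof. exact: mmapN. Qed.
Lemma linM c a b : lin c (a * b) = lin c a * lin c b. Proof. exact: rmorphM. Qed.
Lemma lin_cst c k : lin c (cst k) = k%:P. Proof. exact: mmapC. Qed.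
Lemma lin_x c : lin c (mx C) = 'X. Proof. by rewrite /lin mmapX mmap1U. Qed.
Lemma lin_y c : lin c (my C) = c. Proof. by rewrite /lin mmapX mmap1U. Qed.
Lemma lin1 c : lin c 1 = 1. Proof. by rewrite lin_cst. Qed.
Lemma lin0 c : lin c 0 = 0. Proof. exact: mmap0. Qed.
Lemma linX c a k : lin c (a ^+ k) = lin c a ^+ k.
Proof. by elim: k => [|k IH]; rewrite ?lin1 // !exprS linM IH. Qed.
Definition linE := (linD, linN, linM, lin_cst, lin_x, lin_y, lin1, lin0, linX).

Lemma pev_taylor2 p h : exists c1 c2 A B E,
 h = cst (pev p h) + cst c1 * (mx C - cst p.1) + cst c2 * (my C - cst p.2)
   + (mx C - cst p.1) ^+ 2 * A + (mx C - cst p.1) * (my C - cst p.2) * B + (my C - cst p.2) ^+ 2 * E.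
Proof.
have [h1 [h2 Eh]] := pev_taylor1 p h.
have [a1 [a2 E1]] := pev_taylor1 p h1.
have [b1 [b2 E2]] := pev_taylor1 p h2.
exists (pev p h1), (pev p h2), a1, (a2 + b1), b2.
by rewrite {1}Eh {1}E1 {1}E2; ring.
Qed.
End Composition.

Section Eliminant.
Variable C : cField.
Local Notation P2 := (mpoly 2 C).
Implicit Types (a b h : P2) (p q : C * C).
Variables (J f g : P2) (n : nat) (fr : frame J f n).

Definition Hp : {poly {poly C}} := char_poly (rho fr g).
Definition sub2 (f g : P2) (H : {poly {poly C}}) : P2 := \sum_(j < size H) cu f H`_j * g ^+ j.
Definition hH : P2 := sub2 (mx C) (my C) Hp.

Lemma Hp_horner c : Hp.[c] = \det (rho fr (cu f c - g)).
Proof.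
rewrite -/(horner_eval c _) -det_map_mx; congr (\det _).
apply/matrixP => i j; rewrite rhoB rho_cu !mxE /=.
by rewrite /horner_eval hornerD hornerN hornerC hornerMn hornerX.
Qed.
Lemma cu_comp2 u v c a : comp2 u v (cu a c) = cu (comp2 u v a) c.
Proof.
rewrite !(cuE _ (leqnn (size c))) comp2_sum; apply: eq_bigr => i _.
by rewrite !comp2E.
Qed.
Lemma comp2_sub2 u v H : comp2 u v (sub2 (mx C) (my C) H) = sub2 u v H.
Proof.
rewrite comp2_sum; apply: eq_bigr => j _.
by rewrite comp2M cu_comp2 !comp2E.
Qed.
Lemma lin_cu c r : lin c (cu (mx C) r) = r.
Proof.
rewrite (cuE _ (leqnn (size r))) (big_morph (lin c) (linD c) (lin0 c)).
rewrite -[RHS]coefK poly_def; apply: eq_bigr => i _; rewrite !linE.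
by rewrite mul_polyC.
Qed.
Lemma lin_hH c : lin c hH = Hp.[c].
Proof.
rewrite (big_morph (lin c) (linD c) (lin0 c)) horner_coef.
by apply: eq_bigr => j _; rewrite linM lin_cu !linE.
Qed.
Lemma pev_lin c t h : (lin c h).[t] = pev (t, c.[t]) h.
Proof.
elim/P2_ind: h => [k|||a b Ha Hb|a b Ha Hb]; rewrite !linE ?pevE ?hornerE //=.
 by rewrite Ha Hb.
by rewrite Ha Hb.
Qed.
Lemma pev_hH P : pev P hH = \det (rhot fr P.1 (cst P.2 - g)).
Proof.
have -> : pev P hH = (lin P.2%:P hH).[P.1] by rewrite pev_lin hornerC.
by rewrite lin_hH Hp_horner cu_polyC det_rhot.
Qed.
Lemma hH_zero P : pev P hH = 0 <-> exists2 p, pev p J = 0 & (pev p f, pev p g) = P.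
Proof.
case: P => u0 v0; rewrite pev_hH /=; split.
 move/rhot_sing => [p /andP[/eqP HJ /eqP Hf] Hg]; exists p => //.
 by move: Hg => /eqP; rewrite !pevE subr_eq0 Hf => /eqP ->.
move=> [p HJ [Hf Hg]]; apply: (@rhot_zero _ _ _ _ _ _ p); last by rewrite !pevE Hg subrr.
by rewrite /onf HJ Hf !eqxx.
Qed.
Lemma hH_neq0 : hH != 0.
Proof.
have [ps _ Hps] := fibre_finite fr 0.
have [v Hv] := avoid [seq pev p g | p <- ps].
apply: contraNneq Hv => H0; have : pev (0, v) hH = 0 by rewrite H0 pev0.
move/hH_zero => [p HJ [Hf Hg]]; apply/mapP; exists p => //.
by rewrite Hps /onf HJ Hf !eqxx.
Qed.

(** Cayley-Hamilton: the matrix of h(f, g) is the characteristic polynomial of the matrix of g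
    evaluated at that matrix. *)
Lemma hH_FJ : exists r, comp2 f g hH = J * r.
Proof.
have H0 : rho fr (comp2 f g hH) = 0.
 rewrite comp2_sub2 /sub2 /Hp.
 case: n fr => [|n'] fr'; first by apply/matrixP => -[].
 have := Cayley_Hamilton (rho fr' g).
 rewrite -{1}[char_poly _]coefK poly_def linear_sum /= => <-.
 rewrite (big_morph (rho fr') (rhoD fr') (rho_0 fr')); apply: eq_bigr => j _.
 rewrite linearZ rmorphXn /= horner_mx_X rhoM rho_cu mul_scalar_mx; congr (_ *: _).
 elim: (nat_of_ord j) => [|k IH]; first by rewrite rho1.
 by rewrite !exprS rhoM IH.
exists (fq fr (comp2 f g hH)).
rewrite {1}(fspan fr (comp2 f g hH)) big1 ?add0r // => k _.
have -> : fcd fr (comp2 f g hH) k = 0.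
 rewrite -[comp2 f g hH]mulr1 cdM big1 // => l _.
 by rewrite H0 mxE mul0r.
by rewrite cu0 mul0r.
Qed.
End Eliminant.

(* The local structure of the image curve, read off from the branches of F | C. *)
Section LocalStructure.
Variable C : cField.
Local Notation P2 := (mpoly 2 C).
Implicit Types (a b h : P2) (p q P : C * C).

Definition algsmooth h P := (pev P (dx h) != 0) || (pev P (dy h) != 0).
(** A double point whose quadratic part A(P), B(P), E(P) has nonzero discriminant; A, B, E are
    polynomials, so the expression is exact and no remainder occurs. *)
Definition algnode h P := exists A B E : P2,
 h = (mx C - cst P.1) ^+ 2 * A + (mx C - cst P.1) * (my C - cst P.2) * B + (my C - cst P.2) ^+ 2 * E /\
 pev P B ^+ 2 - 4 * pev P A * pev P E != 0.
(** For the weights 2 of U and 3 of V these are the terms of weight at least 6, with both extreme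
    monomials V^2 and U^3 present: the Newton polygon of an ordinary cusp. *)
Definition algcusp h P := exists (l1 l2 k1 k2 : C) (A B E : P2),
 let U := cst l1 * (mx C - cst P.1) + cst l2 * (my C - cst P.2) in
 let V := cst k1 * (mx C - cst P.1) + cst k2 * (my C - cst P.2) in
 [/\ l1 * k2 - l2 * k1 != 0, h = V ^+ 2 * A + U ^+ 2 * V * B + U ^+ 3 * E,
   pev P A != 0 & pev P E != 0].

Variables (J f g : P2) (n : nat) (fr : frame J f n).
Local Notation cc := (comp2 f g).
Local Notation T := (bra f J).
Local Notation T' := (bra g J).
Local Notation h := (hH g fr).
Local Notation im p := (pev p f, pev p g).
Hypothesis Hsm : forall p, pev p J = 0 -> (pev p (dx J) != 0) || (pev p (dy J) != 0).
Hypothesis HT : forall p, pev p J = 0 -> pev p T = 0 -> pev p (bra T J) != 0.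

(** The restriction of h to a line through P is the norm of the pulled-back equation of the line, so
    its order at P adds the orders of that equation at the preimages of P: 1 at an immersed point
    and 2 at a cusp, once the slope avoids finitely many tangents. *)
Lemma hH_lines P : exists be, exists m,
 let k := lin (P.2%:P + be%:P * ('X - P.1%:P)) h in
 [/\ k != 0, mup P.1 k = m &
  (forall p, pev p J = 0 -> im p = P -> pev p T = 0 -> pev p T' = 0 ->
   (forall q, pev q J = 0 -> im q = P -> q = p) -> m = 2) /\
  (forall p, pev p J = 0 -> im p = P -> (pev p T != 0) || (pev p T' != 0) ->
   (forall q, pev q J = 0 -> im q = P -> q = p) -> m = 1%N) /\
  (forall p q, p != q -> pev p J = 0 -> pev q J = 0 -> im p = P -> im q = P ->
   (pev p T != 0) || (pev p T' != 0) -> (pev q T != 0) || (pev q T' != 0) ->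
   (forall r, pev r J = 0 -> im r = P -> r = p \/ r = q) -> m = 2)].
Proof.
have [ps Hu Hps] := fibre_finite fr P.1.
have Hps' p : pev p J = 0 -> im p = P -> p \in ps.
 by move=> H1 E; rewrite Hps /onf H1 -E !eqxx.
(* The slope excluded at p is the direction of the first nonzero derivative of (f, g) along J =
   0. *)
pose bad p := if (pev p T == 0) && (pev p T' == 0) then (- pev p (bra T' J), pev p (bra T J)) else (- pev p T', pev p T).
have [|be Hbe] := @avoid_lin C [seq bad p | p <- ps].
 move=> x /mapP [p Hp ->]; rewrite /bad; case: ifP => [/andP[/eqP E1 _]|/negbT]; rewrite /= oppr_eq0.
  by rewrite HT ?orbT; move: Hp; rewrite Hps => /andP[/eqP].
 by rewrite negb_and orbC.
pose la : P2 := cst P.2 + cst be * (f - cst P.1) - g.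
pose ord p := if pev p g != P.2 then 0%N else if (pev p T == 0) && (pev p T' == 0) then 2 else 1%N.
have Hla p : p \in ps -> exo J p (ord p) la.
 rewrite Hps => /andP[/eqP HJp /eqP Hfp].
 have E0 : pev p la = P.2 - pev p g by rewrite !pevE Hfp; ring.
 have B1 : bra la J = cst be * T - T'.
  by rewrite /bra !dE; ring.
 rewrite /ord; case: eqP => [Eg|/eqP Ng] /=; last by apply: exo0; rewrite E0 subr_eq0 eq_sym.
 have Hin : bad p \in [seq bad p | p <- ps].
  by apply/mapP; exists p => //; rewrite Hps /onf HJp Hfp !eqxx.
 have := Hbe _ Hin; rewrite /bad; case: ifP => [/andP[/eqP E1 /eqP E2]|_] /= Hb.
  split=> [[|[|//]] _|]; rewrite /=.
  - by rewrite E0 Eg subrr.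
  - by rewrite B1 pevB pevM E1 E2 mulr0 subrr.
  have -> : bra (bra la J) J = cst be * bra T J - bra T' J.
   by rewrite B1 /bra !dE; ring.
  by apply: contra Hb; rewrite pevB pevM pevC addrC.
 split=> [[|//] _|]; rewrite /=; first by rewrite E0 Eg subrr.
 by apply: contra Hb; rewrite B1 pevB pevM pevC addrC.
have Hf p : p \in ps -> exo J p (if pev p T == 0 then 2 else 1%N) (f - cst P.1).
 rewrite Hps => /andP[/eqP HJp /eqP Hfp].
 have B1 : bra (f - cst P.1) J = T by rewrite /bra !dE; ring.
 case: eqP => ET; split.
 - by move=> [|[|//]] _; rewrite /= ?B1 // !pevE Hfp subrr.
 - by rewrite /= B1; apply: HT.
 - by move=> [|//] _; rewrite !pevE Hfp subrr.
 - by rewrite /= B1; apply/eqP.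
have Hsm' p : p \in ps -> (pev p (dx J) != 0) || (pev p (dy J) != 0).
 by rewrite Hps => /andP[/eqP HJp _]; apply: Hsm.
have [_ HO] := rank_and_order fr Hu Hps Hsm' Hf.
have [HO1 HO2] := HO ord la Hla.
pose c : {poly C} := P.2%:P + be%:P * ('X - P.1%:P).
have Ek : lin c h = \det (rho fr la).
 rewrite lin_hH Hp_horner; congr (\det (rho _ _)).
 by rewrite cuD cuM cuB !cu_polyC cuX.
exists be, (\sum_(p <- ps) ord p)%N; rewrite Ek; split=> //.
have ord0 q : q \in ps -> im q != P -> ord q = 0%N.
 rewrite Hps => /andP[_ /eqP Hfq] Hq; rewrite /ord; case: eqP => // Eg.
 by case/eqP: Hq; rewrite Hfq Eg -spair.
have one p : pev p J = 0 -> im p = P -> (forall q, pev q J = 0 -> im q = P -> q = p) ->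
  (\sum_(p <- ps) ord p)%N = ord p.
 move=> HJp Hp Hq; rewrite (big_rem p) ?Hps' //= big1_seq ?addn0 // => q /andP[_].
 rewrite mem_rem_uniq // => /andP[Hqp Hqs]; apply: ord0 => //.
 apply: contra Hqp => /eqP Eq; apply/eqP; apply: Hq => //.
 by move: Hqs; rewrite Hps => /andP[/eqP].
have Eord p : im p = P -> ord p = if (pev p T == 0) && (pev p T' == 0) then 2 else 1%N.
 by move=> Hp; rewrite /ord -Hp eqxx.
split; last split.
- by move=> p HJp Hp E1 E2 Hq; rewrite (one p) // Eord // E1 E2 eqxx.
- by move=> p HJp Hp E Hq; rewrite (one p) // Eord // -[_ && _]negbK negb_and E.
- move=> p q Npq HJp HJq Hp Hq E1 E2 Hr.
 rewrite (big_rem p) ?Hps' //= (big_rem q) /=; last first.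
  by rewrite mem_rem_uniq // inE eq_sym Npq Hps'.
 have O1 r : im r = P -> (pev r T != 0) || (pev r T' != 0) -> ord r = 1%N.
  by move=> Hr1 E; rewrite Eord // -[_ && _]negbK negb_and E.
 rewrite (O1 p) // (O1 q) // big1_seq // => r /andP[_].
 rewrite (mem_rem_uniq _ (rem_uniq _ Hu)) inE (mem_rem_uniq _ Hu) => /andP[Hrq]/andP[Hrp Hrs]; apply: ord0 => //.
 apply: contraTN Hrs => /eqP Er; apply/negP; rewrite Hps => /andP[/eqP HJr _].
 by case: (Hr r HJr Er) => E; [rewrite E eqxx in Hrp|rewrite E eqxx in Hrq].
Qed.

Lemma comp2_hH_vo p k : pev p J = 0 -> vo J p k (cc h).
Proof.
by move=> HJp; have [r ->] := hH_FJ g fr => i _; rewrite dlJ pevM HJp mul0r.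
Qed.
Lemma vo_add p k a b : vo J p k a -> vo J p k b -> vo J p k (a + b).
Proof. by move=> Ha Hb i Hi; rewrite dlD pevD Ha // Hb // addr0. Qed.
Lemma vo_mulr p k a b : vo J p k a -> vo J p k (a * b).
Proof. by move=> Ha; rewrite -[k]addn0; apply: vo_mul. Qed.
Lemma exo_addr p k a b : exo J p k a -> vo J p k.+1 b -> exo J p k (a + b).
Proof.
move=> [Ha Ha'] Hb; split; first by apply: vo_add => //; apply: vo_le Hb.
by rewrite dlD pevD (Hb k) // addr0.
Qed.
(** Tool for reading off the expansion of h at P: a term of exact order k on the branch cannot be
    cancelled by terms of higher order, so its coefficient vanishes at P. *)
Lemma ordcoef p P k m s rest : im p = P -> exo J p k m -> vo J p k.+1 rest ->
 vo J p k.+1 (m * cc s + rest) -> pev P s = 0.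
Proof.
move=> Hp Hm Hrest H; apply/eqP/negPn/negP => Hs.
have : exo J p k (m * cc s + rest).
 apply: exo_addr => //; rewrite -[k]addn0; apply: exo_mul => //; apply: exo0.
 by rewrite pev_comp2 Hp.
by case=> _; rewrite (H k) // eqxx.
Qed.

Lemma grad_relation p : pev p J = 0 ->
 pev p (cc (dx h) * T + cc (dy h) * T') = 0.
Proof. by move=> HJp; rewrite -bra_comp2; apply: (comp2_hH_vo (k := 2%N) HJp (i := 1%N) isT). Qed.

Local Notation X P := (mx C - cst P.1).
Local Notation Y P := (my C - cst P.2).
Lemma taylor_coef P c0 c1 c2 (A B E a : P2) :
 a = cst c0 + cst c1 * X P + cst c2 * Y P + X P ^+ 2 * A + X P * Y P * B + Y P ^+ 2 * E ->
 pev P (dx a) = c1 /\ pev P (dy a) = c2.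
Proof.
move=> ->; rewrite !dE !pevE; split; ring.
Qed.

Lemma lin_double be P (A B E : P2) :
 let c := P.2%:P + be%:P * ('X - P.1%:P) in
 lin c (X P ^+ 2 * A + X P * Y P * B + Y P ^+ 2 * E)
 = ('X - P.1%:P) ^+ 2 * (lin c A + be%:P * lin c B + (be ^+ 2)%:P * lin c E).
Proof. by rewrite /= !linE; ring. Qed.

Lemma mup_mulX t k (r : {poly C}) m : ('X - t%:P) ^+ k * r != 0 -> mup t (('X - t%:P) ^+ k * r) = m ->
 (k <= m)%N /\ (r.[t] = 0 -> (k < m)%N).
Proof.
rewrite mulf_eq0 negb_or => /andP[H1 H2]; rewrite mupM // mup_XsubCX eqxx => <-.
split; first exact: leq_addr.
move=> Hr; rewrite -{1}[k]addn0 ltn_add2l -XsubC_dvd // dvdp_XsubCl; exact/eqP.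
Qed.

Lemma comp2_quad P (A B E : P2) : cc (X P ^+ 2 * A + X P * Y P * B + Y P ^+ 2 * E) =
 (f - cst P.1) * (f - cst P.1) * cc A + (f - cst P.1) * (g - cst P.2) * cc B
 + (g - cst P.2) * (g - cst P.2) * cc E.
Proof. by rewrite !comp2E. Qed.
Lemma dy_quad P (A B E : P2) : dy (X P ^+ 2 * A + X P * Y P * B + Y P ^+ 2 * E) =
 X P * (X P * dy A + B + Y P * dy B) + Y P * (2 * E + Y P * dy E).
Proof. by rewrite !dE; ring. Qed.
Lemma dx_quad P (A B E : P2) : dx (X P ^+ 2 * A + X P * Y P * B + Y P ^+ 2 * E) =
 X P * (2 * A + X P * dx A) + Y P * (B + X P * dx B + Y P * dx E).
Proof. by rewrite !dE; ring. Qed.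
Lemma dy_cuspform (U V A B E d : P2) : dy U = 0 -> dy V = d ->
 dy (V ^+ 2 * A + U ^+ 2 * V * B + U ^+ 3 * E) = V * (2 * d * A + V * dy A) + U * U * (d * B + V * dy B + U * dy E).
Proof. by move=> HU HV; rewrite !dE HU HV; ring. Qed.
Lemma comp2XY P a b : cc (X P * a + Y P * b) = (f - cst P.1) * cc a + (g - cst P.2) * cc b.
Proof. by rewrite !comp2E. Qed.
Lemma pev_nat p k : pev p (k%:R : P2) = k%:R.
Proof. by elim: k => [|k IH]; rewrite ?pev0 // -[in LHS]natr1 pevD IH pev1 natr1. Qed.

Lemma pev_bra_lin p x y a b : pev p x = 0 -> pev p y = 0 ->
 pev p (bra (x * a + y * b) J) = pev p (bra x J) * pev p a + pev p (bra y J) * pev p b.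
Proof.
move=> Hx Hy; rewrite braDl !braMl.
by move: (bra x J) (bra y J) (bra a J) (bra b J) => ? ? ? ?; rewrite !pevE Hx Hy; ring.
Qed.
Lemma comp2_UV (U V M N : P2) : cc (V * M + U * U * N) =
 cc V * cc M + cc U * cc U * cc N.
Proof. by rewrite !comp2E. Qed.

Lemma isotropic_pair (A0 B0 E0 t1 t2 s1 s2 : C) : t1 * s2 - t2 * s1 != 0 ->
 t1 ^+ 2 * A0 + t1 * t2 * B0 + t2 ^+ 2 * E0 = 0 -> s1 ^+ 2 * A0 + s1 * s2 * B0 + s2 ^+ 2 * E0 = 0 ->
 B0 ^+ 2 - 4 * A0 * E0 = 0 -> [/\ A0 = 0, B0 = 0 & E0 = 0].
Proof.
move=> Htr Q1 Q2 Hd.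
have Dz z : (t1 * s2 - t2 * s1) * z = 0 -> z = 0.
 by move=> /eqP; rewrite mulf_eq0 (negbTE Htr) => /eqP.
(* The polar value of the form on the two vectors: its square is the discriminant times the squared
   determinant plus four times the product of the two values. *)
pose b12 := 2 * A0 * t1 * s1 + B0 * (t1 * s2 + s1 * t2) + 2 * E0 * t2 * s2.
have Hb : b12 = 0.
 apply/eqP; rewrite -sqrf_eq0; apply/eqP.
 transitivity ((B0 ^+ 2 - 4 * A0 * E0) * (t1 * s2 - t2 * s1) ^+ 2 + 4 * (t1 ^+ 2 * A0 + t1 * t2 * B0 + t2 ^+ 2 * E0) * (s1 ^+ 2 * A0 + s1 * s2 * B0 + s2 ^+ 2 * E0)).
  by rewrite /b12; ring.
 by rewrite Hd Q1; ring.
have ZA : A0 = 0.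
 do 2!apply: (Dz); transitivity ((t1 ^+ 2 * A0 + t1 * t2 * B0 + t2 ^+ 2 * E0) * s2 ^+ 2 - b12 * t2 * s2 + (s1 ^+ 2 * A0 + s1 * s2 * B0 + s2 ^+ 2 * E0) * t2 ^+ 2).
  by rewrite /b12; ring.
 by rewrite Q1 Q2 Hb; ring.
have ZE : E0 = 0.
 do 2!apply: (Dz); transitivity ((t1 ^+ 2 * A0 + t1 * t2 * B0 + t2 ^+ 2 * E0) * s1 ^+ 2 - b12 * t1 * s1 + (s1 ^+ 2 * A0 + s1 * s2 * B0 + s2 ^+ 2 * E0) * t1 ^+ 2).
  by rewrite /b12; ring.
 by rewrite Q1 Q2 Hb; ring.
have ZB : B0 = 0.
 do 2!apply: (Dz); transitivity (- 2 * (t1 ^+ 2 * A0 + t1 * t2 * B0 + t2 ^+ 2 * E0) * s1 * s2 + b12 * (t1 * s2 + s1 * t2) - 2 * (s1 ^+ 2 * A0 + s1 * s2 * B0 + s2 ^+ 2 * E0) * t1 * t2).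
  by rewrite /b12; ring.
 by rewrite Q1 Q2 Hb; ring.
by [].
Qed.

Lemma lin_cuspform c (U V A B E : P2) : lin c (V ^+ 2 * A + U ^+ 2 * V * B + U ^+ 3 * E) =
 lin c V ^+ 2 * lin c A + lin c U ^+ 2 * lin c V * lin c B + lin c U ^+ 3 * lin c E.
Proof. by rewrite !linE. Qed.

Section Smooth.
Variables (P p : C * C).
Hypotheses (HJp : pev p J = 0) (Hp : im p = P) (Him : (pev p T != 0) || (pev p T' != 0)).
Hypothesis (Hq : forall q, pev q J = 0 -> im q = P -> q = p).
Lemma hP0 : pev P h = 0. Proof. by apply/hH_zero; exists p. Qed.

(** If the gradient vanished, h would have order at least 2 on every line through P, against order 1
    on the chosen one. *)
Lemma smooth_branch : algsmooth h P.
Proof.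
have [be [m [Hk Hm [_ [H1 _]]]]] := hH_lines P.
have Em := H1 p HJp Hp Him Hq.
apply/negPn/negP; rewrite negb_or !negbK => /andP[/eqP D1 /eqP D2].
have [c1 [c2 [A [B [E Eh]]]]] := pev_taylor2 P h.
have [E1 E2] := taylor_coef Eh; rewrite D1 D2 in E1 E2.
rewrite hP0 -E1 -E2 !mul0r !add0r in Eh.
move: Hk Hm; rewrite {1 2}Eh lin_double Em => Hk Hm.
by have [] := mup_mulX Hk Hm.
Qed.

(** Differentiating h(f, g) = J r gives h_x T + h_y T' = 0 along the curve. Where T vanishes, T' and
    h_x do not, and h_y inherits the simple zero of T. *)
Lemma smooth_order : exo J p (if pev p T == 0 then 1%N else 0%N) (cc (dy h)).
Proof.
have HG := grad_relation HJp; rewrite pevD !pevM !pev_comp2 Hp in HG.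
have HS := smooth_branch; rewrite /algsmooth in HS.
case: eqP => HT0; last first.
 apply: exo0; rewrite pev_comp2 Hp; apply: contraTneq HS => E; move/eqP: HG.
 by rewrite E mul0r addr0 mulf_eq0 => /orP[/eqP ->|/eqP//]; rewrite eqxx.
have HT' : pev p T' != 0 by move: Him; rewrite HT0 eqxx.
have Hy : pev P (dy h) = 0.
 by move/eqP: HG; rewrite HT0 mulr0 add0r mulf_eq0 (negbTE HT') orbF => /eqP.
have Hx : pev P (dx h) != 0 by move: HS; rewrite Hy eqxx orbF.
apply: (exo_div (exo0 J HT')); rewrite addn0.
have [r Hr] := hH_FJ g fr.
have E : cc (dy h) * T' = - (cc (dx h) * T) + J * bra r J.
 apply/eqP; rewrite eq_sym addrC subr_eq addrC -bra_comp2 Hr braMl braxx mul0r addr0 //.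
rewrite E; apply/exo_addJ => //; rewrite -mulNr; apply: (exo_mul (i := 0%N)).
 by apply: exo0; rewrite pevN pev_comp2 Hp oppr_eq0.
by split=> [[|//] _|] //=; apply: HT.
Qed.
End Smooth.

Section Node.
Variables (P p q : C * C).
Hypotheses (Npq : p != q) (HJp : pev p J = 0) (HJq : pev q J = 0) (Hp : im p = P) (Hq : im q = P).
Hypothesis (Htr : pev p T * pev q T' - pev p T' * pev q T != 0).
Hypothesis (Hr : forall r, pev r J = 0 -> im r = P -> r = p \/ r = q).

Lemma node_imm1 : (pev p T != 0) || (pev p T' != 0).
Proof. by apply: contraTT Htr; rewrite negb_or !negbK => /andP[/eqP -> /eqP ->]; rewrite !mul0r subrr. Qed.
Lemma node_imm2 : (pev q T != 0) || (pev q T' != 0).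
Proof. by apply: contraTT Htr; rewrite negb_or !negbK => /andP[/eqP -> /eqP ->]; rewrite !mulr0 subrr. Qed.

Lemma dl2_mul s a b c : pev s a = 0 -> pev s b = 0 ->
 pev s (dl J 2 (a * b * c)) = 2 * (pev s (bra a J) * pev s (bra b J)) * pev s c.
Proof.
move=> Ha Hb.
have V1 d : pev s d = 0 -> vo J s 1 d by move=> Hd [|//] _.
have V2 : vo J s 2 (a * b) by rewrite -[2%N]/(1 + 1)%N; apply: vo_mul; apply: V1.
have := vo_lead V2 (vo0 J s c); rewrite mul1r => ->.
by have := vo_lead (V1 _ Ha) (V1 _ Hb); rewrite addn1 => ->.
Qed.

Lemma quad_order2 s (x y a b e : P2) : pev s x = 0 -> pev s y = 0 ->
 pev s (dl J 2 (x * x * a + x * y * b + y * y * e)) =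
 2 * (pev s (bra x J) * pev s (bra x J)) * pev s a + 2 * (pev s (bra x J) * pev s (bra y J)) * pev s b
 + 2 * (pev s (bra y J) * pev s (bra y J)) * pev s e.
Proof. by move=> Hx Hy; rewrite (dlD J 2 (_ + _)) (dlD J 2 (x * x * a)) pevD [pev s (dl J 2 (x * x * a) + _)]pevD !dl2_mul. Qed.
Lemma pev_XBY (a b d : P2) : pev P (X P * a + d + Y P * b) = pev P d.
Proof. by rewrite !pevE !subrr !mul0r add0r addr0. Qed.
Lemma pev_BXY (a b d : P2) : pev P (d + X P * a + Y P * b) = pev P d.
Proof. by rewrite !pevE !subrr !mul0r !addr0. Qed.
Lemma pev_EY (a d : P2) : pev P (2 * d + Y P * a) = 2 * pev P d.
Proof. by rewrite !pevE subrr mul0r addr0. Qed.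

(** The relations h_x T + h_y T' = 0 for two transverse branches kill the gradient, and the
    second-order term vanishes on both tangents. With zero discriminant it would vanish identically,
    and h would have order above 2 on every line through P. *)
Lemma node_local : exists A B E : P2,
 [/\ h = X P ^+ 2 * A + X P * Y P * B + Y P ^+ 2 * E,
  pev P B ^+ 2 - 4 * pev P A * pev P E != 0,
  pev p T ^+ 2 * pev P A + pev p T * pev p T' * pev P B + pev p T' ^+ 2 * pev P E = 0 &
  pev q T ^+ 2 * pev P A + pev q T * pev q T' * pev P B + pev q T' ^+ 2 * pev P E = 0].
Proof.
have [be [m [Hk Hm [_ [_ H2]]]]] := hH_lines P.
have Em := H2 p q Npq HJp HJq Hp Hq node_imm1 node_imm2 Hr.
have G1 := grad_relation HJp; rewrite pevD !pevM !pev_comp2 Hp in G1.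
have G2 := grad_relation HJq; rewrite pevD !pevM !pev_comp2 Hq in G2.
have Dz z : (pev p T * pev q T' - pev p T' * pev q T) * z = 0 -> z = 0.
 by move=> /eqP; rewrite mulf_eq0 (negbTE Htr) => /eqP.
have D1 : pev P (dx h) = 0.
 apply: Dz; transitivity ((pev P (dx h) * pev p T + pev P (dy h) * pev p T') * pev q T'
  - (pev P (dx h) * pev q T + pev P (dy h) * pev q T') * pev p T'); first by ring.
 by rewrite G1 G2; ring.
have D2 : pev P (dy h) = 0.
 apply: Dz; transitivity (- (pev P (dx h) * pev p T + pev P (dy h) * pev p T') * pev q T
  + (pev P (dx h) * pev q T + pev P (dy h) * pev q T') * pev p T); first by ring.
 by rewrite G1 G2; ring.
have [c1 [c2 [A [B [E Eh]]]]] := pev_taylor2 P h.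
have [E1 E2] := taylor_coef Eh; rewrite D1 D2 in E1 E2.
rewrite (hP0 HJp Hp) -E1 -E2 !mul0r !add0r in Eh.
have Q s : pev s J = 0 -> im s = P ->
 pev s T ^+ 2 * pev P A + pev s T * pev s T' * pev P B + pev s T' ^+ 2 * pev P E = 0.
 move=> HJs Hs; have E00 : pev s (dl J 2 (cc h)) = 0 by apply: (comp2_hH_vo HJs).
 have Z1 : pev s (f - cst P.1) = 0 by rewrite !pevE -Hs subrr.
 have Z2 : pev s (g - cst P.2) = 0 by rewrite !pevE -Hs subrr.
 have B1 : bra (f - cst P.1) J = T by rewrite /bra !dE; ring.
 have B2 : bra (g - cst P.2) J = T' by rewrite /bra !dE; ring.
 have E0 : 2 * (pev s T * pev s T) * pev P A + 2 * (pev s T * pev s T') * pev P B + 2 * (pev s T' * pev s T') * pev P E = 0.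
  rewrite Eh comp2_quad (quad_order2 _ _ _ Z1 Z2) B1 B2 in E00.
  by rewrite (pev_comp2 s f g A) (pev_comp2 s f g B) (pev_comp2 s f g E) Hs in E00.
 have : 2 * (pev s T ^+ 2 * pev P A + pev s T * pev s T' * pev P B + pev s T' ^+ 2 * pev P E) = 0.
  by rewrite -E0; ring.
 by move=> /eqP; rewrite mulf_eq0 pnatr_eq0 => /eqP.
have Q1 := Q p HJp Hp; have Q2 := Q q HJq Hq.
exists A, B, E; split=> //; apply/negP => /eqP Hd.
have [ZA ZB ZE] := isotropic_pair Htr Q1 Q2 Hd.
move: Hk Hm; rewrite {1 2}Eh lin_double Em => Hk Hm.
have [_] := mup_mulX Hk Hm; rewrite !hornerE !pev_lin !hornerE subrr mulr0 addr0 -spair.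
by rewrite ZA ZB ZE !mulr0 !addr0 => /(_ erefl).
Qed.

Lemma node_algnode : algnode h P.
Proof. by have [A [B [E [H1 H2 _ _]]]] := node_local; exists A, B, E. Qed.

(** One more than for a smooth branch: the quadratic part is nondegenerate, so h_y, or h_x where T =
    0, has a simple zero along the branch. *)
Lemma node_order : exo J p (if pev p T == 0 then 2%N else 1%N) (cc (dy h)).
Proof.
have [A [B [E [Eh Hd Q1 _]]]] := node_local.
have Z1 : pev p (f - cst P.1) = 0 by rewrite !pevE -Hp subrr.
have Z2 : pev p (g - cst P.2) = 0 by rewrite !pevE -Hp subrr.
have Z1' : vo J p 1 (f - cst P.1) by move=> [|//] _.
have Z2' : vo J p 1 (g - cst P.2) by move=> [|//] _.
have B1 : bra (f - cst P.1) J = T by rewrite /bra !dE; ring.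
have B2 : bra (g - cst P.2) J = T' by rewrite /bra !dE; ring.
have D a b : pev p (dl J 1 ((f - cst P.1) * a + (g - cst P.2) * b)) = pev p T * pev p a + pev p T' * pev p b.
 by rewrite pev_bra_lin // B1 B2.
have W a b : vo J p 1 ((f - cst P.1) * a + (g - cst P.2) * b).
 by apply: vo_add; apply: vo_mulr.
have Ey : cc (dy h) = (f - cst P.1) * cc (X P * dy A + B + Y P * dy B)
   + (g - cst P.2) * cc (2 * E + Y P * dy E).
 by rewrite {1}Eh dy_quad comp2XY.
have Ex : cc (dx h) = (f - cst P.1) * cc (2 * A + X P * dx A)
   + (g - cst P.2) * cc (B + X P * dx B + Y P * dx E).
 by rewrite {1}Eh dx_quad comp2XY.
have XP0 : pev P (X P) = 0 by rewrite !pevE subrr.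
have YP0 : pev P (Y P) = 0 by rewrite !pevE subrr.
case: eqP => HT0; last first.
 split; first by rewrite Ey; apply: W.
 rewrite Ey D (pev_comp2 p f g (_ + B + _)) (pev_comp2 p f g (2 * E + _)) Hp pev_XBY pev_EY.
 apply: contra Hd => /eqP E0; apply/eqP.
 have : pev p T ^+ 2 * (pev P B ^+ 2 - 4 * pev P A * pev P E) = 0.
  transitivity ((pev p T * pev P B + pev p T' * (2 * pev P E)) ^+ 2 - 4 * pev P E * (pev p T ^+ 2 * pev P A + pev p T * pev p T' * pev P B + pev p T' ^+ 2 * pev P E)); first by ring.
  by rewrite E0 Q1; ring.
 by move=> /eqP; rewrite mulf_eq0 sqrf_eq0; case: eqP => [/HT0//|_ /eqP].
have HT' : pev p T' != 0 by move: node_imm1; rewrite HT0 eqxx.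
apply: (exo_div (exo0 J HT')); rewrite addn0.
have [r Er] := hH_FJ g fr.
have EE : cc (dy h) * T' = - (cc (dx h) * T) + J * bra r J.
 apply/eqP; rewrite eq_sym addrC subr_eq addrC -bra_comp2 Er braMl braxx mul0r addr0 //.
rewrite EE; apply/exo_addJ => //; rewrite -mulrN; apply: (exo_mul (i := 1%N)).
 split; first by rewrite Ex; apply: W.
 rewrite Ex D HT0 mul0r add0r (pev_comp2 p f g (B + _ + _)) Hp pev_BXY mulf_neq0 //.
 have E0 : pev P E = 0.
  by move/eqP: Q1; rewrite HT0 expr0n !mul0r !add0r mulf_eq0 sqrf_eq0 (negbTE HT') => /eqP.
 by move: Hd; rewrite E0 mulr0 subr0 sqrf_eq0.
split=> [[|//] _|] /=; first by rewrite pevN HT0 oppr0.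
by rewrite (_ : bra (- T) J = - bra T J) ?pevN ?oppr_eq0; [exact: HT|rewrite /bra; ring].
Qed.
End Node.

Section Cusp.
Variables (P p : C * C).
Hypotheses (HJp : pev p J = 0) (Hp : im p = P) (HT0 : pev p T = 0) (HT0' : pev p T' = 0).
Hypothesis (Hq : forall q, pev q J = 0 -> im q = P -> q = p).
Hypothesis (Hab : pev p (dl J 2 f) * pev p (dl J 3 g) - pev p (dl J 2 g) * pev p (dl J 3 f) != 0).

Let a1 := pev p (dl J 2 f).
Let a2 := pev p (dl J 2 g).
Let U := X P.
(** Chosen to cancel the second-order terms, so that U and V have orders 2 and 3 along the
    branch. *)
Let V := cst a2 * X P - cst a1 * Y P.

Lemma a1_neq0 : a1 != 0. Proof. exact: HT. Qed.

Lemma UV_expand a : exists b1 b2, a = cst (pev P a) + U * b1 + V * b2.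
Proof.
have [s1 [s2 Es]] := pev_taylor1 P a.
exists (s1 + cst (a2 / a1) * s2), (- cst (a1^-1) * s2).
have E : cst a1 * cst a1^-1 = 1 :> P2 by rewrite -cstM divff ?a1_neq0.
rewrite {1}Es /U /V cstM -addrA -addrA; congr (_ + _).
transitivity (X P * s1 + (cst a1 * cst a1^-1) * (Y P * s2)); first by rewrite E mul1r.
ring.
Qed.

Lemma exoU : exo J p 2 (f - cst P.1).
Proof.
have B1 : bra (f - cst P.1) J = T by rewrite /bra !dE; ring.
split; last by rewrite dlS B1; exact: a1_neq0.
by move=> [|[|//]] _; rewrite ?dlS ?B1 //= !pevE -Hp subrr.
Qed.
Lemma exoV : exo J p 3 (cst a2 * (f - cst P.1) - cst a1 * (g - cst P.2)).
Proof.
set v := _ - _.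
have B1 : bra v J = cst a2 * T - cst a1 * T' by rewrite /v /bra !dE; ring.
have B3 (t t' : P2) : bra (cst a2 * t - cst a1 * t') J = cst a2 * bra t J - cst a1 * bra t' J.
 by move: (a2) (a1) => k2 k1; rewrite /bra !dE; ring.
have B2 : bra (cst a2 * T - cst a1 * T') J = cst a2 * bra T J - cst a1 * bra T' J.
 exact: B3.
split.
 move=> [|[|[|//]]] _; rewrite ?dlS ?B1 ?B2 //=.
 - by rewrite !pevE -Hp; ring.
 - by rewrite pevB !pevM !pevC HT0 HT0'; ring.
 - by rewrite pevB !pevM !pevC -/a1 mulrC subrr.
have E3 : pev p (dl J 3 v) = a2 * pev p (dl J 3 f) - a1 * pev p (dl J 3 g).
 rewrite dlS B1 dlS B2 dlS B3 /dl /iter.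
 by move: (bra (bra T J) J) (bra (bra T' J) J) => x y; rewrite pevB 2!pevM 2!pevC.
by rewrite E3 -opprB oppr_eq0.
Qed.

Lemma comp2U : cc U = f - cst P.1. Proof. by rewrite !comp2E. Qed.
Lemma comp2V : cc V = cst a2 * (f - cst P.1) - cst a1 * (g - cst P.2).
Proof. by rewrite !comp2E. Qed.

(** The monomials U, V, U^2, U V have distinct orders 2, 3, 4, 5 along the branch, so their
    coefficients vanish at P one after the other. V^2 is present because h has order 2 on a line
    through P; U^3, also of order 6, must then be present to cancel it. *)
Lemma cusp_local : exists A B E : P2,
 [/\ h = V ^+ 2 * A + U ^+ 2 * V * B + U ^+ 3 * E, pev P A != 0 & pev P E != 0].
Proof.
have [be [m [Hk Hm [H1 _]]]] := hH_lines P.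
have Em := H1 p HJp Hp HT0 HT0' Hq.
have OU := exoU; have OV := exoV; rewrite -comp2U in OU; rewrite -comp2V in OV.
have HF k := comp2_hH_vo (k := k) HJp.
have ex j k a b i : exo J p j a -> exo J p k b -> i = (j + k)%N -> exo J p i (a * b).
 by move=> Ha Hb ->; apply: exo_mul.
have vx k l a b : exo J p k a -> (l <= k)%N -> vo J p l (a * b).
 by move=> [Ha _] Hl; apply: vo_mulr; apply: vo_le Ha.
have OUU : exo J p 4 (cc U * cc U) by exact: (ex _ _ _ _ _ OU OU erefl).
have OUV : exo J p 5 (cc U * cc V) by exact: (ex _ _ _ _ _ OU OV erefl).
have OVV : exo J p 6 (cc V * cc V) by exact: (ex _ _ _ _ _ OV OV erefl).
have OUUU : exo J p 6 (cc U * cc U * cc U) by exact: (ex _ _ _ _ _ OUU OU erefl).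
have OUUV : exo J p 7 (cc U * cc U * cc V) by exact: (ex _ _ _ _ _ OUU OV erefl).
have [h1 [h2 Eh]] := UV_expand h.
rewrite (hP0 HJp Hp) add0r in Eh.
have Z1 : pev P h1 = 0.
 apply: (@ordcoef p P 2 (cc U) h1 (cc V * cc h2)) => //; first by apply: (vx _ _ _ _ OV).
 by rewrite -!comp2M -comp2D -Eh; apply: HF.
have [h11 [h12 E1]] := UV_expand h1; rewrite Z1 add0r in E1.
have Z2 : pev P h2 = 0.
 apply: (@ordcoef p P 3 (cc V) h2 (cc U * cc U * cc h11 + cc U * cc V * cc h12)) => //.
  by apply: vo_add; [by apply: (vx _ _ _ _ OUU)|by apply: (vx _ _ _ _ OUV)].
 have -> : cc V * cc h2 + (cc U * cc U * cc h11 + cc U * cc V * cc h12) = cc h.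
  by rewrite -!comp2M -!comp2D; congr (cc _); rewrite Eh E1; ring.
 exact: HF.
have [h21 [h22 E2]] := UV_expand h2; rewrite Z2 add0r in E2.
have Z11 : pev P h11 = 0.
 apply: (@ordcoef p P 4 (cc U * cc U) h11 (cc U * cc V * cc (h12 + h21) + cc V * cc V * cc h22)) => //.
  by apply: vo_add; [by apply: (vx _ _ _ _ OUV)|by apply: (vx _ _ _ _ OVV)].
 have -> : cc U * cc U * cc h11 + (cc U * cc V * cc (h12 + h21) + cc V * cc V * cc h22) = cc h.
  by rewrite -!comp2M -!comp2D; congr (cc _); rewrite Eh E1 E2; ring.
 exact: HF.
have [k1 [k2 E11]] := UV_expand h11; rewrite Z11 add0r in E11.
have Z12 : pev P (h12 + h21) = 0.
 apply: (@ordcoef p P 5 (cc U * cc V) (h12 + h21) (cc V * cc V * cc h22 + cc U * cc U * cc U * cc k1 + cc U * cc U * cc V * cc k2)) => //.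
  by apply: vo_add; [apply: vo_add; [by apply: (vx _ _ _ _ OVV)|by apply: (vx _ _ _ _ OUUU)]|by apply: (vx _ _ _ _ OUUV)].
 have -> : cc U * cc V * cc (h12 + h21) + (cc V * cc V * cc h22 + cc U * cc U * cc U * cc k1 + cc U * cc U * cc V * cc k2) = cc h.
  by rewrite -!comp2M -!comp2D; congr (cc _); rewrite Eh E1 E2 E11; ring.
 exact: HF.
have [m1 [m2 E12]] := UV_expand (h12 + h21); rewrite Z12 add0r in E12.
pose A := h22 + U * m2; pose B := k2 + m1; pose E := k1.
have EE : h = V ^+ 2 * A + U ^+ 2 * V * B + U ^+ 3 * E.
 transitivity (U * U * h11 + U * V * (h12 + h21) + V * V * h22); first by rewrite Eh E1 E2; ring.
 by rewrite E12 E11 /A /B /E; ring.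
have HA : pev P A != 0.
 apply/negP => /eqP A0.
 pose c : {poly C} := P.2%:P + be%:P * ('X - P.1%:P).
 have EU : lin c U = 'X - P.1%:P by rewrite !linE.
 have EV : lin c V = ('X - P.1%:P) * (a2%:P - a1%:P * be%:P) by rewrite /V !linE /c; ring.
 have El : lin c h = ('X - P.1%:P) ^+ 2 * ((a2%:P - a1%:P * be%:P) ^+ 2 * lin c A +
   ('X - P.1%:P) * (lin c U * 0 + (a2%:P - a1%:P * be%:P) * lin c B + lin c E)).
  by rewrite {1}EE lin_cuspform EU EV; ring.
 move: Hk Hm; rewrite El Em => Hk Hm.
 have [_ H0] := mup_mulX Hk Hm.
 suff /H0 : ((a2%:P - a1%:P * be%:P) ^+ 2 * lin c A +
   ('X - P.1%:P) * (lin c U * 0 + (a2%:P - a1%:P * be%:P) * lin c B + lin c E)).[P.1] = 0 by rewrite ltnn.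
 have cP : c.[P.1] = P.2 by rewrite !hornerE subrr mulr0 addr0.
 by rewrite hornerD hornerM pev_lin cP -spair A0 mulr0 add0r hornerM hornerXsubC subrr mul0r.
exists A, B, E; split=> //; apply/negP => /eqP E0.
have := @ordcoef p P 6 (cc V * cc V) A (cc U * cc U * cc V * cc B + cc U * cc U * cc U * cc E) Hp OVV.
have [e1 [e2 Ee]] := UV_expand E; rewrite E0 add0r in Ee.
move=> HH; case/negP: HA; apply/eqP; apply: HH.
 apply: vo_add; first by apply: (vx _ _ _ _ OUUV).
 rewrite Ee comp2D !comp2M mulrDr !mulrA; apply: vo_add.
  have O8 := ex _ _ _ _ _ OUUU OU erefl; move: (cc e1) => w.
  by apply: (vx 8%N 7%N _ w O8).
 have O9 := ex _ _ _ _ _ OUUU OV erefl; move: (cc e2) => w.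
 by apply: (vx 9%N 7%N _ w O9).
have -> : cc V * cc V * cc A + (cc U * cc U * cc V * cc B + cc U * cc U * cc U * cc E) = cc h.
 by rewrite -!comp2M -!comp2D; congr (cc _); rewrite EE; ring.
exact: HF.
Qed.

Lemma cusp_algcusp : algcusp h P.
Proof.
have [A [B [E [Eh HA HE]]]] := cusp_local.
exists 1, 0, a2, (- a1), A, B, E; split=> //.
 by rewrite mul1r mul0r subr0 oppr_eq0 a1_neq0.
by rewrite mul1r mul0r addr0 cstN mulNr.
Qed.

Lemma cusp_order : exo J p 3 (cc (dy h)).
Proof.
have [A [B [E [Eh HA HE]]]] := cusp_local.
have dyU : dy U = 0 by rewrite !dE; ring.
have dyV : dy V = - cst a1 by rewrite /V !dE; ring.
have Ey := dy_cuspform A B E dyU dyV; rewrite -Eh in Ey.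
have OU := exoU; have OV := exoV; rewrite -comp2U in OU; rewrite -comp2V in OV.
rewrite Ey comp2_UV; apply: exo_addr.
 rewrite -[3%N]addn0; apply: exo_mul => //; apply: exo0.
 have VP0 : pev P V = 0 by rewrite !pevE !subrr !mulr0 subrr.
 rewrite pev_comp2 Hp pevD 3!pevM VP0 mul0r addr0 pev_nat pevN pevC.
 by rewrite !mulf_neq0 ?oppr_eq0 ?a1_neq0 // pnatr_eq0.
by apply: vo_mulr; rewrite -[4%N]/(2 + 2)%N; apply: vo_mul; [exact: OU.1|exact: OU.1].
Qed.
End Cusp.
End LocalStructure.

(** * The part of the eliminant of highest weight *)

Lemma size_prod_bound (R : nzRingType) n (F : 'I_n -> {poly R}) a :
 (forall i, (size (F i) <= (a i).+1)%N) ->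
 (size (\prod_i F i)%R <= (\sum_i a i).+1)%N /\ (\prod_i F i)`_(\sum_i a i) = \prod_i (F i)`_(a i).
Proof.
elim: n F a => [|n IH] F a H; first by rewrite !big_ord0 size_poly1 coef1.
rewrite !big_ord_recl; have [] := IH (fun i => F (lift ord0 i)) (fun i => a (lift ord0 i)) (fun i => H _).
set P := \prod_i _; set A := (\sum_i _)%N => HP <-; have H0 := H ord0.
split; first by apply: leq_trans (size_polyMleq _ _) _; lia.
rewrite coefM (bigD1 (inord (a ord0))) //= inordK ?leq_addr // addKn big1 ?addr0 // => i Hi.
have [Hlt|Hle] := ltnP i (a ord0).
 by rewrite [P`_ _]nth_default ?mulr0 //; apply: leq_trans HP _; lia.
rewrite [(F ord0)`_ _]nth_default ?mul0r //; apply: leq_trans H0 _.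
rewrite ltn_neqAle Hle andbT; apply: contra Hi => /eqP E.
by apply/eqP; apply: val_inj; rewrite /= inordK ?leq_addr.
Qed.

Lemma det_top_coef (R : comNzRingType) n (M : 'M[{poly R}]_n) a :
 (forall i j, (size (M i j) <= (a j).+1)%N) ->
 (size (\det M) <= (\sum_j a j).+1)%N /\
 (\det M)`_(\sum_j a j) = \det (\matrix_(i, j) (M i j)`_(a j)).
Proof.
move=> H; rewrite -det_tr -[in RHS]det_tr /determinant.
have E (s : {perm 'I_n}) := size_prod_bound (fun j => H (s j) j).
have EP (s : {perm 'I_n}) : \prod_i M^T i (s i) = \prod_i M (s i) i by apply: eq_bigr => i _; rewrite mxE.
split.
 apply: (leq_trans (size_sum _ _ _)); apply/bigmax_leqP => s _.
 by rewrite EP mulr_sign; case: ifP; rewrite ?size_polyN; case: (E s).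
rewrite coef_sum; apply: eq_bigr => s _; rewrite EP.
under [in RHS]eq_bigr do rewrite !mxE.
by have [_ <-] := E s; case: odd_perm; rewrite ?mulN1r ?coefN ?mul1r.
Qed.

Section Infinity.
Variable C : cField.
Local Notation P2 := (mpoly 2 C).
Implicit Types (a b : P2) (p : C * C).

Lemma hom_psi m a : hom m a -> psi a = (tf m a)%:P * 'X^m.
Proof.
move=> H; apply/polyP => j; rewrite psi_coef coefCM coefXn.
by case: (eqVneq j m) => [->|/H ->]; rewrite ?mulr1 ?mulr0.
Qed.
Lemma hom_inj m a b : hom m a -> hom m b -> tf m a = tf m b -> a = b.
Proof. by move=> Ha Hb E; apply: psi_inj; rewrite (hom_psi Ha) (hom_psi Hb) E. Qed.
Lemma hom_fm m (c : {poly C}) : (size c <= m.+1)%N -> hom m (fm m c).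
Proof. by move=> Hc j Hj; rewrite tf_fm // (negbTE Hj). Qed.
Lemma homM m n a b : hom m a -> hom n b -> hom (m + n) (a * b).
Proof.
move=> Ha Hb j Hj; rewrite -psi_coef psiM (hom_psi Ha) (hom_psi Hb) mulrACA -polyCM -exprD coefCM coefXn.
by rewrite (negbTE Hj) mulr0.
Qed.
Lemma homD m a b : hom m a -> hom m b -> hom m (a + b).
Proof. by move=> Ha Hb j Hj; rewrite tfD Ha // Hb // addr0. Qed.
Lemma hom0 m : hom m (0 : P2). Proof. by move=> j _; rewrite tf0. Qed.
Lemma hom_sum m I r (P : pred I) (F : I -> P2) :
 (forall i, P i -> hom m (F i)) -> hom m (\sum_(i <- r | P i) F i).
Proof. by move=> H; elim/big_ind: _ => //; [exact: hom0|exact: homD]. Qed.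
Lemma hom_cst (k : C) : hom 0 (cst k).
Proof. by move=> j Hj; apply: dgl_cst; rewrite lt0n. Qed.
Lemma homX m a k : hom m a -> hom (k * m) (a ^+ k).
Proof.
move=> Ha; elim: k => [|k IH]; first by rewrite expr0; apply: hom_cst.
by rewrite exprS; apply: homM.
Qed.
Lemma hom_dgl m a : hom m a -> dgl m a.
Proof. by move=> H j Hj; apply: H; rewrite gtn_eqF. Qed.

Lemma fm0 m : fm m 0 = 0 :> P2.
Proof. by rewrite /fm big1 // => i _; rewrite coef0 scale0r. Qed.
Lemma tf_fmE m a : tf m (fm m (tf m a)) = tf m a.
Proof. by rewrite tf_fm ?size_tf // eqxx. Qed.

(** With n distinct points the evaluation vectors form an invertible matrix that conjugates
    multiplication by a into the diagonal matrix of its values. *)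
Lemma char_poly_fibre J u n (fr : frame J u n) t (zs : seq (C * C)) a :
 uniq zs -> {in zs, forall p, onf J u t p} -> size zs = n ->
 char_poly (rhot fr t a) = \prod_(z <- zs) ('X - (pev z a)%:P).
Proof.
move=> Hu Hon Hn; subst n.
have Hz i : onf J u t (nth (0, 0) zs i) \/ (size zs <= i)%N.
 by have [H|H] := ltnP i (size zs); [left; apply/Hon/mem_nth|right].
set B := rhot fr t a.
pose E := \matrix_(i < size zs, k < size zs) pev (nth (0, 0) zs i) (fe fr k).
pose d := \row_(i < size zs) pev (nth (0, 0) zs i) a.
have HE : \det E != 0 by have := ev_free fr Hu Hon; rewrite row_free_unit unitmxE unitfE.
have EB : E *m B = diag_mx d *m E.
 apply/row_matrixP => i; rewrite row_mul.
 have -> : row i E = \row_k pev (nth (0, 0) zs i) (fe fr k) by apply/rowP => k; rewrite !mxE.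
 by rewrite (ev_eigen fr a (Hon _ (mem_nth _ (ltn_ord i)))) row_mul row_diag_mx -scalemxAl -rowE; congr (_ *: _); [rewrite mxE|apply/rowP => k; rewrite !mxE].
pose E' := map_mx (@polyC C) E.
have EE : E' *m char_poly_mx B = char_poly_mx (diag_mx d) *m E'.
 rewrite mulmxBr mulmxBl -!map_mxM EB; congr (_ - _).
 by rewrite mul_scalar_mx mul_mx_scalar.
have := congr1 determinant EE; rewrite !det_mulmx [X in _ = X]mulrC => H.
have {H} -> : char_poly B = char_poly (diag_mx d).
 by apply: (mulfI _ H); rewrite det_map_mx polyC_eq0.
rewrite (big_nth (0, 0)) big_mkord char_poly_trig //.
by apply: eq_bigr => i _; rewrite !mxE eqxx.
Qed.

Section Weights.
Variables (d1 d2 : nat).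
(** The substitution x = T^d1, y = s T^d2: the outer degree is the weight that bounds total degree
    after substituting f and g. *)
Definition wt (h : P2) : {poly {poly C}} :=
 mmap (polyC \o polyC) (fun i : 'I_2 => if i == ord0 then 'X^d1 else 'X%:P * 'X^d2) h.
Lemma wtD a b : wt (a + b) = wt a + wt b. Proof. exact: mmapD. Qed.
Lemma wtN a : wt (- a) = - wt a. Proof. exact: mmapN. Qed.
Lemma wtM a b : wt (a * b) = wt a * wt b. Proof. exact: rmorphM. Qed.
Lemma wt_cst k : wt (cst k) = k%:P%:P. Proof. exact: mmapC. Qed.
Lemma wt_x : wt (mx C) = 'X^d1. Proof. by rewrite /wt mmapX mmap1U. Qed.
Lemma wt_y : wt (my C) = 'X%:P * 'X^d2. Proof. by rewrite /wt mmapX mmap1U. Qed.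
Lemma wt1 : wt 1 = 1. Proof. by rewrite wt_cst. Qed.
Lemma wt0 : wt 0 = 0. Proof. exact: mmap0. Qed.
Lemma wtX a k : wt (a ^+ k) = wt a ^+ k.
Proof. by elim: k => [|k IH]; rewrite ?wt1 // !exprS wtM IH. Qed.
Lemma wt_sum I r (P : pred I) (F : I -> P2) :
 wt (\sum_(i <- r | P i) F i) = \sum_(i <- r | P i) wt (F i).
Proof. by apply: (big_morph wt wtD wt0). Qed.

Lemma wt_coef h m j : ((wt h)`_m)`_j =
 \sum_(mu <- msupp h | (mu ord0 * d1 + mu ord_max * d2 == m)%N && (mu ord_max == j)) mcoeff mu h.
Proof.
have E (mu : multinom 2) : (('X^d1 ^+ mu ord0 * ('X%:P * 'X^d2) ^+ mu ord_max : {poly {poly C}})`_m)`_j =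
  ((mu ord0 * d1 + mu ord_max * d2 == m)%N && (mu ord_max == j))%:R.
 rewrite exprMn -!exprM -polyC_exp mulrCA -exprD coefCM coefXn mulnC [(d2 * _)%N]mulnC.
 rewrite eq_sym; case: eqP => _; last by rewrite mulr0 coef0.
 by rewrite mulr1 coefXn eq_sym.
rewrite {1}[h]mpolyE wt_sum coef_sum coef_sum [RHS]big_mkcond.
apply: eq_bigr => mu _; rewrite scale_cst wtM wt_cst !coefCM {2}(mnE mu) mpolyX_mn.
by rewrite wtM !wtX wt_x wt_y E; case: ifP; rewrite ?mulr1 ?mulr0.
Qed.
Lemma wt_supp h mu : (0 < d1)%N -> mu \in msupp h ->
 ((wt h)`_(mu ord0 * d1 + mu ord_max * d2))`_(mu ord_max) = mcoeff mu h.
Proof.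
move=> Hd1 Hmu; rewrite wt_coef big_mkcond (bigD1_seq mu) //= !eqxx /=.
rewrite big1 ?addr0 // => nu Hnu; case: ifP => // /andP[/eqP E1 /eqP E2]; case/negP: Hnu.
apply/eqP; rewrite [nu]mnE [mu]mnE; move: E1; rewrite E2 => /eqP.
by rewrite eqn_add2r eqn_pmul2r // => /eqP ->.
Qed.
Lemma wt_gcd h m : (wt h)`_m != 0 -> (gcdn d1 d2 %| m)%N.
Proof.
move=> H; apply/negPn/negP => Hm; case/eqP: H; apply/polyP => j; rewrite coef0 wt_coef big1 // => mu /andP[/eqP E _].
by case/negP: Hm; rewrite -E dvdn_add // dvdn_mull ?dvdn_gcdl ?dvdn_gcdr.
Qed.

Definition wdgl N h := forall m, (N < m)%N -> (wt h)`_m = 0.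

Lemma dy_sum I r (P : pred I) (F : I -> P2) :
 dy (\sum_(i <- r | P i) F i) = \sum_(i <- r | P i) dy (F i).
Proof. by apply: (big_morph (@dy C) (@dyD C) (@dy0 C)). Qed.
Lemma dyX a k : dy (a ^+ k.+1) = (k.+1)%:R * a ^+ k * dy a.
Proof.
elim: k => [|k IH]; first by rewrite !mul1r.
rewrite exprS dyM IH; have -> : (k.+2%:R : P2) = 1 + k.+1%:R by rewrite -[k.+2]add1n.
by rewrite [a ^+ k.+1]exprS; ring.
Qed.
(** A monomial of weight m has degree at most m after substitution of f and g, and differentiation
    in y lowers the weight by d2. Writing N < M + d2 avoids a truncated difference. *)
Lemma dgl_comp2_dy f g N h M : (0 < d1)%N -> dgl d1 f -> dgl d2 g -> wdgl N h -> (N < M + d2)%N ->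
 tf M (comp2 f g (dy h)) = 0.
Proof.
move=> Hd1 Hf Hg HN HM; rewrite [h]mpolyE dy_sum comp2_sum tf_sum big_seq big1 // => mu Hmu.
have Hw : (mu ord0 * d1 + mu ord_max * d2 <= N)%N.
 rewrite leqNgt; apply/negP => H; have := wt_supp Hd1 Hmu; rewrite HN // coef0 => E.
 by move: Hmu; rewrite mcoeff_msupp -E eqxx.
rewrite dyZ scale_cst comp2M comp2_cst {2}(mnE mu) mpolyX_mn.
case Ej : (mu ord_max) => [|j].
 by rewrite mulr1 (_ : dy _ = 0) ?comp2_0 ?mulr0 ?tf0; case: (mu ord0) => [|k]; rewrite ?dE // dyX dyx mulr0.
suff : dgl (mu ord0 * d1 + j * d2) (cst (mcoeff mu h) * comp2 f g (dy (mx C ^+ mu ord0 * my C ^+ j.+1))).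
 by apply; move: Hw; rewrite Ej; lia.
rewrite -[X in dgl X]add0n; apply: dglM; first exact: dgl_cst.
have -> : dy (mx C ^+ mu ord0 * my C ^+ j.+1) = cst (j.+1%:R) * (mx C ^+ mu ord0 * my C ^+ j).
 rewrite dyM dyX dyy mulr1 (_ : dy (mx C ^+ _) = 0); last by case: (mu ord0) => [|k]; rewrite ?dE // dyX dyx mulr0.
 by rewrite mul0r add0r mulrCA; congr (_ * _); rewrite /cst rmorph_nat.
rewrite !comp2E -[X in dgl X]add0n; apply: dglM; first exact: dgl_cst.
by apply: dglM; apply: dglX.
Qed.
End Weights.

Section TopPart.
Variables (J f g : P2) (D d1 d2 : nat).
Hypotheses (HJ : dgl D J) (Hf : dgl d1 f) (Hg : dgl d2 g) (Hd1 : (0 < d1)%N).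
Hypotheses (HJ0 : size (tf D J) = D.+1) (Hcop : coprimep (tf D J) (tf d1 f)).
Let Jh := fm D (tf D J).
Let fh := fm d1 (tf d1 f).
Let gh := fm d2 (tf d2 g).
Variables (w : 'I_(D * d1) -> nat) (be : 'I_(D * d1) -> P2).
Hypothesis Hbe : forall k, hom (w k) (be k).
Variables (fr : frame J f (D * d1)) (fr0 : frame Jh fh (D * d1)).
Hypotheses (Efr : fe fr = be) (Efr0 : fe fr0 = be).
Hypothesis Hdeg : forall N a, dgl N a -> forall k j, (fcd fr a k)`_j != 0 -> (j * d1 + w k <= N)%N.
Let B := \matrix_(k, l) ('X^(w k) * (rho fr g k l \Po 'X^d1))`_(d2 + w l).

Lemma coef_comp_Xn (c : {poly C}) m i : ('X^m * (c \Po 'X^d1))`_i =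
 if (m <= i)%N && (d1 %| i - m)%N then c`_((i - m) %/ d1) else 0.
Proof.
rewrite coefXnM; case: leqP => //= Hm; exact: coef_comp_poly_Xn.
Qed.

(** Both frames have the same basis, and by the degree bound the top form of g times a basis form
    involves only the top terms of its coordinates. These are the coordinates of the homogeneous
    product; evaluation at 1 keeps their coefficients. *)
Lemma rhot_top : rhot fr0 1 gh = B.
Proof.
apply/matrixP => k l; rewrite !mxE coef_comp_Xn Efr Efr0.
set N := (d2 + w l)%N.
have HN : dgl N (g * be l) by apply: dglM => //; apply: hom_dgl.
pose c := fcd fr (g * be l).
pose jj k := ((N - w k) %/ d1)%N.
pose x k := if (w k <= N)%N && (d1 %| N - w k)%N then (c k)`_(jj k) else 0.
have Hx k' : x k' != 0 -> (jj k' * d1 + w k')%N = N.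
 rewrite /x; case: ifP => [/andP[H1 H2] _|]; last by rewrite eqxx.
 by rewrite divnK // subnK.
have Hc k' : dgl N (cu f (c k') * be k') /\ tf N (cu f (c k') * be k') = x k' *: (tf d1 f ^+ jj k' * tf (w k') (be k')).
 have [E|Hn] := eqVneq (c k') 0.
  rewrite E cu0 mul0r tf0; split; first exact: dgl0.
  by rewrite /x E coef0 if_same scale0r.
 pose j := (size (c k')).-1.
 have Hs : size (c k') = j.+1 by rewrite prednK // size_poly_gt0.
 have Hl : (c k')`_j != 0 by rewrite lead_coef_eq0.
 have HjN := Hdeg HN Hl.
 have H1 : dgl (j * d1 + w k') (cu f (c k') * be k').
  by apply: dglM; [apply: dgl_cu; rewrite ?Hs|apply: hom_dgl].
 split; first exact: dgl_mono H1.
 have [Ej|Ej] := eqVneq (j * d1 + w k')%N N.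
  rewrite -{1}Ej tfM; [|by apply: dgl_cu; rewrite ?Hs|exact: hom_dgl].
  have Ejj : jj k' = j by rewrite /jj -Ej addnK mulnK.
  rewrite tf_cu ?Hs // /x Ejj -Ej leq_addl addnK dvdn_mull //= scalerAl.
  done.
 rewrite H1; last by rewrite ltn_neqAle Ej.
 suff -> : x k' = 0 by rewrite scale0r.
 apply/eqP/negPn/negP => Hxn; have := Hx _ Hxn; move: Hxn; rewrite /x; case: ifP => [_|]; last by rewrite eqxx.
 move=> Hcn EN; have : (jj k' <= j)%N.
  by rewrite -ltnS -Hs ltnNge; apply: contra Hcn => H; rewrite nth_default.
 move=> Hle; case/negP: Ej; rewrite eqn_leq HjN -EN leq_add2r leq_mul2r Hle orbT //.
have HJb : dgl N (J * fq fr (g * be l)).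
 have := fspan fr (g * be l); rewrite Efr => E; have -> : J * fq fr (g * be l) = g * be l - \sum_k cu f (fcd fr (g * be l) k) * be k by rewrite {2}E addrAC subrr add0r.
 apply: dglB => //; apply: dgl_sum => k' _; exact: (Hc k').1.
have [b Hb Eb] := tf_Jmul HJ Hd1 HJ0 Hcop HJb.
have -> : fcd fr0 (gh * be l) k = x k *: 'X^(jj k).
 apply: (@fcd_uniq _ _ _ _ fr0 (gh * be l) (fun k => x k *: 'X^(jj k)) (fm (N - D) b)); rewrite Efr0.
 have homJ : hom N (Jh * fm (N - D) b).
  have [HDN|HDN] := leqP D N; last first.
   have -> : b = 0 by apply/eqP; rewrite -size_poly_eq0; move: Hb; lia.
   by rewrite fm0 mulr0; apply: hom0.
  rewrite -{1}(subnKC HDN); apply: homM; apply: hom_fm; [exact: size_tf|lia].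
 have homx k' : hom N (cu fh (x k' *: 'X^(jj k')) * be k').
  have [->|Hn] := eqVneq (x k') 0; first by rewrite scale0r cu0 mul0r; apply: hom0.
  rewrite -mul_polyC cuM cu_polyC -mulrA -(Hx _ Hn) -[X in hom X]add0n; apply: homM; first exact: hom_cst.
  apply: homM => //; rewrite (_ : cu _ _ = fh ^+ jj k'); first by apply: homX; apply: hom_fm; apply: size_tf.
  by rewrite /cu map_polyXn hornerXn.
 apply: (hom_inj (m := N)).
 - by apply: homM => //; apply: hom_fm; apply: size_tf.
 - by apply: homD => //; apply: hom_sum.
 have homg : hom d2 gh by apply: hom_fm; apply: size_tf.
 rewrite tfM; [|exact: hom_dgl|exact: hom_dgl].
 have -> : tf d2 gh * tf (w l) (be l) = tf N (g * be l) by rewrite tf_fmE -tfM //; apply: hom_dgl.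
 have E0 := fspan fr (g * be l); rewrite Efr in E0; rewrite E0.
 rewrite !tfD !tf_sum; congr (_ + _); last first.
  rewrite Eb; have [HDN|HDN] := leqP D N; last first.
   have -> : b = 0 by apply/eqP; rewrite -size_poly_eq0; move: Hb; lia.
   by rewrite fm0 !mulr0 tf0.
  have Hs : (size b <= (N - D).+1)%N by lia.
  have HJh := dgl_fm (size_tf D J); have Hbh := dgl_fm Hs.
  by have := tfM HJh Hbh; rewrite subnKC // tf_fmE tf_fm // eqxx => ->.
 apply: eq_bigr => k' _; rewrite (Hc k').2.
 have [->|Hn] := eqVneq (x k') 0; first by rewrite !scale0r cu0 mul0r tf0.
 rewrite -[x k' *: 'X^(jj k')]mul_polyC cuM cu_polyC -mulrA -[in RHS](Hx _ Hn).
 have H1 : hom (jj k' * d1) (cu fh 'X^(jj k')).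
  by rewrite /cu map_polyXn hornerXn; apply: homX; apply: hom_fm; apply: size_tf.
 have H2 := dglM (hom_dgl H1) (hom_dgl (@Hbe k')).
 have := tfM (dgl_cst (x k')) H2; rewrite add0n => ->.
 rewrite tf_cst tfM; [|exact: hom_dgl|exact: hom_dgl].
 by rewrite mul_polyC /cu map_polyXn hornerXn tfX ?tf_fmE //; apply: dgl_fm; apply: size_tf.
by rewrite hornerZ hornerXn expr1n mulr1 /c.
Qed.

Definition subt (c : {poly C}) : {poly {poly C}} := map_poly polyC (c \Po 'X^d1).
Lemma subt_is_nmod : nmod_morphism subt.
Proof. by split; rewrite /subt ?rmorph0 // => a b; rewrite comp_polyD rmorphD. Qed.
Lemma subt_is_monoid : monoid_morphism subt.
Proof. by split; rewrite /subt ?comp_polyC ?map_polyC // => a b; rewrite comp_polyM rmorphM. Qed.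
HB.instance Definition _ := GRing.isNmodMorphism.Build {poly C} {poly {poly C}} subt subt_is_nmod.
HB.instance Definition _ := GRing.isMonoidMorphism.Build {poly C} {poly {poly C}} subt subt_is_monoid.

Lemma wt_cu c : wt d1 d2 (cu (mx C) c) = subt c.
Proof.
rewrite (cuE _ (leqnn _)) wt_sum /subt comp_polyE rmorph_sum; apply: eq_bigr => i _ /=.
by rewrite wtM wt_cst wtX wt_x -mul_polyC rmorphM /= map_polyC rmorphXn /= map_polyXn.
Qed.

Let pt : {poly {poly C}} := 'X%:P * 'X^d2.
Lemma wt_hH_det : wt d1 d2 (hH g fr) = \det (pt%:M - map_mx subt (rho fr g)).
Proof.
transitivity (map_poly subt (Hp g fr)).[pt].
 rewrite wt_sum (@horner_coef_wide _ (size (Hp g fr))) ?size_poly //.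
 by apply: eq_bigr => i _; rewrite wtM wt_cu wtX wt_y coef_map.
rewrite map_char_poly -/(horner_eval pt _) -det_map_mx; congr (\det _).
apply/matrixP => i j; rewrite !mxE /=.
by rewrite /horner_eval hornerD hornerN hornerC hornerMn hornerX.
Qed.

(** Row k of the characteristic matrix is scaled by T^(w k), so that column l has degree at most d2
    + w l. The top coefficient of the determinant is then the determinant of the top coefficients;
    the scaling contributes the sum of the w k, which cancels. *)
Lemma wt_hH : (size (wt d1 d2 (hH g fr)) <= (D * d1 * d2).+1)%N /\
 (wt d1 d2 (hH g fr))`_(D * d1 * d2) = char_poly (rhot fr0 1 gh).
Proof.
pose Sw := (\sum_k w k)%N.
pose M := \matrix_(k, l) ('X^(w k) * (pt%:M - map_mx subt (rho fr g)) k l).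
have HM : \det M = 'X^Sw * wt d1 d2 (hH g fr).
 rewrite wt_hH_det.
 have -> : M = diag_mx (\row_k 'X^(w k)) *m (pt%:M - map_mx subt (rho fr g)).
  apply/matrixP => k l; rewrite mul_diag_mx [LHS]mxE [RHS]mxE; congr (_ * _).
  by rewrite mxE.
 rewrite det_mulmx det_diag; congr (_ * _).
 by rewrite expr_sum; apply: eq_bigr => k _; rewrite mxE.
have ME k l : M k l = (k == l)%:R * ('X%:P * 'X^(w k + d2)) - map_poly polyC ('X^(w k) * (rho fr g k l \Po 'X^d1)).
 rewrite rmorphM /= map_polyXn -/(subt _).
 rewrite !mxE mulrBr; congr (_ - _).
 by case: (k == l); rewrite ?mulr0 ?mul0r // mul1r mulrCA -exprD.
have Hs k l : (size (M k l) <= (d2 + w l).+1)%N.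
 apply/leq_sizeP => i Hi; rewrite ME coefB coef_map /= coef_comp_Xn.
 have -> : (k == l)%:R * ('X%:P * 'X^(w k + d2)) = (if k == l then 'X%:P * 'X^(w k + d2) else 0) :> {poly {poly C}}.
  by case: eqP; rewrite ?mul1r ?mul0r.
 have -> : (if k == l then 'X%:P * 'X^(w k + d2) else 0 : {poly {poly C}})`_i = 0.
  case: eqP => [->|_]; last by rewrite coef0.
  by rewrite coefCM coefXn; case: eqP => E; rewrite ?mulr0 //; move: Hi; rewrite E; lia.
 rewrite sub0r; apply/eqP; rewrite oppr_eq0 polyC_eq0; case: ifP => // /andP[H1 H2].
 apply/negPn/negP; rewrite mxE => /(Hdeg _).
 have HN : dgl (d2 + w l) (g * be l) by apply: dglM => //; apply: hom_dgl.
 by rewrite Efr => /(_ _ HN); rewrite divnK // subnK // leqNgt Hi.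
have [H1 H2] := det_top_coef Hs.
have ES : (\sum_l (d2 + w l) = Sw + D * d1 * d2)%N.
 by rewrite big_split sum_nat_const card_ord addnC.
rewrite HM ES in H1 H2; split.
 by apply/leq_sizeP => i Hi; move/leq_sizeP: H1 => /(_ (Sw + i)%N); rewrite ltn_add2l Hi => /(_ isT); rewrite coefXnM ltnNge leq_addr addKn.
move: H2; rewrite coefXnM ltnNge leq_addr addKn /= => ->.
rewrite rhot_top; congr (\det _); apply/matrixP => k l.
rewrite [LHS]mxE ME coefB coef_map !mxE; congr (_ - _).
case: (k =P l) => [->|_]; last by rewrite mul0r coef0.
by rewrite mul1r coefCM coefXn addnC eqxx mulr1.
Qed.
End TopPart.

Lemma prod_prim_root n (z y : C) : n.-primitive_root z -> y != 0 ->
 \prod_(i <- iota 0 n) ('X - (z ^+ i * y)%:P) = 'X^n - (y ^+ n)%:P.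
Proof.
move=> Hz Hy; have Hn := prim_order_gt0 Hz.
have := @all_roots_prod_XsubC _ ('X^n - (y ^+ n)%:P) [seq z ^+ i * y | i <- iota 0 n].
rewrite big_map size_map size_iota size_XnsubC // (monicP (monicXnsubC _ _)) // scale1r => <- //.
- apply/allP => _ /mapP[i _ ->]; rewrite /root !hornerE exprMn exprAC (prim_expr_order Hz).
 by rewrite expr1n mul1r subrr.
- rewrite uniq_rootsE map_inj_in_uniq ?iota_uniq // => i j; rewrite !mem_iota !add0n => Hi Hj /(mulIf Hy)/eqP.
 by rewrite (eq_prim_root_expr Hz) !modn_small // => /eqP.
Qed.

(** The powers z^(i k) run gcd(k, n) times through the (n / gcd(k, n))-th roots of unity: the origin
    of the gcd in the node formula. *)
Lemma prod_prim_pow n k (z y : C) : (0 < n)%N -> n.-primitive_root z -> y != 0 ->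
 \prod_(i <- iota 0 n) ('X - (z ^+ (i * k) * y)%:P) = ('X^(n %/ gcdn k n) - (y ^+ (n %/ gcdn k n))%:P) ^+ gcdn k n.
Proof.
move=> Hn Hz Hy; set d := gcdn k n; set m := (n %/ d)%N.
have Hp : m.-primitive_root (z ^+ k) by apply: exp_prim_root.
have -> : n = (d * m)%N by rewrite mulnC divnK // dvdn_gcdr.
clearbody m d; elim: d => [|d IH]; first by rewrite big_nil.
rewrite mulSn addnC iotaD big_cat IH exprSr; congr (_ * _).
rewrite -(prod_prim_root Hp Hy) -[X in iota X _]addn0 iotaDl big_map.
apply: eq_bigr => i _; rewrite -exprM mulnDl exprD -mulnA [(d * _)%N]mulnC -[(m * k)%N]mulnC.
by rewrite -mulnA exprM [_ ^+ (m * d)]exprM (prim_expr_order Hp) expr1n mul1r mulnC.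
Qed.

Lemma prim_root_exists n : (0 < n)%N -> exists z : C, n.-primitive_root z.
Proof.
move=> Hn; pose p : {poly C} := 'X^n - 1.
have [r Er] := closed_field_poly_normal p.
have Hs : size p = n.+1 by rewrite size_XnsubC.
have lp : lead_coef p = 1 by apply/monicP/monicXnsubC.
rewrite lp scale1r in Er.
have Hr : size r = n by apply/eqP; rewrite -eqSS -Hs Er size_prod_XsubC.
have Hu : uniq r.
 rewrite -separable_prod_XsubC -Er; apply: separable_Xn_sub_1.
 by rewrite pnatr_eq0 -lt0n.
have Ha : all n.-unity_root r.
 apply/allP => x Hx; have : root p x by rewrite Er root_prod_XsubC.
 by rewrite /root !hornerE subr_eq0 => /eqP E; apply/unity_rootP.
have := has_prim_root Hn Ha Hu; rewrite Hr leqnn => /(_ isT)/hasP[z _ Hz].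
by exists z.
Qed.
End Infinity.

(** * Forms one degree below the top *)

Section SubLeading.
Variable C : cField.
Local Notation P2 := (mpoly 2 C).
Implicit Types (a b : P2) (p : C * C).

Definition tfp m a : {poly C} := if m is k.+1 then tf k a else 0.

Lemma coefM_sub (R : comNzRingType) (p q : {poly R}) m n : (size p <= m.+1)%N -> (size q <= n.+1)%N ->
 (if (m + n)%N is k.+1 then (p * q)`_k else 0) =
 p`_m * (if n is k.+1 then q`_k else 0) + (if m is k.+1 then p`_k else 0) * q`_n.
Proof.
move=> Hp Hq.
pose p' := \poly_(i < m) p`_i; pose q' := \poly_(i < n) q`_i.
have Ep : p = p' + p`_m *: 'X^m.
 apply/polyP => i; rewrite coefD coefZ coefXn coef_poly; case: (ltngtP i m) => H; rewrite ?mulr0 ?addr0 ?mulr1 ?add0r ?H //.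
 by rewrite nth_default //; apply: leq_trans Hp H.
have Eq : q = q' + q`_n *: 'X^n.
 apply/polyP => i; rewrite coefD coefZ coefXn coef_poly; case: (ltngtP i n) => H; rewrite ?mulr0 ?addr0 ?mulr1 ?add0r ?H //.
 by rewrite nth_default //; apply: leq_trans Hq H.
case Ek : (m + n)%N => [|k].
 by move: Ek => /eqP; rewrite addn_eq0 => /andP[/eqP -> /eqP ->]; rewrite mulr0 mul0r addr0.
have -> : p * q = p' * q' + (p`_m *: (q * 'X^m) + q`_n *: (p' * 'X^n)).
 rewrite {1}Ep {1}Eq mulrDl !mulrDr -!addrA; congr (_ + _).
 have -> : q * 'X^m = q' * 'X^m + q`_n *: 'X^n * 'X^m by rewrite {1}Eq mulrDl.
 by rewrite -!mul_polyC; ring.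
rewrite !coefD !coefZ !coefMXn.
have -> : (p' * q')`_k = 0.
 rewrite nth_default //; apply: leq_trans (size_polyMleq _ _) _.
 have := size_poly m (fun i => p`_i); have := size_poly n (fun i => q`_i); rewrite -/p' -/q'; lia.
rewrite add0r; congr (_ + _).
 by case: n Ek {Hq Eq q'} => [|n] Ek; rewrite ?mulr0; [rewrite (_ : (k < m)%N) ?mulr0 //; lia|
  rewrite ltnNge (_ : (m <= k)%N); [congr (_ * q`_ _); lia|lia]].
rewrite mulrC; congr (_ * _).
case: m Ek {Hp Ep} @p' => [|m] Ek p'; first by rewrite (_ : (k < n)%N) //; lia.
rewrite ltnNge (_ : (n <= k)%N) /=; last by lia.
by rewrite coef_poly (_ : k - n = m)%N ?ltnSn //; lia.
Qed.

Lemma tfpE m a : tfp m a = if m is k.+1 then (psi a)`_k else 0.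
Proof. by case: m => // m; rewrite psi_coef. Qed.
Lemma tfpM m n a b : dgl m a -> dgl n b -> tfp (m + n) (a * b) = tf m a * tfp n b + tfp m a * tf n b.
Proof.
move=> /dglP Ha /dglP Hb; rewrite !tfpE -!psi_coef psiM; exact: coefM_sub.
Qed.
Lemma tfpD m a b : tfp m (a + b) = tfp m a + tfp m b.
Proof. by case: m => [|m]; rewrite /= ?addr0 // tfD. Qed.
Lemma tfpN m a : tfp m (- a) = - tfp m a.
Proof. by case: m => [|m]; rewrite /= ?oppr0 // tfN. Qed.
Lemma tfpX m a k : dgl m a -> tfp (k * m) (a ^+ k) = (k%:R *: tf m a ^+ k.-1) * tfp m a.
Proof.
move=> Ha; elim: k => [|k IH]; first by rewrite scale0r mul0r.
rewrite mulSn exprS tfpM //; last exact: dglX.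
rewrite IH tfX // /= -!mul_polyC; case: k {IH} => [|k]; first by rewrite !expr0; ring.
rewrite [tf m a ^+ k.+1]exprS -[k.+2]add1n natrD; ring.
Qed.
Lemma tfp_hom m a : hom m a -> tfp m a = 0.
Proof. by case: m => [|m] H //=; apply: H; rewrite ltn_eqF. Qed.

(** The hypothesis says that b has degree at most N - m, a bound that may be negative; b is then
    0. *)
Lemma tfM_neg m N a b : dgl m a -> (forall j, (N < j + m)%N -> tf j b = 0) ->
 exists c, tf N (a * b) = tf m a * c.
Proof.
move=> Ha Hb; exists (if (m <= N)%N then tf (N - m) b else 0).
rewrite -psi_coef psiM coefM; case: ifP => Hm.
 rewrite (bigD1 (inord m)) //= inordK // !psi_coef big1 ?addr0 // => i Hi.
 have [Hlt|Hle] := ltnP i m; first by rewrite [(psi b)`_ _]psi_coef Hb ?mulr0 //; lia.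
 rewrite psi_coef Ha ?mul0r // ltn_neqAle Hle andbT; apply: contra Hi => /eqP E.
 by apply/eqP; apply: val_inj; rewrite /= inordK.
rewrite mulr0 big1 // => i _; rewrite [(psi b)`_ _]psi_coef Hb ?mulr0 //.
have := ltn_ord i; lia.
Qed.

Lemma pev_fm m (c : {poly C}) t s : (size c <= m.+1)%N -> pev (t, t * s) (fm m c) = t ^+ m * c.[s].
Proof.
move=> Hc; rewrite pev_sum (horner_coef_wide _ Hc) mulr_sumr; apply: eq_bigr => i _.
rewrite pevZ mpolyX_mn pevM !pevX pevx pevy exprMn [RHS]mulrCA; congr (_ * _).
by rewrite mulrA -exprD subnK // -ltnS.
Qed.
End SubLeading.

Lemma deriv_cross (R : comNzRingType) (a b a' b' : R) k l :
 a ^+ k.+1 * (b' * b ^+ l *+ l.+1) - b ^+ l.+1 * (a' * a ^+ k *+ k.+1) =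
 a ^+ k * b ^+ l * (a * b' * (l.+1)%:R - b * a' * (k.+1)%:R).
Proof. by rewrite !exprS; ring. Qed.

Lemma pred_mul_sub x y k : (0 < x)%N -> (0 < y)%N -> (k <= x)%N ->
 (y * x - k - y.-1 = y.-1 * x.-1 + (x - k))%N.
Proof.
case: x => x; case: y => // y _ _ /= Hk.
have -> : (y.+1 * x.+1 = y * x + y + x.+1)%N by ring.
move: (y * x)%N => z; lia.
Qed.

(** * Behaviour at infinity of the derivative of the eliminant *)

Section Infinity.
Variable C : cField.
Local Notation P2 := (mpoly 2 C).
Variables (f g : P2) (d1 d2 : nat).
Let D := (d1.-1 + d2.-1)%N.
Let J := bra f g.
Let d := gcdn d1 d2.
Let e1 := (d1 %/ d)%N.
Let e2 := (d2 %/ d)%N.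
(** The least common multiple of d1 and d2, which is the weight of each factor [p]. *)
Let L := (e1 * d2)%N.
Let W := (D * L)%N.
Let f0 := tf d1 f.
Let g0 := tf d2 g.
Hypotheses (Hd1 : (0 < d1)%N) (Hd2 : (0 < d2)%N) (HD : (0 < D)%N).
Hypotheses (Hf : dgl d1 f) (Hg : dgl d2 g).
Variables (rs : seq C) (lc : C).
Hypotheses (Hrs : uniq rs) (Srs : size rs = D) (Hlc : lc != 0).
Hypothesis EJ : tf D J = lc *: \prod_(s <- rs) ('X - s%:P).
Hypotheses (Hf0 : forall s, s \in rs -> f0.[s] != 0) (Hg0 : forall s, s \in rs -> g0.[s] != 0).
Hypothesis Hgam : forall s s', s \in rs -> s' \in rs -> s != s' ->
 f0.[s] ^+ e2 * g0.[s'] ^+ e1 != f0.[s'] ^+ e2 * g0.[s] ^+ e1.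
Hypothesis Hsub : (1 < d)%N -> forall s, s \in rs ->
 d1%:R * f0.[s] * (tfp d2 g).[s] - d2%:R * g0.[s] * (tfp d1 f).[s] != 0.

Lemma d_gt0 : (0 < d)%N. Proof. by rewrite gcdn_gt0 Hd1. Qed.
Lemma e1d : (e1 * d = d1)%N. Proof. by rewrite divnK // dvdn_gcdl. Qed.
Lemma e2d : (e2 * d = d2)%N. Proof. by rewrite divnK // dvdn_gcdr. Qed.
Lemma e1_gt0 : (0 < e1)%N. Proof. by move: Hd1; rewrite -e1d; case: e1. Qed.
Lemma e2_gt0 : (0 < e2)%N. Proof. by move: Hd2; rewrite -e2d; case: e2. Qed.
Lemma LE : L = (e2 * d1)%N. Proof. by rewrite /L -e2d -[in RHS]e1d mulnCA. Qed.
Lemma L_gt0 : (0 < L)%N. Proof. by rewrite muln_gt0 e1_gt0. Qed.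
Lemma dglJ : dgl D J.
Proof. by apply: dgl_bra; rewrite prednK. Qed.
Lemma tfJ : tf D J = d1%:R *: f0 * g0^`() - f0^`() * (d2%:R *: g0).
Proof. by have := @tf_bra C d1.-1 d2.-1 f g; rewrite !prednK //; apply. Qed.
Lemma sizeJ : size (tf D J) = D.+1.
Proof. by rewrite EJ size_scale // size_prod_XsubC Srs. Qed.
Lemma rootJ s : (tf D J).[s] = 0 <-> s \in rs.
Proof.
rewrite EJ hornerZ; split=> [/eqP|H].
 by rewrite mulf_eq0 (negbTE Hlc) -rootE root_prod_XsubC.
by apply/eqP; rewrite mulf_eq0 -[X in _ || X]rootE root_prod_XsubC H orbT.
Qed.
Lemma copJ q : (forall s, s \in rs -> q.[s] != 0) -> coprimep (tf D J) q.
Proof.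
move=> H; rewrite EJ coprimepZl // big_seq; elim/big_rec: _ => [|s r Hs IH]; first exact: coprime1p.
by rewrite coprimepMl IH andbT coprimep_sym coprimep_XsubC; apply: H.
Qed.

(* p s is the factor of the top weighted part of h carried by the root s of J0 *)
Let p s : P2 := cst (f0.[s] ^+ e2) * my C ^+ e1 - cst (g0.[s] ^+ e1) * mx C ^+ e2.
Let Ps s : P2 := cst (f0.[s] ^+ e2) * g ^+ e1 - cst (g0.[s] ^+ e1) * f ^+ e2.
Lemma comp2_p s : comp2 f g (p s) = Ps s. Proof. by rewrite !comp2E. Qed.
Lemma dgl_Ps s : dgl L (Ps s).
Proof.
by apply: dglB; rewrite -[X in dgl X]add0n; apply: dglM; try exact: dgl_cst; [|rewrite LE]; apply: dglX.
Qed.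
Lemma tf_Ps s : tf L (Ps s) = f0.[s] ^+ e2 *: g0 ^+ e1 - g0.[s] ^+ e1 *: f0 ^+ e2.
Proof.
rewrite tfB; congr (_ - _).
 by have := tfM (dgl_cst (f0.[s] ^+ e2)) (dglX (k := e1) Hg); rewrite tf_cst tfX // mul_polyC.
have := tfM (dgl_cst (g0.[s] ^+ e1)) (dglX (k := e2) Hf).
by rewrite tf_cst LE tfX // mul_polyC.
Qed.
Lemma tfp_Ps s : tfp L (Ps s) = (f0.[s] ^+ e2 * e1%:R) *: g0 ^+ e1.-1 * tfp d2 g -
 (g0.[s] ^+ e1 * e2%:R) *: f0 ^+ e2.-1 * tfp d1 f.
Proof.
rewrite tfpD tfpN; congr (_ - _).
 have := tfpM (dgl_cst (f0.[s] ^+ e2)) (dglX (k := e1) Hg); rewrite add0n => ->.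
 by rewrite tf_cst tfpX // mul0r addr0 mul_polyC scalerAl scalerA.
have := tfpM (dgl_cst (g0.[s] ^+ e1)) (dglX (k := e2) Hf); rewrite -LE => ->.
by rewrite tf_cst LE tfpX // mul0r addr0 mul_polyC scalerAl scalerA.
Qed.

(** At a root s of J0 the logarithmic derivative of g0^e1 / f0^e2 vanishes, because d times its
    numerator is the value of J0; so the difference with the value at s has a double zero. *)
Lemma Ps_double s : s \in rs -> exists r, tf L (Ps s) = ('X - s%:P) ^+ 2 * r.
Proof.
move=> Hs; set q := tf L (Ps s).
have q0 : root q s.
 by rewrite /root /q tf_Ps hornerD hornerN !hornerZ !horner_exp mulrC subrr.
have [r Er] := factor_theorem _ _ q0.
have q1 : (q^`()).[s] = 0.
 have HJ := (rootJ s).2 Hs; move: HJ; rewrite tfJ hornerD hornerN !hornerM !hornerZ => HJ.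
 have H : f0.[s] * (g0^`()).[s] * e1%:R - g0.[s] * (f0^`()).[s] * e2%:R = 0.
  have Hd : (d%:R : C) != 0 by rewrite pnatr_eq0 -lt0n d_gt0.
  apply: (mulfI Hd); rewrite mulr0 -[RHS]HJ -[d1 in RHS]e1d -[d2 in RHS]e2d; ring.
 rewrite /q tf_Ps derivB !derivZ !deriv_exp hornerD hornerN !hornerZ !hornerMn !hornerM !horner_exp.
 have := deriv_cross f0.[s] g0.[s] (f0^`()).[s] (g0^`()).[s] e2.-1 e1.-1.
 by rewrite !prednK ?e1_gt0 ?e2_gt0 // H mulr0.
have r0 : root r s.
 by move: q1; rewrite Er derivM derivXsubC mulr1 hornerD hornerM hornerXsubC subrr mulr0 add0r => /eqP.
have [r' Er'] := factor_theorem _ _ r0.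
by exists r'; rewrite Er Er'; ring.
Qed.

Let G0 : P2 := \prod_(s <- rs) p s.
Let cG : P2 := \prod_(s <- rs) Ps s.
Lemma comp2_prod I r (P : pred I) (F : I -> P2) :
 comp2 f g (\prod_(i <- r | P i) F i) = \prod_(i <- r | P i) comp2 f g (F i).
Proof. by apply: (big_morph _ (comp2M f g) (comp2_1 f g)). Qed.
Let v s : {poly C} := f0.[s] ^+ e2 *: 'X^e1 - (g0.[s] ^+ e1)%:P.
Lemma wt_p s : wt d1 d2 (p s) = (v s)%:P * 'X^L.
Proof.
rewrite wtD wtN !wtM !wt_cst !wtX wt_x wt_y exprMn -!exprM -[(d1 * e2)%N]mulnC -LE -[(d2 * e1)%N]mulnC -/L.
by rewrite polyCB mulrBl -mul_polyC polyCM [('X^e1)%:P]rmorphXn mulrA.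
Qed.
Lemma wt_prodp (P : pred C) : wt d1 d2 (\prod_(s <- rs | P s) p s) =
 (\prod_(s <- rs | P s) v s)%:P * 'X^(count P rs * L).
Proof.
elim: (rs) => [|s r IH]; first by rewrite !big_nil wt1 mul1r.
rewrite !big_cons /=; case: (P s); rewrite // wtM IH wt_p polyCM mulnDl mul1n exprD.
by rewrite mulrACA.
Qed.
Lemma comp2_G0 : comp2 f g G0 = cG.
Proof. by rewrite comp2_prod; apply: eq_bigr => s _; rewrite comp2_p. Qed.
Lemma dgl_prod I r P (F : I -> P2) m : (forall i, dgl m (F i)) ->
 dgl (count P r * m) (\prod_(i <- r | P i) F i).
Proof.
move=> H; elim: r => [|i r IH]; first by rewrite big_nil; apply: dgl_cst.
by rewrite big_cons /=; case: (P i) => //=; rewrite mulSn; apply: dglM.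
Qed.
Lemma tf_prod I r P (F : I -> P2) m : (forall i, dgl m (F i)) ->
 tf (count P r * m) (\prod_(i <- r | P i) F i) = \prod_(i <- r | P i) tf m (F i).
Proof.
move=> H; elim: r => [|i r IH]; first by rewrite !big_nil tf_cst.
rewrite !big_cons /=; case: (P i) => //=; rewrite tfM ?IH //; exact: dgl_prod.
Qed.
Lemma dgl_cG : dgl W cG.
Proof. by have := dgl_prod (r := rs) (P := predT) (fun s => dgl_Ps s); rewrite count_predT Srs. Qed.

Section AtRoot.
Variable s : C.
Hypothesis Hs : s \in rs.
Let As := \prod_(s' <- rs | s' != s) p s'.
Let cA := \prod_(s' <- rs | s' != s) Ps s'.
Lemma G0s : G0 = p s * As. Proof. by rewrite /G0 (bigD1_seq s). Qed.
Lemma cGs : cG = Ps s * cA. Proof. by rewrite /cG (bigD1_seq s). Qed.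
Lemma cntA : count (predC1 s) rs = D.-1.
Proof.
have := count_predC (pred1 s) rs; rewrite count_uniq_mem // Hs Srs add1n => <-.
by apply: eq_count.
Qed.
Lemma WA : W = (L + D.-1 * L)%N. Proof. by rewrite -mulSn prednK. Qed.
Lemma dgl_cA : dgl (D.-1 * L) cA. Proof. by rewrite -cntA; apply: dgl_prod; apply: dgl_Ps. Qed.
Lemma tf_cA : (tf (D.-1 * L) cA).[s] != 0.
Proof.
rewrite -cntA tf_prod; last exact: dgl_Ps.
rewrite horner_prod prodf_seq_neq0; apply/allP => s' Hs'; apply/implyP => Ns.
rewrite tf_Ps hornerD hornerN !hornerZ !horner_exp subr_eq0 [X in _ != X]mulrC.
by apply: Hgam.
Qed.
Lemma tf_Ps_s : (tf L (Ps s)).[s] = 0.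
Proof. by have [r ->] := Ps_double Hs; rewrite hornerM horner_exp hornerXsubC subrr expr0n mul0r. Qed.
(** In the product rule the terms where [p s] is not differentiated contain the top form of [Ps s],
    which vanishes at s. The remaining term is nonzero since distinct roots give distinct values of
    g0^e1 / f0^e2. *)
Lemma tf_dyG0 : (tf (W - d2) (comp2 f g (dy G0))).[s] != 0 .
Proof.
have Hdp : dy (p s) = cst (f0.[s] ^+ e2 * e1%:R) * my C ^+ e1.-1.
 rewrite /p -(prednK e1_gt0) dyD dyN !dyM !dyC !mul0r !add0r dyX dyy mulr1.
 rewrite (_ : dy (mx C ^+ e2) = 0); last by rewrite -(prednK e2_gt0) dyX dyx mulr0.
 by rewrite mulr0 subr0 mulrA cstM; congr (_ * _ * _); rewrite /cst rmorph_nat.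
have Hc : dgl (L - d2) (cst (f0.[s] ^+ e2 * e1%:R) * g ^+ e1.-1) /\
  tf (L - d2) (cst (f0.[s] ^+ e2 * e1%:R) * g ^+ e1.-1) = (f0.[s] ^+ e2 * e1%:R) *: g0 ^+ e1.-1.
 have -> : (L - d2 = 0 + e1.-1 * d2)%N by rewrite /L -{1}(prednK e1_gt0) addKn.
 split; first by apply: dglM; [apply: dgl_cst|apply: dglX].
 by rewrite tfM ?tf_cst ?tfX ?mul_polyC //; [apply: dgl_cst|apply: dglX].
have HL : (d2 <= L)%N by rewrite leq_pmull // e1_gt0.
rewrite G0s dyM comp2D !comp2M comp2_p tfD hornerD.
have -> : (tf (W - d2) (Ps s * comp2 f g (dy As))).[s] = 0.
 have HA : forall j, ((W - d2) < j + L)%N -> tf j (comp2 f g (dy As)) = 0.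
  move=> j Hj; apply: (dgl_comp2_dy Hd1 Hf Hg (N := (D.-1 * L)%N)); last by rewrite WA in Hj; lia.
  by move=> m Hm; rewrite wt_prodp coefCM coefXn cntA (gtn_eqF Hm) mulr0.
 have [c ->] := tfM_neg (dgl_Ps s) HA.
 by rewrite hornerM tf_Ps_s mul0r.
rewrite addr0 Hdp !comp2E comp2_prod.
rewrite (eq_bigr Ps); last by move=> *; apply: comp2_p.
have -> : (W - d2 = L - d2 + D.-1 * L)%N by rewrite WA addnBAC.
rewrite -/cA tfM ?Hc.2; [|exact: Hc.1|exact: dgl_cA].
rewrite hornerM mulf_neq0 ?tf_cA // hornerZ horner_exp !mulf_neq0 ?expf_neq0 ?Hf0 ?Hg0 //.
by rewrite pnatr_eq0 -lt0n e1_gt0.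
Qed.

Lemma tfp_cG : (tfp W cG).[s] = (tfp L (Ps s)).[s] * (tf (D.-1 * L) cA).[s].
Proof.
rewrite cGs WA tfpM; [|exact: dgl_Ps|exact: dgl_cA].
by rewrite hornerD !hornerM tf_Ps_s mul0r add0r.
Qed.
Lemma tfp_Ps_neq0 : (1 < d)%N -> (tfp L (Ps s)).[s] != 0.
Proof.
move=> Hd; have H := Hsub Hd Hs; apply: contra H; rewrite tfp_Ps hornerD hornerN !hornerM !hornerZ !horner_exp => /eqP H.
apply/eqP; have Hk : f0.[s] ^+ e2.-1 * g0.[s] ^+ e1.-1 != 0 by rewrite mulf_neq0 // expf_neq0 ?Hf0 ?Hg0.
apply: (mulfI Hk); rewrite mulr0 -[RHS](mulr0 d%:R) -[in RHS]H.
have -> : d1%:R = e1%:R * d%:R :> C by rewrite -natrM e1d.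
have -> : d2%:R = e2%:R * d%:R :> C by rewrite -natrM e2d.
have E a k : (0 < k)%N -> a ^+ k = a * a ^+ k.-1 :> C by move=> Hk'; rewrite -exprS prednK.
rewrite (E f0.[s] e2) ?e2_gt0 // (E g0.[s] e1) ?e1_gt0; ring.
Qed.
End AtRoot.

Lemma double_quotient : exists q, tf W cG = tf D J * q /\ forall s, s \in rs -> q.[s] = 0.
Proof.
have [r Hr] : exists r : C -> {poly C}, forall s, s \in rs -> tf L (Ps s) = ('X - s%:P) ^+ 2 * r s.
 have H s : exists r, s \in rs -> tf L (Ps s) = ('X - s%:P) ^+ 2 * r.
  by case: (boolP (s \in rs)) => [/Ps_double[r Er]|_]; [exists r|exists 0].
 by have [r Hr] := boolp.choice H; exists r.
exists (lc^-1 *: \prod_(s <- rs) (('X - s%:P) * r s)); split.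
 have := tf_prod rs predT (fun s => dgl_Ps s); rewrite count_predT Srs => ->.
 rewrite EJ -scalerAr -scalerAl scalerA mulVf // scale1r -big_split /=.
 by rewrite big_seq [in RHS]big_seq; apply: eq_bigr => s /Hr ->; rewrite mulrA.
move=> s Hs; rewrite hornerZ (bigD1_seq s) //= 2!hornerM hornerXsubC subrr !mul0r mulr0 //.
Qed.

Lemma powD_mod (a b j : P2) k : exists c, (a + j * b) ^+ k = a ^+ k + j * c.
Proof.
elim: k => [|k [c Hc]]; first by exists 0; rewrite mulr0 addr0.
by exists (a * c + b * a ^+ k + j * (b * c)); rewrite !exprS Hc; ring.
Qed.

(** The top form of G(f, g) is J0 times a quotient, so subtracting a multiple of J lowers the degree
    by one. By the double zeros the quotient vanishes at the roots of J0, hence the next form keeps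
    its values there. *)
Lemma cG_mod : exists Lp b, [/\ cG = Lp + J * b, dgl W.-1 Lp &
 forall s, s \in rs -> (tf W.-1 Lp).[s] = (tfp W cG).[s]].
Proof.
have [q [Eq Hq]] := double_quotient.
have W0 : (D <= W)%N by rewrite leq_pmulr // L_gt0.
have Wp : (0 < W)%N by apply: leq_trans W0.
have Sq : (size q <= (W - D).+1)%N.
 have [->|q0] := eqVneq q 0; first by rewrite size_poly0.
 have := size_tf W cG; rewrite Eq size_mul // ?sizeJ; last by rewrite -size_poly_gt0 sizeJ.
 have aux x y k : (y <= x)%N -> ((y.+1 + k).-1 <= x.+1)%N -> (k <= (x - y).+1)%N by lia.
 exact: aux W0.
have Hq1 := dgl_fm Sq.
have HJq : dgl W (J * fm (W - D) q) by rewrite -{1}(subnKC W0); apply: dglM => //; apply: dglJ.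
exists (cG - J * fm (W - D) q), (fm (W - D) q); split; first by rewrite subrK.
 move=> j Hj; rewrite tfB; have [E|E] := eqVneq j W.
  rewrite E Eq; have := tfM dglJ Hq1; rewrite subnKC // => ->.
  by rewrite tf_fm // eqxx subrr.
 by rewrite dgl_cG ?HJq ?subrr //; lia.
move=> s Hs; rewrite tfB hornerD hornerN.
have E a : tf W.-1 a = tfp W a by rewrite -{2}(prednK Wp).
rewrite !E; have := tfpM dglJ Hq1; rewrite subnKC // => ->.
by rewrite (tfp_hom (hom_fm Sq)) mulr0 add0r hornerM tf_fm // eqxx Hq // mulr0 subr0.
Qed.
(** The weight of h, minus d2 for the derivative in y, minus one for each of the d - 1 remaining
    factors G(f, g) reduced modulo J. *)
Let M := (D * d1 * d2 - d2 - d.-1)%N.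
Lemma Wd : (D * d1 * d2 = d * W)%N.
Proof. by rewrite /W /L -[d1 in LHS]e1d; ring. Qed.

Variables (w : 'I_(D * d1) -> nat) (be : 'I_(D * d1) -> P2).
Hypothesis Hbe : forall k, hom (w k) (be k).
Variables (fr : frame J f (D * d1)) (fr0 : frame (fm D (tf D J)) (fm d1 f0) (D * d1)).
Hypotheses (Efr : fe fr = be) (Efr0 : fe fr0 = be).
Hypothesis Hdeg : forall N a, dgl N a -> forall k j, (fcd fr a k)`_j != 0 -> (j * d1 + w k <= N)%N.

(** For the homogeneous pair J = 0 is a union of D lines, each meeting the fibre f = 1 in d1 points
    that differ by roots of unity. The values of g on one line give the factor belonging to its
    slope s, to the power d. *)
Lemma char_poly_top : char_poly (rhot fr0 1 (fm d2 g0)) =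
 (\prod_(s <- rs) (f0.[s]^-1 ^+ e2)) ^+ d *: (\prod_(s <- rs) v s) ^+ d.
Proof.
have [om Hom] := prim_root_exists C Hd1.
have Hom0 : om != 0.
 by apply: contra_eq_neq (prim_expr_order Hom) => ->; rewrite expr0n gtn_eqF // eq_sym oner_eq0.
have [y Hy] : exists y, forall s, s \in rs -> y s ^+ d1 * f0.[s] = 1.
 have H s : exists y, s \in rs -> y ^+ d1 * f0.[s] = 1.
  have [Hs|_] := boolP (s \in rs); last by exists 0.
  exists (d1.-root (f0.[s]^-1)) => _; rewrite rootCK // mulVf ?Hf0 //.
 by have [y Hy] := boolp.choice H; exists y.
have Hy0 s : s \in rs -> y s != 0.
 by move=> Hs; apply: contra_eq_neq (Hy s Hs) => ->; rewrite expr0n gtn_eqF // mul0r eq_sym oner_eq0.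
pose pt s i : C * C := (om ^+ i * y s, om ^+ i * y s * s).
pose zs := [seq pt s i | s <- rs, i <- iota 0 d1].
have Uz : uniq zs.
 apply: allpairs_uniq => //; first exact: iota_uniq.
 move=> [s i] [s' i'] /allpairsP[[s1 i1] /= [H1 H2 [-> ->]]] /allpairsP[[s2 i2] /= [H3 H4 [-> ->]]] [E1 E2].
 have N0 : om ^+ i2 * y s2 != 0 by rewrite mulf_neq0 ?Hy0 // expf_neq0.
 move: E2; rewrite E1 => /(mulfI N0) Es; subst s2.
 move: E1 => /(mulIf (Hy0 _ H1))/eqP; rewrite (eq_prim_root_expr Hom).
 by move: H2 H4; rewrite !mem_iota => H2 H4; rewrite !modn_small // => /eqP ->.
have Hon : {in zs, forall p, onf (fm D (tf D J)) (fm d1 f0) 1 p}.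
 move=> q /allpairsP[[s i] /= [Hs _ ->]]; rewrite /onf !pev_fm ?size_tf //.
 rewrite (rootJ s).2 // mulr0 eqxx /= exprMn exprAC (prim_expr_order Hom) expr1n mul1r Hy //.
have Sz : size zs = (D * d1)%N by rewrite size_allpairs size_iota Srs.
rewrite (char_poly_fibre _ _ Uz Hon Sz) big_allpairs_dep /=.
rewrite -exprZn -[in RHS]mul_polyC rmorph_prod -big_split /= -prodrXl.
rewrite big_seq [RHS]big_seq; apply: eq_bigr => s Hs.
have Hgs : y s ^+ d2 * g0.[s] != 0 by rewrite mulf_neq0 ?Hg0 // expf_neq0 // Hy0.
transitivity (\prod_(i <- iota 0 d1) ('X - (om ^+ (i * d2) * (y s ^+ d2 * g0.[s]))%:P)).
 by apply: eq_bigr => i _; rewrite pev_fm ?size_tf // exprMn -exprM mulrA.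
rewrite (prod_prim_pow d2 Hd1 Hom Hgs) gcdnC -/e1; congr (_ ^+ _).
rewrite mul_polyC scalerBr scalerA -exprMn mulVf ?Hf0 // expr1n scale1r; congr (_ - _).
rewrite -mul_polyC -polyCM; congr (_%:P).
rewrite exprMn -exprM [(d2 * e1)%N]mulnC -/L LE mulnC exprM; congr (_ ^+ _ * _).
by apply: (mulIf (Hf0 Hs)); rewrite Hy // mulVf ?Hf0.
Qed.

Let kap : C := (\prod_(s <- rs) (f0.[s]^-1 ^+ e2)) ^+ d.
Let h := hH g fr.
Let R := h - cst kap * G0 ^+ d.
Lemma wt_G0 : wt d1 d2 G0 = (\prod_(s <- rs) v s)%:P * 'X^W.
Proof. by have := wt_prodp predT; rewrite count_predT Srs. Qed.
(** The part of weight d W has been subtracted and every weight is a multiple of d, so the next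
    possible one is d W - d. *)
Lemma wdgl_R : wdgl d1 d2 (d * W - d) R.
Proof.
move=> m Hm.
have [H1 H2] := wt_hH dglJ Hf Hg Hd1 sizeJ (copJ Hf0) Hbe Efr Efr0 Hdeg.
rewrite -/h Wd in H1 H2; rewrite char_poly_top -/kap in H2.
have WR : wt d1 d2 R = wt d1 d2 h - (kap *: (\prod_(s <- rs) v s) ^+ d)%:P * 'X^(d * W).
 by rewrite wtD wtN wtM wt_cst wtX wt_G0 exprMn -exprM [(W * d)%N]mulnC -mul_polyC polyCM [((\prod_(s <- rs) v s) ^+ d)%:P]rmorphXn mulrA.
have [HW|HW|E] := ltngtP (d * W)%N m.
- rewrite WR coefB coefCM coefXn (gtn_eqF HW) mulr0 subr0.
 by rewrite nth_default //; apply: leq_trans H1 _.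
- apply/eqP/negPn/negP => /wt_gcd; rewrite -/d => /dvdnP[k Ek].
 move: Hm HW; rewrite Ek [(d * W)%N]mulnC -[X in (_ - X)%N]mul1n -mulnBl !ltn_pmul2r ?d_gt0; lia.
by rewrite WR coefB coefCM coefXn -E eqxx mulr1 -[X in _ - X]H2 subrr.
Qed.

(** h_y is a constant times G^(d-1) G_y plus R_y. Modulo J each of the d - 1 factors G(f, g) becomes
    [Lp], one degree lower, while R_y contributes degree at most M - 1. The value at a root s is
    nonzero by [tf_dyG0] and, when d > 1, by the second-order condition. *)
Theorem dy_eliminant_top : exists K b : P2,
 [/\ comp2 f g (dy h) = K + J * b, dgl M K & forall s, s \in rs -> (tf M K).[s] != 0].
Proof.
have [Lp [b [EL HL HLs]]] := cG_mod.
have [c Ec] := powD_mod Lp b J d.-1.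
have Eh : h = cst kap * G0 ^+ d + R by rewrite addrC subrK.
pose k0 : P2 := cst kap * d%:R.
have Ed : dy h = k0 * G0 ^+ d.-1 * dy G0 + dy R.
 rewrite {1}Eh dyD dyM dyC mul0r -{1}(prednK d_gt0) dyX prednK ?d_gt0 /k0; ring.
have Hk0 : k0 = cst (kap * d%:R) by rewrite cstM; congr (_ * _); rewrite /cst rmorph_nat.
pose K1 := cst (kap * d%:R) * (Lp ^+ d.-1 * comp2 f g (dy G0)).
exists (K1 + comp2 f g (dy R)), (k0 * c * comp2 f g (dy G0)).
have Wp : (0 < W)%N by rewrite muln_gt0 HD L_gt0.
have HWd : (d2 <= W)%N.
 by rewrite /W mulnA leq_pmull // muln_gt0 HD e1_gt0.
have EM : M = (d.-1 * W.-1 + (W - d2))%N.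
 by rewrite /M Wd; apply: pred_mul_sub => //; apply: d_gt0.
have HG1 j : (W - d2 < j)%N -> tf j (comp2 f g (dy G0)) = 0.
 move=> Hj; apply: (dgl_comp2_dy Hd1 Hf Hg (N := W)); last by rewrite addnC -ltn_subLR.
 by move=> m Hm; rewrite wt_G0 coefCM coefXn (gtn_eqF Hm) mulr0.
have HK1 : dgl M (Lp ^+ d.-1 * comp2 f g (dy G0)) by rewrite EM; apply: dglM => //; apply: dglX.
have HR j : (M <= j)%N -> tf j (comp2 f g (dy R)) = 0.
 move=> Hj; apply: (dgl_comp2_dy Hd1 Hf Hg wdgl_R); move: Hj; rewrite /M Wd.
 have : (d <= d * W)%N by rewrite leq_pmulr.
 move: HWd Wp d_gt0; move: (W) (d) => x y; clear; move=> H1 H2 H3 H4 H5.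
 have : (x <= y * x)%N by rewrite leq_pmull.
 lia.
split.
- rewrite Ed comp2D !comp2M comp2X comp2_G0 EL Ec Hk0 comp2_cst /K1; ring.
- move=> j Hj; rewrite tfD HR ?(ltnW Hj) // addr0.
 have := dglM (dgl_cst (kap * d%:R)) HK1; rewrite add0n; exact.
move=> s Hs; rewrite tfD HR // addr0.
have := tfM (dgl_cst (kap * d%:R)) HK1; rewrite add0n => ->; rewrite tf_cst hornerM hornerC EM.
rewrite (tfM (dglX HL) HG1) (tfX d.-1 HL) hornerM horner_exp !mulf_neq0 ?tf_dyG0 //.
- rewrite expf_neq0 // prodf_seq_neq0; apply/allP => s' Hs'.
 by rewrite expf_neq0 // invr_neq0 // Hf0.
- by rewrite pnatr_eq0 -lt0n d_gt0.
case: (ltngtP d 1) (d_gt0) => [|Hd|->] _; [by case: (d)| |by rewrite oner_eq0].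
by rewrite expf_neq0 // HLs // (tfp_cG Hs) mulf_neq0 ?tfp_Ps_neq0 ?tf_cA.
Qed.
End Infinity.

(** * Counting cusps and nodes *)

Lemma cusp_count d1 d2 c : (0 < d1)%N -> (0 < d2)%N -> (0 < d1.-1 + d2.-1)%N ->
 (c + d1.-1 * d1.-1 = (d1.-1 + d2.-1) * (d1.-1 + (d1.-1 + d2.-1).-1))%N ->
 c%:R = d1%:R ^+ 2 + d2%:R ^+ 2 + 3 * d1%:R * d2%:R - 6 * d1%:R - 6 * d2%:R + 7 :> rat.
Proof.
case: d1 d2 => a [] // b _ _ /= Hab H.
have E : (a + b)%:R = (a + b).-1%:R + 1 :> rat by rewrite -{1}(prednK Hab) -addn1 natrD.
have := congr1 (fun n => n%:R : rat) H; rewrite !(natrD, natrM).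
have {}E : (a + b).-1%:R = a%:R + b%:R - 1 :> rat by rewrite natrD in E; rewrite E addrK.
have S k : k.+1%:R = k%:R + 1 :> rat by rewrite -natr1.
rewrite E (S a) (S b) => {}H.
have -> : c%:R = (a%:R + b%:R) * (a%:R + (a%:R + b%:R - 1)) - a%:R * a%:R :> rat by rewrite -H addrK.
by ring.
Qed.

(** The hypotheses are the two counts. The zeros of T on J = 0 number D (d1 - 1 + D - 1): the cusps
    and the (d1 - 1)^2 critical points of f. The total order of h_y(f, g), D times its degree,
    exceeds that number by two for each node, which has two preimages, and by two for each cusp,
    where the order is 3. *)
Lemma node_count d1 d2 d c n : (0 < d1)%N -> (0 < d2)%N -> (0 < d1.-1 + d2.-1)%N -> (0 < d)%N ->
 (d2 + d.-1 <= (d1.-1 + d2.-1) * d1 * d2)%N ->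
 (c + d1.-1 * d1.-1 = (d1.-1 + d2.-1) * (d1.-1 + (d1.-1 + d2.-1).-1))%N ->
 ((d1.-1 + d2.-1) * ((d1.-1 + d2.-1) * d1 * d2 - d2 - d.-1) =
  (d1.-1 + d2.-1) * (d1.-1 + (d1.-1 + d2.-1).-1) + n.*2 + c.*2)%N ->
 n%:R = 2^-1 * ((d1%:R * d2%:R - 4) * ((d1%:R + d2%:R - 2) ^+ 2 - 2)
     - (d%:R - 5) * (d1%:R + d2%:R - 2) - 6) :> rat.
Proof.
case: d1 d2 d => a [] // b [] // d _ _ /= Hab _ Hle Hc Hn.
have E : (a + b).-1%:R = a%:R + b%:R - 1 :> rat.
 have E : (a + b)%:R = (a + b).-1%:R + 1 :> rat by rewrite -{1}(prednK Hab) -addn1 natrD.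
 by rewrite natrD in E; rewrite E addrK.
rewrite -subnDA in Hn.
have := congr1 (fun n => n%:R : rat) Hc; have := congr1 (fun n => n%:R : rat) Hn.
have S k : k.+1%:R = k%:R + 1 :> rat by rewrite -natr1.
rewrite -!muln2 !natrD !natrM natrB // !natrM !natrD E (S a) (S b) (S d).
move: (a%:R : rat) (b%:R : rat) (c%:R : rat) (d%:R : rat) (n%:R : rat) => x y u v w H1 H2.
have -> : w = 2^-1 * (w * 2) by field.
congr (_ * _).
have E2 : w * 2 = (x + y) * ((x + y) * (x + 1) * (y + 1) - (y + 1 + v)) - (x + y) * (x + (x + y - 1)) - u * 2.
 by rewrite H1; ring.
have E3 : u = (x + y) * (x + (x + y - 1)) - x * x by rewrite -H2 addrK.
rewrite E2 E3; ring.
Qed.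

Section Count.
Variable C : cField.
Local Notation P2 := (mpoly 2 C).
Implicit Types (p q r P : C * C).

(** The fields up to [tame_sep_f] are conditions at infinity; there [tame_gam] separates the
    branches of the image and [tame_sub] is a second-order condition. The others ask for J = 0
    smooth, simple zeros of T, ordinary cusps, transverse double points, no triple points, and
    nondegenerate critical points of f that are not cusps. *)
Record tame (d1 d2 : nat) (f g : P2) : Prop := Tame {
 tame_size : size (tf (d1.-1 + d2.-1) (bra f g)) = (d1.-1 + d2.-1).+1;
 tame_sep : coprimep (tf (d1.-1 + d2.-1) (bra f g)) (tf (d1.-1 + d2.-1) (bra f g))^`();
 tame_f0 : forall s, (tf (d1.-1 + d2.-1) (bra f g)).[s] = 0 -> (tf d1 f).[s] != 0;
 tame_g0 : forall s, (tf (d1.-1 + d2.-1) (bra f g)).[s] = 0 -> (tf d2 g).[s] != 0;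
 tame_gam : forall s s', (tf (d1.-1 + d2.-1) (bra f g)).[s] = 0 ->
  (tf (d1.-1 + d2.-1) (bra f g)).[s'] = 0 -> s != s' ->
  (tf d1 f).[s] ^+ (d2 %/ gcdn d1 d2) * (tf d2 g).[s'] ^+ (d1 %/ gcdn d1 d2) !=
  (tf d1 f).[s'] ^+ (d2 %/ gcdn d1 d2) * (tf d2 g).[s] ^+ (d1 %/ gcdn d1 d2);
 tame_sub : (1 < gcdn d1 d2)%N -> forall s, (tf (d1.-1 + d2.-1) (bra f g)).[s] = 0 ->
  d1%:R * (tf d1 f).[s] * (tfp d2 g).[s] - d2%:R * (tf d2 g).[s] * (tfp d1 f).[s] != 0;
 tame_size_f : size (tf d1 f) = d1.+1;
 tame_sep_f : coprimep (tf d1 f) (tf d1 f)^`();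
 tame_smooth : forall p, pev p (bra f g) = 0 ->
  (pev p (dx (bra f g)) != 0) || (pev p (dy (bra f g)) != 0);
 tame_T : forall p, pev p (bra f g) = 0 -> pev p (bra f (bra f g)) = 0 ->
  pev p (bra (bra f (bra f g)) (bra f g)) != 0;
 tame_cusp : forall p, pev p (bra f g) = 0 -> pev p (bra f (bra f g)) = 0 -> pev p (bra g (bra f g)) = 0 ->
  pev p (dl (bra f g) 2 f) * pev p (dl (bra f g) 3 g) - pev p (dl (bra f g) 2 g) * pev p (dl (bra f g) 3 f) != 0;
 tame_pair : forall p q, p != q -> pev p (bra f g) = 0 -> pev q (bra f g) = 0 ->
  pev p f = pev q f -> pev p g = pev q g ->
  pev p (bra f (bra f g)) * pev q (bra g (bra f g)) - pev p (bra g (bra f g)) * pev q (bra f (bra f g)) != 0;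
 tame_triple : forall p q r, p != q -> p != r -> q != r ->
  pev p (bra f g) = 0 -> pev q (bra f g) = 0 -> pev r (bra f g) = 0 ->
  pev p f = pev q f -> pev p g = pev q g -> pev p f = pev r f -> pev p g = pev r g -> False;
 tame_crit : forall p, pev p (dx f) = 0 -> pev p (dy f) = 0 ->
  pev p (bra g (bra f g)) != 0 /\ pev p (bra (dx f) (dy f)) != 0 }.

(** The conclusion of the theorem in algebraic terms, with [cl] and [nl] the lists of cusps and
    nodes. It makes sense over any [numClosedFieldType]; analytic germs enter only afterwards. *)
Definition discriminant_data (d1 d2 : nat) (f g : P2) : Prop := exists h (cl nl : seq (C * C)),
 [/\ h != 0, forall P, pev P h = 0 <-> exists2 p, pev p (bra f g) = 0 & (pev p f, pev p g) = P,
   uniq cl & uniq nl] /\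
 [/\ (size cl)%:R = d1%:R ^+ 2 + d2%:R ^+ 2 + 3 * d1%:R * d2%:R - 6 * d1%:R - 6 * d2%:R + 7 :> rat,
   (size nl)%:R = 2^-1 * ((d1%:R * d2%:R - 4) * ((d1%:R + d2%:R - 2) ^+ 2 - 2)
     - ((gcdn d1 d2)%:R - 5) * (d1%:R + d2%:R - 2) - 6) :> rat,
   {in cl, forall P, algcusp h P}, {in nl, forall P, algnode h P} &
   forall P, pev P h = 0 -> P \notin cl -> P \notin nl -> algsmooth h P].

Lemma size_undup_pairs (T U : eqType) (F : T -> U) s : uniq s ->
 (forall x, x \in s -> exists2 y, y \in s & [/\ x != y, F x = F y &
   forall z, z \in s -> F z = F x -> z = x \/ z = y]) ->
 size s = (size (undup (map F s))).*2.
Proof.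
move=> Us H.
have <- : \sum_(P <- undup (map F s)) (count (fun x => F x == P) s) = size s.
 have -> : size s = (\sum_(x <- s) \sum_(P <- undup (map F s)) (F x == P))%N.
  rewrite -sum1_size big_seq [RHS]big_seq; apply: eq_bigr => x Hx.
  rewrite (bigD1_seq (F x)) ?undup_uniq ?mem_undup ?map_f //= eqxx big1 // => P.
  by rewrite eq_sym => /negbTE ->.
 by rewrite exchange_big; apply: eq_bigr => P _; rewrite -sum1_count big_mkcond.
rewrite -muln2 mulnC -[X in _ = (_ * X)%N]sum1_size big_distrr /=.
rewrite big_seq [RHS]big_seq; apply: eq_bigr => P; rewrite mem_undup => /mapP[x Hx ->].
have [y Hy [Nxy Exy Hz]] := H x Hx.
rewrite -size_filter; have /perm_size -> // : perm_eq [seq z <- s | F z == F x] [:: x; y].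
apply: uniq_perm; rewrite ?filter_uniq //= ?inE ?Nxy // => z; rewrite mem_filter !inE.
apply/andP/orP => [[/eqP E1 /Hz []// ->]|[/eqP ->|/eqP ->]]; rewrite ?Exy; by [left|right|split].
Qed.

(** Three-term relation between the gradients of f, g and j. For j = {f, g} and at a point of J = 0,
    a zero of T with T' nonzero is a critical point of f. *)
Lemma crit_relx p f g j : pev p (dx f) * pev p (bra g j) =
 pev p (dx g) * pev p (bra f j) - pev p (bra f g) * pev p (dx j).
Proof. by rewrite /bra; ring. Qed.
Lemma crit_rely p f g j : pev p (dy f) * pev p (bra g j) =
 pev p (dy g) * pev p (bra f j) - pev p (bra f g) * pev p (dy j).
Proof. by rewrite /bra; ring. Qed.

Section Main.
Variables (f g : P2) (d1 d2 : nat).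
Hypotheses (Hd1 : (0 < d1)%N) (Hd2 : (0 < d2)%N) (HD : (0 < d1.-1 + d2.-1)%N).
Hypotheses (Hf : dgl d1 f) (Hg : dgl d2 g) (Ht : tame d1 d2 f g).
Local Notation D := (d1.-1 + d2.-1)%N.
Local Notation J := (bra f g).
Local Notation T := (bra f J).
Local Notation T' := (bra g J).

Let HJ : dgl D J. Proof. exact: (dglJ Hd1 Hd2 Hf Hg). Qed.

Lemma roots_top : exists rs lc, [/\ uniq rs, size rs = D, lc != 0 & tf D J = lc *: \prod_(s <- rs) ('X - s%:P)].
Proof.
have [rs E] := closed_field_poly_normal (tf D J); exists rs, (lead_coef (tf D J)).
have J0 : tf D J != 0 by rewrite -size_poly_gt0 (tame_size Ht).
have lc0 : lead_coef (tf D J) != 0 by rewrite lead_coef_eq0.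
split=> //.
 rewrite -separable.separable_prod_XsubC separable.separable_poly.unlock.
 have := tame_sep Ht; move: lc0 E; move: (lead_coef _) => l Nl ->.
 by rewrite derivZ coprimepZl // coprimepZr.
by apply/eqP; rewrite -eqSS -(tame_size Ht) [in X in _ == X]E size_scale // size_prod_XsubC.
Qed.

Lemma crit_list : exists us : seq (C * C), [/\ uniq us, size us = (d1.-1 * d1.-1)%N &
 forall p, (p \in us) = (pev p (dx f) == 0) && (pev p (dy f) == 0)].
Proof.
have Hy : dgl d1.-1 (dy f) by apply: dgl_dy; rewrite prednK.
have Hx : dgl d1.-1 (dx f) by apply: dgl_dx; rewrite prednK.
have Ey : tf d1.-1 (dy f) = (tf d1 f)^`() by rewrite tf_dy prednK.
have Ex : tf d1.-1 (dx f) = d1%:R *: tf d1 f - 'X * (tf d1 f)^`() by rewrite tf_dx prednK.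
have Sy : size (tf d1.-1 (dy f)) = d1.-1.+1.
 rewrite Ey prednK //; apply/eqP; rewrite eqn_leq; apply/andP; split.
  by have := lt_size_deriv (p := tf d1 f); rewrite -size_poly_eq0 (tame_size_f Ht) => /(_ isT).
 rewrite -[X in (X <= _)%N](prednK Hd1) ltnNge; apply/negP => /leq_sizeP/(_ d1.-1 (leqnn _)) /eqP.
 rewrite coef_deriv prednK // -mulr_natr mulf_eq0 pnatr_eq0 (gtn_eqF Hd1) orbF.
 by rewrite -[d1 in _`_d1]/(d1.+1.-1) -(tame_size_f Ht) lead_coef_eq0 -size_poly_eq0 (tame_size_f Ht).
have Cop : coprimep (tf d1.-1 (dy f)) (tf d1.-1 (dx f)).
 by rewrite Ey Ex addrC -mulNr coprimep_addl_mul coprimepZr ?pnatr_eq0 -?lt0n // coprimep_sym (tame_sep_f Ht).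
have Hs p : pev p (dy f) = 0 -> pev p (dx f) = 0 -> (pev p (dx (dy f)) != 0) || (pev p (dy (dy f)) != 0).
 move=> H1 H2; have [_] := tame_crit Ht H2 H1; apply: contraNT; rewrite negb_or !negbK => /andP[/eqP E1 /eqP E2].
 by rewrite pevB !pevM E1 E2 !mulr0 subrr.
have [us Uu [Mu Su]] := bezout Hy Hx Sy Cop Hs.
exists us; split=> //; last by move=> p; rewrite andbC.
rewrite -(Su (fun _ => 1%N)) ?sum1_size // => p; rewrite Mu => /andP[/eqP H1 /eqP H2].
split; first by case=> // _.
by have [] := tame_crit Ht H2 H1.
Qed.

Theorem tame_discriminant : discriminant_data d1 d2 f g.
Proof.
have [rs [lc [Urs Srs Nlc EJ]]] := roots_top.
have Hroot s : s \in rs -> (tf D J).[s] = 0.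
 by move=> Hs; apply/eqP; rewrite EJ hornerZ mulf_eq0 -[X in _ || X]rootE root_prod_XsubC Hs orbT.
have Hf0 s : s \in rs -> (tf d1 f).[s] != 0 by move=> /Hroot; apply: (tame_f0 Ht).
have Hg0 s : s \in rs -> (tf d2 g).[s] != 0 by move=> /Hroot; apply: (tame_g0 Ht).
have SJ := tame_size Ht.
have [w [be [Hbe Hfr]]] := frame_uniform Hd1 SJ (size_tf d1 f) (copJ Nlc EJ Hf0).
have [fr [Efr Hdeg]] := Hfr J f HJ Hf erefl erefl.
have [fr0 [Efr0 _]] := Hfr _ _ (dgl_fm (size_tf D J)) (dgl_fm (size_tf d1 f)) (tf_fmE D J) (tf_fmE d1 f).
have [K [b [EK HK HK0]]] := dy_eliminant_top Hd1 Hd2 HD Hf Hg Urs Srs Nlc EJ Hf0 Hg0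
  (fun s s' H H' => tame_gam Ht (Hroot s H) (Hroot s' H')) (fun Hd s H => tame_sub Ht Hd (Hroot s H)) Hbe Efr Efr0 Hdeg.
set h := hH g fr in EK.
have Hsm := tame_smooth Ht; have HT := tame_T Ht.
have Hsm' a p : pev p J = 0 -> pev p a = 0 -> (pev p (dx J) != 0) || (pev p (dy J) != 0) by move=> /Hsm.
have [us [Uus Sus Mus]] := crit_list.
have HTd : dgl (d1.-1 + D.-1) T by apply: dgl_bra; rewrite prednK.
have CT : coprimep (tf D J) (tf (d1.-1 + D.-1) T).
 apply: (copJ Nlc EJ) => s Hs.
 have := @tf_bra C d1.-1 D.-1 f J; rewrite !prednK // => -> //.
 rewrite hornerD hornerN !hornerM !hornerZ (Hroot s Hs) !mulr0 subr0.
 rewrite !mulf_neq0 ?Hf0 ?pnatr_eq0 -?lt0n //.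
 by apply: (coprimep_root (tame_sep Ht)); apply/eqP; apply: Hroot.
have [ts Uts [Mts Sts]] := bezout HJ HTd SJ CT (Hsm' T).
have Ets : size ts = (D * (d1.-1 + D.-1))%N.
 rewrite -(Sts (fun _ => 1%N)) ?sum1_size // => p; rewrite Mts => /andP[/eqP H1 /eqP H2].
 by split; [case|apply: HT].
have [ps Ups [Mps Sps]] := bezout HJ HK SJ (copJ Nlc EJ HK0) (Hsm' K).
pose im p := (pev p f, pev p g).
pose np p : bool := `[< exists q, [/\ q != p, pev q J = 0 & im q = im p] >].
pose tz p := pev p T == 0; pose tz' p := pev p T' == 0.
(* The order of h_y(f, g) at p: one for a zero of T, one if p is a preimage of a node, two more at a
   cusp. *)
pose m p := (tz p + np p + (tz p && tz' p).*2)%N.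
have Hpair p q : p != q -> pev p J = 0 -> pev q J = 0 -> im q = im p ->
  pev p T * pev q T' - pev p T' * pev q T != 0.
 by move=> Npq H1 H2 [E1 E2]; apply: (tame_pair Ht).
have Hcu p q : pev p J = 0 -> pev p T = 0 -> pev p T' = 0 -> pev q J = 0 -> im q = im p -> q = p.
 move=> H1 H2 H3 H4 E; apply/eqP/negPn/negP => N.
 have := Hpair p q; rewrite eq_sym N H2 H3 !mul0r subrr eqxx => /(_ isT H1 H4 E); done.
have Htri p q r : p != q -> pev p J = 0 -> pev q J = 0 -> im q = im p -> pev r J = 0 -> im r = im p -> r = p \/ r = q.
 move=> N H1 H2 [E1 E2] H3 [E3 E4].
 have [->|N1] := eqVneq r p; first by left.
 have [->|N2] := eqVneq r q; first by right.
 by exfalso; apply: (tame_triple Ht N _ _ H1 H2 H3); rewrite // eq_sym.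
have ordh p : pev p J = 0 -> exo J p (m p) (comp2 f g (dy h)).
 move=> HJp; rewrite /m /tz /tz'; have [/asboolP[q [N HJq Eq]]|Hn] := boolP (np p).
  rewrite eq_sym in N; have := node_order fr Hsm HT N HJp HJq erefl Eq (Hpair _ _ N HJp HJq Eq).
  move=> /(_ (fun r H1 H2 => Htri p q r N HJp HJq Eq H1 H2)).
  case: (eqVneq (pev p T) 0) => HTp //=; case: (eqVneq (pev p T') 0) => HTp' //=.
  by move: N; rewrite (Hcu p q HJp HTp HTp' HJq Eq) eqxx.
 have Hone q : pev q J = 0 -> im q = im p -> q = p.
  by move=> H1 H2; apply/eqP/negPn/negP => N; case/negP: Hn; apply/asboolP; exists q.
 have [/andP[/eqP H1 /eqP H2]|Hi] := boolP ((pev p T == 0) && (pev p T' == 0)).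
  rewrite H1 eqxx; exact: (cusp_order fr Hsm HT HJp erefl H1 H2 Hone (tame_cusp Ht HJp H1 H2)).
 rewrite negb_and in Hi; have := smooth_order fr Hsm HT HJp erefl Hi Hone.
 by case: (pev p T == 0).
have ordK p : p \in ps -> exo J p (m p) K.
 rewrite Mps => /andP[/eqP H1 _]; have := ordh p H1; rewrite EK => H.
 exact: (exo_addJ (m p) K b H1).1 H.
have Hsum := Sps m ordK.
have psP p : (p \in ps) = (pev p J == 0) && (0 < m p)%N.
 rewrite Mps; case: (pev p J =P 0) => //= HJp.
 have := ordh p HJp; rewrite EK => /(exo_addJ (m p) K b HJp).1 [Hv Hx].
 apply/eqP/idP => [HK1|/Hv //].
 by rewrite lt0n; apply: contraTneq Hx => ->; rewrite HK1 eqxx.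
pose cs := [seq p <- ts | pev p T' == 0].
pose ns := [seq p <- ps | np p].
have Ucs : uniq cs by rewrite filter_uniq.
have Uns : uniq ns by rewrite filter_uniq.
have Mcs p : (p \in cs) = [&& pev p J == 0, pev p T == 0 & pev p T' == 0].
 by rewrite mem_filter Mts andbC andbA.
have Mns p : (p \in ns) = (pev p J == 0) && np p.
 rewrite mem_filter psP andbCA; congr (_ && _); rewrite /m /tz /tz'; case: (np p) => //=.
 by rewrite addnS.
(* The zeros of T split into cusps, where T' = 0, and critical points of f. *)
have Scs : (size cs + d1.-1 * d1.-1 = D * (d1.-1 + D.-1))%N.
 rewrite -Ets -Sus -(count_predC (fun p => pev p T' == 0) ts) size_filter; congr (_ + _)%N.
 rewrite -size_filter; apply: perm_size; apply: uniq_perm; rewrite ?filter_uniq // => p.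
 rewrite Mus mem_filter /= Mts.
 have Ex := crit_relx p f g J; have Ey := crit_rely p f g J.
 apply/andP/and3P => [[/eqP H1 /eqP H2]|[H1 /eqP H2 /eqP H3]].
  have [HT' _] := tame_crit Ht H1 H2; split=> //; apply/eqP.
   by rewrite pevB !pevM H1 H2 !mul0r subrr.
  by rewrite pevB !pevM H1 H2 !mul0r subrr.
 rewrite H2 H3 !(mulr0, mul0r, subrr) in Ex Ey.
 by move/eqP: Ex; move/eqP: Ey; rewrite !mulf_eq0 (negbTE H1) !orbF => -> ->.
(* The total order of h_y(f, g), equal by Bezout to D times its degree, is split along the three
   contributions to [m]. *)
have Sps' : (D * (D * d1 * d2 - d2 - (gcdn d1 d2).-1) = D * (d1.-1 + D.-1) + size ns + (size cs).*2)%N.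
 rewrite -Hsum big_split big_split /=; congr (_ + _ + _)%N.
 - rewrite -Ets; transitivity (size [seq p <- ps | tz p]).
   by rewrite size_filter -sum1_count [RHS]big_mkcond; apply: eq_bigr => p _; case: (tz p).
  apply: perm_size; apply: uniq_perm; rewrite ?filter_uniq // => p.
  rewrite mem_filter psP Mts /m /tz /tz' andbC -andbA; congr (_ && _).
  by case: (pev p T == 0); rewrite ?andbF.
 - by rewrite size_filter -sum1_count [RHS]big_mkcond; apply: eq_bigr => p _; case: (np p).
 rewrite -mul2n -[(size cs)]sum1_size big_distrr /=.
 transitivity (\sum_(p <- [seq p <- ps | tz p && tz' p]) 2)%N.
  by rewrite big_filter [RHS]big_mkcond; apply: eq_bigr => p _; case: (_ && _).
 apply: perm_big; apply: uniq_perm; rewrite ?filter_uniq // => p.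
 rewrite mem_filter psP Mcs /m /tz /tz'.
 by case: (pev p J == 0); case: (pev p T == 0); case: (pev p T' == 0); rewrite ?andbT.
have Hns : (size ns = (size (undup (map im ns))).*2)%N.
 apply: size_undup_pairs => // p; rewrite Mns => /andP[/eqP HJp /asboolP[q [N HJq Eq]]].
 exists q; first by rewrite Mns HJq eqxx; apply/asboolP; exists p; rewrite eq_sym.
 split=> //; first by rewrite eq_sym.
 move=> z; rewrite Mns => /andP[/eqP HJz _] Ez.
 by apply: (Htri p q z) => //; rewrite eq_sym.
exists h, (map im cs), (undup (map im ns)); split.
 split; [exact: hH_neq0|exact: hH_zero| |exact: undup_uniq].
 rewrite map_inj_in_uniq // => p q; rewrite !Mcs => /and3P[/eqP H1 /eqP H2 /eqP H3] /and3P[/eqP H4 _ _] E.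
 by apply/esym; apply: (Hcu p q).
split.
- by rewrite size_map; apply: cusp_count.
- apply: (node_count Hd1 Hd2 HD _ _ Scs); rewrite ?gcdn_gt0 ?Hd1 //; last by rewrite Sps' Hns.
 have H1 : (gcdn d1 d2 <= d1)%N by apply: dvdn_leq => //; apply: dvdn_gcdl.
 have H2 : (gcdn d1 d2 <= d2)%N by apply: dvdn_leq => //; apply: dvdn_gcdr.
 have H3 : (0 < gcdn d1 d2)%N by rewrite gcdn_gt0 Hd1.
 have H4 : (d1 * d2 <= D * d1 * d2)%N by rewrite -mulnA leq_pmull.
 move: H4; case: (d1) Hd1 H1 H2 H3 => // [] [|k] _ H1 H2 H3 H4.
  by apply: leq_trans H4; move: H1 H3; rewrite mul1n; lia.
 by apply: leq_trans H4; rewrite leq_add2l; apply: leq_trans (leq_addr _ _); apply: leq_trans (leq_pred _) H2.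
- move=> P /mapP[p]; rewrite Mcs => /and3P[/eqP H1 /eqP H2 /eqP H3] ->.
 by apply: (cusp_algcusp fr Hsm HT H1 erefl H2 H3 _ (tame_cusp Ht H1 H2 H3)) => q Hq Eq; apply: Hcu.
- move=> P; rewrite mem_undup => /mapP[p]; rewrite Mns => /andP[/eqP HJp /asboolP[q [N HJq Eq]]] ->.
 rewrite eq_sym in N; apply: (node_algnode fr Hsm HT N HJp HJq erefl Eq (Hpair _ _ N HJp HJq Eq)) => r.
 exact: Htri.
move=> P /hH_zero[p HJp <-] Nc Nn.
have Hn : ~~ np p.
 by apply: contra Nn => Hn; rewrite mem_undup; apply: map_f; rewrite Mns HJp eqxx.
apply: (smooth_branch fr Hsm HT HJp erefl).
 rewrite -negb_and; apply: contra Nc => /andP[/eqP H1 /eqP H2]; apply: map_f; rewrite Mcs HJp H1 H2 !eqxx //.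
by move=> q H1 H2; apply/eqP/negPn/negP => N; case/negP: Hn; apply/asboolP; exists q.
Qed.
End Main.
End Count.

(** * Polynomial charts and dimension counts *)

Section PolyFun.
Variable C : cField.

(** Polynomial dependence as a predicate on functions: closure lemmas replace explicit polynomials
    in the parameters, and the variables may be indexed by any type. *)
Inductive pfun (I : Type) : ((I -> C) -> C) -> Prop :=
| pf_cst c : pfun (fun _ => c)
| pf_var i : pfun (fun z => z i)
| pf_add f g : pfun f -> pfun g -> pfun (fun z => f z + g z)
| pf_mul f g : pfun f -> pfun g -> pfun (fun z => f z * g z).

Lemma pf_opp I (f : (I -> C) -> C) : pfun f -> pfun (fun z => - f z).
Proof.
move=> Hf; rewrite (_ : (fun z => _) = (fun z => (-1) * f z)); last by apply/funext => z; rewrite mulN1r.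
by apply: pf_mul Hf; apply: pf_cst.
Qed.
Lemma pf_sub I (f g : (I -> C) -> C) : pfun f -> pfun g -> pfun (fun z => f z - g z).
Proof. by move=> Hf Hg; apply: pf_add => //; apply: pf_opp. Qed.
Lemma pf_exp I (f : (I -> C) -> C) k : pfun f -> pfun (fun z => f z ^+ k).
Proof.
move=> Hf; elim: k => [|k IH]; first by under eq_fun do rewrite expr0; apply: pf_cst.
by under eq_fun do rewrite exprS; apply: pf_mul.
Qed.
Lemma pf_sum I J r (P : pred J) (f : J -> (I -> C) -> C) :
 (forall j, P j -> pfun (f j)) -> pfun (fun z => \sum_(j <- r | P j) f j z).
Proof.
move=> H; elim: r => [|j r IH]; first by under eq_fun do rewrite big_nil; apply: pf_cst.
under eq_fun do rewrite big_cons.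
by case E : (P j) => //; apply: pf_add => //; apply: H.
Qed.
Lemma pf_prod I J r (P : pred J) (f : J -> (I -> C) -> C) :
 (forall j, P j -> pfun (f j)) -> pfun (fun z => \prod_(j <- r | P j) f j z).
Proof.
move=> H; elim: r => [|j r IH]; first by under eq_fun do rewrite big_nil; apply: pf_cst.
under eq_fun do rewrite big_cons.
by case E : (P j) => //; apply: pf_mul => //; apply: H.
Qed.
Lemma pf_det I n (M : (I -> C) -> 'M[C]_n) : (forall i j, pfun (fun z => M z i j)) ->
 pfun (fun z => \det (M z)).
Proof.
move=> H; apply: pf_sum => s _; apply: pf_mul; first exact: pf_cst.
by apply: pf_prod => i _; apply: H.
Qed.
Lemma pf_cofactor I n (M : (I -> C) -> 'M[C]_n) i j : (forall i j, pfun (fun z => M z i j)) ->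
 pfun (fun z => cofactor (M z) i j).
Proof.
move=> H; apply: pf_mul; first exact: pf_cst.
by apply: pf_det => k l; under eq_fun do rewrite !mxE; apply: H.
Qed.
Lemma pf_comp I J f (u : I -> (J -> C) -> C) : pfun f -> (forall i, pfun (u i)) ->
 pfun (fun z => f (fun i => u i z)).
Proof.
move=> Hf Hu; elim: Hf => [c|i|g h _ IHg _ IHh|g h _ IHg _ IHh]; first exact: pf_cst.
- exact: Hu.
- exact: pf_add.
exact: pf_mul.
Qed.

(** Substitution of z = num / den and clearing of denominators. All exponents from some e on are
    allowed, so that those of two terms or factors can be matched. *)
Lemma pf_rat I J (f : (I -> C) -> C) (den : (J -> C) -> C) num :
 pfun f -> pfun den -> (forall i, pfun (num i)) ->
 exists e, forall e', (e <= e')%N -> exists2 F, pfun F &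
  forall t z, den t != 0 -> (forall i, z i * den t = num i t) -> f z * den t ^+ e' = F t.
Proof.
move=> Hf Hd Hn; elim: Hf => [c|i|g h _ [e1 H1] _ [e2 H2]|g h _ [e1 H1] _ [e2 H2]].
- exists 0%N => e' _; exists (fun t => c * den t ^+ e') => //.
 by apply: pf_mul; [apply: pf_cst|apply: pf_exp].
- exists 1%N => [[|e']] // _; exists (fun t => num i t * den t ^+ e'); first by apply: pf_mul => //; apply: pf_exp.
 by move=> t z _ H; rewrite exprS mulrA H.
- exists (maxn e1 e2) => e'; rewrite geq_max => /andP[/H1[F HF E1] /H2[G HG E2]].
 exists (fun t => F t + G t); first exact: pf_add.
 by move=> t z Hd0 Hz; rewrite mulrDl (E1 t z) // (E2 t z).
exists (e1 + e2)%N => e' He.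
have [F HF E1] := H1 e1 (leqnn _); have He2 : (e2 <= e' - e1)%N by lia.
have [G HG E2] := H2 _ He2.
exists (fun t => F t * G t); first exact: pf_mul.
move=> t z Hd0 Hz; rewrite -(E1 t z) // -(E2 t z) // mulrACA -exprD subnKC //; lia.
Qed.

Definition upd (I : eqType) (z : I -> C) i t j := if j == i then t else z j.
Definition pdeg (I : eqType) N (f : (I -> C) -> C) :=
 forall i z, exists2 p : {poly C}, (size p <= N.+1)%N & forall t, f (upd z i t) = p.[t].

Lemma pdeg_mono (I : eqType) M N (f : (I -> C) -> C) : (M <= N)%N -> pdeg M f -> pdeg N f.
Proof. by move=> H Hf i z; have [p Hp E] := Hf i z; exists p => //; apply: leq_trans Hp _. Qed.
Lemma pdegM (I : eqType) M N (f g : (I -> C) -> C) : pdeg M f -> pdeg N g -> pdeg (M + N) (fun z => f z * g z).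
Proof.
move=> Hf Hg i z; have [p Hp E] := Hf i z; have [q Hq E'] := Hg i z.
exists (p * q); last by move=> t; rewrite E E' hornerM.
by apply: leq_trans (size_polyMleq _ _) _; lia.
Qed.
Lemma pdegD (I : eqType) N (f g : (I -> C) -> C) : pdeg N f -> pdeg N g -> pdeg N (fun z => f z + g z).
Proof.
move=> Hf Hg i z; have [p Hp E] := Hf i z; have [q Hq E'] := Hg i z.
exists (p + q); last by move=> t; rewrite E E' hornerD.
by apply: leq_trans (size_polyD _ _) _; rewrite geq_max Hp.
Qed.
Lemma pdeg_cst (I : eqType) N c : pdeg N (fun _ : I -> C => c).
Proof. by move=> i z; exists c%:P; [apply: leq_trans (size_polyC_leq1 _) _|move=> t; rewrite hornerC]. Qed.
Lemma pdegX (I : eqType) N (f : (I -> C) -> C) k : pdeg N f -> pdeg (k * N) (fun z => f z ^+ k).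
Proof.
move=> Hf; elim: k => [|k IH]; first by under eq_fun do rewrite expr0; apply: pdeg_cst.
under eq_fun do rewrite exprS; rewrite mulSn; exact: (pdegM Hf IH).
Qed.
Lemma pdeg_sum (I : eqType) N J r (f : J -> (I -> C) -> C) :
 (forall j, pdeg N (f j)) -> pdeg N (fun z => \sum_(j <- r) f j z).
Proof.
move=> H; elim: r => [|j r IH]; first by under eq_fun do rewrite big_nil; apply: pdeg_cst.
under eq_fun do rewrite big_cons; exact: (pdegD (H j) IH).
Qed.
Lemma pdeg_prod (I : eqType) N J r (f : J -> (I -> C) -> C) :
 (forall j, pdeg N (f j)) -> pdeg (size r * N) (fun z => \prod_(j <- r) f j z).
Proof.
move=> H; elim: r => [|j r IH]; first by under eq_fun do rewrite big_nil; apply: pdeg_cst.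
under eq_fun do rewrite big_cons; rewrite mulSn; exact: (pdegM (H j) IH).
Qed.
Lemma polyfun_pdeg (I : eqType) (f : (I -> C) -> C) : pfun f -> exists N, pdeg N f.
Proof.
elim=> [c|i|g h _ [M Hg] _ [N Hh]|g h _ [M Hg] _ [N Hh]].
- by exists 0%N; apply: pdeg_cst.
- exists 1%N => j z; have [E|E] := eqVneq i j.
  by exists 'X; rewrite ?size_polyX // => t; rewrite /upd E eqxx hornerX.
 by exists (z i)%:P; [apply: leq_trans (size_polyC_leq1 _) _|move=> t; rewrite /upd (negbTE E) hornerC].
- exists (maxn M N); apply: pdegD; [apply: pdeg_mono Hg|apply: pdeg_mono Hh]; [exact: leq_maxl|exact: leq_maxr].
by exists (M + N)%N; apply: pdegM.
Qed.

(** Coordinates are freed one at a time: with the others fixed, a polynomial of degree at most N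
    that vanishes at 0, ..., N is zero. *)
Lemma grid_zero (I : finType) N f : pdeg N f ->
 (forall e : {ffun I -> 'I_N.+1}, f (fun i => (e i : nat)%:R) = 0) -> forall z, f z = 0.
Proof.
move=> Hf H z.
suff HS (S : seq I) y : (forall i, i \notin S -> exists m : 'I_N.+1, y i = m%:R) -> f y = 0.
 by apply: (HS (enum I)) => i; rewrite mem_enum.
elim: S y => [|i S IH] y Hy.
 have [e He] := boolp.choice (fun i => Hy i isT).
 by rewrite (_ : y = fun i => ([ffun i => e i] i : nat)%:R) //; apply/funext => i; rewrite ffunE.
have [p Sp Ep] := Hf i y.
have Ey : upd y i (y i) = y by apply/funext => j; rewrite /upd; case: eqP => [->|].
rewrite -Ey Ep; suff -> : p = 0 by rewrite horner0.
apply/eqP/negPn/negP => p0.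
have := @max_poly_roots _ p [seq (m%:R : C) | m <- iota 0 N.+1] p0; rewrite size_map size_iota.
move=> /(_ _ _)/wrap[]; last by move/(leq_trans)/(_ Sp); rewrite ltnn.
- apply/allP => _ /mapP[m Hm ->]; rewrite /root -Ep; apply/eqP; apply: IH => j Hj; rewrite /upd.
 case: (eqVneq j i) => [_|Nj]; last by apply: Hy; rewrite negb_or Nj.
 by move: Hm; rewrite mem_iota => /andP[_ Hm]; exists (Ordinal Hm).
by rewrite map_inj_uniq ?iota_uniq // => m m' /eqP; rewrite eqr_nat => /eqP.
Qed.

(** Finitely many rational charts with parameters indexed by K, each with one common denominator;
    the size of K bounds the dimension of Z. *)
Definition cover (I : Type) (K : finType) (Z : (I -> C) -> Prop) :=
 exists (L : finType) (den : L -> (K -> C) -> C) (num : L -> I -> (K -> C) -> C),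
 [/\ forall l, pfun (den l), forall l i, pfun (num l i) &
 forall z, Z z -> exists l t, den l t != 0 /\ forall i, z i * den l t = num l i t].

Lemma cover_full (I : finType) (Z : (I -> C) -> Prop) : cover I Z.
Proof.
exists unit, (fun _ _ => 1), (fun _ i t => t i); split=> [_|_ i|z _]; [exact: pf_cst|exact: pf_var|].
by exists tt, z; split=> [|i]; rewrite ?oner_eq0 ?mulr1.
Qed.

(* A set covered by charts of fewer parameters than coordinates lies on a
  hypersurface: there are more monomials than values on a grid of parameters. *)
Lemma grid_count n N r k : (r < n)%N -> ((n * N).+1 ^ r < k)%N ->
 ((n * (k * N)).+1 ^ r < k ^ n)%N.
Proof.
move=> Hr Hk; have k0 : (0 < k)%N by apply: leq_ltn_trans Hk.
have H1 : ((n * (k * N)).+1 <= k * (n * N).+1)%N by rewrite mulnS mulnCA addnC -addn1 leq_add2l.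
apply: (@leq_ltn_trans ((k * (n * N).+1) ^ r)); first by case: (r) => // r'; rewrite leq_exp2r.
apply: (@leq_trans (k ^ r.+1)); last by rewrite leq_pexp2l.
by rewrite expnMn expnSr ltn_pmul2l // expn_gt0 k0.
Qed.

Lemma chart_hypersurface n (K : finType) (den : (K -> C) -> C) num :
 (#|K| < n)%N -> pfun den -> (forall i, pfun (num i)) ->
 exists2 P : mpoly n C, P != 0 & forall t x, den t != 0 -> (forall i, x i * den t = num i t) ->
  meval x P = 0.
Proof.
move=> HK Hd Hn; have [N0 HN0] := polyfun_pdeg Hd.
have [Ni HNi] := boolp.choice (fun i => polyfun_pdeg (Hn i)).
pose N := maxn N0 (\max_i Ni i).
have HdN : pdeg N den by apply: pdeg_mono HN0; apply: leq_maxl.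
have HnN i : pdeg N (num i).
 by apply: pdeg_mono (HNi i); apply: leq_trans (leq_maxr _ _); apply: leq_bigmax.
(* As #|K| < n, this k makes the k^n monomials with exponents below k outnumber the (n k N + 1)^#|K|
   points of the parameter grid. *)
pose k := ((n * N).+1 ^ #|K|).+1.
pose Phi (e : {ffun 'I_n -> 'I_k}) t := \prod_(i <- enum 'I_n) (num i t ^+ e i * den t ^+ (k.-1 - e i)).
have HPhi e : pdeg (n * (k * N)) (Phi e).
 have := @pdeg_prod K (k * N) 'I_n (enum 'I_n) (fun i t => num i t ^+ e i * den t ^+ (k.-1 - e i)).
 rewrite size_enum_ord; apply=> i.
 apply: pdeg_mono (pdegM (pdegX (e i) (HnN i)) (pdegX (k.-1 - e i) HdN)).
 by rewrite -mulnDl leq_mul2r subnKC ?leqnSn ?orbT // -ltnS.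
set B := (n * (k * N))%N.
pose A := \matrix_(a < #|{ffun 'I_n -> 'I_k}|, b < #|{ffun K -> 'I_B.+1}|)
 Phi (enum_val a) (fun j => ((enum_val b : {ffun K -> 'I_B.+1}) j : nat)%:R).
have Hlt : (#|{ffun K -> 'I_B.+1}| < #|{ffun 'I_n -> 'I_k}|)%N.
 by rewrite !card_ffun !card_ord; apply: grid_count.
have [v v0 Hv] := left_kernel A Hlt.
pose mon (e : {ffun 'I_n -> 'I_k}) : multinom n := Multinom [tuple (e i : nat) | i < n].
exists (\sum_e v 0 (enum_rank e) *: mpolyX C (mon e)).
 apply/eqP => P0; case/eqP: v0; apply/rowP => a; rewrite mxE.
 have := congr1 (mcoeff (mon (enum_val a))) P0; rewrite mcoeff0 raddf_sum (bigD1 (enum_val a)) //= big1.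
  by rewrite addr0 mcoeffZ mcoeffX eqxx mulr1 enum_valK.
 move=> e Ne; rewrite mcoeffZ mcoeffX; case: eqP => [E|_]; rewrite ?mulr0 //; case/eqP: Ne.
 apply/ffunP => i; apply: val_inj; have := congr1 (fun m : multinom n => m i) E.
 by rewrite !mnmE.
move=> t x Hdt Hx.
have HF : forall z, \sum_(e <- enum {ffun 'I_n -> 'I_k}) v 0 (enum_rank e) * Phi e z = 0.
 apply: (@grid_zero K B).
  by apply: pdeg_sum => e; rewrite -[B]add0n; apply: pdegM => //; apply: pdeg_cst.
 move=> g; have /rowP/(_ (enum_rank g)) := Hv; rewrite !mxE => E.
 rewrite -[RHS]E big_enum (reindex_onto (@enum_val _ _) enum_rank) /=; last by move=> e _; rewrite enum_rankK.
 apply: eq_big => [a|a _]; first by rewrite enum_valK eqxx.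
 by rewrite enum_valK mxE enum_rankK.
have Hk : den t ^+ (n * k.-1) != 0 by rewrite expf_neq0.
apply: (mulIf Hk); rewrite mul0r -[RHS](HF t) big_enum /= (big_morph (meval x) (@mevalD _ _ x) (@meval0 _ _ x)) mulr_suml.
apply: eq_bigr => e _; rewrite mevalZ mevalX -mulrA; congr (_ * _).
rewrite /Phi big_enum mulnC exprM -[X in _ ^+ X](card_ord n) -prodr_const -big_split /=.
apply: eq_bigr => i _; rewrite mnmE -Hx exprMn -mulrA -exprD subnKC // -ltnS.
exact: ltn_ord.
Qed.

Lemma cover_hypersurface n I K (Z : (I -> C) -> Prop) pi :
 cover K Z -> (#|K| < n)%N -> exists2 P : mpoly n C, P != 0 & forall z, Z z -> meval (fun i => z (pi i)) P = 0.
Proof.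
move=> [L [den [num [Hd Hn HZ]]]] HK.
have H l := chart_hypersurface HK (Hd l) (fun i => Hn l (pi i)).
have {}H l : exists P : mpoly n C, P != 0 /\
  forall t x, den l t != 0 -> (forall i, x i * den l t = num l (pi i) t) -> meval x P = 0.
 by have [P P0 HP] := H l; exists P.
have [P HP] := boolp.choice H.
exists (\prod_l P l); first by apply/prodf_neq0 => l _; case: (HP l).
move=> z /HZ[l [t [Hdt Hz]]]; have [_ HPl] := HP l.
rewrite (bigD1 l) //= rmorphM /= (HPl t) ?mul0r // => i; exact: Hz.
Qed.

(** Over a chart of Z the new coordinates solve c independent linear equations. Cramer's rule on c
    pivot columns expresses the pivots by the remaining #|J| - c coordinates, which become
    parameters; each choice of pivots is a chart. *)
Lemma cover_linear (I J K : finType) c (A : 'I_c -> J -> (I -> C) -> C) b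
  Z Z' :
 cover K Z -> (forall i j, pfun (A i j)) -> (forall i, pfun (b i)) ->
 (forall z, Z' z -> [/\ Z (z \o inl),
   forall i, \sum_j A i j (z \o inl) * z (inr j) + b i (z \o inl) = 0 &
   row_free (\matrix_(i < c, k < #|J|) A i (enum_val k) (z \o inl))]) ->
 cover (K + 'I_(#|J| - c))%type Z'.
Proof.
move=> [L [den [num [Hd Hn HZ]]]] HA Hb HZ'.
have clear_den l : exists e al bt,
 [/\ forall i j, pfun (al i j), forall i, pfun (bt i) &
  forall t z, den l t != 0 -> (forall i, z i * den l t = num l i t) ->
  (forall i j, A i j z * den l t ^+ e = al i j t) /\ (forall i, b i z * den l t ^+ e = bt i t)].
 have [e1 H1] := boolp.choice (fun ij => pf_rat (HA ij.1 ij.2) (Hd l) (Hn l)).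
 have [e2 H2] := boolp.choice (fun i => pf_rat (Hb i) (Hd l) (Hn l)).
 pose e := maxn (\max_ij e1 ij) (\max_i e2 i).
 have H1' ij : exists F, pfun F /\ forall t z, den l t != 0 -> (forall i, z i * den l t = num l i t) ->
   A ij.1 ij.2 z * den l t ^+ e = F t.
  have [|F HF E] := H1 ij e; first by apply: leq_trans (leq_maxl _ _); apply: leq_bigmax.
  by exists F.
 have H2' i : exists F, pfun F /\ forall t z, den l t != 0 -> (forall i, z i * den l t = num l i t) ->
   b i z * den l t ^+ e = F t.
  have [|F HF E] := H2 i e; first by apply: leq_trans (leq_maxr _ _); apply: leq_bigmax.
  by exists F.
 have [F1 HF1] := boolp.choice H1'; have [F2 HF2] := boolp.choice H2'.
 exists e, (fun i j => F1 (i, j)), F2; split=> [i j|i|t z Hd0 Hz]; [exact: (HF1 (i, j)).1|exact: (HF2 i).1|].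
 by split=> [i j|i]; [exact: (HF1 (i, j)).2|exact: (HF2 i).2].
have [e He] := boolp.choice clear_den; have [al Hal] := boolp.choice He; have [bt Hbt] := boolp.choice Hal.
pose q := (#|J| - c)%N.
pose T := ((K + 'I_q) -> C)%type.
pose cs (s : {ffun 'I_c -> J}) : seq J := [seq j <- enum J | j \notin codom s].
(* The free coordinate j is read at its position among the columns [cs] off the pivots; the value 0
   at a pivot is a dummy. *)
pose y s j (t : T) : C := if insub (index j (cs s)) is Some i then t (inr i) else 0.
pose As l (s : {ffun 'I_c -> J}) (t : T) : 'M[C]_c := \matrix_(i, k) al l i (s k) (t \o inl).
pose rhs l s i (t : T) := bt l i (t \o inl) + \sum_(j <- cs s) al l i j (t \o inl) * y s j t.
pose den' ls (t : T) := den ls.1 (t \o inl) * \det (As ls.1 ls.2 t).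
pose num' ls x (t : T) := match x with
 | inl i => num ls.1 i (t \o inl) * \det (As ls.1 ls.2 t)
 | inr j => if [pick k | ls.2 k == j] is Some k
   then - den ls.1 (t \o inl) * \sum_i \adj (As ls.1 ls.2 t) k i * rhs ls.1 ls.2 i t
   else y ls.2 j t * den' ls t end.
have pfl f : pfun f -> pfun (fun t : T => f (t \o inl)).
 by move=> Hf; apply: (pf_comp Hf) => i; apply: pf_var.
have pfA l s i k : pfun (fun t => As l s t i k).
 by under eq_fun do rewrite mxE; apply: pfl; have [H _ _] := Hbt l; apply: H.
have pfy s j : pfun (y s j).
 by rewrite /y; case: insub => [i|]; [apply: pf_var|apply: pf_cst].
have pfr l s i : pfun (rhs l s i).
 have [H1 H2 _] := Hbt l.
 by apply: pf_add; [apply: pfl|apply: pf_sum => j _; apply: pf_mul => //; apply: pfl].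
have pfd ls : pfun (den' ls) by apply: pf_mul; [apply: pfl|apply: pf_det].
exists (L * {ffun 'I_c -> J})%type, den', num'; split=> //.
 move=> ls [i|j]; first by apply: pf_mul; [apply: pfl|apply: pf_det].
 rewrite /num'; case: [pick k | ls.2 k == j] => [k|]; last exact: pf_mul.
 apply: pf_mul; first by apply: pf_opp; apply: pfl.
 apply: pf_sum => i _; apply: pf_mul => //.
 by under eq_fun do rewrite mxE; apply: pf_cofactor.
move=> z /HZ'[/HZ[l [t0 [Hd0 Hz0]]] Hlin Hfree].
set M := \matrix_(i, k) _ in Hfree.
have Hfull : row_full M^T by rewrite /row_full mxrank_tr.
pose s : {ffun 'I_c -> J} := [ffun k => enum_val (fullrankfun Hfull k)].
have s_inj : injective s.
 by move=> k k'; rewrite !ffunE => /enum_val_inj /maxrankfun_inj /cast_ord_inj.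
have UJ : uniq (Finite.enum J) by rewrite -enumT enum_uniq.
have Scs : size (cs s) = q.
 have := count_predC (mem (codom s)) (enum J); rewrite -!size_filter -cardE => E.
 have E1 : size [seq j <- enum J | mem (codom s) j] = c.
  rewrite -[RHS](card_ord c) -(card_codom s_inj) cardE; apply: perm_size.
  by apply: uniq_perm; rewrite ?filter_uniq // => j; rewrite mem_filter !mem_enum andbT.
 by rewrite E1 in E; rewrite /q -E addKn.
have [H1 H2 H3] := Hbt l; have [HA3 Hb3] := H3 t0 (z \o inl) Hd0 Hz0.
pose t : T := fun x => match x with inl k => t0 k | inr i => nth 0 [seq z (inr j) | j <- cs s] i end.
have Et : t \o inl = t0 by [].
have Ey j : j \in cs s -> y s j t = z (inr j).
 move=> Hj; have Hi : (index j (cs s) < q)%N by rewrite -Scs index_mem.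
 by rewrite /y insubT /= (nth_map j) ?Scs // nth_index.
have EAs : As l s t = den l t0 ^+ e l *: (rowsub (fullrankfun Hfull) M^T)^T.
 by apply/matrixP => i k; rewrite !mxE ffunE mulrC.
have Hdet : \det (As l s t) != 0.
 rewrite EAs detZ mulf_neq0 ?expf_neq0 // det_tr -unitfE -unitmxE.
 exact: fullrowsub_unit.
have Hsys i : \sum_k As l s t i k * z (inr (s k)) = - rhs l s i t.
 apply/eqP; rewrite -subr_eq0 opprK; apply/eqP.
 rewrite -[RHS](mul0r (den l t0 ^+ e l)) -[in RHS](Hlin i) mulrDl Hb3 mulr_suml /rhs Et addrCA [RHS]addrC.
 congr (_ + _); rewrite [RHS](bigID (fun j => j \in codom s)) /=; congr (_ + _).
  rewrite -[RHS]big_filter.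
  transitivity (\sum_(j <- [seq s k | k <- enum 'I_c]) A i j (z \o inl) * z (inr j) * den l t0 ^+ e l).
   by rewrite big_map big_enum; apply: eq_bigr => k _; rewrite mxE -HA3 mulrAC.
  apply: perm_big; apply: uniq_perm.
  - by rewrite map_inj_uniq // enum_uniq.
  - by rewrite filter_uniq.
  by move=> j; rewrite mem_filter mem_index_enum andbT.
 rewrite big_filter big_enum_cond /=; apply: eq_big => [j|j Hj] //.
 have Hc : j \in cs s by rewrite mem_filter Hj mem_enum.
 by rewrite (Ey j Hc) -HA3; apply: mulrAC.
exists (l, s), t; split; first by rewrite mulf_neq0.
case=> [i|j] /=; first by rewrite -Hz0 mulrA.
case: pickP => [k /eqP <-|Hk].
 have Hx : As l s t *m (\col_k z (inr (s k))) = - \col_i rhs l s i t.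
  apply/colP => i; rewrite [LHS]mxE [RHS]mxE [X in - X]mxE -Hsys.
  by apply: eq_bigr => k' _; congr (_ * _); rewrite mxE.
 have := congr1 (fun w => (\adj (As l s t) *m w) k 0) Hx.
 rewrite mulmxA mul_adj_mx mul_scalar_mx mulmxN [LHS]mxE [X in _ * X]mxE [RHS]mxE [X in - X]mxE => E.
 rewrite mulrCA [z _ * _]mulrC E mulrN mulNr; congr (- (_ * _)).
 by apply: eq_bigr => i _; congr (_ * _); rewrite mxE.
rewrite Ey // mem_filter mem_enum andbT; apply/negP => /codomP[k E].
by have := Hk k; rewrite E eqxx.
Qed.
End PolyFun.

(** * Linear conditions on the coefficients of f and g *)

Section Families.
Variable C : cField.
Local Notation P2 := (mpoly 2 C).

Inductive pfam (I : Type) : ((I -> C) -> P2) -> Prop :=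
| pfm_cst c : pfun c -> pfam (fun z => cst (c z))
| pfm_x : pfam (fun _ => mx C)
| pfm_y : pfam (fun _ => my C)
| pfm_add F G : pfam F -> pfam G -> pfam (fun z => F z + G z)
| pfm_mul F G : pfam F -> pfam G -> pfam (fun z => F z * G z).

Section Closure.
Variable I : Type.
Implicit Types (F G : (I -> C) -> P2).
Lemma pfm_const u : pfam (fun _ : I -> C => u).
Proof.
elim/P2_ind: u => [c|||a b Ha Hb|a b Ha Hb].
- by apply: pfm_cst; apply: pf_cst.
- exact: pfm_x.
- exact: pfm_y.
- exact: pfm_add.
exact: pfm_mul.
Qed.
Lemma pfm_opp F : pfam F -> pfam (fun z => - F z).
Proof.
move=> H; rewrite (_ : (fun z => _) = (fun z => (- 1) * F z)); last by apply/funext => z; rewrite mulN1r.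
exact: pfm_mul (pfm_const _) H.
Qed.
Lemma pfm_sub F G : pfam F -> pfam G -> pfam (fun z => F z - G z).
Proof. by move=> HF HG; apply: pfm_add => //; apply: pfm_opp. Qed.
Lemma pfm_sum J r (F : J -> (I -> C) -> P2) :
 (forall j, pfam (F j)) -> pfam (fun z => \sum_(j <- r) F j z).
Proof.
move=> H; elim: r => [|j r IH]; first by under eq_fun do rewrite big_nil; apply: pfm_const.
by under eq_fun do rewrite big_cons; apply: pfm_add.
Qed.
Lemma pfm_d F : pfam F -> pfam (fun z => dx (F z)) /\ pfam (fun z => dy (F z)).
Proof.
elim=> [c Hc|||G H HG [Gx Gy] HH [Hx Hy]|G H HG [Gx Gy] HH [Hx Hy]].
- by split; under eq_fun do rewrite ?dxC ?dyC; apply: pfm_const.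
- by split; apply: pfm_const.
- by split; apply: pfm_const.
- by split; under eq_fun do rewrite ?dxD ?dyD; apply: pfm_add.
by split; under eq_fun do rewrite ?dxM ?dyM; apply: pfm_add; apply: pfm_mul.
Qed.
Lemma pfm_dx F : pfam F -> pfam (fun z => dx (F z)). Proof. by case/pfm_d. Qed.
Lemma pfm_dy F : pfam F -> pfam (fun z => dy (F z)). Proof. by case/pfm_d. Qed.
Lemma pfm_bra F G : pfam F -> pfam G -> pfam (fun z => bra (F z) (G z)).
Proof. by move=> /pfm_d[? ?] /pfm_d[? ?]; apply: pfm_sub; apply: pfm_mul. Qed.
Lemma pf_pev x y F : pfun x -> pfun y -> pfam F ->
 pfun (fun z => pev (x z, y z) (F z)).
Proof.
move=> Hx Hy; elim=> [c Hc|||G H _ IG _ IH|G H _ IG _ IH].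
- by under eq_fun do rewrite pevC.
- by under eq_fun do rewrite pevx.
- by under eq_fun do rewrite pevy.
- by under eq_fun do rewrite pevD; apply: pf_add.
by under eq_fun do rewrite pevM; apply: pf_mul.
Qed.
Lemma pf_tfc m i F : pfam F -> pfun (fun z => (tf m (F z))`_i).
Proof.
move=> HF; elim: HF m i => [c Hc m i|m i|m i|G H _ IG _ IH m i|G H _ IG _ IH m i].
- case: m => [|m]; last by under eq_fun do rewrite dgl_cst //; apply: pf_cst.
 under eq_fun do rewrite tf_cst coefC; case: (i == 0)%N => //; exact: pf_cst.
- exact: pf_cst.
- exact: pf_cst.
- by under eq_fun do rewrite tfD coefD; apply: pf_add.
rewrite (_ : (fun z => _) = (fun z => \sum_(k < m.+1) \sum_(l < i.+1) (tf k (G z))`_l * (tf (m - k) (H z))`_(i - l))).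
 by apply: pf_sum => k _; apply: pf_sum => l _; apply: pf_mul.
apply/funext => z; rewrite -psi_coef psiM coefM coef_sum.
by apply: eq_bigr => k _; rewrite coefM; apply: eq_bigr => l _; rewrite !psi_coef.
Qed.
Lemma pf_tf m s F : pfun s -> pfam F -> pfun (fun z => (tf m (F z)).[s z]).
Proof.
move=> Hs HF; under eq_fun do rewrite (horner_coef_wide _ (size_tf m _)).
by apply: pf_sum => i _; apply: pf_mul; [apply: pf_tfc|apply: pf_exp].
Qed.
End Closure.

Definition cidx d : finType := bmultinom 2 d.+1.
Definition pol d (a : cidx d -> C) : P2 := \sum_m a m *: mpolyX C m.
Lemma polE d f : dgl d f -> pol (fun m : cidx d => mcoeff m f) = f.
Proof.
move=> /dgl_msize Hf; apply/mpolyP => m; rewrite raddf_sum /=.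
have [Hm|Hm] := ltnP (mdeg m) d.+1.
 rewrite (bigD1 (BMultinom Hm)) //= mcoeffZ mcoeffX eqxx mulr1 big1 ?addr0 // => k Hk.
 rewrite mcoeffZ mcoeffX; case: eqP => E; rewrite ?mulr0 //; case/eqP: Hk; exact: val_inj.
rewrite (memN_msupp_eq0); last by apply: msize_mdeg_ge; apply: leq_trans Hm.
rewrite big1 // => k _; rewrite mcoeffZ mcoeffX; case: eqP => E; rewrite ?mulr0 //.
by move: Hm; rewrite -E leqNgt bmdeg.
Qed.
Lemma dgl_pol d a : dgl d (pol (d := d) a).
Proof.
apply: dgl_sum => m _; apply/dgl_msize; apply: leq_trans (msizeZ_le _ _) _.
by rewrite msizeX bmdeg.
Qed.
Lemma pfm_pol I d (pi : cidx d -> I) : pfam (fun z => pol (fun m => z (pi m))).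
Proof.
rewrite /pol; apply: pfm_sum => m; under eq_fun do rewrite scale_cst.
by apply: pfm_mul; [apply: pfm_cst; apply: pf_var|apply: pfm_const].
Qed.

Lemma pfm_polr I d : pfam (fun z : I + cidx d -> C => pol (z \o inr)).
Proof. exact: (pfm_pol inr). Qed.

Definition lin_fun (phi : P2 -> C) := forall a u v, phi (a *: u + v) = a * phi u + phi v.
Lemma lin_fun0 phi : lin_fun phi -> phi 0 = 0.
Proof. by move=> H; have := H 1 0 0; rewrite scale1r addr0 mul1r => /eqP; rewrite -subr_eq subrr => /eqP. Qed.
Lemma lin_pol d phi a : lin_fun phi -> phi (pol a) = \sum_(m : cidx d) phi (mpolyX C m) * a m.
Proof.
move=> H; rewrite /pol; elim/big_rec2: _ => [|m x y _ <-]; first exact: lin_fun0.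
by rewrite mulrC.
Qed.

Fixpoint allT {T} (P : T -> Prop) (l : seq T) : Prop := if l is x :: l' then P x /\ allT P l' else True.
Lemma allT_nth T (P : T -> Prop) l x i : allT P l -> (i < size l)%N -> P (nth x l i).
Proof. by elim: l i => // y l IH [|i] [H1 H2] //= Hi; apply: IH. Qed.

(* Triangular test polynomials: each functional has one on which it does not
  vanish but all the later ones do. *)
Fixpoint indep d (l : seq (P2 -> C)) : Prop := if l is phi :: l' then
 (exists u, [/\ dgl d u, phi u != 0 & allT (fun psi : P2 -> C => psi u = 0) l']) /\ indep d l' else True.

Lemma indep_free d l : allT lin_fun l -> indep d l ->
 forall v : 'I_(size l) -> C, (forall m : cidx d, \sum_i v i * nth (fun=> 0) l i (mpolyX C m) = 0) -> forall i, v i = 0.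
Proof.
elim: l => [|phi l IH] /=; first by move=> _ _ v _ [].
move=> [Hphi Hl] [[u [Hu Hpu Hul]] Hi] v Hv.
have Hall w : dgl d w -> \sum_i v i * nth (fun=> 0) (phi :: l) i w = 0.
 move=> Hw; rewrite -(polE Hw).
 under eq_bigr => i _.
  rewrite lin_pol; last by case: i => [[|i] Hi']; apply: allT_nth.
  rewrite mulr_sumr; over.
 rewrite exchange_big big1 //= => m _; under eq_bigr do rewrite mulrA.
 by rewrite -mulr_suml Hv mul0r.
have v0 : v ord0 = 0.
 have := Hall u Hu; rewrite big_ord_recl /= big1 ?addr0 => [/eqP|i _].
  by rewrite mulf_eq0 (negbTE Hpu) orbF => /eqP.
 by rewrite (allT_nth (fun=> 0) Hul) ?mulr0 // ltn_ord.
have Hr := IH Hl Hi (fun i => v (lift ord0 i)).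
move=> i; case: (unliftP ord0 i) => [j ->|->] //; apply: Hr => m.
by have := Hv m; rewrite big_ord_recl v0 mul0r add0r.
Qed.

Lemma indep_row_free d c l : size l = c -> allT lin_fun l -> indep d l ->
 row_free (\matrix_(i < c, k < #|cidx d|) nth (fun=> 0) l i (mpolyX C (enum_val k))).
Proof.
move=> Hc Hl Hi; subst c; apply: inj_row_free => v Hv; apply/rowP => i; rewrite mxE.
apply: (@indep_free d l Hl Hi (fun i => v 0 i)) => m.
have /rowP/(_ (enum_rank m)) := Hv; rewrite [LHS]mxE [RHS]mxE => E; rewrite -[RHS]E.
by apply: eq_bigr => j _; rewrite mxE enum_rankK.
Qed.

Definition cix d1 d2 : finType := (cidx d1 + cidx d2)%type.
Definition coefs d1 d2 (f g : P2) (i : 'I_#|cix d1 d2|) : C :=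
 match enum_val i with inl m => mcoeff m f | inr m => mcoeff m g end.
(** Contained in a hypersurface of the space of coefficients: a notion stable under subsets and
    finite unions, whose complement contains a nonempty Zariski open set. *)
Definition negl d1 d2 (B : P2 -> P2 -> Prop) := exists2 P : mpoly #|cix d1 d2| C,
 P != 0 & forall f g, dgl d1 f -> dgl d2 g -> B f g -> meval (@coefs d1 d2 f g) P = 0.

Lemma negl_sub d1 d2 A B : (forall f g, dgl d1 f -> dgl d2 g -> A f g -> B f g) ->
 negl d1 d2 B -> negl d1 d2 A.
Proof. by move=> H [P P0 HP]; exists P => // f g Hf Hg HA; apply: HP => //; apply: H. Qed.
Lemma negl_or d1 d2 A B : negl d1 d2 A -> negl d1 d2 B ->
 negl d1 d2 (fun f g => A f g \/ B f g).
Proof.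
move=> [P P0 HP] [Q Q0 HQ]; exists (P * Q); first by rewrite mulf_neq0.
by move=> f g Hf Hg [/HP|/HQ] E; rewrite mevalM E ?mul0r ?mulr0.
Qed.
Lemma negl_False d1 d2 B : (forall f g, dgl d1 f -> dgl d2 g -> ~ B f g) -> negl d1 d2 B.
Proof. by move=> H; exists 1; rewrite ?oner_neq0 // => f g Hf Hg /H-/(_ Hf Hg). Qed.

Section Lin.
Variables (d1 d2 k : nat).
Local Notation Th := ('I_k -> C).
Variables (Phi : seq (Th -> P2 -> C)) (Psi : seq (Th -> P2 -> P2 -> C)) (Good : Th -> P2 -> P2 -> Prop).
Hypothesis Hk : (k < size Phi + size Psi)%N.
Hypothesis HPhi : allT (fun phi : Th -> P2 -> C => (forall th, lin_fun (phi th)) /\ forall u, pfun (fun th => phi th u)) Phi.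
Hypothesis HPsi : allT (fun psi : Th -> P2 -> P2 -> C => (forall th f, lin_fun (psi th f)) /\
 forall u, pfun (fun z : 'I_k + cidx d1 -> C => psi (z \o inl) (pol (z \o inr)) u)) Psi.
Hypothesis HiPhi : forall th f g, dgl d1 f -> dgl d2 g -> Good th f g -> indep d1 [seq phi th | phi <- Phi].
Hypothesis HiPsi : forall th f g, dgl d1 f -> dgl d2 g -> Good th f g -> indep d2 [seq psi th f | psi <- Psi].

(** Dimension count in two stages: over the k parameters the coefficients of f lose [size Phi]
    dimensions, and over parameters and f those of g lose [size Psi]. Together these exceed k, so
    bad pairs have fewer parameters than coefficients. [Good] collects the position hypotheses under
    which the conditions are independent. *)
Theorem negl_lin : negl d1 d2 (fun f g => exists th, [/\ Good th f g,
 allT (fun phi : Th -> P2 -> C => phi th f = 0) Phi & allT (fun psi : Th -> P2 -> P2 -> C => psi th f g = 0) Psi]).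
Proof.
set Bad := (X in negl _ _ X).
have nthP i u : pfun (fun th => nth (fun _ _ => 0) Phi i th u).
 have [Hi|Hi] := ltnP i (size Phi); first by have [_] := allT_nth (fun _ _ => 0) HPhi Hi; apply.
 by under eq_fun do rewrite nth_default //; apply: pf_cst.
have nthQ i u : pfun (fun z : 'I_k + cidx d1 -> C => nth (fun _ _ _ => 0) Psi i (z \o inl) (pol (z \o inr)) u).
 have [Hi|Hi] := ltnP i (size Psi); first by have [_] := allT_nth (fun _ _ _ => 0) HPsi Hi; apply.
 by under eq_fun do rewrite nth_default //; apply: pf_cst.
have linP th : allT lin_fun [seq phi th | phi <- Phi].
 by elim: Phi HPhi => //= phi l IH [[H _] Hl]; split=> //; apply: IH.
have linQ th f : allT lin_fun [seq psi th f | psi <- Psi].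
 by elim: Psi HPsi => //= psi l IH [[H _] Hl]; split=> //; apply: IH.
have nP th i : nth (fun=> 0) [seq phi th | phi <- Phi] i = nth (fun _ _ => 0) Phi i th.
 have [Hi|Hi] := ltnP i (size Phi); first by rewrite (nth_map (fun _ _ => 0)).
 by rewrite !nth_default // size_map.
have nQ th f i : nth (fun=> 0) [seq psi th f | psi <- Psi] i = nth (fun _ _ _ => 0) Psi i th f.
 have [Hi|Hi] := ltnP i (size Psi); first by rewrite (nth_map (fun _ _ _ => 0)).
 by rewrite !nth_default // size_map.
have freeP th f g : dgl d1 f -> dgl d2 g -> Good th f g ->
  row_free (\matrix_(i < size Phi, k0 < #|cidx d1|) nth (fun _ _ => 0) Phi i th (mpolyX C (enum_val k0))).
 move=> Hf Hg HG; have := indep_row_free (size_map _ Phi) (linP th) (HiPhi Hf Hg HG).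
 by under eq_mx do rewrite nP.
have freeQ th f g : dgl d1 f -> dgl d2 g -> Good th f g ->
  row_free (\matrix_(i < size Psi, k0 < #|cidx d2|) nth (fun _ _ _ => 0) Psi i th f (mpolyX C (enum_val k0))).
 move=> Hf Hg HG; have := indep_row_free (size_map _ Psi) (linQ th f) (HiPsi Hf Hg HG).
 by under eq_mx do rewrite nQ.
(* A bad pair, if there is one, shows that the conditions do not outnumber the coefficients, so the
   subtractions that count parameters are not truncated. *)
have [[f0 [g0 [Hf0 Hg0 HB]]]|HN] := boolp.pselect (exists f g, [/\ dgl d1 f, dgl d2 g & Bad f g]); last first.
 by apply: negl_False => f g Hf Hg HB; apply: HN; exists f, g.
have [th0 [HG0 _ _]] := HB.
have c1le : (size Phi <= #|cidx d1|)%N.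
 by have /eqP <- := freeP _ _ _ Hf0 Hg0 HG0; apply: rank_leq_col.
have c2le : (size Psi <= #|cidx d2|)%N.
 by have /eqP <- := freeQ _ _ _ Hf0 Hg0 HG0; apply: rank_leq_col.
pose BadZ th f g := [/\ dgl d1 f, dgl d2 g & [/\ Good th f g,
 allT (fun phi => phi th f = 0) Phi & allT (fun psi => psi th f g = 0) Psi]].
pose Z1 (z : 'I_k + cidx d1 -> C) := exists g, BadZ (z \o inl) (pol (z \o inr)) g.
pose Z2 (z : 'I_k + cidx d1 + cidx d2 -> C) := BadZ (z \o inl \o inl) (pol (z \o inl \o inr)) (pol (z \o inr)).
have C1 := cover_linear (J := cidx d1) (c := size Phi) (A := fun i m th => nth (fun _ _ => 0) Phi i th (mpolyX C m))
 (b := fun _ _ => 0) (Z' := Z1) (cover_full (fun _ => True)) (fun i m => nthP i _) (fun _ => pf_cst _ _).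
have {C1} /C1 : forall z, Z1 z -> [/\ True, forall i : 'I_(size Phi), \sum_m nth (fun _ _ => 0) Phi i (z \o inl) (mpolyX C (m : cidx d1)) * z (inr m) + 0 = 0 &
 row_free (\matrix_(i < size Phi, k0 < #|cidx d1|) nth (fun _ _ => 0) Phi i (z \o inl) (mpolyX C (enum_val k0)))].
 move=> z [g [Hf Hg [HG HP _]]]; split=> //; last exact: freeP HG.
 move=> i; rewrite addr0; have E := allT_nth (fun _ _ => 0) HP (ltn_ord i).
 rewrite -[RHS]E -[in RHS]nP [RHS]lin_pol; last by apply: (allT_nth _ (linP _)); rewrite size_map.
 by apply: eq_bigr => m _; rewrite nP.
move=> C1.
have C2 := cover_linear (J := cidx d2) (c := size Psi) (A := fun i m z => nth (fun _ _ _ => 0) Psi i (z \o inl) (pol (z \o inr)) (mpolyX C m))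
 (b := fun _ _ => 0) (Z' := Z2) C1 (fun i m => nthQ i _) (fun _ => pf_cst _ _).
have {C1 C2} /C2 C2 : forall z, Z2 z -> [/\ Z1 (z \o inl), forall i : 'I_(size Psi), \sum_m nth (fun _ _ _ => 0) Psi i (z \o inl \o inl) (pol (z \o inl \o inr)) (mpolyX C (m : cidx d2)) * z (inr m) + 0 = 0 &
 row_free (\matrix_(i < size Psi, k0 < #|cidx d2|) nth (fun _ _ _ => 0) Psi i (z \o inl \o inl) (pol (z \o inl \o inr)) (mpolyX C (enum_val k0)))].
 move=> z HZ; have [Hf Hg [HG HP HQ]] := HZ; split; [by exists (pol (z \o inr))| |exact: freeQ HG].
 move=> i; rewrite addr0; have E := allT_nth (fun _ _ _ => 0) HQ (ltn_ord i).
 rewrite -[RHS]E -[in RHS]nQ [RHS]lin_pol; last by apply: (allT_nth _ (linQ _ _)); rewrite size_map.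
 by apply: eq_bigr => m _; rewrite nQ.
pose pi (i : 'I_#|cix d1 d2|) : 'I_k + cidx d1 + cidx d2 := match enum_val i with inl m => inl (inr m) | inr m => inr m end.
have [|P P0 HP] := cover_hypersurface pi C2.
 rewrite !card_sum !card_ord; move: c1le c2le Hk.
 move: #|cidx d1| #|cidx d2| (size Phi) (size Psi) => a b c d; clear; lia.
exists P => // f g Hf Hg [th [HG HPf HQg]].
pose z (x : 'I_k + cidx d1 + cidx d2) : C := match x with
 inl (inl i) => th i | inl (inr m) => mcoeff m f | inr m => mcoeff m g end.
rewrite -(HP z); last first.
 have E1 : z \o inl \o inl = th by [].
 have E2 : pol (z \o inl \o inr) = f := polE Hf.
 have E3 : pol (z \o inr) = g := polE Hg.
 by rewrite /Z2 E2 E3.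
by congr (meval _ P); apply/funext => i; rewrite /coefs /pi; case: (enum_val i).
Qed.
End Lin.
End Families.

Definition hoE := (hornerXsubC, hornerD, hornerN, hornerM, hornerZ, horner_exp, hornerC, hornerX).
Definition deE := (derivXsubC, derivM, derivD, derivB, derivN, derivZ, deriv_exp, derivC).
Definition zeE := (subrr, mulr0, mul0r, addr0, add0r, subr0, oppr0, expr0n, mulr1, mul1r).

Section LinearOperators.
Variable C : cField.
Local Notation P2 := (mpoly 2 C).
Implicit Types (F : P2 -> P2) (phi psi : P2 -> C).

Definition lin_op F := forall a u v, F (a *: u + v) = a *: F u + F v.
Lemma lo_id : lin_op (fun u => u). Proof. by []. Qed.
Lemma lo_bra f F : lin_op F -> lin_op (fun u => bra f (F u)).
Proof. by move=> H a u v; rewrite H braDr !scale_cst braMr bra_cstr mul0r addr0. Qed.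
Lemma lo_dx F : lin_op F -> lin_op (fun u => dx (F u)).
Proof. by move=> H a u v; rewrite H dxD dxZ. Qed.
Lemma lo_dy F : lin_op F -> lin_op (fun u => dy (F u)).
Proof. by move=> H a u v; rewrite H dyD dyZ. Qed.
Lemma lf_pev p F : lin_op F -> lin_fun (fun u => pev p (F u)).
Proof. by move=> H a u v; rewrite H pevD pevZ. Qed.
Lemma tfZ m a (u : P2) : tf m (a *: u) = a *: tf m u.
Proof. by apply/polyP => i; rewrite coefZ !coef_tf; case: ifP; rewrite ?mcoeffZ ?mulr0. Qed.
Lemma lf_tf m s F : lin_op F -> lin_fun (fun u => (tf m (F u)).[s]).
Proof. by move=> H a u v; rewrite H tfD tfZ hornerD hornerZ. Qed.
Lemma lf_tfc m i F : lin_op F -> lin_fun (fun u => (tf m (F u))`_i).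
Proof. by move=> H a u v; rewrite H tfD tfZ coefD coefZ. Qed.
Lemma lf_add phi psi : lin_fun phi -> lin_fun psi -> lin_fun (fun u => phi u + psi u).
Proof. by move=> H1 H2 a u v; rewrite H1 H2; ring. Qed.
Lemma lf_sub phi psi : lin_fun phi -> lin_fun psi -> lin_fun (fun u => phi u - psi u).
Proof. by move=> H1 H2 a u v; rewrite H1 H2; ring. Qed.
Lemma lf_mul c phi : lin_fun phi -> lin_fun (fun u => c * phi u).
Proof. by move=> H a u v; rewrite H; ring. Qed.
End LinearOperators.

Ltac lins := repeat first [apply: lo_id | apply: lo_bra | apply: lo_dx | apply: lo_dy | apply: lf_pev |
 apply: lf_tf | apply: lf_tfc | apply: lf_sub | apply: lf_add | apply: lf_mul].
Ltac pfs := repeat first [apply: pf_pev | apply: pf_tf | apply: pf_tfc | apply: pf_sub | apply: pf_add | apply: pf_opp | apply: pf_exp |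
 apply: pfm_bra | apply: pfm_dx | apply: pfm_dy | apply: pfm_polr | exact: pfm_const | exact: pf_cst | exact: pf_var |
 exact: (pf_var (inl _)) | apply: pf_mul].
Ltac sp3 := split; last split; last split=> //.
Ltac sp4 := split; last split; last split; last split=> //.
Ltac sp5 := split; last split; last split; last split; last split=> //.
Ltac lp1 := split; first by split=> [th|u]; [lins|pfs].
Ltac lp2 := split; first by split=> [th f|u]; [lins|pfs].

(** * Genericity at infinity *)

Section Conditions.
Variable C : cField.
Local Notation P2 := (mpoly 2 C).
Variables (d1 d2 : nat).
Hypotheses (Hd1 : (0 < d1)%N) (Hd2 : (1 < d2)%N).
Local Notation D := (d1.-1 + d2.-1)%N.
Local Notation "th '`' i" := (th (inord i)) (at level 5, i at level 0, only parsing).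

Lemma negl_f_lead : negl d1 d2 (fun f g : P2 => (tf d1 f)`_d1 = 0).
Proof.
apply: negl_sub (@negl_lin C d1 d2 0 [:: fun th u => (tf d1 u)`_d1] [::] (fun _ _ _ => True) _ _ _ _ _) => //=.
- by move=> f g _ _ H; exists (fun=> 0).
- by split; split=> [th|u]; [lins|pfs].
move=> th f g _ _ _; split=> //; exists (fm d1 'X^d1).
have Hs : (size ('X^d1 : {poly C}) <= d1.+1)%N by rewrite size_polyXn.
by split=> //; [exact: dgl_fm|rewrite tf_fm // eqxx coefXn eqxx oner_eq0].
Qed.

Lemma tfJ_at (f u : P2) s : dgl d1 f -> dgl d2 u -> (tf D (bra f u)).[s] =
 d1%:R * (tf d1 f).[s] * ((tf d2 u)^`()).[s] - ((tf d1 f)^`()).[s] * (d2%:R * (tf d2 u).[s]).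
Proof. by move=> Hf Hu; rewrite (tfJ Hd1 (ltnW Hd2) Hf Hu) hornerD hornerN !hornerM !hornerZ. Qed.

Lemma negl_J_lead : negl d1 d2 (fun f g : P2 => (tf d1 f)`_d1 != 0 /\ (tf D (bra f g))`_D = 0).
Proof.
apply: negl_sub (@negl_lin C d1 d2 0 [::] [:: fun th f u => (tf D (bra f u))`_D]
 (fun _ f _ => (tf d1 f)`_d1 != 0) _ _ _ _ _) => //=.
- by move=> f g _ _ [H1 H2]; exists (fun=> 0).
- by split; split=> [th f|u]; [lins|pfs].
(* With top form s^(d2-1) the coefficient of degree D is a (d1 (d2 - 1) - d1 d2) = - d1 a, where a
   is the leading coefficient of f0. *)
move=> th f g Hf _ H; split=> //; exists (fm d2 'X^(d2.-1)).
have Hs : (size ('X^(d2.-1) : {poly C}) <= d2.+1)%N by rewrite size_polyXn prednK ltnW.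
split=> //; first exact: dgl_fm.
rewrite (tfJ Hd1 (ltnW Hd2) Hf (dgl_fm Hs)) tf_fm // eqxx derivXn.
rewrite coefB -scalerAl mulrnAr -scaler_nat scalerA -scalerAr !coefZ !coefMXn.
have E1 : ((D < d2.-1.-1) = false)%N by move: Hd1 Hd2; case: d1 d2 => // a [|[|b]] _ _; rewrite /=; lia.
have E2 : ((D < d2.-1) = false)%N by rewrite ltnNge leq_addl.
have E3 : (D - d2.-1.-1 = d1)%N by move: Hd1 Hd2; case: d1 d2 => // a [|[|b]] // _ _; rewrite /=; lia.
rewrite E1 E2 E3 addnK coef_deriv prednK //.
set a := (tf d1 f)`_d1 in H *; have -> : (d2.-1)%:R = d2%:R - 1 :> C by rewrite -{2}(prednK (ltnW Hd2)) -natr1 addrK.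
rewrite -[a *+ d1]mulr_natr; have -> : d1%:R * (d2%:R - 1) * a - d2%:R * (a * d1%:R) = - (d1%:R * a) by ring.
by rewrite oppr_eq0 mulf_neq0 // pnatr_eq0 -lt0n.
Qed.

Lemma negl_common_root : negl d1 d2 (fun f g : P2 => exists s, (tf d1 f).[s] = 0 /\ (tf d2 g).[s] = 0).
Proof.
apply: negl_sub (@negl_lin C d1 d2 1 [:: fun th u => (tf d1 u).[th`0]] [:: fun th f u => (tf d2 u).[th`0]]
 (fun _ _ _ => True) _ _ _ _ _) => //=.
- by move=> f g _ _ [s [H1 H2]]; exists (fun=> s).
- by split; split=> [th|u]; [lins|pfs].
- by split; split=> [th f|u]; [lins|pfs].
- move=> th f g _ _ _; split=> //; exists (fm d1 1).
 have Hs : (size (1%R : {poly C}) <= d1.+1)%N by rewrite size_poly1.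
 by split=> //; [exact: dgl_fm|rewrite tf_fm // eqxx hornerC oner_eq0].
move=> th f g _ _ _; split=> //; exists (fm d2 1).
have Hs : (size (1%R : {poly C}) <= d2.+1)%N by rewrite size_poly1.
by split=> //; [exact: dgl_fm|rewrite tf_fm // eqxx hornerC oner_eq0].
Qed.

Lemma deriv_tf m (u : P2) s : (0 < m)%N -> ((tf m u)^`()).[s] = (tf m.-1 (dy u)).[s].
Proof. by move=> Hm; rewrite tf_dy prednK. Qed.

Lemma dbl_root_indep d (s : C) : (0 < d)%N ->
 indep d [:: fun u => (tf d u).[s]; fun u => (tf d.-1 (dy u)).[s]].
Proof.
move=> Hd; split; last split=> //=.
 exists (fm d 1); have Hs : (size (1%R : {poly C}) <= d.+1)%N by rewrite size_poly1.
 split=> /=; [exact: dgl_fm|by rewrite tf_fm // eqxx hornerC oner_eq0|split=> //].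
 by rewrite -deriv_tf // tf_fm // eqxx derivC horner0.
exists (fm d ('X - s%:P)); have Hs : (size ('X - s%:P)%R <= d.+1)%N by rewrite size_XsubC.
by split=> //; [exact: dgl_fm|rewrite -deriv_tf // tf_fm // eqxx derivXsubC hornerC oner_eq0].
Qed.

Lemma negl_f_double : negl d1 d2 (fun f g : P2 => exists s, (tf d1 f).[s] = 0 /\ ((tf d1 f)^`()).[s] = 0).
Proof.
apply: negl_sub (@negl_lin C d1 d2 1 [:: fun th u => (tf d1 u).[th`0]; fun th u => (tf d1.-1 (dy u)).[th`0]] [::]
 (fun _ _ _ => True) _ _ _ _ _) => //=.
- by move=> f g _ _ [s [H1 H2]]; exists (fun=> s); rewrite -deriv_tf.
- by do 2!lp1.
by move=> th f g _ _ _; apply: dbl_root_indep.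
Qed.
Lemma negl_g_double : negl d1 d2 (fun f g : P2 => exists s, (tf d2 g).[s] = 0 /\ ((tf d2 g)^`()).[s] = 0).
Proof.
have Hd2' := ltnW Hd2.
apply: negl_sub (@negl_lin C d1 d2 1 [::] [:: fun th f u => (tf d2 u).[th`0]; fun th f u => (tf d2.-1 (dy u)).[th`0]]
 (fun _ _ _ => True) _ _ _ _ _) => //=.
- by move=> f g _ _ [s [H1 H2]]; exists (fun=> s); rewrite -deriv_tf.
- by do 2!lp2.
by move=> th f g _ _ _; apply: dbl_root_indep.
Qed.

Lemma negl_J_double : negl d1 d2 (fun f g : P2 => exists s, [/\ (tf d1 f).[s] != 0,
 (tf D (bra f g)).[s] = 0 & ((tf D (bra f g))^`()).[s] = 0]).
Proof.
have HD : (0 < D)%N by move: Hd2; case: (d2) => [|[|b]] // _; rewrite addnS.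
apply: negl_sub (@negl_lin C d1 d2 1 [::] [:: fun th f u => (tf D.-1 (dy (bra f u))).[th`0]; fun th f u => (tf D (bra f u)).[th`0]]
 (fun th f _ => (tf d1 f).[th`0] != 0) _ _ _ _ _) => //=.
- by move=> f g _ _ [s [H1 H2 H3]]; exists (fun=> s); rewrite -deriv_tf.
- by do 2!lp2.
move=> th f g Hf _; set s := th`0 => Hs0; split; last split=> //=.
 exists (fm d2 (('X - s%:P) * ('X - s%:P))).
 have Hs : (size (('X - s%:P) * ('X - s%:P))%R <= d2.+1)%N by rewrite -expr2 size_exp_XsubC.
 have Hu := dgl_fm Hs; split=> //=; last first.
  split=> //; rewrite tfJ_at // tf_fm // eqxx derivM derivXsubC mul1r mulr1 hornerD hornerM !hornerXsubC subrr.
  by rewrite addr0 !mulr0 subr0.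
 rewrite -deriv_tf // (tfJ Hd1 (ltnW Hd2) Hf Hu) tf_fm // eqxx.
 rewrite !deE !(mul1r, mulr1) !(deE, hoE) !zeE.
 by rewrite -[1 + 1]/(2%:R) !mulf_neq0 // pnatr_eq0 -?lt0n.
exists (fm d2 ('X - s%:P)); have Hs : (size ('X - s%:P)%R <= d2.+1)%N by rewrite size_XsubC ltnW.
have Hu := dgl_fm Hs; split=> //; rewrite tfJ_at // tf_fm // eqxx derivXsubC !hoE !zeE.
by rewrite mulf_neq0 // pnatr_eq0 -lt0n.
Qed.

Lemma negl_sub_lead : negl d1 d2 (fun f g : P2 => exists s, [/\ (tf d1 f).[s] != 0,
 (tf D (bra f g)).[s] = 0 & d1%:R * (tf d1 f).[s] * (tfp d2 g).[s] - d2%:R * (tf d2 g).[s] * (tfp d1 f).[s] = 0]).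
Proof.
apply: negl_sub (@negl_lin C d1 d2 1 [::] [:: fun th f u => (d1%:R * (tf d1 f).[th`0]) * (tf d2.-1 u).[th`0] -
   (d2%:R * (tf d1.-1 f).[th`0]) * (tf d2 u).[th`0]; fun th f u => (tf D (bra f u)).[th`0]]
 (fun th f _ => (tf d1 f).[th`0] != 0) _ _ _ _ _) => //=.
- move=> f g _ _ [s [H1 H2 H3]]; exists (fun=> s); split=> //; split=> //.
 have E m (u : P2) : (0 < m)%N -> tfp m u = tf m.-1 u by case: m.
 by rewrite -[RHS]H3 !E ?(ltnW Hd2) //; ring.
- by do 2!lp2.
move=> th f g Hf _; set s := th`0 => Hs0; split; last split=> //=.
 (* A form of degree d2 - 1 changes the subleading form of g and leaves J0 unchanged. *)
 exists (fm d2.-1 1); have Hs : (size (1%R : {poly C}) <= d2.-1.+1)%N by rewrite size_poly1.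
 have Hu : dgl d2 (fm d2.-1 (1 : {poly C})) by apply: dgl_mono (dgl_fm Hs); apply: leq_pred.
 have T0 : tf d2 (fm d2.-1 1) = 0 :> {poly C}.
  by apply: (dgl_fm Hs); rewrite -{2}(prednK (ltnW Hd2)).
 split=> //=; last by split=> //; rewrite tfJ_at // T0 deriv0 !horner0 !mulr0 subrr.
 by rewrite T0 horner0 mulr0 subr0 tf_fm // eqxx hornerC mulr1 mulf_neq0 // pnatr_eq0 -lt0n.
exists (fm d2 ('X - s%:P)); have Hs : (size ('X - s%:P)%R <= d2.+1)%N by rewrite size_XsubC ltnW.
have Hu := dgl_fm Hs; split=> //; rewrite tfJ_at // tf_fm // eqxx derivXsubC !hoE !zeE.
by rewrite mulf_neq0 // pnatr_eq0 -lt0n.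
Qed.

(** Equality of g0^e1 / f0^e2 at s and s' is parametrised by t, through f0(s) = t^d1 f0(s') and
    g0(s) = t^d2 g0(s'): three parameters and four conditions linear in f or g. One test is a cubic,
    hence d2 > 2. *)
Lemma negl_gamma : (2 < d2)%N -> negl d1 d2 (fun f g : P2 => exists s s' t,
 [/\ s != s', (tf d1 f).[s] != 0, (tf d1 f).[s'] != 0 & [/\ (tf d1 f).[s] = t ^+ d1 * (tf d1 f).[s'],
  (tf d2 g).[s] = t ^+ d2 * (tf d2 g).[s'], (tf D (bra f g)).[s] = 0 & (tf D (bra f g)).[s'] = 0]]).
Proof.
move=> Hd3.
apply: negl_sub (@negl_lin C d1 d2 3 [:: fun th u => (tf d1 u).[th`0] - th`2 ^+ d1 * (tf d1 u).[th`1]]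
 [:: fun th f u => (tf D (bra f u)).[th`0]; fun th f u => (tf D (bra f u)).[th`1];
   fun th f u => (tf d2 u).[th`0] - th`2 ^+ d2 * (tf d2 u).[th`1]]
 (fun th f _ => [/\ th`0 != th`1, (tf d1 f).[th`0] != 0 & (tf d1 f).[th`1] != 0]) _ _ _ _ _) => //=.
- move=> f g _ _ [s [s' [t [H1 H2 H3 [H4 H5 H6 H7]]]]]; exists (fun i => nth 0 [:: s; s'; t] i).
 by rewrite !inordK; split=> //; [rewrite H4 subrr|rewrite H5 subrr].
- by split; split=> [th|u]; [lins|pfs].
- by do 3!lp2.
- move=> th f g _ _ []; set s := th`0; set s' := th`1 => N _ _; split=> //; exists (fm d1 ('X - s'%:P)).
 have Hs : (size ('X - s'%:P)%R <= d1.+1)%N by rewrite size_XsubC.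
 by split=> //; [exact: dgl_fm|rewrite tf_fm // eqxx !hoE !zeE subr_eq0].
move=> th f g Hf _ []; set s := th`0; set s' := th`1 => N Hs0 Hs1.
have Hdd1 : (d1%:R : C) != 0 by rewrite pnatr_eq0 -lt0n.
have N' : s - s' != 0 by rewrite subr_eq0.
split; last split; last split=> //=.
- exists (fm d2 (('X - s%:P) * ('X - s'%:P) ^+ 2)).
 have Hs : (size (('X - s%:P) * ('X - s'%:P) ^+ 2)%R <= d2.+1)%N.
  by rewrite size_monicM ?monicXsubC ?expf_neq0 ?polyXsubC_eq0 // size_XsubC size_exp_XsubC.
 have Hu := dgl_fm Hs; have Td := tf_fm d2 Hs; rewrite eqxx in Td.
 rewrite /= !tfJ_at // Td derivM deriv_exp !derivXsubC /= expr1 !hoE !zeE.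
 by split=> //; rewrite !mulf_neq0.
- exists (fm d2 (('X - s'%:P) * ('X - s%:P))).
 have Hs : (size (('X - s'%:P) * ('X - s%:P))%R <= d2.+1)%N.
  by rewrite size_monicM ?monicXsubC ?polyXsubC_eq0 // !size_XsubC ltnS.
 have Hu := dgl_fm Hs; have Td := tf_fm d2 Hs; rewrite eqxx in Td.
 rewrite !tfJ_at // Td derivM !derivXsubC !hoE !zeE; split=> //.
 by rewrite !mulf_neq0 // -opprB oppr_eq0.
exists (fm d2 ('X - s'%:P)); have Hs : (size ('X - s'%:P)%R <= d2.+1)%N by rewrite size_XsubC ltnW.
have Td := tf_fm d2 Hs; rewrite eqxx in Td.
by split=> //; [exact: dgl_fm|rewrite Td !hoE !zeE].
Qed.
End Conditions.

(** * Genericity at a single point of the plane *)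

Section AffineConditions.
Variable C : cField.
Local Notation P2 := (mpoly 2 C).
Implicit Types (p q r : C * C) (f g u v : P2).

Definition tl p (a b : C) : P2 := cst a * (mx C - cst p.1) + cst b * (my C - cst p.2).
Lemma pev_tl r p a b : pev r (tl p a b) = a * (r.1 - p.1) + b * (r.2 - p.2).
Proof. by rewrite !pevE. Qed.
Lemma dx_tl p a b : dx (tl p a b) = cst a. Proof. by rewrite !dE; ring. Qed.
Lemma dy_tl p a b : dy (tl p a b) = cst b. Proof. by rewrite !dE; ring. Qed.
Lemma bra_tl f p a b : bra f (tl p a b) = cst b * dx f - cst a * dy f.
Proof. by rewrite /bra dx_tl dy_tl; ring. Qed.
Lemma pev_dx_bra f u p : pev p (dx (bra f u)) = pev p (dx (dx f)) * pev p (dy u) + pev p (dx f) * pev p (dx (dy u)) -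
   (pev p (dx (dy f)) * pev p (dx u) + pev p (dy f) * pev p (dx (dx u))).
Proof. by rewrite !(dxD, dyD, dxN, dyN, dxM, dyM, pevD, pevN, pevM). Qed.
Lemma pev_dy_bra f u p : pev p (dy (bra f u)) = pev p (dy (dx f)) * pev p (dy u) + pev p (dx f) * pev p (dy (dy u)) -
   (pev p (dy (dy f)) * pev p (dx u) + pev p (dy f) * pev p (dy (dx u))).
Proof. by rewrite !(dxD, dyD, dxN, dyN, dxM, dyM, pevD, pevN, pevM). Qed.
Lemma pev_bra r f u : pev r (bra f u) = pev r (dx f) * pev r (dy u) - pev r (dy f) * pev r (dx u).
Proof. by rewrite pevB !pevM. Qed.
Opaque bra.
Lemma pev_brM p f u v : pev p (bra f (u * v)) = pev p u * pev p (bra f v) + pev p (bra f u) * pev p v.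
Proof. by rewrite braMr pevD !pevM. Qed.
Lemma pev_d1_tl2 p a b a' b' : pev p (dx (tl p a b * tl p a' b')) = 0 /\ pev p (dy (tl p a b * tl p a' b')) = 0.
Proof. by rewrite !(dxM, dyM, pevD, pevM, pev_tl); split; ring. Qed.
Lemma pev_d2_tl2 r p a b a' b' : [/\ pev r (dx (dx (tl p a b * tl p a' b'))) = a * a' + a * a', pev r (dx (dy (tl p a b * tl p a' b'))) = a * b' + b * a',
  pev r (dy (dx (tl p a b * tl p a' b'))) = a * b' + b * a' & pev r (dy (dy (tl p a b * tl p a' b'))) = b * b' + b * b'].
Proof.
rewrite !(dxM, dyM) !(dx_tl, dy_tl) !(dxD, dyD) !(dxM, dyM) !(dx_tl, dy_tl) !(dxC, dyC) !(pevD, pevM, pevC, pev0).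
by split; ring.
Qed.
Lemma dgl_tl p a b : dgl 1 (tl p a b).
Proof.
have H k c u : dgl 1 u -> dgl 1 (cst k * (u - cst c)).
 move=> Hu; apply: (dglM (dgl_cst k)).
 by apply: dglB => //; apply: dgl_mono (dgl_cst _).
by apply: dglD; apply: H; [apply: dgl_mx|apply: dgl_my].
Qed.
Lemma dgl1 d p a b : (0 < d)%N -> dgl d (tl p a b).
Proof. by move=> H; apply: dgl_mono (dgl_tl _ _ _). Qed.
Lemma dgl_step d u p a b : dgl d u -> dgl d.+1 (u * tl p a b).
Proof. by move=> Hu; rewrite -addn1; apply: dglM => //; apply: dgl_tl. Qed.
Lemma dgl2 d p a b p' a' b' : (1 < d)%N -> dgl d (tl p a b * tl p' a' b').
Proof. by case: d => // d H; apply: dgl_step; apply: dgl1. Qed.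

Definition dnz f p := (pev p (dx f) != 0) || (pev p (dy f) != 0).
Lemma dnzN f p : ~~ dnz f p -> pev p (dx f) = 0 /\ pev p (dy f) = 0.
Proof. by rewrite negb_or !negbK => /andP[/eqP -> /eqP]. Qed.
Lemma dnz_dir f p : dnz f p -> exists a b, b * pev p (dx f) - a * pev p (dy f) != 0.
Proof.
case/orP => H; [exists 0, 1|exists 1, 0]; first by rewrite mul1r mul0r subr0.
by rewrite mul0r mul1r sub0r oppr_eq0.
Qed.
Lemma sep_dir p q : p != q -> exists a b, a * (q.1 - p.1) + b * (q.2 - p.2) = 1.
Proof.
move=> N; have [E|E] := eqVneq (q.1 - p.1) 0.
 exists 0, (q.2 - p.2)^-1; rewrite mul0r add0r mulVf //; apply: contra N; rewrite subr_eq0 => /eqP E2.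
 by move/eqP: E; rewrite subr_eq0 => /eqP E1; rewrite [p]spair [q]spair E1 E2.
by exists (q.1 - p.1)^-1, 0; rewrite mul0r addr0 mulVf.
Qed.

Lemma pev_brtl r f p a b : pev r (bra f (tl p a b)) = b * pev r (dx f) - a * pev r (dy f).
Proof. by rewrite bra_tl pevB !pevM !pevC. Qed.
Lemma pev_dxM p u v : pev p (dx (u * v)) = pev p (dx u) * pev p v + pev p u * pev p (dx v).
Proof. by rewrite dxM pevD !pevM. Qed.
Lemma pev_dyM p u v : pev p (dy (u * v)) = pev p (dy u) * pev p v + pev p u * pev p (dy v).
Proof. by rewrite dyM pevD !pevM. Qed.
Lemma pev_dxtl r p a b : pev r (dx (tl p a b)) = a. Proof. by rewrite dx_tl pevC. Qed.
Lemma pev_dytl r p a b : pev r (dy (tl p a b)) = b. Proof. by rewrite dy_tl pevC. Qed.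
Definition evE := (pev_brM, pev_brtl, pev_dxM, pev_dyM, pev_dxtl, pev_dytl, pevM, pev_tl).
Ltac tln := rewrite !evE; split=> //; [exact: dgl1|exact: oner_neq0].

Variables (d1 d2 : nat).
Hypotheses (Hd1 : (0 < d1)%N) (Hd2 : (1 < d2)%N).
Local Notation "th '`' i" := (th (inord i)) (at level 5, i at level 0, only parsing).
Local Notation P0 th := (th (inord 0), th (inord 1)).
Local Notation gx := (fun th u => pev (P0 th) (dx u)).
Local Notation gy := (fun th u => pev (P0 th) (dy u)).
Local Notation bP := (fun th f u => pev (P0 th) (bra f u)).
Local Notation bbP := (fun th f u => pev (P0 th) (bra f (bra f u))).
Local Notation par2 p := (fun i : 'I_2 => nth 0 [:: p.1; p.2] i).

Lemma negl_crit2 : negl d1 d2 (fun f g => exists p, ~~ dnz f p /\ ~~ dnz g p).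
Proof.
apply: negl_sub (@negl_lin C d1 d2 2 [:: gx; gy]
 [:: fun th f u => pev (P0 th) (dx u); fun th f u => pev (P0 th) (dy u)] (fun _ _ _ => True) _ _ _ _ _) => //=.
- move=> f g _ _ [p [H1 H2]]; exists (par2 p).
 rewrite !inordK //= -spair.
 by move: H1 H2 => /dnzN[-> ->] /dnzN[-> ->].
- by do 2!lp1.
- by do 2!lp2.
- move=> th f g _ _ _; split; last split=> //; [exists (tl (0, 0) 1 0)|exists (tl (0, 0) 0 1)].
  by tln.
 by tln.
move=> th f g _ _ _; split; last split=> //; [exists (tl (0, 0) 1 0)|exists (tl (0, 0) 0 1)].
 by rewrite !evE; split=> //; [apply: dgl1; apply: ltnW|exact: oner_neq0].
by rewrite !evE; split=> //; [apply: dgl1; apply: ltnW|exact: oner_neq0].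
Qed.

Lemma negl_singular : negl d1 d2 (fun f g => exists p, [/\ dnz f p, pev p (bra f g) = 0,
 pev p (dx (bra f g)) = 0 & pev p (dy (bra f g)) = 0]).
Proof.
have Hd2' := ltnW Hd2.
apply: negl_sub (@negl_lin C d1 d2 2 [::] [:: fun th f u => pev (P0 th) (dx (bra f u));
  fun th f u => pev (P0 th) (dy (bra f u)); bP]
 (fun th f _ => dnz f (P0 th)) _ _ _ _ _) => //=.
- move=> f g _ _ [p [H1 H2 H3 H4]]; exists (par2 p).
 by rewrite !inordK.
- by do 3!lp2.
move=> th f g Hf _; set p := P0 th => Hp.
have H2 a b a' b' : dgl d2 (tl p a b * tl p a' b') by apply: dgl2.
have Evv a b a' b' := conj (pev_d1_tl2 p a b a' b') (pev_d2_tl2 p p a b a' b').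
have E1 a b a' b' : pev p (bra f (tl p a b * tl p a' b')) = 0 by rewrite !evE; ring.
split; last split; last first.
- have [a [b Hab]] := dnz_dir Hp; split=> //; exists (tl p a b); rewrite pev_brtl; split=> //; exact: dgl1.
- have [Hx|Hx] := boolP (pev p (dx f) == 0).
  have Hy : pev p (dy f) != 0 by move: Hp; rewrite /dnz Hx.
  exists (tl p 1 0 * tl p 0 1); have [[A1 A2] [A3 A4 A5 A6]] := Evv 1 0 0 1.
  rewrite !pev_dy_bra A1 A2 A5 A6 (eqP Hx); split=> //.
  by rewrite !(mulr0, mul0r, addr0, add0r, mulr1, sub0r) oppr_eq0.
 exists (tl p 0 1 * tl p 0 1); have [[A1 A2] [A3 A4 A5 A6]] := Evv 0 1 0 1.
 rewrite !pev_dy_bra A1 A2 A5 A6; split=> //.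
 by rewrite !(mulr0, mul0r, addr0, add0r, mulr1, subr0) mulf_neq0 // -mulr2n pnatr_eq0.
have [Hx|Hx] := boolP (pev p (dx f) == 0).
 have Hy : pev p (dy f) != 0 by move: Hp; rewrite /dnz Hx.
 exists (tl p 1 0 * tl p 1 0); have [[A1 A2] [A3 A4 A5 A6]] := Evv 1 0 1 0.
 rewrite /= E1 !pev_dx_bra !pev_dy_bra A1 A2 A3 A4 A5 (eqP Hx); split=> //; last by split; [ring|].
 by rewrite !(mulr0, mul0r, addr0, add0r, mulr1, sub0r) oppr_eq0 mulf_neq0 // -mulr2n pnatr_eq0.
(* The coefficients make f_x u_yy = f_y u_xy, so the derivative in y of {f, u} vanishes at p while
   the derivative in x is 2 f_x^2. *)
exists (tl p (2 * pev p (dx f)) (pev p (dy f)) * tl p 0 1).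
have [[A1 A2] [A3 A4 A5 A6]] := Evv (2 * pev p (dx f)) (pev p (dy f)) 0 1.
rewrite !pev_dx_bra !pev_dy_bra A1 A2 A3 A4 A5 A6; split=> //; last by split; [ring|].
by rewrite !(mulr0, mul0r, addr0, add0r, mulr1, subr0) !mulf_neq0 // pnatr_eq0.
Qed.

(** The tests are t^3, t^2 and t for an affine t with {f, t} nonzero at p, triangular for the
    iterated derivation; the cube is the reason for d2 > 2. *)
Lemma negl_flat : (2 < d2)%N -> negl d1 d2 (fun f g => exists p, [/\ dnz f p, pev p (bra f g) = 0,
 pev p (bra f (bra f g)) = 0 & pev p (bra f (bra f (bra f g))) = 0]).
Proof.
move=> Hd3; have Hd2' := ltnW Hd2.
apply: negl_sub (@negl_lin C d1 d2 2 [::] [:: fun th f u => pev (P0 th) (bra f (bra f (bra f u)));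
  bbP; bP]
 (fun th f _ => dnz f (P0 th)) _ _ _ _ _) => //=.
- move=> f g _ _ [p [H1 H2 H3 H4]]; exists (par2 p).
 by rewrite !inordK.
- by do 3!lp2.
move=> th f g Hf _; set p := P0 th => Hp.
have [a [b Hab]] := dnz_dir Hp; have [t [t0 tX t1]] : exists t, [/\ pev p t = 0, pev p (bra f t) != 0 & dgl 1 t].
 by exists (tl p a b); rewrite pev_tl pev_brtl !subrr !mulr0 addr0; split=> //; apply: dgl_tl.
have D2 : dgl 2 (t * t) by apply: (dglM (m := 1)).
have D3 : dgl 3 (t * t * t) by apply: (dglM (m := 2)).
move: (fun a b => braMr a b f) (fun a b => braDr a b f) (pevM p) (pevD p) t0 tX.
move: (bra f) (pev p) => X e XM XD eM eD t0 tX.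
sp3.
- exists (t * t * t); rewrite !(XM, XD) !(eM, eD) t0 ?zeE; split; first exact: dgl_mono D3.
  move: (e (X t)) tX => x x0; rewrite (_ : _ + _ = 6 * x ^+ 3); last by ring.
  by rewrite mulf_neq0 ?expf_neq0 ?pnatr_eq0.
 by [].
- exists (t * t); rewrite !(XM, XD) !(eM, eD) t0 ?zeE; split; first exact: dgl_mono D2.
  by rewrite -mulr2n mulrn_eq0 mulf_neq0.
 by [].
by exists t; split=> //; apply: dgl_mono t1.
Qed.

(* The tests are t * w, t * t and t, where w is affine with the gradient of f at p: for quadrics no cube is available. *)
Definition hess f p (v : C * C) := v.1 ^+ 2 * pev p (dx (dx f)) + 2 * v.1 * v.2 * pev p (dx (dy f)) + v.2 ^+ 2 * pev p (dy (dy f)).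
Lemma negl_flat_quadric : negl d1 d2 (fun f g => exists p, [/\ dnz f p, hess f p (- pev p (dy f), pev p (dx f)) != 0 &
 [/\ pev p (bra f g) = 0, pev p (bra f (bra f g)) = 0 & pev p (bra f (bra f (bra f g))) = 0]]).
Proof.
have Hd2' := ltnW Hd2.
apply: negl_sub (@negl_lin C d1 d2 2 [::] [:: fun th f u => pev (P0 th) (bra f (bra f (bra f u)));
  bbP; bP]
 (fun th f _ => dnz f (P0 th) /\ hess f (P0 th) (- pev (P0 th) (dy f), pev (P0 th) (dx f)) != 0) _ _ _ _ _) => //=.
- move=> f g _ _ [p [H1 H2 [H3 H4 H5]]]; exists (par2 p).
 by rewrite !inordK //=.
- by do 3!lp2.
move=> th f g Hf _; set p := P0 th => -[Hp Hh].
have [a [b Hab]] := dnz_dir Hp; have [t [t0 tX t1]] : exists t, [/\ pev p t = 0, pev p (bra f t) != 0 & dgl 1 t].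
 by exists (tl p a b); rewrite pev_tl pev_brtl !subrr !mulr0 addr0; split=> //; apply: dgl_tl.
have [w [w0 wX wXX w1]] : exists w, [/\ pev p w = 0, pev p (bra f w) = 0, pev p (bra f (bra f w)) != 0 & dgl 1 w].
 exists (tl p (pev p (dx f)) (pev p (dy f))); rewrite pev_tl pev_brtl !subrr !mulr0 addr0; split=> //; [ring| |exact: dgl_tl].
 rewrite pev_bra pev_dx_bra pev_dy_bra dx_tl dy_tl !(dxC, dyC) !(pevC, pev0) -(dxydyx f).
 move: Hh; rewrite /hess /=; move: (pev p (dx f)) (pev p (dy f)) (pev p (dx (dx f))) (pev p (dx (dy f))) (pev p (dy (dy f))) => x y xx xy yy.
 by rewrite -oppr_eq0; congr (_ != 0); ring.
have D2 : dgl 2 (t * t) by apply: (dglM (m := 1)).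
have D2' : dgl 2 (t * w) by apply: (dglM (m := 1)).
move: (fun a b => braMr a b f) (fun a b => braDr a b f) (pevM p) (pevD p) t0 tX w0 wX wXX.
clear Hh Hp; move: (bra f) (pev p) => X e XM XD eM eD t0 tX w0 wX wXX.
sp3.
- exists (t * w); rewrite !(XM, XD) !(eM, eD) t0 w0 wX ?zeE; split; first exact: dgl_mono D2'.
  move: (e (X t)) (e (X (X w))) tX wXX => x y x0 y0; rewrite (_ : _ + _ = 3 * (x * y)); last by ring.
  by rewrite !mulf_neq0 ?pnatr_eq0.
 by [].
- exists (t * t); rewrite !(XM, XD) !(eM, eD) t0 ?zeE; split; first exact: dgl_mono D2.
  by rewrite -mulr2n mulrn_eq0 mulf_neq0.
 by [].
by exists t; split=> //; apply: dgl_mono t1.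
Qed.

(* Critical points of f: second order data along the direction (1, m) or (0, 1). *)
Lemma negl_crit_tangent : (1 < d1)%N -> negl d1 d2 (fun f g => exists p m, [/\ ~~ dnz f p,
 pev p (dx (dx f)) + 2 * m * pev p (dx (dy f)) + m ^+ 2 * pev p (dy (dy f)) = 0 & pev p (dx g) + m * pev p (dy g) = 0]).
Proof.
move=> Hd11; have Hd2' := ltnW Hd2.
apply: negl_sub (@negl_lin C d1 d2 3 [:: fun th u => pev (P0 th) (dx (dx u)) + (2 * th`2) * pev (P0 th) (dx (dy u)) +
   th`2 ^+ 2 * pev (P0 th) (dy (dy u)); gx; gy]
 [:: fun th f u => pev (P0 th) (dx u) + th`2 * pev (P0 th) (dy u)] (fun _ _ _ => True) _ _ _ _ _) => //=.
- move=> f g _ _ [p [m [H1 H2 H3]]]; exists (fun i => nth 0 [:: p.1; p.2; m] i).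
 rewrite !inordK //= -spair.
 by move: H1 => /dnzN[-> ->].
- by do 3!lp1.
- by lp2.
- move=> th f g _ _ _; set p := P0 th; sp3.
 + exists (tl p 1 0 * tl p 1 0); have [A1 A2] := pev_d1_tl2 p 1 0 1 0; have [A3 A4 A5 A6] := pev_d2_tl2 p p 1 0 1 0.
  rewrite ?A3 ?A4 ?A6 !zeE; split=> //; first exact: dgl2.
  by rewrite -mulr2n pnatr_eq0.
 + by exists (tl p 1 0); tln.
 by exists (tl p 0 1); tln.
move=> th f g _ _ _; split=> //; exists (tl (0, 0) 1 0); rewrite !evE mulr0 addr0; split=> //; [exact: dgl1|exact: oner_neq0].
Qed.
Lemma negl_crit_vertical : (1 < d1)%N -> negl d1 d2 (fun f g => exists p, [/\ ~~ dnz f p,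
 pev p (dy (dy f)) = 0 & pev p (dy g) = 0]).
Proof.
move=> Hd11; have Hd2' := ltnW Hd2.
apply: negl_sub (@negl_lin C d1 d2 2 [:: fun th u => pev (P0 th) (dy (dy u)); gx; gy]
 [:: fun th f u => pev (P0 th) (dy u)] (fun _ _ _ => True) _ _ _ _ _) => //=.
- move=> f g _ _ [p [H1 H2 H3]]; exists (par2 p).
 rewrite !inordK //= -spair.
 by move: H1 => /dnzN[-> ->].
- by do 3!lp1.
- by lp2.
- move=> th f g _ _ _; set p := P0 th; sp3.
 + exists (tl p 0 1 * tl p 0 1); have [A1 A2] := pev_d1_tl2 p 0 1 0 1; have [A3 A4 A5 A6] := pev_d2_tl2 p p 0 1 0 1.
  rewrite ?A6 !zeE; split=> //; first exact: dgl2.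
  by rewrite -mulr2n pnatr_eq0.
 + by exists (tl p 1 0); tln.
 by exists (tl p 0 1); tln.
by move=> th f g _ _ _; split=> //; exists (tl (0, 0) 0 1); tln.
Qed.
Lemma negl_degenerate : (1 < d1)%N -> negl d1 d2 (fun f g => exists p m, [/\ ~~ dnz f p,
 pev p (dx (dx f)) + m * pev p (dx (dy f)) = 0 & pev p (dx (dy f)) + m * pev p (dy (dy f)) = 0]).
Proof.
move=> Hd11.
apply: negl_sub (@negl_lin C d1 d2 3 [:: fun th u => pev (P0 th) (dx (dx u)) + th`2 * pev (P0 th) (dx (dy u));
   fun th u => pev (P0 th) (dx (dy u)) + th`2 * pev (P0 th) (dy (dy u));
   gx; gy] [::] (fun _ _ _ => True) _ _ _ _ _) => //=.
- move=> f g _ _ [p [m [H1 H2 H3]]]; exists (fun i => nth 0 [:: p.1; p.2; m] i).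
 rewrite !inordK //= -spair.
 by move: H1 => /dnzN[-> ->].
- by do 4!lp1.
move=> th f g _ _ _; set p := P0 th; sp4.
- exists (tl p 1 0 * tl p 1 0); have [A1 A2] := pev_d1_tl2 p 1 0 1 0; have [A3 A4 A5 A6] := pev_d2_tl2 p p 1 0 1 0.
 rewrite ?A3 ?A4 ?A6 !zeE; split=> //; first exact: dgl2.
 by rewrite -mulr2n pnatr_eq0.
- exists (tl p 1 0 * tl p 0 1); have [A1 A2] := pev_d1_tl2 p 1 0 0 1; have [A3 A4 A5 A6] := pev_d2_tl2 p p 1 0 0 1.
 rewrite ?A4 ?A6 !zeE; split=> //; first exact: dgl2.
 by rewrite oner_neq0.
- by exists (tl p 1 0); tln.
by exists (tl p 0 1); tln.
Qed.
Lemma negl_degenerate_vertical : (1 < d1)%N -> negl d1 d2 (fun f g => exists p, [/\ ~~ dnz f p,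
 pev p (dx (dy f)) = 0 & pev p (dy (dy f)) = 0]).
Proof.
move=> Hd11.
apply: negl_sub (@negl_lin C d1 d2 2 [:: fun th u => pev (P0 th) (dx (dy u)); fun th u => pev (P0 th) (dy (dy u));
   gx; gy] [::] (fun _ _ _ => True) _ _ _ _ _) => //=.
- move=> f g _ _ [p [H1 H2 H3]]; exists (par2 p).
 rewrite !inordK //= -spair.
 by move: H1 => /dnzN[-> ->].
- by do 4!lp1.
move=> th f g _ _ _; set p := P0 th; sp4.
- exists (tl p 1 0 * tl p 0 1); have [A1 A2] := pev_d1_tl2 p 1 0 0 1; have [A3 A4 A5 A6] := pev_d2_tl2 p p 1 0 0 1.
 rewrite ?A4 ?A6 !zeE; split=> //; first exact: dgl2.
 by rewrite oner_neq0.
- exists (tl p 0 1 * tl p 0 1); have [A1 A2] := pev_d1_tl2 p 0 1 0 1; have [A3 A4 A5 A6] := pev_d2_tl2 p p 0 1 0 1.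
 rewrite ?A6 !zeE; split=> //; first exact: dgl2.
 by rewrite -mulr2n pnatr_eq0.
- by exists (tl p 1 0); tln.
by exists (tl p 0 1); tln.
Qed.
End AffineConditions.
Transparent bra.

(** * Genericity at two and three points *)

Section MultiPoint.
Variable C : cField.
Local Notation P2 := (mpoly 2 C).
Implicit Types (p q r : C * C) (f g u v : P2).

Definition lp p q (x : C) : C * C := (p.1 + x * (q.1 - p.1), p.2 + x * (q.2 - p.2)).
Definition dd u p q r := pev r (dx u) * (q.1 - p.1) + pev r (dy u) * (q.2 - p.2).

Opaque bra.

Lemma line_coord p q : p != q -> exists t, [/\ forall x, dgl 1 (t x),
 forall x, pev p (t x) = - x, forall x, pev q (t x) = 1 - x, forall x y, pev (lp p q y) (t x) = y - x &
 (forall x f r, pev r (bra f (t x)) = pev r (bra f (t 0))) /\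
 (forall x r, [/\ pev r (dx (t x)) = pev r (dx (t 0)), pev r (dy (t x)) = pev r (dy (t 0)) & dd (t x) p q r = 1])].
Proof.
case/sep_dir => a [b Hab]; exists (fun x => tl p a b - cst x); split.
- by move=> x; apply: dglB; [apply: dgl_tl|apply: dgl_mono (dgl_cst _)].
- by move=> x; rewrite pevB pevC pev_tl; ring.
- by move=> x; rewrite pevB pevC pev_tl Hab.
- move=> x y; rewrite pevB pevC pev_tl /=; congr (_ - _).
 by transitivity (y * (a * (q.1 - p.1) + b * (q.2 - p.2))); [ring|rewrite Hab mulr1].
split=> [x f r|x r]; first by rewrite !pev_bra !(dxD, dyD, dxN, dyN, dxC, dyC) !oppr0.
have Ex y : dx (tl p a b - cst y) = cst a by rewrite dxD dxN dx_tl dxC oppr0 addr0.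
have Ey y : dy (tl p a b - cst y) = cst b by rewrite dyD dyN dy_tl dyC oppr0 addr0.
by rewrite /dd !Ex !Ey !pevC.
Qed.

Lemma grad_coord p a b : exists h, [/\ dgl 1 h, pev p h = 0, forall r, pev r (dx h) = a, forall r, pev r (dy h) = b &
 forall f r, pev r (bra f h) = b * pev r (dx f) - a * pev r (dy f)].
Proof.
exists (tl p a b); split; first exact: dgl_tl.
- by rewrite pev_tl !subrr !mulr0 addr0.
- by move=> r; rewrite pev_dxtl.
- by move=> r; rewrite pev_dytl.
by move=> f r; rewrite pev_brtl.
Qed.
Lemma unit_coord f p : dnz f p -> exists h, [/\ dgl 1 h, pev p h = 0 & pev p (bra f h) = 1].
Proof.
case/dnz_dir => a [b Hab]; set e := _ - _ in Hab.
have [h [H1 H2 H3 H4 H5]] := grad_coord p (a / e) (b / e); exists h; split=> //.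
by rewrite H5; transitivity (e / e); [rewrite /e; ring|rewrite divff].
Qed.

Lemma along_coord p q : exists l, [/\ dgl 1 l, forall x, pev (lp p q x) l = 0, pev p l = 0, pev q l = 0 &
 forall f r, pev r (bra f l) = - dd f p q r].
Proof.
have [h [H1 H2 H3 H4 H5]] := grad_coord p (q.2 - p.2) (p.1 - q.1).
exists (tl p (q.2 - p.2) (p.1 - q.1)); split; first exact: dgl_tl.
- by move=> x; rewrite pev_tl /=; ring.
- by rewrite pev_tl; ring.
- by rewrite pev_tl; ring.
by move=> f r; rewrite pev_brtl /dd; ring.
Qed.

Lemma dglM2 d u v : dgl 1 u -> dgl 1 v -> (1 < d)%N -> dgl d (u * v).
Proof. by move=> H1 H2 H; apply: dgl_mono (dglM H1 H2). Qed.
Lemma dglM3 d u v w : dgl 1 u -> dgl 1 v -> dgl 1 w -> (2 < d)%N -> dgl d (u * v * w : P2).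
Proof. by move=> H1 H2 H3 H; apply: dgl_mono H (dglM (m := 2) (dglM2 H1 H2 _) H3). Qed.
Lemma dglM4 d u v w x : dgl 1 u -> dgl 1 v -> dgl 1 w -> dgl 1 x -> (3 < d)%N -> dgl d (u * v * w * x : P2).
Proof. by move=> H1 H2 H3 H4 H; apply: dgl_mono H (dglM (m := 3) (dglM3 H1 H2 H3 _) H4). Qed.
Lemma dglM5 d u v w x y : dgl 1 u -> dgl 1 v -> dgl 1 w -> dgl 1 x -> dgl 1 y -> (4 < d)%N -> dgl d (u * v * w * x * y : P2).
Proof. by move=> H1 H2 H3 H4 H5 H; apply: dgl_mono H (dglM (m := 4) (dglM4 H1 H2 H3 H4 _) H5). Qed.
Lemma dglI1 d u : dgl 1 u -> (0 < d)%N -> dgl d u.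
Proof. by move=> H1 H; apply: dgl_mono H1. Qed.

Variables (d1 d2 : nat).
Hypotheses (Hd1 : (0 < d1)%N) (Hd2 : (1 < d2)%N).
Local Notation "th '`' i" := (th (inord i)) (at level 5, i at level 0, only parsing).
Local Notation pt th i j := (th (inord i), th (inord j)).
Local Notation P0 th := (th (inord 0), th (inord 1)).
Local Notation P1 th := (th (inord 2), th (inord 3)).
Local Notation gx := (fun th u => pev (P0 th) (dx u)).
Local Notation gy := (fun th u => pev (P0 th) (dy u)).
Local Notation bP := (fun th f u => pev (P0 th) (bra f u)).
Local Notation bbP := (fun th f u => pev (P0 th) (bra f (bra f u))).
Local Notation gap0 := (fun th u => pev (P0 th) u - pev (P1 th) u).
Local Notation gap1 := (fun th _ u => pev (P0 th) u - pev (P1 th) u).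
Local Notation bQ := (fun th f u => pev (P1 th) (bra f u)).
Local Notation par4 p q := (fun i : 'I_4 => nth 0 [:: p.1; p.2; q.1; q.2] i).
Let Hd2' : (0 < d2)%N := ltnW Hd2.

Lemma line_transverse p q r f (t : C -> P2) : p != q -> dnz f r -> dd f p q r = 0 ->
 (forall x r, [/\ pev r (dx (t x)) = pev r (dx (t 0)), pev r (dy (t x)) = pev r (dy (t 0)) & dd (t x) p q r = 1]) ->
 pev r (bra f (t 0)) != 0.
Proof.
move=> N Hd; rewrite /dd => E Ht; have [_ _] := Ht 0 r; rewrite pev_bra.
move: E Hd; rewrite /dnz; move: (pev r (dx f)) (pev r (dy f)) (pev r (dx (t 0))) (pev r (dy (t 0))) (q.1 - p.1) (q.2 - p.2) => a b x y u v E Hd Hxy.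
apply/eqP => K.
have Ha : a = 0.
 transitivity (a * (x * u + y * v)); first by rewrite Hxy mulr1.
 by transitivity (x * (a * u + b * v) + v * (a * y - b * x)); [ring|rewrite E K !mulr0 addr0].
have Hb : b = 0.
 transitivity (b * (x * u + y * v)); first by rewrite Hxy mulr1.
 by transitivity (y * (a * u + b * v) - u * (a * y - b * x)); [ring|rewrite E K !mulr0 subr0].
by move: Hd; rewrite Ha Hb eqxx.
Qed.

Lemma lf_mulr c phi : lin_fun phi -> lin_fun (fun u => phi u * c).
Proof. by move=> H a u v; rewrite H; ring. Qed.
Ltac lins' := repeat first [apply: lo_id | apply: lo_bra | apply: lo_dx | apply: lo_dy | apply: lf_pev | apply: lf_sub | apply: lf_add | apply: lf_mulr].

Ltac dglt := lazymatch goal with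
 | |- is_true _ => done
 | |- dgl _ (_ * _ * _ * _ * _) => apply: dglM5; first [done | lia] | |- dgl _ (_ * _ * _ * _) => apply: dglM4; first [done | lia]
 | |- dgl _ (_ * _ * _) => apply: dglM3; first [done | lia] | |- dgl _ (_ * _) => apply: dglM2; first [done | lia] | |- _ => apply: dglI1; first [done | lia] end.
Ltac tst u := exists u; split; [by dglt | | ].
Ltac trw tp tq := rewrite ?tp ?tq ?subr0 ?oppr0 ?sub0r ?oppr_eq0 ?oner_eq0.

(* Replaces bra f and the evaluations by variables subject to their algebraic rules: rewriting would otherwise unfold them. *)
Tactic Notation "seal2" constr(f) constr(p) constr(q) hyp_list(hs) := revert hs;
 move: (fun a b => braMr a b f) (fun a b => braDr a b f) (pevM p) (pevD p) (pevM q) (pevD q);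
 move: (bra f) (pev p) (pev q) => X0 e0 e1 XM XD e0M e0D e1M e1D; have EE := (XM, XD, (e0M, e0D, e1M, e1D)); intros.
Tactic Notation "seal2d" constr(f) constr(p) constr(q) hyp_list(hs) := revert hs;
 move: (fun a b => braMr a b f) (fun a b => braDr a b f) (pevM p) (pevD p) (pevM q) (pevD q) (@dxM C) (@dyM C);
 move: (bra f) (pev p) (pev q) (@dx C) (@dy C) => X0 e0 e1 Dx Dy XM XD e0M e0D e1M e1D DxM DyM; have EE := (XM, XD, DxM, DyM, (e0M, e0D, e1M, e1D)); intros.
Tactic Notation "seal3" constr(f) constr(p) constr(q) constr(r) hyp_list(hs) := revert hs;
 move: (fun a b => braMr a b f) (fun a b => braDr a b f) (pevM p) (pevD p) (pevM q) (pevD q) (pevM r) (pevD r);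
 move: (bra f) (pev p) (pev q) (pev r) => X0 e0 e1 e2 XM XD e0M e0D e1M e1D e2M e2D;
 have EE := (XM, XD, (e0M, e0D, e1M, e1D, e2M, e2D)); intros.

(** Where J = 0 and df is nonzero, dg is a multiple of df, and the factor is the slope of the image
    branch. Comparing derivatives along a fixed direction (c1, c2) makes equality of two slopes
    linear in g. *)
Lemma negl_tangent c1 c2 : (2 < d2)%N -> negl d1 d2 (fun f g => exists p q, [/\ p != q, c1 * pev p (dx f) + c2 * pev p (dy f) != 0,
  c1 * pev q (dx f) + c2 * pev q (dy f) != 0, pev p f = pev q f &
  [/\ pev p g = pev q g, pev p (bra f g) = 0, pev q (bra f g) = 0 & (c1 * pev q (dx f) + c2 * pev q (dy f)) * (c1 * pev p (dx g) + c2 * pev p (dy g)) =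
   (c1 * pev p (dx f) + c2 * pev p (dy f)) * (c1 * pev q (dx g) + c2 * pev q (dy g))]]).
Proof.
move=> Hd3.
apply: negl_sub (@negl_lin C d1 d2 4 [:: gap0]
 [:: fun th f u => (c1 * pev (P1 th) (dx f) + c2 * pev (P1 th) (dy f)) * (c1 * pev (P0 th) (dx u) + c2 * pev (P0 th) (dy u)) -
   (c1 * pev (P0 th) (dx f) + c2 * pev (P0 th) (dy f)) * (c1 * pev (P1 th) (dx u) + c2 * pev (P1 th) (dy u));
  bP; bQ; gap1]
 (fun th f _ => [/\ P0 th != P1 th, c1 * pev (P0 th) (dx f) + c2 * pev (P0 th) (dy f) != 0 &
   c1 * pev (P1 th) (dx f) + c2 * pev (P1 th) (dy f) != 0]) _ _ _ _ _) => //=.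
- move=> f g _ _ [p [q [H1 H2 H3 H4 [H5 H6 H7 H8]]]]; exists (par4 p q).
 by rewrite !inordK //= -!spair H4 H5 H8 !subrr.
- by split; split=> [th|u]; [lins|pfs].
- by do 4!lp2.
- move=> th f g _ _ [N _ _]; split=> //; have [t [t1 tp tq _ _]] := line_coord N.
 by tst (t 0); trw tp tq.
move=> th f g _ _ []; move: (P0 th) (P1 th) => p q N Hp Hq.
have N1 r : c1 * pev r (dx f) + c2 * pev r (dy f) != 0 -> dnz f r.
 by rewrite /dnz; case: (eqVneq (pev r (dx f))) => [->|//]; case: (eqVneq (pev r (dy f))) => [->|//]; rewrite !mulr0 addr0 eqxx.
have [t [t1 tp tq _ _]] := line_coord N.
have [h [h1 hp hX]] := unit_coord (N1 _ Hp); have [k [k1 kq kX]] := unit_coord (N1 _ Hq).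
have [m [m1 mp mx my mX]] := grad_coord p (pev p (dx f)) (pev p (dy f)).
have mX0 : pev p (bra f m) = 0 by rewrite mX; ring.
have mxp := mx p; have myp := my p; clear N1 mX mx my th.
seal2d f p q tp tq hp hX kq kX mp mX0 mxp myp Hp Hq.
sp4.
- tst (m * t 1 * t 1); rewrite ?EE ?mp ?mxp ?myp ?tp ?tq ?mX0 ?zeE.
  by rewrite !mulrN1 !opprK mulf_neq0.
 by do 3!(split; first by ring).
- by tst (h * t 1 * t 1); rewrite ?EE ?hp ?hX ?tp ?tq ?zeE ?mulrNN ?mulr1 ?oner_neq0.

- tst (k * t 0 * t 0); rewrite ?EE ?kq ?kX ?tp ?tq ?zeE ?oner_neq0 //.
by tst (t 0); trw tp tq.
Qed.

Lemma negl_cusp_pair : (2 < d2)%N -> negl d1 d2 (fun f g => exists p q, [/\ p != q, dd f p q p != 0, dd f p q q != 0, pev p f = pev q f &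
  [/\ pev p g = pev q g, pev p (bra f g) = 0, pev p (bra f (bra f g)) = 0 & pev q (bra f g) = 0]]).
Proof.
move=> Hd3.
apply: negl_sub (@negl_lin C d1 d2 4 [:: gap0]
 [:: bbP; bQ; bP;
  gap1]
 (fun th f _ => [/\ P0 th != P1 th, dd f (P0 th) (P1 th) (P0 th) != 0 & dd f (P0 th) (P1 th) (P1 th) != 0]) _ _ _ _ _) => //=.
- move=> f g _ _ [p [q [H1 H2 H3 H4 [H5 H6 H7 H8]]]]; exists (par4 p q).
 by rewrite !inordK //= -!spair H4 H5 !subrr.
- by split; split=> [th|u]; [lins|pfs].
- by do 4!lp2.
- move=> th f g _ _ [N _ _]; split=> //; have [t [t1 tp tq _ _]] := line_coord N.
 by tst (t 0); trw tp tq.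
move=> th f g _ _ []; move: (P0 th) (P1 th) => p q N Hp Hq.
have [t [t1 tp tq _ _]] := line_coord N; have [l [l1 _ lep leq lX]] := along_coord p q.
have lXp := lX f p; have lXq := lX f q; clear lX th.
seal2 f p q tp tq lep leq lXp lXq.
sp4.
- tst (l * l); rewrite ?EE ?lep ?leq ?lXp ?zeE.
  by rewrite -mulr2n mulrn_eq0 mulf_neq0 ?oppr_eq0.
 by do 3!(split; first by ring).
- tst (l * t 0 * t 0); rewrite ?EE ?leq ?lXq ?tp ?tq ?zeE ?oppr_eq0 //.
- tst (l * t 1); rewrite ?EE ?lep ?leq ?lXp ?tp ?zeE.
  by rewrite mulf_neq0 ?oppr_eq0 // oner_eq0.
 by [].
by tst (t 0); trw tp tq.
Qed.

(** For f of degree one the line through p and q is a fibre of f, and the form vanishing on it has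
    bracket 0 with f, so it gives no test. Products of coordinates along the line are used instead,
    of degree up to 4. *)
Lemma negl_cusp_pair_along : (3 < d2)%N -> negl d1 d2 (fun f g => exists p q, [/\ p != q, [/\ dd f p q p = 0, dd f p q q = 0, dnz f p & dnz f q], pev p f = pev q f &
  [/\ pev p g = pev q g, pev p (bra f g) = 0, pev p (bra f (bra f g)) = 0 & pev q (bra f g) = 0]]).
Proof.
move=> Hd3.
apply: negl_sub (@negl_lin C d1 d2 4 [:: gap0]
 [:: bQ; bbP; bP;
  gap1]
 (fun th f _ => P0 th != P1 th /\ [/\ dd f (P0 th) (P1 th) (P0 th) = 0, dd f (P0 th) (P1 th) (P1 th) = 0,
   dnz f (P0 th) & dnz f (P1 th)]) _ _ _ _ _) => //=.
- move=> f g _ _ [p [q [H1 H2 H4 [H5 H6 H7 H8]]]]; exists (par4 p q).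
 by rewrite !inordK //= -!spair H4 H5 !subrr.
- by split; split=> [th|u]; [lins|pfs].
- by do 4!lp2.
- move=> th f g _ _ [N _]; split=> //; have [t [t1 tp tq _ _]] := line_coord N.
 by tst (t 0); trw tp tq.
move=> th f g _ _ []; move: (P0 th) (P1 th) => p q N [Ep Eq Np Nq].
have [t [t1 tp tq _ [tX tD]]] := line_coord N.
have XP := line_transverse N Np Ep tD; have XQ := line_transverse N Nq Eq tD.
have tXp := fun x => tX x f p; have tXq := fun x => tX x f q; clear tX tD Ep Eq Np Nq th.
seal2 f p q tp tq tXp tXq XP XQ.
sp4.
- tst (t 0 * t 0 * t 0 * t 1); rewrite ?EE ?tp ?tq ?subrr ?zeE ?tXq //.
- tst (t 0 * t 0 * t 1); rewrite ?EE ?tp ?tq ?zeE //.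
 by rewrite mulf_neq0 ?oppr_eq0 ?oner_eq0 // -mulr2n mulrn_eq0 mulf_neq0.
- tst (t 0 * t 1); rewrite ?EE ?tp ?tq ?zeE //.
 by rewrite mulf_neq0 ?oppr_eq0 // oner_eq0.
by tst (t 0); trw tp tq.
Qed.

Lemma negl_crit_pair : (1 < d1)%N -> negl d1 d2 (fun f g => exists p q, [/\ p != q, ~~ dnz f p, dnz f q, pev p f = pev q f &
  pev p g = pev q g /\ pev q (bra f g) = 0]).
Proof.
move=> Hd11.
apply: negl_sub (@negl_lin C d1 d2 4 [:: gap0; gx; gy]
 [:: bQ; gap1]
 (fun th f _ => P0 th != P1 th /\ dnz f (P1 th)) _ _ _ _ _) => //=.
- move=> f g _ _ [p [q [H1 H2 H3 H4 [H5 H6]]]]; exists (par4 p q).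
 rewrite !inordK //= -!spair H4 H5 H6 !subrr.
 by move: H2 => /dnzN[-> ->].
- by do 3!lp1.
- by do 2!lp2.
- move=> th f g _ _ []; move: (P0 th) (P1 th) => p q N _; have [t [t1 tp tq _ _]] := line_coord N.
 have [X [X1 _ Xx Xy _]] := grad_coord p 1 0; have [Y [Y1 _ Yx Yy _]] := grad_coord p 0 1.
 have Xxp := Xx p; have Xyp := Xy p; have Yxp := Yx p; have Yyp := Yy p; clear Xx Xy Yx Yy th.
seal2d f p q tp tq Xxp Xyp Yxp Yyp.
 sp3.
 + tst (t 0 * t 0); rewrite ?EE ?tp ?tq ?zeE ?oppr_eq0 ?oner_eq0 //.
 + by tst X; rewrite ?Xxp ?oner_neq0.
 by tst Y; rewrite ?Yyp ?oner_neq0.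
move=> th f g _ _ []; move: (P0 th) (P1 th) => p q N Hq.
have [t [t1 tp tq _ _]] := line_coord N; have [k [k1 kq kX]] := unit_coord Hq.
clear th.
seal2 f p q tp tq kq kX.
split; last split=> //.
- by tst (k * t 0); rewrite ?EE ?kq ?kX ?tp ?tq ?zeE ?oner_neq0.
by tst (t 0); trw tp tq.
Qed.

Lemma negl_crit_crit : (2 < d1)%N -> negl d1 d2 (fun f g => exists p q, [/\ p != q, ~~ dnz f p, ~~ dnz f q & pev p f = pev q f]).
Proof.
move=> Hd13.
apply: negl_sub (@negl_lin C d1 d2 4 [:: gap0; gx; gy;
  fun th u => pev (P1 th) (dx u); fun th u => pev (P1 th) (dy u)] [::]
 (fun th f _ => P0 th != P1 th) _ _ _ _ _) => //=.
- move=> f g _ _ [p [q [H1 H2 H3 H4]]]; exists (par4 p q).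
 rewrite !inordK //= -!spair H4 !subrr.
 by move: H2 H3 => /dnzN[-> ->] /dnzN[-> ->].
- by do 5!lp1.
move=> th f g _ _; move: (P0 th) (P1 th) => p q N; have [t [t1 tp tq _ [_ tD]]] := line_coord N.
have [X [X1 Xp Xx Xy _]] := grad_coord p 1 0; have [Y [Y1 Yp Yx Yy _]] := grad_coord p 0 1.
have [X' [X'1 X'q X'x X'y _]] := grad_coord q 1 0; have [Y' [Y'1 Y'q Y'x Y'y _]] := grad_coord q 0 1.
have tdx r : pev r (dx (t 1)) = pev r (dx (t 0)) by have [] := tD 1 r.
have tdy r : pev r (dy (t 1)) = pev r (dy (t 0)) by have [] := tD 1 r.
have tdh r : pev r (dx (t (3 / 2))) = pev r (dx (t 0)) /\ pev r (dy (t (3 / 2))) = pev r (dy (t 0)) by have [] := tD (3 / 2) r.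
have tdxp := fun x => let: And3 a _ _ := tD x p in a; have tdyp := fun x => let: And3 _ a _ := tD x p in a.
have tdxq := fun x => let: And3 a _ _ := tD x q in a; have tdyq := fun x => let: And3 _ a _ := tD x q in a.
have Xxp := Xx p; have Xyp := Xy p; have Yxp := Yx p; have Yyp := Yy p; have X'xp := X'x q; have X'yp := X'y q; have Y'xp := Y'x q; have Y'yp := Y'y q; have Xxq := Xx q; have Xyq := Xy q; have Yxq := Yx q; have Yyq := Yy q.
have X'xpp := X'x p; have X'ypp := X'y p; have Y'xpp := Y'x p; have Y'ypp := Y'y p; clear Xx Xy Yx Yy X'x X'y Y'x Y'y tdx tdy tdh tD th.
seal2d f p q tp tq tdxp tdyp tdxq tdyq Xp Yp X'q Y'q Xxp Xyp Yxp Yyp X'xp X'yp Y'xp Y'yp Xxq Xyq Yxq Yyq X'xpp X'ypp Y'xpp Y'ypp.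
sp5.
(* In the coordinate tau along the line this is tau^2 (tau - 3/2), critical at tau = 0 and tau = 1
   with different values there. *)
- tst (t 0 * t 0 * t (3 / 2)); rewrite ?EE ?tp ?tq ?(tdxp (3 / 2)) ?(tdyp (3 / 2)) ?(tdxq (3 / 2)) ?(tdyq (3 / 2)).
  rewrite subr0 oppr0 !mul0r !mul1r sub0r oppr_eq0 subr_eq0; apply/eqP => E.
  have /eqP := congr1 (fun z => z * 2) E.
  by rewrite mul1r divfK ?pnatr_eq0 // eqr_nat.
 have E2 : (1 - 3 / 2 : C) = - (1 / 2) by field.
 rewrite E2 subr0 oppr0.
 by do 4!(split; first by field).
- tst (X * t 1 * t 1); rewrite ?EE ?Xp ?Xxp ?Xyp ?tp ?tq ?zeE ?mulrNN ?mulr1 ?oner_neq0 //.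
- tst (Y * t 1 * t 1); rewrite ?EE ?Yp ?Yyp ?tp ?tq ?zeE ?mulrNN ?mulr1 ?oner_neq0 //.
- tst X'; rewrite ?X'xp ?oner_neq0 //.
tst Y'; rewrite ?Y'yp ?oner_neq0 //.
Qed.

Lemma negl_along_pair : (1 < d1)%N -> (2 < d2)%N -> negl d1 d2 (fun f g => exists p q, [/\ p != q, dnz f p, dnz f q, pev p f = pev q f &
  [/\ dd f p q p = 0, pev p g = pev q g, pev p (bra f g) = 0 & pev q (bra f g) = 0]]).
Proof.
move=> Hd12 Hd3.
apply: negl_sub (@negl_lin C d1 d2 4 [:: fun th u => pev (P0 th) (dx u) * (th`2 - th`0) + pev (P0 th) (dy u) * (th`3 - th`1);
  gap0]
 [:: bP; bQ;
  gap1]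
 (fun th f _ => [/\ P0 th != P1 th, dnz f (P0 th) & dnz f (P1 th)]) _ _ _ _ _) => //=.
- move=> f g _ _ [p [q [H1 H2 H3 H4 [H5 H6 H7 H8]]]]; exists (par4 p q).
 by move: H5; rewrite !inordK //= -!spair H4 H6 !subrr.
- by do 2![split; first by split=> [th|u]; [lins'|pfs]].
- by do 3!lp2.
- move=> th f g _ _ [N _ _]; have [t [t1 tp tq _ [_ tD]]] := line_coord N.
 have [_ _] := tD 0 (P0 th); have [Ex Ey D1] := tD 1 (P0 th); rewrite /dd /= => D0.
 split; last split=> //.
 + tst (t 0 * t 1); rewrite !(pev_dxM, pev_dyM, pevM) ?tp ?tq ?zeE //.
  by rewrite !mulrN1 !mulNr -opprD D0 oppr_eq0 oner_eq0.
 by tst (t 0); trw tp tq.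
move=> th f g _ _ []; move: (P0 th) (P1 th) => p q N Hp Hq.
have [t [t1 tp tq _ _]] := line_coord N.
have [h [h1 hp hX]] := unit_coord Hp; have [k [k1 kq kX]] := unit_coord Hq.
clear th.
seal2 f p q tp tq hp hX kq kX.
sp3.
- by tst (h * t 1 * t 1); rewrite ?EE ?hp ?hX ?tp ?tq ?zeE ?mulrNN ?mulr1 ?oner_neq0.

- tst (k * t 0 * t 0); rewrite ?EE ?kq ?kX ?tp ?tq ?zeE ?oner_neq0 //.
by tst (t 0); trw tp tq.
Qed.

Definition det3 p q r := (q.1 - p.1) * (r.2 - p.2) - (q.2 - p.2) * (r.1 - p.1).
Lemma bary p q r : det3 p q r != 0 -> exists h, [/\ dgl 1 h, pev p h = 1, pev q h = 0 & pev r h = 0].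
Proof.
rewrite /det3; set e := _ - _ => He; have [h [h1 hq hx hy _]] := grad_coord q ((q.2 - r.2) / e) ((r.1 - q.1) / e).
exists (tl q ((q.2 - r.2) / e) ((r.1 - q.1) / e)); split; first exact: dgl_tl.
- by rewrite pev_tl; transitivity (e / e); [rewrite {3}/e; field|rewrite divff].
- by rewrite pev_tl; ring.
by rewrite pev_tl; field.
Qed.

Lemma bary3 p q r : det3 p q r != 0 -> exists a b c, [/\ [/\ dgl 1 a, pev p a = 1, pev q a = 0 & pev r a = 0],
 [/\ dgl 1 b, pev p b = 0, pev q b = 1 & pev r b = 0] & [/\ dgl 1 c, pev p c = 0, pev q c = 0 & pev r c = 1]].
Proof.
move=> N; have [|b [b1 bq br bp]] := @bary q r p; first by rewrite (_ : det3 _ _ _ = det3 p q r) // /det3; ring.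
have [|c [c1 cr cp cq]] := @bary r p q; first by rewrite (_ : det3 _ _ _ = det3 p q r) // /det3; ring.
by have [a Ha] := bary N; exists a, b, c.
Qed.

Lemma negl_triple : (2 < d2)%N -> negl d1 d2 (fun f g => exists p q r, [/\ det3 p q r != 0, [/\ dnz f p, dnz f q & dnz f r], pev p f = pev q f, pev p f = pev r f &
  [/\ pev p g = pev q g, pev p g = pev r g, pev p (bra f g) = 0, pev q (bra f g) = 0 & pev r (bra f g) = 0]]).
Proof.
move=> Hd3.
apply: negl_sub (@negl_lin C d1 d2 6 [:: gap0; fun th u => pev (P0 th) u - pev (pt th 4 5) u]
 [:: bP; bQ; fun th f u => pev (pt th 4 5) (bra f u);
  gap1; fun th _ u => pev (P0 th) u - pev (pt th 4 5) u]
 (fun th f _ => det3 (P0 th) (P1 th) (pt th 4 5) != 0 /\ [/\ dnz f (P0 th), dnz f (P1 th) & dnz f (pt th 4 5)]) _ _ _ _ _) => //=.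
- move=> f g _ _ [p [q [r [H1 H2 H3 H4 [H5 H6 H7 H8 H9]]]]]; exists (fun i => nth 0 [:: p.1; p.2; q.1; q.2; r.1; r.2] i).
 by rewrite !inordK //= -!spair -H3 -H4 -H5 -H6 !subrr.
- by do 2!lp1.
- by do 5!lp2.
- move=> th f g _ _ []; move: (P0 th) (P1 th) (pt th 4 5) => p q r N _.
 have [a [b [c [[a1 ap aq ar] [b1 bp bq br] [c1 cp cq cr]]]]] := bary3 N.
 split; last split=> //.
 + by tst b; rewrite ?bp ?bq ?br ?subrr ?sub0r ?oppr_eq0 ?oner_eq0.
 by tst c; rewrite ?cp ?cr ?sub0r ?oppr_eq0 ?oner_eq0.
move=> th f g _ _ []; move: (P0 th) (P1 th) (pt th 4 5) => p q r N [Hp Hq Hr].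
have [a [b [c [[a1 ap aq ar] [b1 bp bq br] [c1 cp cq cr]]]]] := bary3 N.
have [h [h1 hp hX]] := unit_coord Hp; have [k [k1 kq kX]] := unit_coord Hq; have [l [l1 lr lX]] := unit_coord Hr.
clear th.
seal3 f p q r hp hX kq kX lr lX ap aq ar bp bq br cp cq cr.
sp5.
- by tst (h * a * a); rewrite ?EE ?hp ?hX ?ap ?aq ?ar ?zeE ?oner_neq0.
- by tst (k * b * b); rewrite ?EE ?kq ?kX ?bp ?bq ?br ?zeE ?oner_neq0.
- by tst (l * c * c); rewrite ?EE ?lr ?lX ?cp ?cq ?cr ?zeE ?oner_neq0.
- by tst b; rewrite ?bp ?bq ?br ?subrr ?sub0r ?oppr_eq0 ?oner_eq0.
by tst c; rewrite ?cp ?cr ?sub0r ?oppr_eq0 ?oner_eq0.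
Qed.

(** Collinear points have no barycentric coordinates. A triple is then given by p, q and a ratio x,
    five parameters, and the tests come from the form vanishing on the line and the coordinate along
    it. *)
Lemma negl_triple_line : (1 < d1)%N -> (2 < d2)%N -> negl d1 d2 (fun f g => exists p q x, [/\ p != q, x != 0 /\ x != 1,
  [/\ dd f p q p != 0, dd f p q q != 0 & dd f p q (lp p q x) != 0], pev p f = pev q f /\ pev p f = pev (lp p q x) f &
  [/\ pev p g = pev q g, pev p g = pev (lp p q x) g, pev p (bra f g) = 0, pev q (bra f g) = 0 & pev (lp p q x) (bra f g) = 0]]).
Proof.
move=> Hd12 Hd3.
apply: negl_sub (@negl_lin C d1 d2 5 [:: gap0; fun th u => pev (P0 th) u - pev (th`0 + th`4 * (th`2 - th`0), th`1 + th`4 * (th`3 - th`1)) u]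
 [:: bP; bQ; fun th f u => pev (th`0 + th`4 * (th`2 - th`0), th`1 + th`4 * (th`3 - th`1)) (bra f u);
  gap1; fun th _ u => pev (P0 th) u - pev (th`0 + th`4 * (th`2 - th`0), th`1 + th`4 * (th`3 - th`1)) u]
 (fun th f _ => [/\ P0 th != P1 th, th`4 != 0 /\ th`4 != 1 & [/\ dd f (P0 th) (P1 th) (P0 th) != 0,
   dd f (P0 th) (P1 th) (P1 th) != 0 & dd f (P0 th) (P1 th) (lp (P0 th) (P1 th) th`4) != 0]]) _ _ _ _ _) => //=.
- move=> f g _ _ [p [q [x [H1 H2 H3 [H4 H4'] [H5 H6 H7 H8 H9]]]]]; exists (fun i => nth 0 [:: p.1; p.2; q.1; q.2; x] i).
 rewrite !inordK //= -!spair -H4 -H5 H7 H8.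
 by move: H4' H6 H9; rewrite /lp => <- <- ->; rewrite !subrr.
- by do 2!lp1.
- by do 5!lp2.
- move=> th f g _ _ []; rewrite -/(lp (P0 th) (P1 th) th`4); move: (P0 th) (P1 th) th`4 => p q x N [x0 x1] _.
 have [t [t1 tp tq tr _]] := line_coord N; have x1' : 1 - x != 0 by rewrite subr_eq0 eq_sym.
 have {}tr y := tr y x; clear th.
 move: (pevM p) (pevM q) (pevM (lp p q x)) tp tq tr; move: (pev p) (pev q) (pev (lp p q x)) => e0 e1 e2 e0M e1M e2M tp tq tr.
 split; last split=> //.
 + by tst (t 0 * t x); rewrite !(e0M, e1M, e2M) ?tp ?tq ?tr ?zeE ?oppr_eq0.
 by tst (t 0); rewrite ?tp ?tr ?oppr0 ?sub0r ?addr0 ?oppr_eq0.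
move=> th f g _ _ []; rewrite -/(lp (P0 th) (P1 th) th`4); move: (P0 th) (P1 th) th`4 => p q x N [x0 x1] [Hp Hq Hr].
have [t [t1 tp tq tr _]] := line_coord N; have x1' : 1 - x != 0 by rewrite subr_eq0 eq_sym.
have [l [l1 ler lep leq lX]] := along_coord p q.
have lXp := lX f p; have lXq := lX f q; have lXr := lX f (lp p q x); have {}tr y := tr y x; have {}ler := ler x; clear th lX.
seal3 f p q (lp p q x) tp tq tr lep leq ler lXp lXq lXr.
sp5.
- tst (l * t 1 * t x); rewrite ?EE ?lep ?leq ?ler ?lXp ?tp ?tq ?tr ?zeE //.
 by rewrite !mulf_neq0 ?oppr_eq0 ?oner_eq0.
- tst (l * t x); rewrite ?EE ?lep ?leq ?ler ?lXq ?tq ?tr ?zeE //.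
 by rewrite !mulf_neq0 ?oppr_eq0.
- by tst l; rewrite ?lep ?leq ?ler ?lXr ?subrr ?oppr_eq0.
- by tst (t 0 * t x); rewrite !(e0M, e1M, e2M) ?tp ?tq ?tr ?zeE ?oppr_eq0.
by tst (t 0); rewrite ?tp ?tr ?oppr0 ?sub0r ?addr0 ?oppr_eq0.
Qed.

(** For f of degree one, f(p) = f(q) makes f constant on the line, so the only condition on f is
    [gap0]: it and the five on g stand against five parameters. The tests along the line have degree
    up to 5. *)
Lemma negl_triple_along : (4 < d2)%N -> negl d1 d2 (fun f g => exists p q x, [/\ p != q, x != 0 /\ x != 1,
  [/\ dd f p q p = 0, dd f p q q = 0 & dd f p q (lp p q x) = 0] /\ [/\ dnz f p, dnz f q & dnz f (lp p q x)], pev p f = pev q f &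
  [/\ pev p g = pev q g, pev p g = pev (lp p q x) g, pev p (bra f g) = 0, pev q (bra f g) = 0 & pev (lp p q x) (bra f g) = 0]]).
Proof.
move=> Hd5.
apply: negl_sub (@negl_lin C d1 d2 5 [:: gap0]
 [:: fun th f u => pev (th`0 + th`4 * (th`2 - th`0), th`1 + th`4 * (th`3 - th`1)) (bra f u); bQ; bP;
  gap1; fun th _ u => pev (P0 th) u - pev (th`0 + th`4 * (th`2 - th`0), th`1 + th`4 * (th`3 - th`1)) u]
 (fun th f _ => [/\ P0 th != P1 th, th`4 != 0 /\ th`4 != 1 & [/\ dd f (P0 th) (P1 th) (P0 th) = 0,
   dd f (P0 th) (P1 th) (P1 th) = 0 & dd f (P0 th) (P1 th) (lp (P0 th) (P1 th) th`4) = 0] /\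
   [/\ dnz f (P0 th), dnz f (P1 th) & dnz f (lp (P0 th) (P1 th) th`4)]]) _ _ _ _ _) => //=.
- move=> f g _ _ [p [q [x [H1 H2 H3 H4 [H5 H6 H7 H8 H9]]]]]; exists (fun i => nth 0 [:: p.1; p.2; q.1; q.2; x] i).
 rewrite !inordK //= -!spair -H4 -H5 H7 H8.
 by move: H6 H9; rewrite /lp => <- ->; rewrite !subrr.
- by lp1.
- by do 5!lp2.
- move=> th f g _ _ []; move: (P0 th) (P1 th) th`4 => p q x N [x0 x1] _.
 have [t [t1 tp tq tr _]] := line_coord N; split=> //; clear th.
 move: tp tq; move: (pev p) (pev q) => e0 e1 tp tq.
 by tst (t 0); rewrite ?tp ?tq ?oppr0 ?sub0r ?addr0 ?oppr_eq0 ?oner_eq0.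
move=> th f g _ _ []; rewrite -/(lp (P0 th) (P1 th) th`4); move: (P0 th) (P1 th) th`4 => p q x N [x0 x1] [[Ep Eq Er] [Hp Hq Hr]].
have [t [t1 tp tq tr [tX tD]]] := line_coord N; have x1' : 1 - x != 0 by rewrite subr_eq0 eq_sym.
have x1'' : x - 1 != 0 by rewrite subr_eq0.
have XP := line_transverse N Hp Ep tD; have XQ := line_transverse N Hq Eq tD; have XR := line_transverse N Hr Er tD.
have tXp := fun x => tX x f p; have tXq := fun x => tX x f q; have tXr := fun y => tX y f (lp p q x); have {}tr y := tr y x; clear th tX tD Ep Eq Er Hp Hq Hr.
seal3 f p q (lp p q x) tp tq tr tXp tXq tXr XP XQ XR.
sp5.
- tst (t 0 * t 0 * t 1 * t 1 * t x); rewrite ?EE ?tp ?tq ?tr ?zeE ?tXr //.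
 by rewrite !mulf_neq0.
- tst (t 0 * t 0 * t 1 * t x); rewrite ?EE ?tp ?tq ?tr ?zeE ?tXq //.
 by rewrite !mulf_neq0.
- tst (t 0 * t 1 * t x); rewrite ?EE ?tp ?tq ?tr ?zeE //.
 by rewrite !mulf_neq0 ?oppr_eq0 ?oner_eq0.
- by tst (t 0 * t x); rewrite !(e0M, e1M, e2M) ?tp ?tq ?tr ?zeE ?oppr_eq0.
by tst (t 0); rewrite ?tp ?tr ?oppr0 ?sub0r ?addr0 ?oppr_eq0.
Qed.
End MultiPoint.
Transparent bra.

(** * Restriction to lines *)

Section Lines.
Variable C : cField.
Local Notation P2 := (mpoly 2 C).
Implicit Types (p q r : C * C) (f g u v : P2).

Lemma dgl0E u : dgl 0 u -> exists c, u = cst c.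
Proof.
move=> Hu; exists (tf 0 u)`_0; apply: psi_inj; apply/polyP => j.
rewrite !psi_coef; case: j => [|j]; last by rewrite Hu // dgl_cst.
by rewrite tf_cst; apply: size1_polyC; apply: size_tf.
Qed.

(* restriction of u to the line through p with direction w *)
Definition rst p (w : C * C) u : {poly C} :=
 mmap (@polyC C) (fun i : 'I_2 => if i == ord0 then p.1%:P + w.1 *: 'X else p.2%:P + w.2 *: 'X) u.
Lemma rstD p w u v : rst p w (u + v) = rst p w u + rst p w v. Proof. exact: mmapD. Qed.
Lemma rstM p w u v : rst p w (u * v) = rst p w u * rst p w v. Proof. exact: rmorphM. Qed.
Lemma rstC p w c : rst p w (cst c) = c%:P. Proof. exact: mmapC. Qed.
Lemma rstx p w : rst p w (mx C) = p.1%:P + w.1 *: 'X. Proof. by rewrite /rst mmapX mmap1U. Qed.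
Lemma rsty p w : rst p w (my C) = p.2%:P + w.2 *: 'X. Proof. by rewrite /rst mmapX mmap1U. Qed.
Lemma horner_rst p w u t : (rst p w u).[t] = pev (p.1 + t * w.1, p.2 + t * w.2) u.
Proof.
elim/P2_ind: u => [c|||a b Ha Hb|a b Ha Hb].
- by rewrite rstC hornerC pevC.
- by rewrite rstx pevx !hoE mulrC.
- by rewrite rsty pevy !hoE mulrC.
- by rewrite rstD hornerD pevD Ha Hb.
by rewrite rstM hornerM pevM Ha Hb.
Qed.
Lemma deriv_rst p w u : (rst p w u)^`() = rst p w (cst w.1 * dx u + cst w.2 * dy u).
Proof.
have EX (a b : C) : (a%:P + b *: 'X)^`() = b%:P by rewrite derivD derivC derivZ derivX add0r -mul_polyC mulr1.
elim/P2_ind: u => [c|||a b Ha Hb|a b Ha Hb].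
- by rewrite rstC derivC dxC dyC !mulr0 addr0 rstC.
- by rewrite rstx dxx dyx mulr1 mulr0 addr0 rstC.
- by rewrite rsty dxy dyy mulr1 mulr0 add0r rstC.
- by rewrite rstD derivD Ha Hb -rstD !dxD; congr (rst p w _); ring.
rewrite rstM derivM Ha Hb -!rstM -rstD; congr (rst p w _).
by rewrite dxM dyM; ring.
Qed.

Lemma poly_deriv_bound (P : {poly C}) m c : (size P^`() <= m.+1)%N -> (P^`())`_m = m.+1%:R * c ->
 (size P <= m.+2)%N /\ P`_m.+1 = c.
Proof.
move=> Hs Hc; split.
 apply/leq_sizeP => j Hj; move/leq_sizeP: Hs => /(_ j.-1); rewrite coef_deriv.
 case: j Hj => // j Hj /(_ Hj) /eqP; rewrite mulrn_eq0 => /eqP //.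
have N : (m.+1%:R : C) != 0 by rewrite pnatr_eq0.
by apply: (mulfI N); rewrite -Hc coef_deriv mulr_natl.
Qed.

Lemma rst_slope p s m u : dgl m u -> (size (rst p (1%R, s) u) <= m.+1)%N /\ (rst p (1%R, s) u)`_m = (tf m u).[s].
Proof.
elim: m u => [u /dgl0E[c ->]|m IH u Hu].
 by rewrite rstC size_polyC_leq1 tf_cst coefC hornerC.
have [|H1 H2] := IH (cst 1 * dx u + cst s * dy u).
 by rewrite -!scale_cst scale1r; apply: dglD; [apply: dgl_dx|rewrite scale_cst; apply: (dglM (m := 0)); [apply: dgl_cst|apply: dgl_dy]].
rewrite -deriv_rst in H1 H2; apply: poly_deriv_bound => //; rewrite H2.
rewrite tfD -!scale_cst !tfZ tf_dx tf_dy hornerD !hornerZ hornerD hornerN hornerM hornerX hornerZ; ring.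
Qed.
Lemma rst_vert p m u : dgl m u -> (size (rst p (0%R, 1%R) u) <= m.+1)%N /\ (rst p (0%R, 1%R) u)`_m = (tf m u)`_m.
Proof.
elim: m u => [u /dgl0E[c ->]|m IH u Hu].
 by rewrite rstC size_polyC_leq1 tf_cst.
have [|H1 H2] := IH (cst 0 * dx u + cst 1 * dy u).
 by rewrite mul0r add0r mul1r; apply: dgl_dy.
rewrite -deriv_rst in H1 H2; apply: poly_deriv_bound => //; rewrite H2.
by rewrite mul0r add0r mul1r tf_dy coef_deriv mulr_natl.
Qed.

Lemma affine_diff u p q : dgl 1 u -> pev q u - pev p u = pev p (dx u) * (q.1 - p.1) + pev p (dy u) * (q.2 - p.2).
Proof.
move=> Hu; have [a Ea] := dgl0E (dgl_dx Hu); have [b Eb] := dgl0E (dgl_dy Hu).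
set w := (q.1 - p.1, q.2 - p.2); set P := rst p w u.
have EP : P^`() = (a * w.1 + b * w.2)%:P.
 by rewrite deriv_rst Ea Eb -!cstM -cstD rstC mulrC [b * _]mulrC.
have [H1 H2] : (size P <= 2)%N /\ P`_1 = a * w.1 + b * w.2.
 by apply: poly_deriv_bound; rewrite EP ?size_polyC_leq1 // coefC mul1r.
have E t : P.[t] = P`_0 + P`_1 * t.
 by rewrite (horner_coef_wide _ H1) !big_ord_recl big_ord0 mulr1 addr0.
have := E 1; have := E 0; rewrite !horner_rst !mul0r !mul1r !addr0 H2 -spair /= => E0 E1.
have -> : q = (p.1 + (q.1 - p.1), p.2 + (q.2 - p.2)) by rewrite !subrKC -spair.
by rewrite E1 E0 Ea Eb !pevC /=; ring.
Qed.
End Lines.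

(** * Generic pairs: conditions at infinity and at one point *)

Section Generic.
Variable C : cField.
Local Notation P2 := (mpoly 2 C).
Variables (d1 d2 : nat).
Hypotheses (Hd1 : (0 < d1)%N) (Hd12 : (d1 <= d2)%N) (Hd2 : (1 < d2)%N).
Local Notation D := (d1.-1 + d2.-1)%N.
Implicit Types (p q r : C * C) (f g u v : P2).

Definition generally (Q : P2 -> P2 -> Prop) := negl d1 d2 (fun f g => ~ Q f g).
Lemma gen_not B : negl d1 d2 B -> generally (fun f g => ~ B f g).
Proof. by apply: negl_sub => f g _ _ /contrapT. Qed.
Lemma gen_and A B : generally A -> generally B -> generally (fun f g => A f g /\ B f g).
Proof.
move=> HA HB; apply: negl_sub (negl_or HA HB) => f g _ _ N; apply: contrapT => M.
by apply: N; split; apply: contrapT => K; apply: M; [left|right].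
Qed.
Lemma gen_imp A B : generally A -> (forall f g, dgl d1 f -> dgl d2 g -> A f g -> B f g) -> generally B.
Proof. by move=> HA H; apply: negl_sub HA => f g Hf Hg N HA; apply: N; apply: H. Qed.

Local Notation "'NG(' L ')'" := (gen_not (ltac:(by apply: L))) (only parsing).
Definition tops f g := [/\ size (tf D (bra f g)) = D.+1, size (tf d1 f) = d1.+1,
 forall s, (tf d1 f).[s] = 0 -> (tf d2 g).[s] != 0,
 (forall s, (tf d1 f).[s] = 0 -> ((tf d1 f)^`()).[s] != 0) /\ (forall s, (tf d2 g).[s] = 0 -> ((tf d2 g)^`()).[s] != 0) &
 [/\ forall s, (tf D (bra f g)).[s] = 0 -> (tf d1 f).[s] != 0, forall s, (tf D (bra f g)).[s] = 0 -> (tf d2 g).[s] != 0 &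
 forall s, (tf D (bra f g)).[s] = 0 -> ((tf D (bra f g))^`()).[s] != 0]].

Lemma size_tf_lead m u : (tf m u)`_m != 0 -> size (tf m u) = m.+1.
Proof.
move=> H; apply/eqP; rewrite eqn_leq size_tf ltnNge; apply: contra H => /leq_sizeP/(_ m (leqnn m)) -> //.
Qed.

Lemma gen_tops : generally tops.
Proof.
have H := (gen_and (NG(negl_f_lead)) (gen_and (NG(negl_J_lead))
 (gen_and (NG(negl_common_root)) (gen_and (NG(negl_f_double))
 (gen_and (NG(negl_g_double)) (NG(negl_J_double))))))).
refine (gen_imp H _); clear H; move=> f g Hf Hg [/eqP N1 [N2 [N3 [N4 [N5 N6]]]]].
have S0 : forall s, (tf d1 f).[s] = 0 -> (tf d2 g).[s] != 0 by move=> s E; apply/eqP => E'; apply: N3; exists s.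
have S1 : forall s, (tf d1 f).[s] = 0 -> ((tf d1 f)^`()).[s] != 0 by move=> s E; apply/eqP => E'; apply: N4; exists s.
have S2 : forall s, (tf d2 g).[s] = 0 -> ((tf d2 g)^`()).[s] != 0 by move=> s E; apply/eqP => E'; apply: N5; exists s.
have T1 s : (tf D (bra f g)).[s] = 0 -> (tf d1 f).[s] != 0.
 rewrite tfJ_at // => E; apply/eqP => F; move/eqP: E; rewrite F mulr0 mul0r sub0r oppr_eq0 !mulf_eq0 pnatr_eq0.
 by rewrite (negPf (S1 _ F)) (negPf (S0 _ F)); move: Hd2; case: (d2).
have T2 s : (tf D (bra f g)).[s] = 0 -> (tf d2 g).[s] != 0.
 rewrite tfJ_at // => E; apply/eqP => F; move/eqP: E; rewrite F !mulr0 subr0 !mulf_eq0 pnatr_eq0.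
 by rewrite (negPf (S2 _ F)) orbF -[d1 == 0%N]negbK -lt0n Hd1 => /eqP/S0; rewrite F eqxx.
split=> //; try exact: size_tf_lead.
 by apply: size_tf_lead; apply/eqP => E; apply: N2.
by split=> // s E; apply/eqP => E'; apply: N6; exists s; split=> //; apply: T1.
Qed.

Lemma coprime_roots (P Q : {poly C}) : (forall s, P.[s] = 0 -> Q.[s] != 0) -> coprimep P Q.
Proof. by move=> H; apply: Pdiv.ClosedField.root_coprimep => s /eqP; apply: H. Qed.

(** Exponents with u a = v b + 1 give c = x^u / y^v. *)
Lemma equal_powers a b (x y : C) : coprime a b -> (0 < a)%N -> x != 0 -> y != 0 -> x ^+ b = y ^+ a ->
 exists c, x = c ^+ a /\ y = c ^+ b.
Proof.
move=> co a0 x0 y0 E; have [u v Huv _] := egcdnP b a0; move: Huv; rewrite (eqP co) => Huv.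
exists (x ^+ u / y ^+ v); rewrite !expr_div_n -!exprM.
have -> : y ^+ (v * a) = x ^+ (v * b) by rewrite mulnC exprM -E -exprM mulnC.
have -> : x ^+ (u * b) = y ^+ (u * a) by rewrite mulnC exprM E -exprM mulnC.
by rewrite Huv addn1 !exprS !mulfK ?expf_neq0.
Qed.

Lemma two_roots_eq0 (P : {poly C}) s s' : s != s' -> (size P <= 3)%N -> P.[s] = 0 -> (P^`()).[s] = 0 -> P.[s'] = 0 -> P = 0.
Proof.
move=> N Hs E1 E2 E3; apply/eqP/negPn/negP => P0.
have /factor_theorem[Q EQ] : root P s by apply/eqP.
have EQ' : Q.[s] = 0.
 by move: E2; rewrite EQ derivM derivXsubC mulr1 hornerD hornerM hornerXsubC subrr mulr0 add0r.
have /factor_theorem[S ES] : root Q s by apply/eqP.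
have ES' : S.[s'] = 0.
 move/eqP: E3; rewrite EQ ES !hornerM !hornerXsubC -mulrA mulf_eq0 mulf_eq0 orbb subr_eq0 [s' == s]eq_sym (negPf N) orbF => /eqP //.
have /factor_theorem[T ET] : root S s' by apply/eqP.
move: Hs P0; rewrite EQ ES ET; have [->|T0] := eqVneq T 0; first by rewrite !mul0r eqxx.
have H0 x : ('X - x%:P : {poly C}) != 0 by rewrite polyXsubC_eq0.
rewrite size_Mmonic ?mulf_neq0 ?monicXsubC // size_Mmonic ?mulf_neq0 ?monicXsubC // size_Mmonic ?monicXsubC //.
by rewrite !size_XsubC; move: T0; rewrite -size_poly_gt0; case: (size T) => n; rewrite !addn2.
Qed.

Lemma gen_gamma : generally (fun f g => tops f g -> forall s s', (tf D (bra f g)).[s] = 0 -> (tf D (bra f g)).[s'] = 0 -> s != s' ->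
  (tf d1 f).[s] ^+ (d2 %/ gcdn d1 d2) * (tf d2 g).[s'] ^+ (d1 %/ gcdn d1 d2) !=
  (tf d1 f).[s'] ^+ (d2 %/ gcdn d1 d2) * (tf d2 g).[s] ^+ (d1 %/ gcdn d1 d2)).
Proof.
have [Hd3|Hd3] := ltnP 2 d2.
 have H := NG(negl_gamma).
 refine (gen_imp H _); clear H; move=> f g Hf Hg N [_ _ _ _ [T1 T2 _]] s s' Es Es' Nss.
 apply/eqP => E; have [A0 A0' B0 B0'] := And4 (T1 _ Es) (T1 _ Es') (T2 _ Es) (T2 _ Es').
 have g0 : (0 < gcdn d1 d2)%N by rewrite gcdn_gt0 Hd1.
 have co : coprime (d1 %/ gcdn d1 d2) (d2 %/ gcdn d1 d2).
  by rewrite /coprime -(eqn_pmul2r g0) muln_gcdl !divnK ?dvdn_gcdl ?dvdn_gcdr // mul1n.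
 have [||||c [Ec1 Ec2]] := @equal_powers (d1 %/ gcdn d1 d2) (d2 %/ gcdn d1 d2) ((tf d1 f).[s] / (tf d1 f).[s']) ((tf d2 g).[s] / (tf d2 g).[s']) co.
 - by rewrite divn_gt0 dvdn_leq // dvdn_gcdl.
 - by rewrite mulf_neq0 ?invr_eq0.
 - by rewrite mulf_neq0 ?invr_eq0.
 - by rewrite !expr_div_n; apply/eqP; rewrite eqr_div ?expf_neq0 // E mulrC.
 set t := (gcdn d1 d2).-root c.
 have Et : t ^+ gcdn d1 d2 = c by rewrite rootCK.
 apply: N; exists s, s', t; split=> //; split=> //.
  by rewrite -[X in t ^+ X](divnK (dvdn_gcdl d1 d2)) mulnC exprM Et -Ec1 divfK.
 by rewrite -[X in t ^+ X](divnK (dvdn_gcdr d1 d2)) mulnC exprM Et -Ec2 divfK.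
apply: negl_False => f g Hf Hg; apply; move=> [SJ Sf _ _ [T1 T2 _]] s s' Es Es' Nss.
have Ed2 : d2 = 2%N by apply/eqP; rewrite eqn_leq Hd3.
apply/eqP => E.
have [Ed1|Ed1] : d1 = 1%N \/ d1 = 2%N by move: Hd1 Hd12; rewrite Ed2; case: (d1) => [|[|[|]]]; auto.
 have [P1 P2] : root (tf D (bra f g)) s /\ root (tf D (bra f g)) s' by split; apply/eqP.
 have := @max_poly_roots _ (tf D (bra f g)) [:: s; s'].
 rewrite -size_poly_gt0 SJ /= P1 P2 inE Nss; move=> /(_ isT isT isT).
 by rewrite Ed1 Ed2.
set F := tf d1 f in SJ Sf T1 E *; set G := tf d2 g in T2 E *.
have [A0 A0' B0 B0'] := And4 (T1 _ Es) (T1 _ Es') (T2 _ Es) (T2 _ Es').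
have Eg : gcdn d1 d2 = 2%N by rewrite Ed1 Ed2.
move: E; rewrite Ed1 Ed2 !expr1 => E.
set l := G.[s] / F.[s].
have El : G.[s'] = l * F.[s'] by apply: (mulfI A0); rewrite E /l; field.
have El' : G.[s] = l * F.[s] by rewrite divfK.
have EJ x : (tf D (bra f g)).[x] = 2 * (F.[x] * (G - l *: F)^`().[x] - F^`().[x] * (G - l *: F).[x]).
 by rewrite tfJ_at // -/F -/G Ed1 Ed2 !(derivB, derivZ) !(hornerD, hornerN, hornerZ); ring.
have Q0 x : G.[x] = l * F.[x] -> (tf D (bra f g)).[x] = 0 -> F.[x] != 0 -> (G - l *: F).[x] = 0 /\ ((G - l *: F)^`()).[x] = 0.
 move=> E1 E2 E3; have Z : (G - l *: F).[x] = 0 by rewrite !(hornerD, hornerN, hornerZ) E1 subrr.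
 split; move/eqP: E2; rewrite EJ Z mulr0 subr0 !mulf_eq0 pnatr_eq0 (negPf E3) => /eqP //.
have [Z1 Z2] := Q0 s El' Es A0; have [Z3 _] := Q0 s' El Es' A0'.
have ZQ : G - l *: F = 0.
 apply: two_roots_eq0 Nss _ Z1 Z2 Z3; apply: leq_trans (size_polyD _ _) _; rewrite size_polyN geq_max.
 by rewrite (leq_trans (size_scale_leq _ _)) ?Sf ?Ed1 // andbT; have := size_tf d2 g; rewrite {2}Ed2.
have : tf D (bra f g) = 0.
 have EG : tf d2 g = l *: tf d1 f by apply: subr0_eq.
 by rewrite (tfJ Hd1 (ltnW Hd2) Hf Hg) EG derivZ Ed1 Ed2 -!mul_polyC; ring.
by move=> Z; move: SJ; rewrite Z size_poly0.
Qed.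

Lemma hess_det (a b c : C) : (forall m, a + m * b = 0 -> b + m * c = 0 -> False) -> (b = 0 -> c = 0 -> False) -> a * c - b * b != 0.
Proof.
move=> H1 H2; apply/eqP => E; have [c0|c0] := eqVneq c 0.
 by apply: H2; move/eqP: E; rewrite c0 mulr0 sub0r oppr_eq0 mulf_eq0 orbb => /eqP.
apply: (H1 (- b / c)); last by field.
by apply: (mulIf c0); rewrite mul0r -E; field.
Qed.
Lemma hess_iso (a b c x y : C) : (forall m, a + 2 * m * b + m ^+ 2 * c = 0 -> x + m * y = 0 -> False) -> (c = 0 -> y = 0 -> False) ->
 (x != 0) || (y != 0) -> a * y ^+ 2 - 2 * b * x * y + c * x ^+ 2 != 0.
Proof.
move=> H1 H2 H3; apply/eqP => E; have [y0|y0] := eqVneq y 0.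
 move: H3 E; rewrite y0 eqxx orbF expr0n !mulr0 subr0 add0r => x0 /eqP; rewrite mulf_eq0 expf_eq0 (negPf x0) orbF => /eqP c0.
 exact: H2.
apply: (H1 (- x / y)); last by field.
by apply: (mulIf (expf_neq0 2 y0)); rewrite mul0r -E; field.
Qed.
Lemma hess_image (a b c x y : C) : a * c - b * b != 0 -> (x != 0) || (y != 0) -> (a * y - b * x != 0) || (b * y - c * x != 0).
Proof.
move=> N H; rewrite -negb_and; apply/negP => /andP[/eqP E1 /eqP E2].
have Ex : (a * c - b * b) * x = 0 by transitivity (b * (a * y - b * x) - a * (b * y - c * x)); [ring|rewrite E1 E2 !mulr0 subrr].
have Ey : (a * c - b * b) * y = 0 by transitivity (c * (a * y - b * x) - b * (b * y - c * x)); [ring|rewrite E1 E2 !mulr0 subrr].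
by move: H; move/eqP: Ex; rewrite mulf_eq0 (negPf N) /= => ->; move/eqP: Ey; rewrite mulf_eq0 (negPf N) /= => ->.
Qed.

Lemma tops_dy f g p : dgl d1 f -> tops f g -> d1 = 1%N -> pev p (dy f) != 0.
Proof.
move=> Hf [_ Sf _ _ _] E; have Hf1 : dgl 1 f by rewrite -E.
have [c Ec] := dgl0E (dgl_dy Hf1); rewrite Ec pevC.
have := lead_coef_eq0 (tf d1 f); rewrite lead_coefE Sf /= -size_poly_eq0 Sf E => /negbT.
by have := congr1 (fun P : {poly C} => P`_0) (tf_dy 0 f); rewrite Ec tf_cst coefC coef_deriv mulr1n => <-.
Qed.
Lemma tops_dnz f g p : dgl d1 f -> tops f g -> d1 = 1%N -> dnz f p.
Proof. by move=> Hf Ht E; rewrite /dnz (tops_dy p Hf Ht E) orbT. Qed.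
Lemma tops_slope1 f p : dgl 1 f -> pev p (dy f) != 0 -> (tf 1 f).[pev p (dx f) / - pev p (dy f)] = 0.
Proof.
move=> Hf y0; set s := _ / _.
have [H1 <-] := rst_slope p s Hf; have := deriv_rst p (1, s) f => /(congr1 (fun P => P.[0])).
rewrite horner_rst !mul0r !addr0 -spair horner_coef0 coef_deriv mulr1n => ->.
rewrite /= pevD !pevM !pevC /s; field; rewrite //.
Qed.

Definition crit_ok f g := forall p, ~~ dnz f p -> [/\ dnz g p,
 pev p (dx (dx f)) * pev p (dy (dy f)) - pev p (dx (dy f)) * pev p (dx (dy f)) != 0 &
 pev p (dx (dx f)) * pev p (dy g) ^+ 2 - 2 * pev p (dx (dy f)) * pev p (dx g) * pev p (dy g) + pev p (dy (dy f)) * pev p (dx g) ^+ 2 != 0].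
Lemma gen_crit : generally crit_ok.
Proof.
have [Hd|Hd] := ltnP 1 d1.
 have H := gen_and (NG(negl_crit2)) (gen_and (NG(negl_crit_tangent))
  (gen_and (NG(negl_crit_vertical)) (gen_and (NG(negl_degenerate)) (NG(negl_degenerate_vertical))))).
 refine (gen_imp H _); clear H; move=> f g Hf Hg [N1 [N2 [N3 [N4 N5]]]] p Np.
 have Ng : dnz g p by apply/negPn/negP => M; apply: N1; exists p.
 split=> //.
  by apply: hess_det => [m E1 E2|E1 E2]; [apply: N4; exists p, m|apply: N5; exists p].
 by apply: hess_iso => // [m E1 E2|E1 E2]; [apply: N2; exists p, m|apply: N3; exists p].
refine (gen_imp gen_tops _) => f g Hf Hg Ht p; rewrite (tops_dnz p Hf Ht) //.
by apply/eqP; rewrite eqn_leq Hd.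
Qed.

Lemma ndnz f p : ~~ dnz f p -> pev p (dx f) = 0 /\ pev p (dy f) = 0.
Proof. by rewrite negb_or !negbK => /andP[/eqP -> /eqP ->]. Qed.

(** At a critical point of f the gradient of J is the Hessian of f applied to the rotated gradient
    of g, nonzero as the Hessian is nondegenerate. *)
Lemma gen_smooth : generally (fun f g => forall p, pev p (bra f g) = 0 -> dnz (bra f g) p).
Proof.
refine (gen_imp (gen_and gen_crit (NG(negl_singular))) _) => f g Hf Hg [H1 H2] p E.
have [Hp|Hp] := boolP (dnz f p).
 by apply/negPn/negP => /ndnz[E1 E2]; apply: H2; exists p.
have [Ng Hdet _] := H1 p Hp; have [fx fy] := ndnz Hp.
have := hess_image Hdet Ng; rewrite /dnz pev_dx_bra pev_dy_bra fx fy -(dxydyx f) !mul0r !addr0.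
by [].
Qed.

Lemma prop_dir (a b x y : C) : (a != 0) || (b != 0) -> a * y - b * x = 0 -> exists m, x = m * a /\ y = m * b.
Proof.
move=> H E; have [a0|a0] := eqVneq a 0.
 have b0 : b != 0 by move: H; rewrite a0 eqxx.
 by exists (y / b); split; [apply: (mulfI b0); move: E; rewrite a0 mul0r sub0r mulr0 => /eqP; rewrite oppr_eq0 => /eqP ->; rewrite mulr0|field].
exists (x / a); split; first by field.
by apply: (mulfI a0); move/eqP: E; rewrite subr_eq0 => /eqP ->; field.
Qed.

Lemma pev_bra2 p f g : pev p (bra f (bra f g)) = hess g p (- pev p (dy f), pev p (dx f)) +
 pev p (dx f) * (pev p (dx (dy f)) * pev p (dy g) - pev p (dy (dy f)) * pev p (dx g)) -
 pev p (dy f) * (pev p (dx (dx f)) * pev p (dy g) - pev p (dx (dy f)) * pev p (dx g)).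
Proof.
rewrite pev_bra pev_dx_bra pev_dy_bra /hess /= -(dxydyx f) -(dxydyx g).
move: (pev p (dx f)) (pev p (dy f)) (pev p (dx g)) (pev p (dy g)) => a b c d.
move: (pev p (dx (dx f))) (pev p (dx (dy f))) (pev p (dy (dy f))) (pev p (dx (dx g))) (pev p (dx (dy g))) (pev p (dy (dy g))) => *; ring.
Qed.

Lemma hess_top u p (v : C * C) : dgl 2 u -> v.1 != 0 -> hess u p v = 2 * v.1 ^+ 2 * (tf 2 u).[v.2 / v.1].
Proof.
move=> Hu v0; set s := v.2 / v.1.
have [H1 H2] := rst_slope p s Hu; rewrite -H2.
have := congr1 (fun P => P.[0]) (congr1 (@deriv C) (deriv_rst p (1, s) u)).
rewrite [in X in _ = X -> _]deriv_rst horner_rst !mul0r !addr0 -spair /=.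
have -> : ((rst p (1, s) u)^`()^`()).[0] = 2 * (rst p (1, s) u)`_2.
 by rewrite horner_coef0 !coef_deriv mulr_natl.
rewrite !mul1r !(dxD, dyD, dxM, dyM, dxC, dyC, mul0r, add0r) !(pevD, pevM, pevC) -(dxydyx u) => E.
rewrite (_ : 2 * _ * _ = v.1 ^+ 2 * (2 * (rst p (1, s) u)`_2)); last by ring.
by rewrite E /hess /s; field.
Qed.
Lemma hess_top_vert u p (v : C * C) : dgl 2 u -> v.1 = 0 -> hess u p v = 2 * v.2 ^+ 2 * (tf 2 u)`_2.
Proof.
move=> Hu v0; have [H1 H2] := rst_vert p Hu; rewrite -H2.
have := congr1 (fun P => P.[0]) (congr1 (@deriv C) (deriv_rst p (0, 1) u)).
rewrite [in X in _ = X -> _]deriv_rst horner_rst !mul0r !addr0 -spair /=.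
have -> : ((rst p (0, 1) u)^`()^`()).[0] = 2 * (rst p (0, 1) u)`_2.
 by rewrite horner_coef0 !coef_deriv mulr_natl.
rewrite !add0r !mul1r => E.
rewrite (_ : 2 * _ * _ = v.2 ^+ 2 * (2 * (rst p (0, 1) u)`_2)); last by ring.
by rewrite E /hess v0; ring.
Qed.

Definition flat_ok f g := forall p, dnz f p -> pev p (bra f g) = 0 -> pev p (bra f (bra f g)) = 0 -> pev p (bra f (bra f (bra f g))) != 0.
(** For d2 = 2 the quadric tests fail only if the Hessian of f vanishes along the tangent of its
    fibre. Since dg = m df at p, the second equation then makes the Hessian of g vanish there too,
    and f0 and g0 share a root; for d1 = 1 the root of f0 is the direction of the fibre itself. *)
Lemma gen_flat : generally flat_ok.
Proof.
have [Hd3|Hd3] := ltnP 2 d2.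
 refine (gen_imp (NG(negl_flat)) _) => f g _ _ N p H1 H2 H3.
 by apply/eqP => H4; apply: N; exists p.
have Ed2 : d2 = 2%N by apply/eqP; rewrite eqn_leq Hd3.
have Hd12' : (d1 <= 2)%N by rewrite -Ed2.
refine (gen_imp (gen_and gen_tops (NG(negl_flat_quadric))) _) => f g Hf Hg [Ht N] p Hp E1 E2.
have Hf2 : dgl 2 f by apply: dgl_mono Hf.
have Hg2 : dgl 2 g by rewrite -Ed2.
have [Hh|Hh] := eqVneq (hess f p (- pev p (dy f), pev p (dx f))) 0; last by apply/eqP => E3; apply: N; exists p.
exfalso; have [m [Em1 Em2]] := prop_dir Hp (etrans (esym (pev_bra p f g)) E1).
have Hg0 : hess g p (- pev p (dy f), pev p (dx f)) = 0.
 move: E2 Hh; rewrite pev_bra2 Em1 Em2 /hess /=; set a := pev p (dx f); set b := pev p (dy f).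
 have K x y z : y = 0 -> z = 0 -> x = y + m * z -> x = 0 by move=> -> -> ->; rewrite mulr0 addr0.
 by move=> E2 Hh; apply: (K _ _ _ E2 Hh); ring.
have [Sf Sf1 Sf2] : [/\ size (tf d1 f) = d1.+1, forall s, (tf d1 f).[s] = 0 -> (tf d2 g).[s] != 0 & dgl d1 f] by case: Ht.
have Hfy : d1 = 1%N -> pev p (dy f) != 0.
 by move=> Ed1; have := tops_dnz p Hf Ht Ed1; have := tops_dy p Hf Ht Ed1.
have [Ed1|Ed1] : d1 = 1%N \/ d1 = 2%N by move: Hd1 Hd12'; case: (d1) => [|[|[|]]]; auto.
 have y0 := Hfy Ed1; move: Hg0; rewrite hess_top ?oppr_eq0 //= => /eqP.
 have := Sf1 (pev p (dx f) / - pev p (dy f)); rewrite Ed2 Ed1 => K; rewrite !mulf_eq0 oppr_eq0 (negPf y0) pnatr_eq0 /=.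
 apply/negP; apply: K; apply: tops_slope1 => //; rewrite -Ed1; exact: Sf2.
have Hf2' : forall s, (tf 2 f).[s] = 0 -> (tf 2 g).[s] != 0 by move=> s; have := Sf1 s; rewrite Ed1 Ed2.
have [y0|y0] := eqVneq (pev p (dy f)) 0; last first.
 move: Hh Hg0; rewrite !hess_top ?oppr_eq0 //= => /eqP + /eqP.
 by rewrite !mulf_eq0 !oppr_eq0 (negPf y0) !pnatr_eq0 => /eqP/Hf2'/negPf ->.
have x0 : pev p (dx f) != 0 by move: Hp; rewrite /dnz y0 eqxx orbF.
move/eqP: Hh; rewrite hess_top_vert ?y0 ?oppr0 //= !mulf_eq0 (negPf x0) pnatr_eq0 => /eqP Z.
by have := lead_coef_eq0 (tf d1 f); rewrite lead_coefE -size_poly_eq0 Sf Ed1 Z eqxx.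
Qed.

Definition turn_ok f g := forall p, pev p (bra f g) = 0 -> pev p (bra f (bra f g)) = 0 -> pev p (bra (bra f (bra f g)) (bra f g)) != 0.
(** A zero of T on J = 0 where df is nonzero has dJ = l df with l nonzero, so the bracket with J is
    that with f up to a nonzero factor, and [flat_ok] applies. At a critical point of f the value is
    the Hessian determinant times the Hessian on the tangent of the fibre of g. *)
Lemma gen_turn : generally turn_ok.
Proof.
refine (gen_imp (gen_and gen_crit (gen_and gen_smooth gen_flat)) _) => f g Hf Hg [H1 [H2 H3]] p E1 E2.
have [Hp|Hp] := boolP (dnz f p).
 have [l [El1 El2]] := prop_dir Hp (etrans (esym (pev_bra p f (bra f g))) E2).
 have l0 : l != 0 by apply/eqP => l0; have := H2 p E1; rewrite /dnz El1 El2 l0 !mul0r eqxx.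
 rewrite pev_bra El1 El2 (_ : _ - _ = - l * pev p (bra f (bra f (bra f g)))); last by rewrite [in RHS]pev_bra; ring.
 by rewrite mulf_neq0 ?oppr_eq0 ?H3.
have [Ng Hdet Hiso] := H1 p Hp; have [fx fy] := ndnz Hp.
rewrite pev_bra (pev_dx_bra f (bra f g)) (pev_dy_bra f (bra f g)) pev_dx_bra pev_dy_bra fx fy -(dxydyx f) !mul0r !addr0.
move: (mulf_neq0 Hdet Hiso); congr (_ != 0).
move: (pev p (dx (dx f))) (pev p (dx (dy f))) (pev p (dy (dy f))) (pev p (dx g)) (pev p (dy g)) => *; ring.
Qed.

Lemma crit_dual f g p : crit_ok f g -> ~~ dnz f p -> pev p (bra g (bra f g)) != 0.
Proof.
move=> H Hp; have [Ng Hdet Hiso] := H p Hp; have [fx fy] := ndnz Hp.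
rewrite pev_bra pev_dx_bra pev_dy_bra fx fy -(dxydyx f) !mul0r !addr0.
move: Hiso; rewrite -oppr_eq0; congr (_ != 0); ring.
Qed.

Lemma der_relation (X : P2 -> P2) (e : P2 -> C) : (forall u v, X (u + v) = X u + X v) -> (forall u v, X (u * v) = u * X v + X u * v) ->
 (forall u v, e (u + v) = e u + e v) -> (forall u v, e (u * v) = e u * e v) -> forall a b c G T J : P2,
 a * G + c * J = b * T -> X J = 0 -> e J = 0 -> e T = 0 -> e G = 0 ->
 e a * e (X G) = e b * e (X T) /\ e a * e (X (X G)) + 2 * e (X a) * e (X G) = e b * e (X (X T)) + 2 * e (X b) * e (X T).
Proof.
move=> XD XM eD eM a b c G T J E XJ eJ eT eG.
have X0 : X 0 = 0 by apply: (addIr (X 0)); rewrite -XD !add0r.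
have e0 : e 0 = 0 by apply: (addIr (e 0)); rewrite -eD !add0r.
have E1 := congr1 (fun u => e (X u)) E; have E2 := congr1 (fun u => e (X (X u))) E.
rewrite !(XM, XD) XJ ?X0 !(eM, eD) e0 eJ eT eG !mulr0 !addr0 in E1 E2.
split=> //; transitivity (e a * e (X (X G)) + e (X a) * e (X G) + e (X a) * e (X G)); first by ring.
by rewrite E2; ring.
Qed.

Lemma cusp_alg (a b fxx fxy fyy gxx gxy gyy l m GX TX GXX TXX : C) :
 l * a = fxx * (m * b) + a * gxy - (fxy * (m * a) + b * gxx) ->
 l * b = fxy * (m * b) + a * gyy - (fyy * (m * a) + b * gxy) ->
 TX != 0 -> l != 0 -> (a != 0) || (b != 0) -> a * GX = m * a * TX ->
 a * GXX + 2 * (fxx * (l * b) - fxy * (l * a)) * GX = m * a * TXX + 2 * (gxx * (l * b) - gxy * (l * a)) * TX ->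
 b * GX = m * b * TX ->
 b * GXX + 2 * (fxy * (l * b) - fyy * (l * a)) * GX = m * b * TXX + 2 * (gxy * (l * b) - gyy * (l * a)) * TX ->
 TX * GXX - GX * TXX != 0.
Proof.
have addrK' (x y z : C) : x + y = z -> x = z - y by move=> <-; rewrite addrK.
move=> Jx Jy T0 l0 Hp Ax1 Ax2 Ay1 Ay2.
have EG : GX = m * TX.
 case/orP: Hp => N0; first by apply: (mulfI N0); rewrite Ax1; ring.
 by apply: (mulfI N0); rewrite Ay1; ring.
apply/eqP => E.
have K c d j : c != 0 -> j = l * c -> c * (TX * GXX - GX * TXX) = d * TX ^+ 2 -> d = - 2 * l * j -> False.
 move=> c0 -> ; rewrite E mulr0 => /esym/eqP; rewrite mulf_eq0 expf_eq0 (negPf T0) orbF => /eqP -> /esym/eqP.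
 by rewrite !mulf_eq0 oppr_eq0 pnatr_eq0 (negPf l0) (negPf c0).
case/orP: Hp => N0.
 apply: (K a (2 * ((gxx - m * fxx) * (l * b) - (gxy - m * fxy) * (l * a))) (l * a) N0 erefl); last first.
  by rewrite [in RHS]Jx; ring.
 have -> : a * (TX * GXX - GX * TXX) = TX * (a * GXX) - a * GX * TXX by ring.
 have -> : a * GXX = m * a * TXX + 2 * (gxx * (l * b) - gxy * (l * a)) * TX - 2 * (fxx * (l * b) - fxy * (l * a)) * GX.
  by rewrite (addrK' _ _ _ Ax2); ring.
 by rewrite EG; ring.
apply: (K b (2 * ((gxy - m * fxy) * (l * b) - (gyy - m * fyy) * (l * a))) (l * b) N0 erefl); last first.
 by rewrite [in RHS]Jy; ring.
have -> : b * (TX * GXX - GX * TXX) = TX * (b * GXX) - b * GX * TXX by ring.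
have -> : b * GXX = m * b * TXX + 2 * (gxy * (l * b) - gyy * (l * a)) * TX - 2 * (fxy * (l * b) - fyy * (l * a)) * GX.
 by rewrite (addrK' _ _ _ Ay2); ring.
by rewrite EG; ring.
Qed.

(** The relation f_x {g, J} + J_x {f, g} = g_x {f, J}, its analogue in y, and their first two
    derivatives along J = 0 give the value -2 l^2 {T, J}^2 for the determinant, where dJ = l df at
    p. *)
Lemma cusp_det f g p : crit_ok f g -> turn_ok f g -> (forall p, pev p (bra f g) = 0 -> dnz (bra f g) p) ->
 pev p (bra f g) = 0 -> pev p (bra f (bra f g)) = 0 -> pev p (bra g (bra f g)) = 0 ->
 pev p (dl (bra f g) 2 f) * pev p (dl (bra f g) 3 g) - pev p (dl (bra f g) 2 g) * pev p (dl (bra f g) 3 f) != 0.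
Proof.
move=> H1 H2 H3 E1 E2 E3; have Hp : dnz f p by apply/negPn/negP => /(crit_dual H1); rewrite E3 eqxx.
have [l [El1 El2]] := prop_dir Hp (etrans (esym (pev_bra p f (bra f g))) E2).
have l0 : l != 0 by apply/eqP => l0; have := H3 p E1; rewrite /dnz El1 El2 l0 !mul0r eqxx.
have [m [Em1 Em2]] := prop_dir Hp (etrans (esym (pev_bra p f g)) E1).
have T0 := H2 p E1 E2.
have Rx j : dx f * bra g j + dx j * bra f g = dx g * bra f j by rewrite /bra; ring.
have Ry j : dy f * bra g j + dy j * bra f g = dy g * bra f j by rewrite /bra; ring.
have Jx := pev_dx_bra f g p; have Jy := pev_dy_bra f g p.
have DR := der_relation (fun u v => braDl u v (bra f g)) (fun u v => braMl u v (bra f g)) (pevD p) (pevM p).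
have [Ax1 Ax2] := DR _ _ _ _ _ _ (Rx (bra f g)) (braxx _) E1 E2 E3.
have [Ay1 Ay2] := DR _ _ _ _ _ _ (Ry (bra f g)) (braxx _) E1 E2 E3.
clear DR Rx Ry; rewrite /=.
have DfX := pev_bra p (dx f) (bra f g); have DgX := pev_bra p (dx g) (bra f g).
have DfY := pev_bra p (dy f) (bra f g); have DgY := pev_bra p (dy g) (bra f g).
rewrite El1 El2 -?(dxydyx f) -?(dxydyx g) in Jx Jy DfX DgX DfY DgY.
rewrite Em1 Em2 in Jx Jy Ax1 Ax2 Ay1 Ay2.
rewrite DfX DgX in Ax2; rewrite DfY DgY in Ay2.
exact: (cusp_alg Jx Jy T0 l0 Hp Ax1 Ax2 Ay1 Ay2).
Qed.

End Generic.

Opaque bra.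

(** * Generic pairs: double and triple points *)

Section Pairs.
Variable C : cField.
Local Notation P2 := (mpoly 2 C).
Variables (d1 d2 : nat).
Hypotheses (Hd1 : (0 < d1)%N) (Hd12 : (d1 <= d2)%N) (Hd2 : (1 < d2)%N).
Local Notation D := (d1.-1 + d2.-1)%N.
Implicit Types (p q r : C * C) (f g u v : P2).
Local Notation generally := (@generally C d1 d2).
Local Notation tops := (@tops C d1 d2).
Local Notation crit_ok := (@crit_ok C).

Local Notation "'NG(' L ')'" := (@gen_not C d1 d2 _ (ltac:(by apply: L))) (only parsing).
Definition same_image f g p q := [/\ p != q, pev p (bra f g) = 0, pev q (bra f g) = 0, pev p f = pev q f & pev p g = pev q g].
Lemma same_imC f g p q : same_image f g p q -> same_image f g q p.
Proof. by move=> [H1 H2 H3 H4 H5]; split=> //; rewrite eq_sym. Qed.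

Lemma double_roots (Q : {poly C}) rs : uniq rs -> (forall x, x \in rs -> Q.[x] = 0 /\ (Q^`()).[x] = 0) -> Q != 0 ->
 ((size rs).*2 < size Q)%N.
Proof.
elim: rs Q => [|x rs IH] Q /=; first by rewrite size_poly_gt0.
move=> /andP[Nx U] H Q0; have [E1 E2] := H x (mem_head _ _).
have /factor_theorem[S ES] : root Q x by apply/eqP.
have S1 : S.[x] = 0 by move: E2; rewrite ES derivM derivXsubC mulr1 hornerD hornerM hornerXsubC subrr mulr0 add0r.
have /factor_theorem[T ET] : root S x by apply/eqP.
have EQ : Q = T * ('X - x%:P) ^+ 2 by rewrite ES ET mulrA.
have T0 : T != 0 by apply: contraNneq Q0 => Z; rewrite EQ Z mul0r.
have -> : size Q = (size T).+2.
 by rewrite EQ size_Mmonic ?monic_exp ?monicXsubC // size_exp_XsubC addn3.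
rewrite doubleS; apply: IH => // y Hy; have [Z1 Z2] := H y (mem_behead (s := x :: rs) Hy).
have yx : y - x != 0 by rewrite subr_eq0; apply: contraNneq Nx => <-.
have Ty : T.[y] = 0.
 by move/eqP: Z1; rewrite EQ hornerM horner_exp hornerXsubC mulf_eq0 expf_eq0 (negPf yx) orbF => /eqP.
split=> //; move/eqP: Z2; rewrite EQ derivM hornerD !hornerM Ty !mul0r addr0 hornerXsubC.
by rewrite !mulf_eq0 (negPf yx) !orbF => /eqP.
Qed.

Section Linear.
Hypothesis E1 : d1 = 1%N.

(** For f of degree one a fibre is a line on which J is a constant times the derivative of g. Points
    with equal image are double zeros of g minus a constant there, so they number at most d2 / 2. *)
Lemma linear_fibre f g p rs : dgl d1 f -> dgl d2 g -> tops f g -> uniq (p :: rs) -> pev p (bra f g) = 0 ->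
 (forall q, q \in rs -> same_image f g p q) -> ((size rs).*2.+1 < d2)%N.
Proof.
move=> Hf Hg Ht U Jp H; have Hf1 : dgl 1 f by rewrite -E1.
have y0 := tops_dy p Hf Ht E1; set s := pev p (dx f) / - pev p (dy f).
have Fs : (tf 1 f).[s] = 0 := tops_slope1 Hf1 y0.
have Gs : (tf d2 g).[s] != 0 by case: Ht => _ _ K _ _; apply: K; rewrite E1.
have [cx Ecx] := dgl0E (dgl_dx Hf1); have [cy Ecy] := dgl0E (dgl_dy Hf1).
have cy0 : cy != 0 by move: y0; rewrite Ecy pevC.
have Es : cx = - cy * s by rewrite /s Ecx Ecy !pevC; field.
set P := rst p (1, s) g; have [SP CP] := rst_slope p s Hg; rewrite -/P in SP CP.
have dP t : (P^`()).[t] = - cy^-1 * pev (p.1 + t * 1, p.2 + t * s) (bra f g).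
 rewrite deriv_rst horner_rst pev_bra pevD !pevM Ecx Ecy !pevC Es /=; field.
 by rewrite cy0.
have onl q : pev p f = pev q f -> q = (p.1 + (q.1 - p.1) * 1, p.2 + (q.1 - p.1) * s).
 move=> Ef; have := affine_diff p q Hf1; rewrite Ef subrr Ecx Ecy !pevC Es => K.
 have E2 : q.2 = p.2 + (q.1 - p.1) * s.
  apply: (mulfI cy0); apply/eqP; rewrite -subr_eq0; apply/eqP; rewrite [RHS]K; ring.
 by rewrite mulr1 subrKC -E2 -spair.
set ts := [seq q.1 - p.1 | q <- p :: rs].
have inj : {in p :: rs &, injective (fun q => q.1 - p.1)}.
 have He q : q \in p :: rs -> pev p f = pev q f by rewrite inE => /orP[/eqP ->|/H[]].
 by move=> q q' /He/onl -> /He/onl ->; rewrite /= => /(addIr _) ; rewrite !mulr1 => /(addrI _) ->.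
have Uts : uniq ts by rewrite map_inj_in_uniq.
have Q0 : P - (pev p g)%:P != 0.
 rewrite subr_eq0; apply/eqP => Z; move: CP Gs; rewrite Z coefC => <-.
 by move: Hd2; case: (d2) => // n _; rewrite eqxx.
have := double_roots Uts _ Q0; rewrite size_map /= => K.
have : ((size rs).+1.*2 < d2.+1)%N.
 apply: leq_trans (K _) _.
  move=> x /mapP[q Hq ->]; rewrite derivB derivC subr0 dP hornerD hornerN hornerC horner_rst.
  have Ef : pev p f = pev q f by move: Hq; rewrite inE => /orP[/eqP ->|/H[]].
  have Eg : pev p g = pev q g by move: Hq; rewrite inE => /orP[/eqP ->|/H[]].
  have EJ : pev q (bra f g) = 0 by move: Hq; rewrite inE => /orP[/eqP ->|/H[]].
  by rewrite -(onl q Ef) Eg EJ subrr mulr0.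
 apply: leq_trans (size_polyD _ _) _; rewrite geq_max SP size_polyN.
 by apply: leq_trans (size_polyC_leq1 _) _.
by rewrite doubleS.
Qed.
End Linear.

(** On the line through p and q both quadrics take equal values at p and q, so their derivatives
    along it vanish at the midpoint and J vanishes there. The conic J = 0 then contains the line
    and, J0 having a simple zero in its direction, has a singular point on it. *)
Lemma quadric_fibre f g p q : d1 = 2%N -> d2 = 2%N -> dgl d1 f -> dgl d2 g -> tops f g -> (forall p, pev p (bra f g) = 0 -> dnz (bra f g) p) ->
 ~ same_image f g p q.
Proof.
move=> Ed1 Ed2 Hf Hg [SJ _ _ _ [_ _ Hsep]] Hsm [N Jp Jq Ef Eg].
have ED : D = 2%N by rewrite Ed1 Ed2.
have HJ : dgl 2 (bra f g) by rewrite -ED; exact: (dglJ Hd1 (ltnW Hd2) Hf Hg).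
have [w [h [Eq W0 SW]]] : exists w h, [/\ q = (p.1 + h * w.1, p.2 + h * w.2), w = (1, w.2) \/ w = (0, 1) & forall u, dgl 2 u -> (size (rst p w u) <= 3)%N].
 have [E|E] := eqVneq (q.1 - p.1) 0.
  exists (0, 1), (q.2 - p.2); split; [|by right|by move=> u /(rst_vert p)[]].
  by rewrite mulr0 mulr1 addr0 subrKC; move/eqP: E; rewrite subr_eq0 => /eqP <-; rewrite -spair.
 exists (1, (q.2 - p.2) / (q.1 - p.1)), (q.1 - p.1); split; [|by left|by move=> u Hu; have [] := rst_slope p ((q.2 - p.2) / (q.1 - p.1)) Hu].
 by rewrite mulr1 mulrC divfK // !subrKC -spair.
have h0 : h != 0 by apply: contraNneq N => Z; rewrite Eq Z !mul0r !addr0 -spair.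
have quad (P : {poly C}) : (size P <= 3)%N -> forall x, P.[x] = P`_0 + P`_1 * x + P`_2 * x ^+ 2 /\ (P^`()).[x] = P`_1 + 2 * P`_2 * x.
 move=> HP x; rewrite (horner_coef_wide _ HP) (horner_coef_wide (n := 2)).
  by rewrite !big_ord_recr !big_ord0 /= !coef_deriv; split; ring.
 by apply: leq_trans (size_poly _ _) _; rewrite -ltnS (leq_trans (leqSpred _)); case: (size P) HP.
have mid u : dgl 2 u -> pev p u = pev q u -> ((rst p w u)^`()).[h / 2] = 0.
 move=> Hu E; have Q := quad _ (SW u Hu); have [A0 _] := Q 0; have [A1 _] := Q h; have [_ ->] := Q (h / 2).
 have K : h * ((rst p w u)`_1 + (rst p w u)`_2 * h) = 0.
  move: A0 A1; rewrite !horner_rst !mul0r !addr0 -spair -Eq -E => -> A; apply: (addrI (rst p w u)`_0).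
  move: A; rewrite mulr0 expr0n mulr0 !addr0 => A; rewrite [RHS]A; ring.
 by move/eqP: K; rewrite mulf_eq0 (negPf h0) => /eqP K; rewrite -[RHS]K; field.
have Hf2 : dgl 2 f by rewrite -Ed1.
have Hg2 : dgl 2 g by rewrite -Ed2.
set m := (p.1 + h / 2 * w.1, p.2 + h / 2 * w.2).
have Jm : pev m (bra f g) = 0.
 have := mid g Hg2 Eg; have := mid f Hf2 Ef; rewrite pev_bra !deriv_rst !horner_rst -/m !pevD !pevM !pevC.
 move: (pev m (dx f)) (pev m (dy f)) (pev m (dx g)) (pev m (dy g)) => a b c d.
 case: W0 => -> /=; rewrite ?mul1r ?mul0r ?add0r => /eqP + /eqP.
  rewrite !addr_eq0 => /eqP -> /eqP ->; ring.
 by move=> /eqP -> /eqP ->; ring.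
have UJ : rst p w (bra f g) = 0.
 apply/eqP/negPn/negP => U0.
 have h2 : h / 2 != h.
  by rewrite -subr_eq0 (_ : h / 2 - h = - (h / 2)) ?oppr_eq0 ?mulf_neq0 ?invr_eq0 ?pnatr_eq0 //; field.
 have := @max_poly_roots _ (rst p w (bra f g)) [:: 0; h / 2; h] U0.
 rewrite /= !inE /root !horner_rst Jm -Eq Jq !mul0r !addr0 -spair Jp eqxx /=.
 rewrite ![0 == _]eq_sym mulf_eq0 (negPf h0) h2 invr_eq0 pnatr_eq0 => /(_ isT isT).
 by rewrite ltnNge SW.
case: W0 => Ew; last first.
 have [_ K] := rst_vert p HJ; move: K; rewrite -Ew UJ coef0 => K.
 by have := lead_coef_eq0 (tf D (bra f g)); rewrite lead_coefE -size_poly_eq0 SJ ED -K eqxx.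
set s := w.2 in Ew; have [_ K] := rst_slope p s HJ; rewrite -Ew UJ coef0 in K.
have Ks : ((tf D (bra f g))^`()).[s] != 0 by apply: Hsep; rewrite ED.
have [S1 C1] := rst_slope p s (dgl_dy HJ); rewrite -Ew in S1 C1.
rewrite ED -tf_dy -C1 in Ks.
set P := rst p w (dy (bra f g)) in S1 C1 Ks; set t := - P`_0 / P`_1.
have Pt : P.[t] = 0.
 by rewrite (horner_coef_wide _ S1) !big_ord_recl big_ord0 /t; field.
set z := (p.1 + t * w.1, p.2 + t * w.2).
have zy : pev z (dy (bra f g)) = 0 by rewrite -horner_rst.
have zx : pev z (dx (bra f g)) = 0.
 have := deriv_rst p w (bra f g); rewrite UJ deriv0 => /(congr1 (fun P => P.[t])).
 by rewrite horner0 horner_rst -/z pevD !pevM !pevC zy mulr0 addr0 Ew mul1r.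
have zJ : pev z (bra f g) = 0 by rewrite -horner_rst UJ horner0.
by have := Hsm z zJ; rewrite /dnz zx zy eqxx.
Qed.

(** Two critical points on one level are excluded by a cubic test when d1 > 2. For d1 = 2 the
    gradient of f is affine, and two critical points would put q - p in the kernel of the
    Hessian. *)
Lemma gen_pair_dnz : generally (fun f g => forall p q, same_image f g p q -> dnz f p).
Proof.
have [Hd|Hd] := ltnP 1 d1; last first.
 refine (gen_imp (gen_tops C Hd1 Hd2) _) => f g Hf Hg Ht p q _; apply: tops_dnz Hf Ht _.
 by apply/eqP; rewrite eqn_leq Hd.
have H0 := NG(negl_crit_pair).
have [Hd3|Hd3] := ltnP 2 d1.
 refine (gen_imp (gen_and H0 NG(negl_crit_crit)) _) => f g Hf Hg [N1 N2] p q [N Jp Jq Ef Eg].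
 apply/negPn/negP => Np; have [Hq|Hq] := boolP (dnz f q); first by apply: N1; exists p, q.
 by apply: N2; exists p, q.
refine (gen_imp (gen_and H0 (gen_crit C Hd1 Hd2)) _) => f g Hf Hg [N1 Hc] p q [N Jp Jq Ef Eg].
apply/negPn/negP => Np; have [Hq|Hq] := boolP (dnz f q); first by apply: N1; exists p, q.
have [_ Hdet _] := Hc p Np; have [px py] := ndnz Np; have [qx qy] := ndnz Hq.
have Hf2 : dgl 2 f by apply: dgl_mono Hf.
have Ax := affine_diff p q (dgl_dx Hf2); have Ay := affine_diff p q (dgl_dy Hf2).
rewrite px qx -(dxydyx f) subrr in Ax; rewrite py qy subrr in Ay.
have v0 : (- (q.2 - p.2) != 0) || (q.1 - p.1 != 0).
 rewrite oppr_eq0 !subr_eq0 -negb_and; apply: contra N => /andP[/eqP E2 /eqP E1'].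
 by rewrite [p]spair [q]spair E1' E2.
have := hess_image Hdet v0; rewrite !mulrN !opprK -Ax -Ay eqxx //.
Qed.

(** The lowest degrees have no double points at all; otherwise tests of degree 3, and of degree 4
    when d1 = 1, are available. *)
Lemma gen_pair_big : generally (fun f g => forall p q, same_image f g p q -> (2 < d2)%N /\ (d1 = 1%N -> (3 < d2)%N)).
Proof.
refine (gen_imp (gen_and (gen_tops C Hd1 Hd2) (gen_smooth C Hd1 Hd2)) _) => f g Hf Hg [Ht Hs] p q Hpq.
have Hlin : d1 = 1%N -> (3 < d2)%N.
 move=> E; have [N Jp _ _ _] := Hpq; have := @linear_fibre E f g p [:: q] Hf Hg Ht; apply=> //=; first by rewrite inE N.
 by move=> r; rewrite inE => /eqP ->.
split=> //; have [/eqP/Hlin/ltnW//|Hd] := boolP (d1 == 1%N).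
rewrite ltn_neqAle Hd2 andbT; apply/eqP => Ed2; move: Hpq; apply: quadric_fibre => //.
by apply/eqP; rewrite eqn_leq {1}Ed2 Hd12 ltn_neqAle eq_sym Hd.
Qed.

Lemma gen_pair_across : (1 < d1)%N -> (2 < d2)%N -> generally (fun f g => forall p q, same_image f g p q -> dd f p q p != 0).
Proof.
move=> Hd Hd3; refine (gen_imp (gen_and gen_pair_dnz NG(negl_along_pair)) _) => f g _ _ [Hn N] p q Hpq.
have Hp := Hn _ _ Hpq; have Hq := Hn _ _ (same_imC Hpq); have [N1 Jp Jq Ef Eg] := Hpq.
by apply/eqP => E; apply: N; exists p, q.
Qed.

Lemma dd_sym f p q r : dd f q p r = - dd f p q r.
Proof. by rewrite /dd; ring. Qed.

Lemma linear_dd f p q r : d1 = 1%N -> dgl d1 f -> pev p f = pev q f -> dd f p q r = 0.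
Proof.
move=> E Hf Ef; have Hf1 : dgl 1 f by rewrite -E.
have := affine_diff p q Hf1; rewrite Ef subrr /dd.
by have [a ->] := dgl0E (dgl_dx Hf1); have [b ->] := dgl0E (dgl_dy Hf1); rewrite !pevC => <-.
Qed.

Lemma gen_pair_turn : generally (fun f g => forall p q, same_image f g p q -> pev p (bra f (bra f g)) != 0).
Proof.
have [Hd3|Hd3] := ltnP 2 d2; last first.
 refine (gen_imp gen_pair_big _) => f g Hf Hg H p q /H[]; by rewrite ltnNge Hd3.
have [Hd|Hd] := ltnP 1 d1.
 refine (gen_imp (gen_and (gen_pair_across Hd Hd3) NG(negl_cusp_pair)) _) => f g _ _ [Hn N] p q Hpq.
 have Hp := Hn _ _ Hpq; have Hq := Hn _ _ (same_imC Hpq); have [N1 Jp Jq Ef Eg] := Hpq.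
 rewrite dd_sym oppr_eq0 in Hq.
 by apply/eqP => E; apply: N; exists p, q.
have E1 : d1 = 1%N by apply/eqP; rewrite eqn_leq Hd.
have [Hd4|Hd4] := ltnP 3 d2; last first.
 refine (gen_imp gen_pair_big _) => f g Hf Hg H p q /H[_ /(_ E1)]; by rewrite ltnNge Hd4.
refine (gen_imp (gen_and gen_pair_dnz NG(negl_cusp_pair_along)) _) => f g Hf _ [Hn N] p q Hpq.
have Hp := Hn _ _ Hpq; have Hq := Hn _ _ (same_imC Hpq); have [N1 Jp Jq Ef Eg] := Hpq.
by apply/eqP => E; apply: N; exists p, q; split=> //; split=> //; apply: linear_dd.
Qed.

Lemma gen_pair : generally (fun f g => forall p q, p != q -> pev p (bra f g) = 0 -> pev q (bra f g) = 0 ->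
  pev p f = pev q f -> pev p g = pev q g ->
  pev p (bra f (bra f g)) * pev q (bra g (bra f g)) - pev p (bra g (bra f g)) * pev q (bra f (bra f g)) != 0).
Proof.
have [Hd3|Hd3] := ltnP 2 d2; last first.
 refine (gen_imp gen_pair_big _) => f g Hf Hg H p q N1 Jp Jq Ef Eg.
 by have [|+ _] := H p q; [split|rewrite ltnNge Hd3].
(* Two nonzero covectors are both nonzero on at least one of the directions (1, 0), (0, 1), (1,
   1). *)
have HT (c1 c2 : C) := gen_not (negl_tangent Hd1 Hd2 c1 c2 Hd3).
refine (gen_imp (gen_and gen_pair_dnz (gen_and gen_pair_turn (gen_and (HT 1 0) (gen_and (HT 0 1) (HT 1 1))))) _).
move=> f g Hf Hg [Hn [Ht [N1 [N2 N3]]]] p q N Jp Jq Ef Eg.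
have Hpq : same_image f g p q by [].
have Hp := Hn _ _ Hpq; have Hq := Hn _ _ (same_imC Hpq).
have Tp := Ht _ _ Hpq; have Tq := Ht _ _ (same_imC Hpq).
have [m [mx my]] := prop_dir Hp (etrans (esym (pev_bra p f g)) Jp).
have [k [kx ky]] := prop_dir Hq (etrans (esym (pev_bra q f g)) Jq).
have Gp : pev p (bra g (bra f g)) = m * pev p (bra f (bra f g)) by rewrite !(pev_bra p) mx my; ring.
have Gq : pev q (bra g (bra f g)) = k * pev q (bra f (bra f g)) by rewrite !(pev_bra q) kx ky; ring.
rewrite Gp Gq (_ : _ - _ = pev p (bra f (bra f g)) * pev q (bra f (bra f g)) * (k - m)); last by ring.
rewrite !mulf_neq0 // subr_eq0; apply/eqP => Ekm.
have bad c1 c2 : c1 * pev p (dx f) + c2 * pev p (dy f) != 0 -> c1 * pev q (dx f) + c2 * pev q (dy f) != 0 ->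
  (exists p q, [/\ p != q, c1 * pev p (dx f) + c2 * pev p (dy f) != 0,
  c1 * pev q (dx f) + c2 * pev q (dy f) != 0, pev p f = pev q f &
  [/\ pev p g = pev q g, pev p (bra f g) = 0, pev q (bra f g) = 0 & (c1 * pev q (dx f) + c2 * pev q (dy f)) * (c1 * pev p (dx g) + c2 * pev p (dy g)) =
   (c1 * pev p (dx f) + c2 * pev p (dy f)) * (c1 * pev q (dx g) + c2 * pev q (dy g))]]).
 by move=> A B; exists p, q; split=> //; split=> //; rewrite mx my kx ky Ekm; ring.
have {}N1 := fun A B => N1 (bad _ _ A B); have {}N2 := fun A B => N2 (bad _ _ A B); have {}N3 := fun A B => N3 (bad _ _ A B).
clear -Hp Hq N1 N2 N3; move: Hp Hq N1 N2 N3; rewrite /dnz !mul0r !mul1r !addr0 !add0r.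
move: (pev p (dx f)) (pev p (dy f)) (pev q (dx f)) (pev q (dy f)) => a b a' b'.
have [->|a0] := eqVneq a 0; have [->|b0] := eqVneq b 0; have [->|a0'] := eqVneq a' 0; have [->|b0'] := eqVneq b' 0; rewrite //= ?addr0 ?add0r.
- by move=> _ _ _ H _; apply: H.
- by move=> _ _ _ _ H; apply: H.
- by move=> _ _ _ H _; apply: H.
- by move=> _ _ _ _ H; apply: H.
- by move=> _ _ H _ _; apply: H.
- by move=> _ _ H _ _; apply: H.
- by move=> _ _ _ H _; apply: H.
- by move=> _ _ H _ _; apply: H.
- by move=> _ _ H _ _; apply: H.
Qed.

Lemma collinear p q r : p != q -> p != r -> q != r -> det3 p q r = 0 -> exists x, [/\ r = lp p q x, x != 0 & x != 1].
Proof.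
move=> N1 N2 N3 E; have [a [b Hab]] := sep_dir N1.
have Er : r = lp p q (a * (r.1 - p.1) + b * (r.2 - p.2)).
 rewrite [LHS]spair; congr (_, _).
  transitivity (p.1 + (a * (q.1 - p.1) + b * (q.2 - p.2)) * (r.1 - p.1)); first by rewrite Hab; ring.
  transitivity (p.1 + (a * (r.1 - p.1) + b * (r.2 - p.2)) * (q.1 - p.1) - b * det3 p q r); first by rewrite /det3; ring.
  by rewrite E; ring.
 transitivity (p.2 + (a * (q.1 - p.1) + b * (q.2 - p.2)) * (r.2 - p.2)); first by rewrite Hab; ring.
 transitivity (p.2 + (a * (r.1 - p.1) + b * (r.2 - p.2)) * (q.2 - p.2) + a * det3 p q r); first by rewrite /det3; ring.
 by rewrite E; ring.
eexists; split; first exact: Er.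
 by apply: contraNneq N2 => Z; rewrite Er Z /lp !mul0r !addr0 -spair.
by apply: contraNneq N3 => Z; rewrite Er Z /lp !mul1r !subrKC -spair.
Qed.

Lemma gen_triple : generally (fun f g => forall p q r, p != q -> p != r -> q != r ->
  pev p (bra f g) = 0 -> pev q (bra f g) = 0 -> pev r (bra f g) = 0 ->
  pev p f = pev q f -> pev p g = pev q g -> pev p f = pev r f -> pev p g = pev r g -> False).
Proof.
have [Hd3|Hd3] := ltnP 2 d2; last first.
 refine (gen_imp gen_pair_big _) => f g Hf Hg H p q r N1 _ _ Jp Jq _ Ef Eg _ _.
 by have [|+ _] := H p q; [split|rewrite ltnNge Hd3].
have H0 := gen_and gen_pair_dnz NG(negl_triple).
have [Hd|Hd] := ltnP 1 d1.
 refine (gen_imp (gen_and H0 (gen_and (gen_pair_across Hd Hd3) NG(negl_triple_line))) _).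
 move=> f g _ _ [[Hn N] [Ha Nl]] p q r N1 N2 N3 Jp Jq Jr Ef Eg Ef' Eg'.
 have Spq : same_image f g p q by []. have Spr : same_image f g p r by [].
 have Sqr : same_image f g q r by split; congruence.
 have [E|E] := eqVneq (det3 p q r) 0; last first.
  by apply: N; exists p, q, r; split=> //; split; [exact: (Hn p q)|exact: (Hn q r)|exact: (Hn r p (same_imC Spr))].
 have [x [Er x0 x1]] := collinear N1 N2 N3 E.
 have dp := Ha _ _ Spq; have dq := Ha _ _ (same_imC Spq); have dr := Ha _ _ (same_imC Spr).
 apply: Nl; exists p, q, x; rewrite -Er; split=> //; split=> //; first by rewrite dd_sym oppr_eq0 in dq.
 apply: contraNneq dr => Z; rewrite dd_sym oppr_eq0.
 have -> : dd f p r r = x * dd f p q r by rewrite /dd {2 4}Er /=; ring.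
 by rewrite Z mulr0.
have E1 : d1 = 1%N by apply/eqP; rewrite eqn_leq Hd.
(* With f of degree one, three points with equal image need d2 >= 6, while quintic tests exist from
   d2 = 5 on. *)
have [Hd5|Hd5] := ltnP 4 d2; last first.
 refine (gen_imp (gen_tops C Hd1 Hd2) _) => f g Hf Hg Ht p q r N1 N2 N3 Jp Jq Jr Ef Eg Ef' Eg'.
 have := @linear_fibre E1 f g p [:: q; r] Hf Hg Ht; rewrite /= !inE negb_or N1 N2 N3 => /(_ isT Jp) K.
 have : (5 < d2)%N by apply: K => s; rewrite !inE => /orP[]/eqP ->.
 by move=> /ltnW; rewrite ltnNge Hd5.
refine (gen_imp (gen_and H0 NG(negl_triple_along)) _).
move=> f g Hf _ [[Hn N] Nl] p q r N1 N2 N3 Jp Jq Jr Ef Eg Ef' Eg'.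
have Spq : same_image f g p q by []. have Spr : same_image f g p r by [].
have Sqr : same_image f g q r by split; congruence.
have [np nq nr] : [/\ dnz f p, dnz f q & dnz f r] by split; [exact: (Hn p q)|exact: (Hn q r)|exact: (Hn r p (same_imC Spr))].
have [E|E] := eqVneq (det3 p q r) 0; last by apply: N; exists p, q, r.
have [x [Er x0 x1]] := collinear N1 N2 N3 E.
by apply: Nl; exists p, q, x; rewrite -Er; split=> //; split=> //; split; apply: linear_dd.
Qed.

Theorem generic_tame : generally (tame d1 d2).
Proof.
have H := gen_and (gen_tops C Hd1 Hd2) (gen_and (gen_gamma C Hd1 Hd12 Hd2) (gen_and NG(negl_sub_lead) (gen_and (gen_crit C Hd1 Hd2)
 (gen_and (gen_smooth C Hd1 Hd2) (gen_and (gen_turn C Hd1 Hd12 Hd2) (gen_and gen_pair gen_triple)))))).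
refine (gen_imp H _); clear H; move=> f g Hf Hg [Ht [Hga [Hs [Hc [Hsm [Htu [Hp Htr]]]]]]].
have [S1 S2 R1 [R2 R3] [R4 R5 R6]] := Ht.
split=> //.
- exact: coprime_roots.
- exact: Hga.
- by move=> Hgcd s Es; apply/eqP => E; apply: Hs; exists s; split=> //; apply: R4.
- exact: coprime_roots.
- by move=> p E1 E2 E3; apply: cusp_det.
move=> p fx fy; have Np : ~~ dnz f p by rewrite /dnz fx fy eqxx.
split; first exact: crit_dual.
have [_ Hdet _] := Hc p Np; rewrite pev_bra -(dxydyx f); exact: Hdet.
Qed.
End Pairs.
Transparent bra.

(** * Exchange of f and g, and completion of the generic statement *)

Section Swap.
Variable C : cField.
Local Notation P2 := (mpoly 2 C).
Implicit Types (f g u v h : P2).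

Definition swp u : P2 := mmap (@mpolyC 2 C) (fun i : 'I_2 => if i == ord0 then my C else mx C) u.
Definition flip (P : C * C) := (P.2, P.1).
Lemma flipK : involutive flip. Proof. by case. Qed.
Lemma swpD u v : swp (u + v) = swp u + swp v. Proof. exact: mmapD. Qed.
Lemma swpM u v : swp (u * v) = swp u * swp v. Proof. exact: rmorphM. Qed.
Lemma swpC c : swp (cst c) = cst c. Proof. exact: mmapC. Qed.
Lemma swpx : swp (mx C) = my C. Proof. by rewrite /swp mmapX mmap1U. Qed.
Lemma swpy : swp (my C) = mx C. Proof. by rewrite /swp mmapX mmap1U. Qed.
Lemma swpN u : swp (- u) = - swp u.
Proof. by rewrite -mulN1r swpM -cstN swpC cstN mulN1r. Qed.
Lemma swpK u : swp (swp u) = u.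
Proof.
elim/P2_ind: u => [c|||a b Ha Hb|a b Ha Hb]; first by rewrite !swpC.
- by rewrite swpx swpy.
- by rewrite swpy swpx.
- by rewrite !swpD Ha Hb.
by rewrite !swpM Ha Hb.
Qed.
Lemma pev_swp P u : pev P (swp u) = pev (flip P) u.
Proof.
elim/P2_ind: u => [c|||a b Ha Hb|a b Ha Hb]; first by rewrite swpC !pevC.
- by rewrite swpx pevx pevy.
- by rewrite swpy pevx pevy.
- by rewrite swpD !pevD Ha Hb.
by rewrite swpM !pevM Ha Hb.
Qed.
Lemma d_swp u : dx (swp u) = swp (dy u) /\ dy (swp u) = swp (dx u).
Proof.
have c0 : swp 0 = 0 :> P2 by rewrite swpC.
have c1 : swp 1 = 1 by rewrite swpC.
elim/P2_ind: u => [c|||a b [Ha Ha'] [Hb Hb']|a b [Ha Ha'] [Hb Hb']].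
- by rewrite swpC dxC dyC.
- by rewrite swpx dxy dyy dxx dyx c0.
- by rewrite swpy dxy dyy dxx dyx c0.
- by rewrite !(swpD, dxD, dyD) Ha Hb Ha' Hb'.
by rewrite !(swpM, swpD, dxM, dyM) Ha Hb Ha' Hb'.
Qed.

Lemma smooth_swp h P : algsmooth h P -> algsmooth (swp h) (flip P).
Proof. by rewrite /algsmooth; have [-> ->] := d_swp h; rewrite !pev_swp orbC. Qed.
Lemma node_swp h P : algnode h P -> algnode (swp h) (flip P).
Proof.
move=> [A [B [E [-> H]]]]; exists (swp E), (swp B), (swp A); rewrite !pev_swp; split; last by move: H; rewrite mulrAC.
by rewrite !(swpD, swpM, expr2, swpN, swpC, swpx, swpy) /=; ring.
Qed.
Lemma cusp_swp h P : algcusp h P -> algcusp (swp h) (flip P).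
Proof.
move=> [l1 [l2 [k1 [k2 [A [B [E [Hd -> HA HE]]]]]]]]; exists l2, l1, k2, k1, (swp A), (swp B), (swp E).
rewrite !pev_swp; split=> //; first by rewrite -oppr_eq0 opprB.
by rewrite !(swpD, swpM, expr2, exprS, expr0, mulr1, swpN, swpC, swpx, swpy) /=; ring.
Qed.

Lemma data_swap d1 d2 f g : discriminant_data d2 d1 g f -> discriminant_data d1 d2 f g.
Proof.
move=> [h [cl [nl [[h0 Hz Uc Un] [Sc Sn Hc Hn Hs]]]]].
have inF := inv_inj flipK.
have mF s P : (P \in map flip s) = (flip P \in s) by rewrite -[P in LHS]flipK (mem_map inF).
exists (swp h), (map flip cl), (map flip nl); rewrite !size_map !(map_inj_uniq inF); split; split=> //.
- by apply: contraNneq h0 => Z; rewrite -(swpK h) Z swpC.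
- move=> P; rewrite pev_swp Hz; split=> -[p Jp E]; exists p.
 + by move: Jp; rewrite braC pevN => /eqP; rewrite oppr_eq0 => /eqP.
 + by rewrite -[P]flipK -E.
 + by rewrite braC pevN Jp oppr0.
 by rewrite -E.
- by rewrite Sc; ring.
- by rewrite Sn gcdnC; congr (2^-1 * _); ring.
- by move=> P; rewrite mF => /Hc/cusp_swp; rewrite flipK.
- by move=> P; rewrite mF => /Hn/node_swp; rewrite flipK.
move=> P; rewrite pev_swp !mF => H1 H2 H3; rewrite -[P]flipK; apply: smooth_swp; exact: Hs.
Qed.

Lemma mpoly_ring_ind n (Q : mpoly n C -> Prop) : (forall c, Q (mpolyC n c)) -> (forall i, Q (mpolyX C (mnm1 i))) ->
 (forall a b, Q a -> Q b -> Q (a + b)) -> (forall a b, Q a -> Q b -> Q (a * b)) -> forall a, Q a.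
Proof.
move=> Hc Hx HD HM; have Q1 : Q 1 by rewrite -mpolyC1.
have HX a k : Q a -> Q (a ^+ k) by move=> Ha; elim: k => [|k IH]; rewrite // exprS; apply: HM.
have HE m : Q (mpolyX C m).
 rewrite mpolyXE_id; elim/big_rec: _ => // i x _ Hq; apply: HM => //; exact: HX.
elim/mpolyind => [|c m p _ _ Hp]; first by rewrite -mpolyC0.
by rewrite -mul_mpolyC; apply: HD => //; apply: HM.
Qed.

(** A polynomial that vanishes everywhere has partial derivatives that vanish everywhere, and its
    coefficients are, up to nonzero integers, constant terms of iterated derivatives. *)
Lemma mpoly_nonroot n (P : mpoly n C) : P != 0 -> exists v : 'I_n -> C, meval v P != 0.
Proof.
move=> P0; apply: contrapT => N.
have {N} H w : meval w P = 0 by apply/eqP/negPn/negP => E; apply: N; exists w.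
have D i : forall Q : mpoly n C, (forall w, meval w Q = 0) -> forall w, meval w (mderiv i Q) = 0.
 move=> Q HQ v; pose u := mmap (@polyC C) (fun j => if j == i then 'X else (v j)%:P) : mpoly n C -> {poly C}.
 have uM a b : u (a * b) = u a * u b by exact: rmorphM.
 have uD a b : u (a + b) = u a + u b by exact: mmapD.
 have hu t a : (u a).[t] = meval (fun j => if j == i then t else v j) a.
  elim/mpoly_ring_ind: a => [c|j|a b Ha Hb|a b Ha Hb].
  - by rewrite /u mmapC hornerC mevalC.
  - by rewrite /u mmapX mmap1U mevalXU; case: eqP; rewrite ?hornerX ?hornerC.
  - by rewrite uD hornerD Ha Hb mevalD.
  by rewrite uM hornerM Ha Hb mevalM.
 have du a : (u a)^`() = u (mderiv i a).
  elim/mpoly_ring_ind: a => [c|j|a b Ha Hb|a b Ha Hb].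
  - by rewrite /u mmapC derivC mderivC mmap0.
  - rewrite /u mmapX mmap1U mderivX; case: (eqVneq j i) => [->|Nji].
    by rewrite derivX mnm1E eqxx (_ : mnm_sub _ _ = mnm0) ?mpolyX0 ?scale1r; [rewrite mmapC|apply/mnmP => x; rewrite mnmBE subnn mnm0E].
   by rewrite derivC mnm1E (negPf Nji) scale0r mmap0.
  - by rewrite uD derivD Ha Hb mderivD.
  by rewrite uM derivM Ha Hb mderivM uD !uM.
 have u0 : u Q = 0.
  apply/eqP/negPn/negP => uQ; have := @max_poly_roots _ (u Q) [seq k%:R | k <- iota 0 (size (u Q))] uQ.
  rewrite size_map size_iota ltnn map_inj_uniq ?iota_uniq; last by move=> a b /eqP; rewrite eqr_nat => /eqP.
  by move=> K; suff : false by []; apply: K => //; apply/allP => x _; apply/eqP; rewrite hu.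
 have := congr1 (fun q => q.[v i]) (du Q); rewrite u0 deriv0 horner0 hu => E; rewrite [RHS]E.
 by apply: meval_eq => j; case: eqP => [->|].
move/eqP: P0; apply; apply/mpolyP => m; rewrite mcoeff0.
elim: {m}(mdeg m) {-2}m P H (erefl (mdeg m)) => [|k IH] m P H Hm.
 have -> : m = mnm0 by apply/eqP; rewrite -mdeg_eq0 Hm.
 rewrite -[RHS](H (fun=> 0)); elim/mpoly_ring_ind: {H} P => [c|j|a b Ha Hb|a b Ha Hb].
 - by rewrite mcoeffC eqxx mulr1 mevalC.
 - by rewrite mevalXU mcoeffX mnm1_eq0.
 - by rewrite mcoeffD mevalD Ha Hb.
 by rewrite mevalM -Ha -Hb; exact: (rmorphM (mcoeff mnm0)).
have [i mi] : exists i, m i != 0%N.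
 apply: contrapT => K; move: Hm; rewrite mdegE big1 // => i _.
 by apply/eqP/negPn/negP => Hi; apply: K; exists i.
have Ei : m = mnm_add (mnm_sub m (mnm1 i)) (mnm1 i).
 by rewrite submK // lep1mP.
have Km : mdeg (mnm_sub m (mnm1 i)) = k.
 by apply/eqP; rewrite -(eqn_add2r 1) -{1}(mdeg1 i) -mdegD -Ei Hm addn1.
have := IH _ _ (D i P H) Km; rewrite mcoeff_deriv -Ei => /eqP.
by rewrite mulrn_eq0 => /eqP.
Qed.

Lemma negl_swap d1 d2 B : negl d2 d1 B -> negl d1 d2 (fun f g => B g f).
Proof.
move=> [P P0 HP].
pose s (i : 'I_#|cix d2 d1|) : 'I_#|cix d1 d2| := enum_rank (match enum_val i with inl m => inr m | inr m => inl m end : cix d1 d2).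
pose t (i : 'I_#|cix d1 d2|) : 'I_#|cix d2 d1| := enum_rank (match enum_val i with inl m => inr m | inr m => inl m end : cix d2 d1).
have stK i : t (s i) = i.
 by rewrite /t enum_rankK -[RHS]enum_valK; congr enum_rank; case: (enum_val i).
pose rn := mmap (@mpolyC _ C) (fun i => mpolyX C (mnm1 (s i))) : mpoly _ C -> mpoly #|cix d1 d2| C.
have ev w Q : meval w (rn Q) = meval (w \o s) Q.
 elim/mpoly_ring_ind: Q => [c|j|a b Ha Hb|a b Ha Hb].
 - by rewrite /rn mmapC !mevalC.
 - by rewrite /rn mmapX mmap1U !mevalXU.
 - by rewrite /rn mmapD !mevalD Ha Hb.
 have -> : rn (a * b) = rn a * rn b by exact: rmorphM.
 by rewrite !mevalM Ha Hb.
exists (rn P).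
 have [w Hw] := mpoly_nonroot P0; apply: contraNneq Hw => Z.
 have := ev (w \o t) P; rewrite Z meval0 => ->; apply/eqP; apply: meval_eq => i.
 by rewrite /= stK.
move=> f g Hf Hg HB; rewrite ev -[RHS](HP g f Hg Hf HB); apply: meval_eq => i.
by rewrite /coefs /= enum_rankK; case: (enum_val i).
Qed.

(** J is a constant, nonzero outside a hypersurface: the curve is then empty with equation 1, and
    both formulas give 0. *)
Lemma negl_affine : negl 1 1 (fun f g => ~ discriminant_data 1 1 f g).
Proof.
apply: (@negl_sub C 1 1 _ (fun f g => pev (0, 0) (dx f) = 0 \/ (pev (0, 0) (dx f) != 0 /\ pev (0, 0) (bra f g) = 0))); last first.
 apply: negl_or.
  apply: negl_sub (@negl_lin C 1 1 0 [:: fun th u => pev (0, 0) (dx u)] [::] (fun _ _ _ => True) _ _ _ _ _) => //=.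
  - by move=> f g _ _ H; exists (fun=> 0).
  - by split; split=> [th|u]; [lins|pfs].
  by move=> th f g _ _ _; split=> //; exists (mx C); rewrite dxx pev1 oner_neq0; split=> //; exact: dgl_mx.
 apply: negl_sub (@negl_lin C 1 1 0 [::] [:: fun th f u => pev (0, 0) (bra f u)] (fun _ f _ => pev (0, 0) (dx f) != 0) _ _ _ _ _) => //=.
 - by move=> f g _ _ [H1 H2]; exists (fun=> 0).
 - by split; split=> [th f|u]; [lins|pfs].
 move=> th f g _ _ H; split=> //; exists (my C); rewrite pev_bra dyy dxy pev1 pev0 mulr1 mulr0 subr0; split=> //; exact: dgl_my.
move=> f g Hf Hg N; have [E|E] := eqVneq (pev (0, 0) (dx f)) 0; [by left|right; split=> //].
apply/eqP/negPn/negP => J0; apply: N.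
have Jc p : pev p (bra f g) = pev (0, 0) (bra f g).
 rewrite !pev_bra; have [a ->] := dgl0E (dgl_dx Hf); have [b ->] := dgl0E (dgl_dy Hf).
 by have [c ->] := dgl0E (dgl_dx Hg); have [d ->] := dgl0E (dgl_dy Hg); rewrite !pevC.
exists 1, [::], [::]; split; split=> //; first exact: oner_neq0.
- move=> P; rewrite pev1; split=> [/eqP|[p]]; first by rewrite oner_eq0.
 by rewrite Jc => Z; move: J0; rewrite Z eqxx.
by move=> P; rewrite pev1 => /eqP; rewrite oner_eq0.
Qed.

Theorem generic_discriminant d1 d2 : (0 < d1)%N -> (0 < d2)%N -> negl d1 d2 (fun f g : P2 => ~ discriminant_data d1 d2 f g).
Proof.
wlog le12 : d1 d2 / (d1 <= d2)%N.
 move=> H Hd1 Hd2; have [le|le] := leqP d1 d2; first exact: H.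
 apply: negl_sub (negl_swap (H d2 d1 (ltnW le) Hd2 Hd1)) => f g _ _ N M; apply: N; exact: data_swap.
move=> Hd1 Hd2; have [Hd|Hd] := ltnP 1 d2; last first.
 have E2 : d2 = 1%N by apply/eqP; rewrite eqn_leq Hd.
 have E1 : d1 = 1%N by apply/eqP; rewrite eqn_leq Hd1 andbT -E2.
 by rewrite E1 E2; exact: negl_affine.
apply: negl_sub (generic_tame C Hd1 le12 Hd) => f g Hf Hg N M; apply: N.
by apply: tame_discriminant => //; move: Hd; case: (d2) => [|[|k]] // _; rewrite addnS.
Qed.
End Swap.

End Algebra.

From mathcomp Require Import all_classical all_reals all_analysis.
From mathcomp Require Import complex ring lra.
Import Algebra.
Import Order.TTheory GRing.Theory Num.Theory.
Import numFieldNormedType.Exports.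
Local Open Scope classical_set_scope.
Local Open Scope ring_scope.

(** * Differentiability over C of polynomial maps *)

Section Differentiability.
Variable K : cField.
Local Notation PL := (K * K)%type.

Definition lf (a b : K) (v : PL) : K := a * v.1 + b * v.2.
Lemma lf_linear a b : linear (lf a b).
Proof. by move=> k u v; rewrite /lf /= scalerDr !scalerAr /GRing.scale; ring. Qed.
HB.instance Definition _ a b := GRing.isLinear.Build K PL K _ (lf a b) (lf_linear a b).
Lemma lf_continuous a b : continuous (lf a b).
Proof.
move=> x; apply: cvgD; apply: cvgM; try exact: cvg_cst; [exact: cvg_fst|exact: cvg_snd].
Qed.

Lemma normPL (v : PL) : `|v.1| <= `|v| /\ `|v.2| <= `|v|.
Proof. have Rc : `|v.1| >=< `|v.2| by apply: real_comparable; rewrite normr_real.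
by rewrite !comparable_le_max // !lexx orbT. Qed.

(** Caratheodory's criterion: continuous slopes give the differential. It serves polynomials, local
    inverses and square roots alike, each through its own expression of f y - f z. *)
Lemma caratheodory f (z : PL) (a b : PL -> K) :
 {for z, continuous a} -> {for z, continuous b} ->
 (\forall y \near z, f y - f z = a y * (y.1 - z.1) + b y * (y.2 - z.2)) ->
 differentiable f z /\ 'd f z = lf (a z) (b z) :> (PL -> K).
Proof.
move=> Ca Cb Hf.
have E (e : K) : 0 < e -> \forall v \near (0 : PL), `|f (v + z) - (f z + lf (a z) (b z) v)| <= e * `|v|.
 move=> e0.
 have e20 : 0 < e / 2 by rewrite divr_gt0.
 have N1 : \forall y \near z, `|a z - a y| < e / 2 by exact: (cvgrPdist_lt _ _).1 Ca _ e20.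
 have N2 : \forall y \near z, `|b z - b y| < e / 2 by exact: (cvgrPdist_lt _ _).1 Cb _ e20.
 have {N1} := (nbhs0P _ _).1 N1; have {N2} := (nbhs0P _ _).1 N2; have := (nbhs0P _ _).1 Hf.
 move=> H3 H2 H1; near=> v.
 have K1 : `|a z - a (z + v)| < e / 2 by near: v; exact: H1.
 have K2 : `|b z - b (z + v)| < e / 2 by near: v; exact: H2.
 have K3 : f (z + v) - f z = a (z + v) * v.1 + b (z + v) * v.2.
  have -> : a (z + v) * v.1 + b (z + v) * v.2 = a (z + v) * ((z + v).1 - z.1) + b (z + v) * ((z + v).2 - z.2).
   have -> : (z + v).1 - z.1 = v.1 by rewrite addrC addKr.
   by have -> : (z + v).2 - z.2 = v.2 by rewrite addrC addKr.
  by near: v; exact: H3.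
 have -> : f (v + z) - (f z + lf (a z) (b z) v) = - ((a z - a (z + v)) * v.1 + (b z - b (z + v)) * v.2).
  by rewrite [v + z]addrC opprD addrA K3 /lf; ring.
 rewrite normrN (le_trans (ler_normD _ _)) // !normrM [leRHS](_ : _ = e / 2 * `|v| + e / 2 * `|v|); last by rewrite -mulrDl -splitr.
 have [L1 L2] := normPL v.
 by apply: lerD; apply: ler_pM => //; apply: ltW.
have D : 'd f z = lf (a z) (b z) :> (PL -> K).
 by apply: diff_unique; [exact: lf_continuous|apply/eqaddoP => e e0; exact: E].
split=> //; apply/diff_locallyP; rewrite D; split; first exact: lf_continuous.
by apply/eqaddoP => e e0; exact: E.
Unshelve. all: end_near.
Qed.
End Differentiability.

Section Continuity.
Lemma near_all (T : topologicalType) (t : T) P : (forall y, P y) -> \forall y \near t, P y.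
Proof. by move=> H; apply: nearW. Qed.
Lemma cts_pair (T U V : topologicalType) (f : T -> U) (g : T -> V) t : {for t, continuous f} -> {for t, continuous g} ->
 {for t, continuous (fun y => (f y, g y))}.
Proof. by move=> Hf Hg; apply: cvg_pair. Qed.
Lemma cts_comp (T U V : topologicalType) (f : T -> U) (g : U -> V) t : {for t, continuous f} -> {for f t, continuous g} ->
 {for t, continuous (fun y => g (f y))}.
Proof. exact: continuous_comp. Qed.
Variables (K : cField) (T : topologicalType).
Implicit Types (f g : T -> K) (t : T).
Lemma ctsC (c : K) t : {for t, continuous (fun _ => c)}. Proof. exact: cvg_cst. Qed.
Lemma ctsD f g t : {for t, continuous f} -> {for t, continuous g} -> {for t, continuous (fun y => f y + g y)}.
Proof. by move=> Hf Hg; apply: cvgD. Qed.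
Lemma ctsB f g t : {for t, continuous f} -> {for t, continuous g} -> {for t, continuous (fun y => f y - g y)}.
Proof. by move=> Hf Hg; apply: cvgB. Qed.
Lemma ctsM f g t : {for t, continuous f} -> {for t, continuous g} -> {for t, continuous (fun y => f y * g y)}.
Proof. by move=> Hf Hg; apply: cvgM. Qed.
Lemma ctsV f t : f t != 0 -> {for t, continuous f} -> {for t, continuous (fun y => (f y)^-1)}.
Proof. by move=> H Hf; apply: cvgV. Qed.
Lemma cts_neq0 f t : f t != 0 -> {for t, continuous f} -> \forall y \near t, f y != 0.
Proof.
move=> H Hf; have /(cvgrPdist_lt _ _).1/(_ `|f t|) := Hf; rewrite normr_gt0 => /(_ H) N.
by apply: filterS N => y; apply: contraTneq => ->; rewrite subr0 ltxx.
Qed.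
End Continuity.

Section PolynomialMaps.
Variable C : cField.
Local Notation PL := (C * C)%type.
Local Notation P2 := (mpoly 2 C).
Implicit Types (u v : P2) (z : PL).

Lemma cts_pev (T : topologicalType) (q : T -> PL) u t : {for t, continuous q} -> {for t, continuous (fun t => pev (q t) u)}.
Proof.
move=> Hq; elim/P2_ind: u => [c|||a b Ha Hb|a b Ha Hb].
- rewrite (_ : (fun t => _) = (fun=> c)); first exact: ctsC.
 by apply/funext => s; rewrite pevC.
- rewrite (_ : (fun t => _) = (fun t => (q t).1)); last by apply/funext => s; rewrite pevx.
 by apply: (cvg_comp _ _ Hq); exact: cvg_fst.
- rewrite (_ : (fun t => _) = (fun t => (q t).2)); last by apply/funext => s; rewrite pevy.
 by apply: (cvg_comp _ _ Hq); exact: cvg_snd.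
- rewrite (_ : (fun t => _) = (fun t => pev (q t) a + pev (q t) b)); last by apply/funext => s; rewrite pevD.
 exact: ctsD.
rewrite (_ : (fun t => _) = (fun t => pev (q t) a * pev (q t) b)); last by apply/funext => s; rewrite pevM.
exact: ctsM.
Qed.

(** Divided differences continuous in both points at once; joint continuity is what bounds the
    inverse matrix near (p, p). *)
Lemma hadamard u : exists a b : PL * PL -> C, [/\ continuous a, continuous b,
 forall y z, pev y u - pev z u = a (y, z) * (y.1 - z.1) + b (y, z) * (y.2 - z.2),
 forall z, a (z, z) = pev z (dx u) & forall z, b (z, z) = pev z (dy u)].
Proof.
have c1 v : continuous (fun t : PL * PL => pev t.1 v) by move=> t; apply: cts_pev; exact: cvg_fst.
have c2 v : continuous (fun t : PL * PL => pev t.2 v) by move=> t; apply: cts_pev; exact: cvg_snd.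
elim/P2_ind: u => [c|||u v [a [b [Ca Cb E Ea Eb]]] [a' [b' [Ca' Cb' E' Ea' Eb']]]|u v [a [b [Ca Cb E Ea Eb]]] [a' [b' [Ca' Cb' E' Ea' Eb']]]].
- exists (fun=> 0), (fun=> 0); split; try (by move=> t; apply: ctsC).
 + by move=> y z; rewrite !pevC subrr !mul0r addr0.
 + by move=> z; rewrite dxC pev0.
 by move=> z; rewrite dyC pev0.
- exists (fun=> 1), (fun=> 0); split; try (by move=> t; apply: ctsC).
 + by move=> y z; rewrite !pevx mul1r mul0r addr0.
 + by move=> z; rewrite dxx pev1.
 by move=> z; rewrite dyx pev0.
- exists (fun=> 0), (fun=> 1); split; try (by move=> t; apply: ctsC).
 + by move=> y z; rewrite !pevy mul1r mul0r add0r.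
 + by move=> z; rewrite dxy pev0.
 by move=> z; rewrite dyy pev1.
- exists (fun t => a t + a' t), (fun t => b t + b' t); split.
 + by move=> t; apply: ctsD; [exact: Ca|exact: Ca'].
 + by move=> t; apply: ctsD; [exact: Cb|exact: Cb'].
 + by move=> y z; rewrite !pevD opprD addrACA E E'; ring.
 + by move=> z; rewrite dxD pevD Ea Ea'.
 by move=> z; rewrite dyD pevD Eb Eb'.
exists (fun t => pev t.1 u * a' t + a t * pev t.2 v), (fun t => pev t.1 u * b' t + b t * pev t.2 v); split.
- move=> t; apply: (ctsD (f := fun t => pev t.1 u * a' t) (g := fun t => a t * pev t.2 v)).
  by apply: ctsM; [exact: c1|exact: Ca'].
 by apply: ctsM; [exact: Ca|exact: c2].
- move=> t; apply: (ctsD (f := fun t => pev t.1 u * b' t) (g := fun t => b t * pev t.2 v)).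
  by apply: ctsM; [exact: c1|exact: Cb'].
 by apply: ctsM; [exact: Cb|exact: c2].
- move=> y z; rewrite !pevM /=.
 have -> : pev y u * pev y v - pev z u * pev z v = pev y u * (pev y v - pev z v) + (pev y u - pev z u) * pev z v by ring.
 by rewrite E E'; ring.
- by move=> z; rewrite dxM Ea Ea'; ring.
by move=> z; rewrite dyM Eb Eb'; ring.
Qed.

Lemma cts_pair1 (a : PL * PL -> C) (q : PL -> PL) z z' : continuous a -> {for z, continuous q} ->
 {for z, continuous (fun y => a (q y, z'))}.
Proof.
move=> Ca Cq; apply: (@cts_comp _ _ _ (fun y => (q y, z')) a); last exact: Ca.
by apply: cts_pair => //; exact: cvg_cst.
Qed.

Lemma diff_pev u z : differentiable (fun y => pev y u) z /\
 'd (fun y => pev y u) z = lf (pev z (dx u)) (pev z (dy u)) :> (PL -> C).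
Proof.
have [a [b [Ca Cb E Ea Eb]]] := hadamard u; rewrite -Ea -Eb.
apply: (@caratheodory C (fun y => pev y u) z (fun y => a (y, z)) (fun y => b (y, z))).
- by apply: cts_pair1 => //; exact: cvg_id.
- by apply: cts_pair1 => //; exact: cvg_id.
by apply: near_all => y; rewrite E.
Qed.

End PolynomialMaps.

Section SmoothPoints.
Variable R : realType.
Local Notation C := (Cplx R).
Local Notation P2 := (mpoly 2 C).
Lemma smooth_alg (h : P2) X p : X = [set p | pev p h = 0] -> pev p h = 0 ->
 (pev p (dx h) != 0) || (pev p (dy h) != 0) -> smooth_point X p.
Proof.
move=> -> hp Hd; exists (fun z => pev z h); split=> //.
- by apply: near_all => z; have [] := diff_pev h z.
- have [_ ->] := diff_pev h p; case/orP: Hd => N; [exists (1, 0)|exists (0, 1)]; rewrite /lf /=.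
  by rewrite mulr1 mulr0 addr0.
 by rewrite mulr1 mulr0 add0r.
by apply: near_all.
Qed.
End SmoothPoints.

(** * Local inverse of a polynomial map *)

Section Inverse.
Variable C : cField.
Local Notation PL := (C * C)%type.
Local Notation P2 := (mpoly 2 C).
Variables (F1 F2 : P2) (p : PL).
Hypothesis Hdet : pev p (bra F1 F2) != 0.
Definition Fm (z : PL) : PL := (pev z F1, pev z F2).

Lemma cts_dist (T : topologicalType) (V : normedModType C) (f : T -> V) t (e : C) : {for t, continuous f} -> 0 < e ->
 \forall y \near t, `|f y - f t| < e.
Proof.
move=> Cf e0; have H : \forall y \near t, `|f t - f y| < e by exact: (cvgrPdist_lt _ _).1 Cf _ e0.
by apply: filterS H => y; rewrite distrC.
Qed.
Lemma nearS (T : topologicalType) (t : T) (P Q : T -> Prop) : (forall y, P y -> Q y) ->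
 (\forall y \near t, P y) -> \forall y \near t, Q y.
Proof. by move=> H; apply: filterS. Qed.
Lemma nearI (T : topologicalType) (t : T) (P Q : T -> Prop) :
 (\forall y \near t, P y) -> (\forall y \near t, Q y) -> \forall y \near t, P y /\ Q y.
Proof. by move=> H1 H2; near=> y; split; near: y. Unshelve. all: end_near. Qed.
Lemma near_dist (z : PL) (e : C) : 0 < e -> \forall y \near z, `|y - z| < e.
Proof. by move=> e0; apply/nbhs_ballP; exists e => // y /=; rewrite -ball_normE /= distrC. Qed.

(* inverse of the Hadamard matrix of F at (y, z) *)
Record local_inverse (e k : C) (n : bool -> bool -> PL * PL -> C) : Prop := LocalInverse {
 li_e : 0 < e; li_k : 0 < k;
 li_cts : forall i j y z, `|y - p| < e -> `|z - p| < e -> {for (y, z), continuous (n i j)};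
 li_bound : forall i j y z, `|y - p| < e -> `|z - p| < e -> `|n i j (y, z)| < k;
 li_eq1 : forall y z, `|y - p| < e -> `|z - p| < e ->
  y.1 - z.1 = n false false (y, z) * (pev y F1 - pev z F1) + n false true (y, z) * (pev y F2 - pev z F2);
 li_eq2 : forall y z, `|y - p| < e -> `|z - p| < e ->
  y.2 - z.2 = n true false (y, z) * (pev y F1 - pev z F1) + n true true (y, z) * (pev y F2 - pev z F2);
 li_diag : forall z, `|z - p| < e -> pev z (bra F1 F2) != 0 }.

Lemma near_ball (P : PL * PL -> Prop) : (\forall t \near (p, p), P t) -> exists2 e : C, 0 < e &
 forall y z, `|y - p| < e -> `|z - p| < e -> P (y, z).
Proof.
move/nbhs_ballP => [e /= e0 H]; exists e => // y z Hy Hz; apply: H; split; rewrite /= -ball_normE /= distrC //.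
Qed.

Lemma local_inverseP : exists e k n, local_inverse e k n.
Proof.
have [a1 [b1 [Ca1 Cb1 E1 Ea1 Eb1]]] := hadamard F1; have [a2 [b2 [Ca2 Cb2 E2 Ea2 Eb2]]] := hadamard F2.
pose d t := a1 t * b2 t - b1 t * a2 t.
have Cd : continuous d.
 move=> t; apply: (ctsB (f := fun t => a1 t * b2 t) (g := fun t => b1 t * a2 t)); apply: ctsM.
 - exact: Ca1. - exact: Cb2. - exact: Cb1. exact: Ca2.
have dz z : d (z, z) = pev z (bra F1 F2).
 by rewrite /d Ea1 Eb2 Eb1 Ea2 /bra pevB !pevM.
have dpp : d (p, p) != 0 by rewrite dz.
pose m i j := match i, j with false, false => b2 | false, true => fun t => - b1 t | true, false => fun t => - a2 t | true, true => a1 end.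
have Cm i j : continuous (m i j).
 by case: i; case: j => //= t; apply: cvgN; [exact: Ca2|exact: Cb1].
pose n i j t := m i j t * (d t)^-1.
have Cn i j t : d t != 0 -> {for t, continuous (n i j)}.
 by move=> H; apply: (ctsM (f := m i j)); [exact: Cm|apply: ctsV => //; exact: Cd].
pose k := 1 + \sum_(i : bool) \sum_(j : bool) `|n i j (p, p)|.
have Hk i j : `|n i j (p, p)| < k.
 rewrite /k -[X in X < _]add0r ltr_leD ?ltr01 // (bigD1 i) //= (bigD1 j) //= -addrA lerDl addr_ge0 //; apply: sumr_ge0 => // x _.
 by apply: sumr_ge0.
have k0 : 0 < k by apply: le_lt_trans (Hk true true).
have near_n i j : \forall t \near (p, p), `|n i j t| < k.
 have K : 0 < k - `|n i j (p, p)| by rewrite subr_gt0.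
 apply: nearS (cts_dist (Cn i j _ dpp) K) => t Ht; rewrite -(subrK `|n i j (p, p)| k) -ltrBlDr.
 by apply: le_lt_trans Ht; apply: lerB_dist.
have near_d : \forall t \near (p, p), d t != 0 by apply: cts_neq0 => //; exact: Cd.
have H0 : \forall t \near (p, p), d t != 0 /\ forall i j, `|n i j t| < k.
 near=> t; split; first by near: t.
 case; case; near: t; exact: near_n.
have [e e0 He] := near_ball H0.
exists e, k, n; split=> //.
- by move=> i j y z Hy Hz; have [D _] := He _ _ Hy Hz; apply: Cn.
- by move=> i j y z Hy Hz; have [_] := He _ _ Hy Hz.
- move=> y z Hy Hz; have [D _] := He _ _ Hy Hz; rewrite E1 E2 /n /=; move: D; rewrite /d => D; field.
 exact: D.
- move=> y z Hy Hz; have [D _] := He _ _ Hy Hz; rewrite E1 E2 /n /=; move: D; rewrite /d => D; field.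
 exact: D.
by move=> z Hz; have [D _] := He _ _ Hz Hz; rewrite -dz.
Unshelve. all: end_near.
Qed.

Section WithInverse.
Variables (e k : C) (n : bool -> bool -> PL * PL -> C).
Hypothesis Hn : local_inverse e k n.

Lemma li_lip y z : `|y - p| < e -> `|z - p| < e -> `|y - z| <= 2 * k * `|Fm y - Fm z|.
Proof.
move=> Hy Hz; have [N1 N2] := normPL (Fm y - Fm z).
have B i j : `|n i j (y, z)| <= k by apply: ltW; exact: (li_bound Hn).
have k0 := ltW (li_k Hn).
have S (u v : C) i i' j j' : `|u| <= `|Fm y - Fm z| -> `|v| <= `|Fm y - Fm z| -> `|n i j (y, z) * u + n i' j' (y, z) * v| <= 2 * k * `|Fm y - Fm z|.
 move=> Hu Hv; rewrite (le_trans (ler_normD _ _)) // !normrM -mulrA mulr_natl mulr2n.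
 by apply: lerD; apply: ler_pM.
rewrite prod_normE; have Rc : `|(y - z).1| >=< `|(y - z).2| by apply: real_comparable; rewrite normr_real.
rewrite comparable_ge_max // -[(y - z).1]/(y.1 - z.1) -[(y - z).2]/(y.2 - z.2) (li_eq1 Hn Hy Hz) (li_eq2 Hn Hy Hz).
by rewrite !S.
Qed.

Lemma li_inj y z : `|y - p| < e -> `|z - p| < e -> Fm y = Fm z -> y = z.
Proof.
move=> Hy Hz E; apply/eqP; rewrite -subr_eq0 -normr_le0; have := li_lip Hy Hz.
by rewrite E subrr normr0 mulr0.
Qed.

Hypothesis solvable : exists2 h : C, 0 < h & forall w, `|w - Fm p| < h -> exists2 z, `|z - p| < e & Fm z = w.

(** Given local surjectivity, the inverse is a choice of preimage. It is Lipschitz by [li_lip], and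
    differentiable since the inverse Hadamard matrix at (psi w', psi w) supplies continuous
    slopes. *)
Lemma inverse_function : exists psi : PL -> PL, [/\ psi (Fm p) = p, \forall w \near Fm p, Fm (psi w) = w,
 \forall z \near p, psi (Fm z) = z, \forall w \near Fm p, differentiable psi w & {for Fm p, continuous psi}].
Proof.
have [h h0 Hs] := solvable.
have ep : `|p - p| < e by rewrite subrr normr0 (li_e Hn).
have [psi Hpsi] : exists psi : PL -> PL, forall w, `|w - Fm p| < h -> `|psi w - p| < e /\ Fm (psi w) = w.
 have H (w : PL) : exists z : PL, `|w - Fm p| < h -> `|z - p| < e /\ Fm z = w.
  have [H|H] := boolP (`|w - Fm p| < h); last by exists p.
  by have [z Hz Ez] := Hs w H; exists z.
 by have [psi Hpsi] := choice H; exists psi.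
have nearh w : `|w - Fm p| < h -> \forall w' \near w, `|w' - Fm p| < h.
 move=> Hw; have K : 0 < h - `|w - Fm p| by rewrite subr_gt0.
 apply/nbhs_ballP; exists (h - `|w - Fm p|) => // w' /=; rewrite -ball_normE /= => Hw'.
 rewrite -(subrKA w) addrC; apply: le_lt_trans (ler_normD _ _) _.
 by rewrite addrC -ltrBrDr distrC.
have lip w w' : `|w - Fm p| < h -> `|w' - Fm p| < h -> `|psi w - psi w'| <= 2 * k * `|w - w'|.
 by move=> /Hpsi[A1 A2] /Hpsi[B1 B2]; have := li_lip A1 B1; rewrite A2 B2.
have k20 : 0 < 2 * k by rewrite mulr_gt0 // (li_k Hn).
have Cpsi w : `|w - Fm p| < h -> {for w, continuous psi}.
 move=> Hw; apply/cvgrPdist_lt => c c0; have := nearh w Hw => K.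
 have K2 : \forall w' \near w, `|w - w'| < c / (2 * k).
  by apply/nbhs_ballP; exists (c / (2 * k)); [rewrite /= divr_gt0|move=> w' /=; rewrite -ball_normE].
 near=> w'; have Hw' : `|w' - Fm p| < h by near: w'.
 apply: le_lt_trans (lip w w' Hw Hw') _; rewrite mulrC -ltr_pdivlMr //; near: w'; exact: K2.
have pF : psi (Fm p) = p.
 by have [|A1 A2] := Hpsi (Fm p); [rewrite subrr normr0|apply: li_inj A2].
have hp : `|Fm p - Fm p| < h by rewrite subrr normr0.
exists psi; split=> //.
- by apply: nearS (nearh _ hp) => w /Hpsi[].
- have CF : {for p, continuous Fm} by apply: cts_pair; apply: cts_pev; exact: cvg_id.
 have K1 : \forall z \near p, `|Fm z - Fm p| < h.
  exact: cts_dist.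
 have K2 : \forall z \near p, `|z - p| < e.
  by apply: near_dist; exact: (li_e Hn).
 near=> z; have [|A1 A2] := Hpsi (Fm z); first by near: z.
 by apply: li_inj => //; near: z.
- apply: nearS (nearh _ hp) => w Hw; have [A1 A2] := Hpsi w Hw.
 have comp (i : bool) : differentiable (fun w' => if i then (psi w').2 else (psi w').1) w.
  have Cn j : {for w, continuous (fun w' => n i j (psi w', psi w))}.
   apply: (@cts_comp _ _ _ (fun w' => (psi w', psi w)) (n i j)); last exact: (li_cts Hn).
   by apply: cts_pair; [exact: Cpsi|exact: cvg_cst].
  have [] // := @caratheodory C (fun w' => if i then (psi w').2 else (psi w').1) w _ _ (Cn false) (Cn true).
  apply: nearS (nearh w Hw) => w' /Hpsi[B1 B2].
  have [E1 E2] : (pev (psi w') F1 = w'.1 /\ pev (psi w') F2 = w'.2) by rewrite -{2 4}B2.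
  have [E3 E4] : (pev (psi w) F1 = w.1 /\ pev (psi w) F2 = w.2) by rewrite -{2 4}A2.
  by case: (i); [rewrite (li_eq2 Hn)|rewrite (li_eq1 Hn)] => //; rewrite E1 E2 E3 E4.
 have := differentiable_pair (comp false) (comp true).
 by congr (differentiable _ _); apply/funext => w'; rewrite /= -spair.
exact: Cpsi.
Unshelve. all: end_near.
Qed.
End WithInverse.
End Inverse.

Lemma cramer2 (K : fieldType) (a b c d A1 A2 : K) : a * d - b * c != 0 ->
 a * (- (A1 * d - A2 * b) / (a * d - b * c)) + b * (- (A2 * a - A1 * c) / (a * d - b * c)) = - A1 /\
 c * (- (A1 * d - A2 * b) / (a * d - b * c)) + d * (- (A2 * a - A1 * c) / (a * d - b * c)) = - A2.
Proof. by move=> H; split; field; exact: H. Qed.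

(** v is a Newton step for u = c: moving by x v removes the fraction x of the defect A, and the
    remainder is quadratic in x. *)
Lemma quad_bound (C : cField) u (z v : C * C) (A c : C) :
 pev z u - c = A -> pev z (dx u) * v.1 + pev z (dy u) * v.2 = - A ->
 exists2 K : C, 0 <= K & forall x : C, 0 <= x <= 1 ->
  `|pev (z.1 + x * v.1, z.2 + x * v.2) u - c| <= (1 - x) * `|A| + x ^+ 2 * K.
Proof.
move=> EA EV; set P := rst z v u.
have P0 : P`_0 = c + A by rewrite -horner_coef0 horner_rst !mul0r !addr0 -EA; ring.
have P1 : P`_1 = - A.
 have := congr1 (fun q => q.[0]) (deriv_rst z v u).
 rewrite horner_rst !mul0r !addr0 -spair horner_coef0 coef_deriv mulr1n => ->.
 by rewrite pevD !pevM !pevC -EV; ring.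
exists (\sum_(i < size (drop_poly 2 P)) `|(drop_poly 2 P)`_i|); first exact: sumr_ge0.
move=> x /andP[x0 x1].
have -> : pev (z.1 + x * v.1, z.2 + x * v.2) u - c = (1 - x) * A + x ^+ 2 * (drop_poly 2 P).[x].
 have <- : P.[x] = pev (z.1 + x * v.1, z.2 + x * v.2) u by exact: horner_rst.
 rewrite -{1}(poly_take_drop 2 P) hornerD hornerM hornerXn.
 rewrite (horner_coef_wide _ (size_take_poly 2 P)) !big_ord_recr big_ord0 !coef_take_poly /= P0 P1; ring.
rewrite (le_trans (ler_normD _ _)) // (normrM (1 - x)) (ger0_norm _) ?subr_ge0 // lerD2l (normrM (x ^+ 2)) normrX (ger0_norm x0).
rewrite ler_wpM2l ?exprn_ge0 // horner_coef (le_trans (ler_norm_sum _ _ _)) //.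
by apply: ler_sum => i _; rewrite normrM ler_piMr // normrX ger0_norm // exprn_ile1.
Qed.

(** The t are the real coordinates of an interior point of a box of half-side d, the u those of the
    direction of descent. For small x the point stays in the box, and the bound gives 2 g <= x M
    with M fixed, so g = 0. *)
Lemma descent (R : realFieldType) (g a1 a2 K1 K2 d t1 t2 t3 t4 u1 u2 u3 u4 : R) :
 0 <= a1 -> 0 <= a2 -> 0 <= K1 -> 0 <= K2 -> g = a1 ^+ 2 + a2 ^+ 2 -> `|t1| < d -> `|t2| < d -> `|t3| < d -> `|t4| < d ->
 (forall x, 0 <= x <= 1 -> `|t1 + x * u1| <= d -> `|t2 + x * u2| <= d -> `|t3 + x * u3| <= d -> `|t4 + x * u4| <= d ->
   g <= ((1 - x) * a1 + x ^+ 2 * K1) ^+ 2 + ((1 - x) * a2 + x ^+ 2 * K2) ^+ 2) -> g = 0.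
Proof.
move=> a10 a20 K10 K20 gt H1 H2 H3 H4 Hs.
have [n1 n2 n3 n4] := And4 (normr_ge0 u1) (normr_ge0 u2) (normr_ge0 u3) (normr_ge0 u4).
pose mu := Num.min (Num.min (d - `|t1|) (d - `|t2|)) (Num.min (d - `|t3|) (d - `|t4|)).
have mu0 : 0 < mu by rewrite !lt_min !subr_gt0 H1 H2 H3.
have [M1 M2 M3 M4] : [/\ mu <= d - `|t1|, mu <= d - `|t2|, mu <= d - `|t3| & mu <= d - `|t4|].
 by split; rewrite !ge_min lexx ?orbT.
move: mu mu0 M1 M2 M3 M4 => mu mu0 M1 M2 M3 M4.
have [B [B0 B1 B2 B3 B4]] : exists B, [/\ 1 <= B, `|u1| <= B, `|u2| <= B, `|u3| <= B & `|u4| <= B].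
 by exists (1 + `|u1| + `|u2| + `|u3| + `|u4|); split; lra.
have small x : 0 < x -> x * B <= mu -> x <= 1 -> 2 * g <= x * ((a1 + K1) ^+ 2 + (a2 + K2) ^+ 2).
 move=> xp xB x1; have x0 := ltW xp.
 have bd (a b : R) : mu <= d - `|a| -> `|b| <= B -> `|a + x * b| <= d.
  move=> Ha Hb; rewrite (le_trans (ler_normD _ _)) // normrM (ger0_norm x0).
  have : x * `|b| <= x * B by rewrite ler_wpM2l.
  lra.
 have x01 : 0 <= x <= 1 by rewrite x0.
 rewrite -(ler_pM2l xp); have H0 := Hs x x01 (bd _ _ M1 B1) (bd _ _ M2 B2) (bd _ _ M3 B3) (bd _ _ M4 B4).
 have id (a K : R) : x * (x * (a + K) ^+ 2) - x * (2 * a ^+ 2) - (((1 - x) * a + x ^+ 2 * K) ^+ 2 - a ^+ 2) = x ^+ 2 * K ^+ 2 * (1 - x) * (1 + x) + 2 * x ^+ 3 * a * K by ring.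
 have pos (a K : R) : 0 <= a -> 0 <= K -> 0 <= x ^+ 2 * K ^+ 2 * (1 - x) * (1 + x) + 2 * x ^+ 3 * a * K.
  move=> a0 K0; rewrite addr_ge0 ?mulr_ge0 ?sqr_ge0 ?exprn_ge0 //; lra.
 have := pos _ _ a10 K10; have := pos _ _ a20 K20; rewrite -!id; rewrite gt in H0 *; lra.
have N0 : 0 <= g by rewrite gt addr_ge0 ?sqr_ge0.
apply/eqP; rewrite eq_le N0 andbT leNgt; apply/negP => Np.
set M := (a1 + K1) ^+ 2 + (a2 + K2) ^+ 2 in small.
have M0 : 0 <= M by rewrite addr_ge0 ?sqr_ge0.
have M1p : 0 < M + 1 by lra.
have Bp : 0 < B by lra.
pose x := Num.min (Num.min 1 (mu / B)) (g / (M + 1)).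
have x0 : 0 < x by rewrite !lt_min ltr01 !divr_gt0.
have [X1 X2 X3] : [/\ x <= 1, x <= mu / B & x <= g / (M + 1)] by split; rewrite !ge_min lexx ?orbT.
have X2' : x * B <= mu by rewrite -ler_pdivlMr.
have X3' : x * (M + 1) <= g by rewrite -ler_pdivlMr.
have := small x x0 X2' X1; move: x x0 {X1 X2 X3 X2'} X3' => x x0 X3'; nra.
Qed.

(** * Real coordinates and local surjectivity *)

Section RealParts.
Variable R : realType.
Local Notation C := (Cplx R).
Definition cr (a : R) : C := real_complex R a.
Definition mk (a b : R) : C := Complex a b.
Definition re (x : C) : R := complex.Re x.
Definition im (x : C) : R := complex.Im x.

Lemma crD a b : cr (a + b) = cr a + cr b. Proof. exact: (rmorphD (real_complex R)). Qed.
Lemma crM a b : cr (a * b) = cr a * cr b. Proof. exact: (rmorphM (real_complex R)). Qed.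
Lemma crN a : cr (- a) = - cr a. Proof. exact: (rmorphN (real_complex R)). Qed.
Lemma cr1 : cr 1 = 1. Proof. exact: (rmorph1 (real_complex R)). Qed.
Lemma crX a n : cr (a ^+ n) = cr a ^+ n. Proof. exact: (rmorphXn (real_complex R)). Qed.
Lemma crle a b : (cr a <= cr b) = (a <= b). Proof. exact: lecR. Qed.
Lemma crlt a b : (cr a < cr b) = (a < b). Proof. exact: ltcR. Qed.
Lemma norm_cr a : `|cr a| = cr `|a|.
Proof. by rewrite [LHS]normc_def expr0n addr0 sqrtr_sqr. Qed.
Lemma mkE a b : mk a b = cr a + mk 0 1 * cr b.
Proof. by rewrite /mk; apply/eqP; rewrite eq_complex; apply/andP; split; apply/eqP; rewrite /=; ring. Qed.
Lemma norm_i : `|mk 0 1| = 1.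
Proof. by rewrite [LHS]normc_def expr0n expr1n add0r sqrtr1. Qed.
Lemma mk_reim x : mk (re x) (im x) = x. Proof. by case: x. Qed.
Lemma mkD a b c d : mk (a + c) (b + d) = mk a b + mk c d. Proof. by []. Qed.
Lemma reB x y : re (x - y) = re x - re y. Proof. by case: x; case: y. Qed.
Lemma imB x y : im (x - y) = im x - im y. Proof. by case: x; case: y. Qed.
Lemma re_crM a x : re (cr a * x) = a * re x. Proof. by case: x => u v; rewrite /=; ring. Qed.
Lemma im_crM a x : im (cr a * x) = a * im x. Proof. by case: x => u v; rewrite /=; ring. Qed.
Lemma norm_sq x : cr (re x ^+ 2 + im x ^+ 2) = `|x| ^+ 2. Proof. exact: add_Re2_Im2. Qed.
Lemma norm_re x : cr `|re x| <= `|x|. Proof. exact: normc_ge_Re. Qed.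
Lemma norm_im x : cr `|im x| <= `|x|.
Proof.
rewrite [leRHS]normc_def crle -sqrtr_sqr ler_wsqrtr // lerDr sqr_ge0 //.
Qed.
Lemma norm_mk a b : `|mk a b| <= cr (`|a| + `|b|).
Proof. by rewrite mkE crD (le_trans (ler_normD _ _)) // normrM norm_i mul1r !norm_cr. Qed.
Lemma posC (e : C) : 0 < e -> exists2 r : R, 0 < r & e = cr r.
Proof.
case: e => a b; rewrite /= => /andP[/eqP b0 a0]; exists a => //; by rewrite b0.
Qed.
Lemma nonnegC (e : C) : 0 <= e -> exists2 r : R, 0 <= r & e = cr r.
Proof.
case: e => a b; rewrite /= => /andP[/eqP b0 a0]; exists a => //; by rewrite b0.
Qed.

Section Cts.
Variables (T : topologicalType) (t : T).
Lemma re_cts (f : T -> C) : {for t, continuous f} -> {for t, continuous (fun t => re (f t))}.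
Proof.
move=> Cf; apply/cvgrPdist_lt => e e0; have e0' : 0 < cr e by rewrite crlt.
apply: nearS (cts_dist Cf e0') => s Hs; rewrite distrC -crlt; apply: le_lt_trans Hs.
by rewrite -reB; exact: norm_re.
Qed.
Lemma im_cts (f : T -> C) : {for t, continuous f} -> {for t, continuous (fun t => im (f t))}.
Proof.
move=> Cf; apply/cvgrPdist_lt => e e0; have e0' : 0 < cr e by rewrite crlt.
apply: nearS (cts_dist Cf e0') => s Hs; rewrite distrC -crlt; apply: le_lt_trans Hs.
by rewrite -imB; exact: norm_im.
Qed.
Lemma mk_cts (a b : T -> R) : {for t, continuous a} -> {for t, continuous b} -> {for t, continuous (fun t => mk (a t) (b t))}.
Proof.
move=> Ca Cb; apply/cvgrPdist_lt => e /posC[r r0 ->].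
have r2 : 0 < r / 2 by rewrite divr_gt0.
have H1 : \forall s \near t, `|a t - a s| < r / 2 by exact: (cvgrPdist_lt _ _).1 Ca _ r2.
have H2 : \forall s \near t, `|b t - b s| < r / 2 by exact: (cvgrPdist_lt _ _).1 Cb _ r2.
apply: nearS (nearI H1 H2) => s [K1 K2].
have -> : mk (a t) (b t) - mk (a s) (b s) = mk (a t - a s) (b t - b s) by [].
by apply: le_lt_trans (norm_mk _ _) _; rewrite crlt (splitr r) ltrD.
Qed.
End Cts.
End RealParts.

Section Solvable.
Variable R : realType.
Local Notation C := (Cplx R).
Local Notation P2 := (mpoly 2 C).
Variables (F1 F2 : P2) (p : plane R) (e k : C) (n : bool -> bool -> plane R * plane R -> C).
Hypothesis Hn : local_inverse F1 F2 p e k n.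
Local Notation F := (Fm F1 F2).
Local Notation T := ((R * R) * (R * R))%type.

Definition cpt (t : T) : plane R := (p.1 + mk t.1.1 t.1.2, p.2 + mk t.2.1 t.2.2).
Lemma cpt_cts : continuous cpt.
Proof.
have P1 : continuous (fun t : T => t.1) by move=> t; exact: cvg_fst.
have P2 : continuous (fun t : T => t.2) by move=> t; exact: cvg_snd.
have Q1 : continuous (fun t : R * R => t.1) by move=> t; exact: cvg_fst.
have Q2 : continuous (fun t : R * R => t.2) by move=> t; exact: cvg_snd.
move=> t; apply: (cts_pair (f := fun t : T => p.1 + mk t.1.1 t.1.2) (g := fun t : T => p.2 + mk t.2.1 t.2.2)).
 apply: (ctsD (f := fun=> p.1) (g := fun t : T => mk t.1.1 t.1.2)); first exact: ctsC.
 by apply: (mk_cts (a := fun t : T => t.1.1) (b := fun t : T => t.1.2)); [apply: (cts_comp (g := fst) (@P1 t)); exact: Q1|apply: (cts_comp (g := snd) (@P1 t)); exact: Q2].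
apply: (ctsD (f := fun=> p.2) (g := fun t : T => mk t.2.1 t.2.2)); first exact: ctsC.
by apply: (mk_cts (a := fun t : T => t.2.1) (b := fun t : T => t.2.2)); [apply: (cts_comp (g := fst) (@P2 t)); exact: Q1|apply: (cts_comp (g := snd) (@P2 t)); exact: Q2].
Qed.

Lemma mk_shift (c y : C) (a b x : R) : c + mk (a + x * re y) (b + x * im y) = c + mk a b + cr x * y.
Proof. by rewrite mkD -re_crM -im_crM mk_reim addrA. Qed.
Lemma cpt_shift (t : T) (v : plane R) (x : R) :
 cpt ((t.1.1 + x * re v.1, t.1.2 + x * im v.1), (t.2.1 + x * re v.2, t.2.2 + x * im v.2)) =
 ((cpt t).1 + cr x * v.1, (cpt t).2 + cr x * v.2).
Proof. exact: (f_equal2 pair (mk_shift p.1 v.1 t.1.1 t.1.2 x) (mk_shift p.2 v.2 t.2.1 t.2.2 x)). Qed.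

Definition sq (x : C) : R := re x ^+ 2 + im x ^+ 2.
Lemma sq_norm x (r : R) : `|x| <= cr r -> sq x <= r ^+ 2.
Proof.
move=> H; rewrite -crle norm_sq crX lerXn2r //; exact: le_trans H.
Qed.
Lemma sq_normE (y : C) s : `|y| = cr s -> sq y = s ^+ 2.
Proof. by move=> Hy; apply: (complexI (R := R)); rewrite -!/(cr _) norm_sq crX Hy. Qed.
Lemma sq_ge0 x : 0 <= sq x. Proof. by rewrite addr_ge0 ?sqr_ge0. Qed.
Lemma sq_eq0 x : sq x = 0 -> x = 0.
Proof. by move=> H; apply/eqP; rewrite -normr_eq0 -sqrf_eq0 -norm_sq -/(sq x) H. Qed.

Lemma sq_cts (S : topologicalType) (f : S -> C) s : {for s, continuous f} -> {for s, continuous (fun s => sq (f s))}.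
Proof.
move=> Cf; rewrite (_ : (fun s => _) = (fun s => re (f s) * re (f s) + im (f s) * im (f s))); last by apply/funext => x; rewrite /sq.
by apply: cvgD; apply: cvgM; (exact: (re_cts Cf) || exact: (im_cts Cf)).
Qed.
Definition gap (w : plane R) (t : T) : R := sq (pev (cpt t) F1 - w.1) + sq (pev (cpt t) F2 - w.2).
Lemma gap_cts w : continuous (gap w).
Proof.
have H (u : P2) (c : C) : continuous (fun t => sq (pev (cpt t) u - c)).
 move=> t; have Cu : {for t, continuous (fun t => pev (cpt t) u - c)}.
  by apply: ctsB; [apply: cts_pev; exact: cpt_cts|exact: ctsC].
 exact: sq_cts Cu.
by move=> t; apply: cvgD; exact: H.
Qed.

(* A positive minimum in the interior is impossible: moving along v with dF(v) = w - F decreases the gap. *)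
Lemma gap_decrease w (t : T) (d : R) : `|cpt t - p| < e -> `|t.1.1| < d -> `|t.1.2| < d -> `|t.2.1| < d -> `|t.2.2| < d ->
 (forall s : T, `|s.1.1| <= d -> `|s.1.2| <= d -> `|s.2.1| <= d -> `|s.2.2| <= d -> gap w t <= gap w s) -> gap w t = 0.
Proof.
move=> He H1 H2 H3 H4 Hmin; set z := cpt t in He *.
have Hdet := li_diag Hn He; rewrite pev_bra in Hdet.
set A1 := pev z F1 - w.1; set A2 := pev z F2 - w.2.
set D := _ - _ in Hdet.
pose v : plane R := (- (A1 * pev z (dy F2) - A2 * pev z (dy F1)) / D, - (A2 * pev z (dx F1) - A1 * pev z (dx F2)) / D).
have [V1 V2] : pev z (dx F1) * v.1 + pev z (dy F1) * v.2 = - A1 /\ pev z (dx F2) * v.1 + pev z (dy F2) * v.2 = - A2.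
 exact: (cramer2 A1 A2 Hdet).
have quad (u : P2) (A c : C) : pev z u - c = A -> pev z (dx u) * v.1 + pev z (dy u) * v.2 = - A ->
  exists2 K : R, 0 <= K & forall x : R, 0 <= x <= 1 -> `|pev (z.1 + cr x * v.1, z.2 + cr x * v.2) u - c| <= cr (1 - x) * `|A| + cr (x ^+ 2 * K).
 move=> EA EV; have [K0 /nonnegC[K Kp ->] HK] := quad_bound EA EV.
 exists K => // x /andP[x0 x1]; rewrite crD crN cr1 (crM (x ^+ 2)) crX.
 by apply: HK; rewrite !crle x0.
have [K1 K10 B1] := quad F1 A1 w.1 erefl V1; have [K2 K20 B2] := quad F2 A2 w.2 erefl V2.
have [a1 a10 E1] := nonnegC (normr_ge0 A1); have [a2 a20 E2] := nonnegC (normr_ge0 A2).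
have gt : gap w t = a1 ^+ 2 + a2 ^+ 2.
 by rewrite /gap (sq_normE E1) (sq_normE E2).
apply: (descent a10 a20 K10 K20 gt H1 H2 H3 H4 (u1 := re v.1) (u2 := im v.1) (u3 := re v.2) (u4 := im v.2)).
move=> x x01 X1 X2 X3 X4.
have [s [Y1 Y2 Y3 Y4 Es]] : exists s : T, [/\ s.1.1 = t.1.1 + x * re v.1, s.1.2 = t.1.2 + x * im v.1,
  s.2.1 = t.2.1 + x * re v.2, s.2.2 = t.2.2 + x * im v.2 & cpt s = (z.1 + cr x * v.1, z.2 + cr x * v.2)].
 by exists ((t.1.1 + x * re v.1, t.1.2 + x * im v.1), (t.2.1 + x * re v.2, t.2.2 + x * im v.2)); split; [..|exact: cpt_shift].
rewrite -Y1 in X1; rewrite -Y2 in X2; rewrite -Y3 in X3; rewrite -Y4 in X4; have Hs := Hmin s X1 X2 X3 X4.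
apply: le_trans Hs _; apply: lerD; apply: sq_norm; rewrite Es crD (crM (1 - x)) -?E1 -?E2; [exact: B1|exact: B2].
Qed.

(** The gap attains a minimum on a compact box around p. The Lipschitz bound makes the gap larger on
    the boundary than at the centre, so the minimum is interior and [gap_decrease] makes it 0. *)
Lemma solvable : exists2 h : C, 0 < h & forall w : plane R, `|w - F p| < h -> exists2 z : plane R, `|z - p| < e & F z = w.
Proof.
have [r r0 Er] := posC (li_e Hn); have [kr kr0 Ekr] := posC (li_k Hn).
pose d := r / 4; have d0 : 0 < d by rewrite divr_gt0.
(* At a boundary point |F - F(p)| >= d / (2 k) = 4 h, so |F - w| >= 3 h and the gap is at least 9
   h^2; at the centre it is at most 2 h^2. *)
pose h := d / (8 * kr); have h0 : 0 < h by rewrite divr_gt0 // mulr_gt0.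
exists (cr h); first by rewrite crlt.
move=> w Hw.
have close (t : T) : `|t.1.1| <= d -> `|t.1.2| <= d -> `|t.2.1| <= d -> `|t.2.2| <= d -> `|cpt t - p| < e.
 move=> A1 A2 A3 A4; rewrite Er; apply: (@le_lt_trans _ _ (cr (2 * d))); last by rewrite crlt /d; lra.
 rewrite comparable_ge_max; last by apply: real_comparable; rewrite normr_real.
 have -> : (cpt t - p).1 = mk t.1.1 t.1.2 by rewrite -[LHS]/(p.1 + _ - p.1) addrC addKr.
 have -> : (cpt t - p).2 = mk t.2.1 t.2.2 by rewrite -[LHS]/(p.2 + _ - p.2) addrC addKr.
 by rewrite !(le_trans (norm_mk _ _)) // crle; lra.
pose I := `[- d, d]%classic : set R.
pose Q : set T := (I `*` I) `*` (I `*` I).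
have memI (x : R) : I x <-> `|x| <= d by rewrite ler_norml.
have cQ : compact Q by apply: compact_setX; apply: compact_setX; exact: segment_compact.
have Q0 : Q ((0, 0), (0, 0)) by split; split; apply/memI; rewrite normr0 ltW.
have [t Ht Hmin] := @compact_EVT_min T R (gap w) Q (ex_intro _ _ Q0) cQ (continuous_subspaceT (@gap_cts w)).
move: Ht; rewrite inE => -[[/memI B1 /memI B2] [/memI B3 /memI B4]].
have ct := close t B1 B2 B3 B4.
have pp : `|p - p| < e by rewrite subrr normr0 (li_e Hn).
have g0 : gap w t <= 2 * h ^+ 2.
 have := Hmin ((0, 0), (0, 0)); rewrite inE => /(_ Q0) H; apply: le_trans H _.
 have c0 : cpt ((0, 0), (0, 0)) = p.
  have m0 : mk 0 0 = 0 :> C by [].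
  by rewrite /cpt !addr0 -spair.
 have [N1 N2] := normPL (F p - w); rewrite distrC in Hw.
 rewrite /gap c0 mulrDl mul1r; apply: lerD; apply: sq_norm.
  exact: le_trans N1 (ltW Hw).
 exact: le_trans N2 (ltW Hw).
have inside (x : R) (i : bool) : cr `|x| <= `|if i then (cpt t - p).2 else (cpt t - p).1| -> `|x| < d.
 move=> Hx; rewrite ltNge; apply/negP => dx.
 have N : cr d <= `|cpt t - p|.
  have [N1 N2] := normPL (cpt t - p); apply: (@le_trans _ _ (cr `|x|)); first by rewrite crle.
  by apply: le_trans Hx _; case: i.
 have L := li_lip Hn ct pp; have LD : `|F (cpt t) - F p| <= `|F (cpt t) - w| + `|w - F p| by rewrite -[F (cpt t) - F p](subrKA w) ler_normD.
 have [f f0 Ef] := nonnegC (normr_ge0 (F (cpt t) - w)).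
 have fh : 3 * h <= f.
  have K1 : cr d <= cr (2 * kr * (f + h)).
   rewrite (crM (2 * kr)) (crM 2) (_ : cr 2 = 2); last by rewrite crD.
   rewrite -Ekr; apply: le_trans N _; apply: le_trans L _.
   rewrite ler_wpM2l ?mulr_ge0 ?(ltW (li_k Hn)) //; apply: le_trans LD _; rewrite crD -Ef lerD2l; exact: ltW.
  rewrite crle in K1; have E8 : d = h * (8 * kr) by rewrite divfK // lt0r_neq0 // mulr_gt0.
  rewrite E8 in K1; rewrite leNgt; apply/negP => C0; nra.
 have gf : f ^+ 2 <= gap w t.
  have := prod_normE (F (cpt t) - w); rewrite Ef.
  have [u1 u10 E1] := nonnegC (normr_ge0 (F (cpt t) - w).1); have [u2 u20 E2] := nonnegC (normr_ge0 (F (cpt t) - w).2).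
  rewrite /gap (sq_normE E1) (sq_normE E2) E1 E2 /Order.max; case: ifP => _ /(complexI (R := R)) ->.
   by rewrite lerDr sqr_ge0.
  by rewrite lerDl sqr_ge0.
 nra.
have Z : gap w t = 0.
 apply: (gap_decrease (d := d)) => //.
 - apply: (inside _ false); rewrite /= addrC addKr; exact: norm_re (mk _ _).
 - apply: (inside _ false); rewrite /= addrC addKr; exact: norm_im (mk _ _).
 - apply: (inside _ true); rewrite /= addrC addKr; exact: norm_re (mk _ _).
 - apply: (inside _ true); rewrite /= addrC addKr; exact: norm_im (mk _ _).
 move=> s A1 A2 A3 A4; apply: Hmin; rewrite inE; split; split; exact/memI.
exists (cpt t); move: Z; rewrite /gap => /eqP; rewrite paddr_eq0 ?sq_ge0 // => /andP[/eqP/sq_eq0 Z1 /eqP/sq_eq0 Z2].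
by rewrite [w]spair /Fm (subr0_eq Z1) (subr0_eq Z2).
Qed.
End Solvable.

Theorem inverse_map (R : realType) (F1 F2 : mpoly 2 (Cplx R)) (p : plane R) : pev p (bra F1 F2) != 0 ->
 exists psi : plane R -> plane R, [/\ psi (Fm F1 F2 p) = p, \forall w \near Fm F1 F2 p, Fm F1 F2 (psi w) = w,
 \forall z \near p, psi (Fm F1 F2 z) = z, \forall w \near Fm F1 F2 p, differentiable psi w & {for Fm F1 F2 p, continuous psi}].
Proof.
move=> H; have [e [k [n Hn]]] := local_inverseP H.
exact: (inverse_function Hn (solvable Hn)).
Qed.

Section Radius.
Variables (C : cField) (V : normedModType C).
Lemma near_radius (x : V) P : (\forall y \near x, P y) -> exists2 r : C, 0 < r & forall y, `|y - x| < r -> P y.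
Proof. by move/nbhs_ballP => [r r0 H]; exists r => // y Hy; apply: H; rewrite -ball_normE /= distrC. Qed.
Lemma radius_near (x : V) P (r : C) : 0 < r -> (forall y, `|y - x| < r -> P y) -> \forall y \near x, P y.
Proof. by move=> r0 H; apply/nbhs_ballP; exists r => // y; rewrite -ball_normE /= distrC; exact: H. Qed.
Lemma dist_near (x : V) (r : C) : 0 < r -> \forall y \near x, `|y - x| < r.
Proof. by move=> r0; apply: (radius_near r0). Qed.
End Radius.

(** * Holomorphic square roots and local equations *)

Section SquareRoot.
Variable C : cField.

(* the branch of the square root with values in the disc of radius 1 around 1 *)
Definition sig (y : C) : C := let t := sqrtC y in if `|t - 1| <= `|t + 1| then t else - t.
Lemma sig_sq y : sig y ^+ 2 = y.
Proof. by rewrite /sig; case: ifP => _; rewrite ?sqrrN sqrtCK. Qed.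
Lemma sig_half y : `|sig y - 1| <= `|sig y + 1|.
Proof.
rewrite /sig; case: ifP => // H; have := real_leVge (normr_real (sqrtC y - 1)) (normr_real (sqrtC y + 1)).
rewrite H => K; rewrite -opprD normrN -(normrN (- _ + 1)) opprD opprK; exact: K.
Qed.
Lemma sig_prod y : (sig y - 1) * (sig y + 1) = y - 1.
Proof. by rewrite -{3}(sig_sq y); ring. Qed.
Lemma sig_near y : `|y - 1| < 1 -> `|sig y - 1| < 1.
Proof.
move=> H; rewrite -(@expr_lt1 _ 2) //; apply: le_lt_trans H; rewrite -(sig_prod y) normrM expr2.
by rewrite ler_wpM2l // sig_half.
Qed.
Lemma sig_neq0 y : `|y - 1| < 1 -> sig y != 0.
Proof. by move=> /sig_near; apply: contraTneq => ->; rewrite sub0r normrN normr1 ltxx. Qed.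
Lemma sig1 : sig 1 = 1.
Proof.
have /eqP := sig_prod 1; rewrite subrr mulf_eq0 => /orP[/eqP/subr0_eq //|/eqP E].
have := sig_half 1; rewrite E normr0 normr_le0 => /eqP/subr0_eq H; move: E; rewrite H => /eqP.
by rewrite -mulr2n.
Qed.
Lemma dist_cts (T : topologicalType) (f : T -> C) t : (forall e : C, 0 < e -> \forall y \near t, `|f y - f t| < e) -> {for t, continuous f}.
Proof.
move=> H; apply/cvgrPdist_lt => e e0; apply: nearS (H e e0) => y; by rewrite distrC.
Qed.
Lemma sig_cts y : `|y - 1| < 1 -> {for y, continuous sig}.
Proof.
move=> Hy; apply: dist_cts => e e0; pose r := 1 - `|sig y - 1|.
have r0 : 0 < r by rewrite subr_gt0 sig_near.
have y0 : 0 < 1 - `|y - 1| by rewrite subr_gt0.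
have H1 := @dist_near C C y _ y0.
have H2 := @dist_near C C y _ (mulr_gt0 e0 r0).
apply: nearS (nearI H1 H2) => z [Hz1 Hz2].
have Hz : `|z - 1| < 1.
 rewrite -(subrKA y) (le_lt_trans (ler_normD _ _)) // -ltrBrDr; exact: Hz1.
rewrite -(ltr_pM2r r0); apply: le_lt_trans Hz2.
have -> : z - y = (sig z - sig y) * (sig z + sig y) by rewrite -{1}(sig_sq z) -{1}(sig_sq y); ring.
rewrite normrM ler_wpM2l //.
have -> : sig z + sig y = 1 - ((1 - sig z) + (1 - sig y)) + 1 by ring.
have K : `|(1 - sig z) + (1 - sig y)| <= 1 + `|sig y - 1|.
 by rewrite (le_trans (ler_normD _ _)) // (distrC 1 (sig y)) lerD2r distrC ltW // sig_near.
have -> : 1 - (1 - sig z + (1 - sig y)) + 1 = 2 - (1 - sig z + (1 - sig y)) by ring.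
apply: le_trans (lerB_dist _ _); rewrite normr_nat /r lerBrDr -lerBrDl.
by apply: le_trans K _; rewrite (_ : 2 - (1 - `|sig y - 1|) = 1 + `|sig y - 1|) //; ring.
Qed.

Local Notation PL := (C * C)%type.
Local Notation P2 := (mpoly 2 C).

Lemma sqrt_branch (u : P2) p r0 : r0 ^+ 2 = pev p u -> r0 != 0 ->
 exists s, [/\ s p = r0, forall z, s z ^+ 2 = pev z u & \forall z \near p, {for z, continuous s} /\ s z != 0].
Proof.
move=> Er N; have N2 : r0 ^+ 2 != 0 by rewrite expf_neq0.
pose t z := pev z u * (r0 ^+ 2)^-1; have tp : t p = 1 by rewrite /t -Er divff.
have Ct z : {for z, continuous t}.
 by apply: ctsM; [apply: cts_pev; exact: cvg_id|exact: ctsC].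
exists (fun z => r0 * sig (t z)); split.
- by rewrite tp sig1 mulr1.
- by move=> z; rewrite exprMn sig_sq mulrC divfK.
apply: nearS (cts_dist (Ct p) ltr01) => z; rewrite tp => Hz; split; last by rewrite mulf_neq0 // sig_neq0.
apply: (ctsM (g := fun z => sig (t z))); first exact: ctsC.
by apply: cts_comp; [exact: Ct|exact: sig_cts].
Qed.

Lemma sqrt_diff (u : P2) s z : (forall y, s y ^+ 2 = pev y u) -> {for z, continuous s} -> s z != 0 -> differentiable s z.
Proof.
move=> Es Cs N; have [a [b [Ca Cb E _ _]]] := hadamard u.
have Csum : {for z, continuous (fun y => s y + s z)} by apply: ctsD => //; exact: ctsC.
have N2 : s z + s z != 0 by rewrite -mulr2n mulrn_eq0.
have H (c : PL * PL -> C) : continuous c -> {for z, continuous (fun y => c (y, z) * (s y + s z)^-1)}.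
 move=> Cc; apply: ctsM.
  by apply: cts_pair1 => //; exact: cvg_id.
 exact: ctsV.
have [] // := @caratheodory C s z (fun y => a (y, z) * (s y + s z)^-1) (fun y => b (y, z) * (s y + s z)^-1) (H _ Ca) (H _ Cb).
apply: nearS (cts_neq0 (f := fun y => s y + s z) N2 Csum) => y Hy; apply: (mulIf Hy).
have -> : (s y - s z) * (s y + s z) = pev y u - pev z u by rewrite -!Es; ring.
by rewrite E; field; exact: Hy.
Qed.
End SquareRoot.

Section Estimates.
Variable C : cField.
Section Maps.
Variables (V W : normedModType C).
Lemma diff_small (f : V -> W) x (e : C) : differentiable f x -> 0 < e -> \forall y \near x, `|f y - f x - 'd f x (y - x)| <= e * `|y - x|.
Proof.
move=> /diff_locallyP[_ /eqaddoP H] e0; have /near_radius[r r0 Hr] := H e e0.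
apply: (radius_near r0) => y Hy; have := Hr (y - x); rewrite subr0 => /(_ Hy) K.
have : `|f (y - x + x) - (f x + 'd f x (y - x))| <= e * `|y - x| by exact: K.
by rewrite subrK opprD addrA.
Qed.
Lemma diff_lip (f : V -> W) x : differentiable f x -> exists2 k : C, 0 < k & \forall y \near x, `|f y - f x| <= k * `|y - x|.
Proof.
move=> D; have [k k0 Hk] := linear_lipschitz (diff_continuous D); exists (1 + k); first by rewrite addr_gt0.
apply: nearS (diff_small D ltr01) => y Hy; rewrite -(subrK ('d f x (y - x)) (f y - f x)).
by rewrite (le_trans (ler_normD _ _)) // mulrDl lerD.
Qed.
End Maps.

Local Notation PL := (C * C)%type.
Local Notation P2 := (mpoly 2 C).
Lemma diffM (f g : PL -> C) z : differentiable f z -> differentiable g z -> differentiable (fun y => f y * g y) z.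
Proof. exact: differentiableM. Qed.
Lemma diffD (f g : PL -> C) z : differentiable f z -> differentiable g z -> differentiable (fun y => f y + g y) z.
Proof. exact: differentiableD. Qed.
Lemma diffC (c : C) (z : PL) : differentiable (fun _ => c) z.
Proof. exact: differentiable_cst. Qed.
Lemma diff_fst c (z : PL) : differentiable (fun y : PL => y.1 - c) z.
Proof.
rewrite (_ : (fun y => _) = (fun y => pev y (mx C - cst c))); first by have [] := diff_pev (mx C - cst c) z.
by apply/funext => y; rewrite pevB pevx pevC.
Qed.
Lemma diff_snd c (z : PL) : differentiable (fun y : PL => y.2 - c) z.
Proof.
rewrite (_ : (fun y => _) = (fun y => pev y (my C - cst c))); first by have [] := diff_pev (my C - cst c) z.
by apply/funext => y; rewrite pevB pevy pevC.
Qed.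
Lemma diff_Fm (F1 F2 : P2) z : differentiable (Fm F1 F2) z.
Proof.
have [D1 _] := diff_pev F1 z; have [D2 _] := diff_pev F2 z.
exact: (@differentiable_pair C PL C C (fun y => pev y F1) (fun y => pev y F2) z D1 D2).
Qed.

Lemma branch_equation (a b : PL -> C) p : (\forall z \near p, differentiable a z /\ differentiable b z) ->
 let f z := a z * (z.1 - p.1) + b z * (z.2 - p.2) in
 [/\ \forall z \near p, differentiable f z, f p = 0 & 'd f p = lf (a p) (b p) :> (PL -> C)].
Proof.
move=> H f; split.
- apply: nearS H => z [Da Db].
 apply: (diffD (f := fun z => a z * (z.1 - p.1)) (g := fun z => b z * (z.2 - p.2))).
  by apply: diffM => //; exact: diff_fst.
 by apply: diffM => //; exact: diff_snd.
- by rewrite /f !subrr !mulr0 addr0.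
have [Da Db] := nbhs_singleton H.
have [] // := @caratheodory C f p a b (differentiable_continuous Da) (differentiable_continuous Db).
by apply: near_all => y; rewrite /f !subrr !mulr0 addr0 subr0.
Qed.

Lemma lf_indep (a b c : C) v : a * c - b ^+ 2 != 0 -> lf a b v = 0 -> lf b c v = 0 -> v = 0.
Proof.
rewrite /lf => N E1 E2; have X1 : (a * c - b ^+ 2) * v.1 = 0.
 by transitivity (c * (a * v.1 + b * v.2) - b * (b * v.1 + c * v.2)); [ring|rewrite E1 E2 !mulr0 subr0].
have X2 : (a * c - b ^+ 2) * v.2 = 0.
 by transitivity (a * (b * v.1 + c * v.2) - b * (a * v.1 + b * v.2)); [ring|rewrite E1 E2 !mulr0 subr0].
by rewrite [v]spair; congr pair; apply: (mulfI N); rewrite mulr0.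
Qed.

(** With s a square root of B^2 - 4 A E and q = (B + s) / 2 one has A E + q^2 = q B, so q h is the
    product (A x + q y)(q x + E y) in coordinates centred at p. The sign of s is chosen so that q(p)
    is nonzero. *)
Lemma node_branches h p : algnode h p -> exists (a q e : PL -> C),
 [/\ \forall z \near p, [/\ differentiable a z, differentiable q z & differentiable e z], q p != 0, a p * e p - q p ^+ 2 != 0 &
  \forall z \near p, pev z h = 0 <-> a z * (z.1 - p.1) + q z * (z.2 - p.2) = 0 \/ q z * (z.1 - p.1) + e z * (z.2 - p.2) = 0].
Proof.
move=> [A [B [E [Eh N]]]]; pose u := B ^+ 2 - cst 4 * A * E.
have up : pev p u != 0 by rewrite pevB !pevM pevC.
pose r := sqrtC (pev p u); have rE : r ^+ 2 = pev p u by rewrite sqrtCK.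
have rN : r != 0 by apply: contraNneq up => H; rewrite -rE H expr0n.
have [r0 [r0E r0N r0S]] : exists r0, [/\ r0 ^+ 2 = pev p u, r0 != 0 & pev p B + r0 != 0].
 have [Z|] := eqVneq (pev p B + r) 0; last by exists r.
 exists (- r); rewrite sqrrN oppr_eq0; split=> //; apply: contraNneq rN => Z'.
 have : 2 * r = 0 by rewrite -(subrr 0) -{1}Z -Z'; ring.
 by move/eqP; rewrite mulf_eq0 pnatr_eq0.
have [s [sp ss Hs]] := sqrt_branch r0E r0N.
have q2 z : pev z A * pev z E = 2^-1 * (pev z B + s z) * pev z B - (2^-1 * (pev z B + s z)) ^+ 2.
 have := ss z; rewrite pevB pevX !pevM pevC => Z.
 have -> : pev z A * pev z E = (pev z B ^+ 2 - s z ^+ 2) / 4 by rewrite Z; field.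
 by field.
have Hq : \forall z \near p, differentiable (fun z => 2^-1 * (pev z B + s z)) z.
 apply: nearS Hs => z [Cs N0]; apply: diffM; first exact: diffC.
 apply: diffD; first by have [] := diff_pev B z.
 exact: (sqrt_diff ss).
have N1 : 2^-1 * (pev p B + s p) != 0 by rewrite mulf_neq0 ?sp.
exists (fun z => pev z A), (fun z => 2^-1 * (pev z B + s z)), (fun z => pev z E); split=> //.
- apply: nearS Hq => z Dz; split=> //; [by have [] := diff_pev A z|by have [] := diff_pev E z].
- have -> : pev p A * pev p E - (2^-1 * (pev p B + s p)) ^+ 2 = - (2^-1 * (pev p B + s p)) * s p by rewrite q2; field.
 by rewrite mulf_neq0 ?oppr_eq0 // sp.
have Cq := differentiable_continuous (nbhs_singleton Hq).
apply: nearS (cts_neq0 (f := fun z => 2^-1 * (pev z B + s z)) N1 Cq) => z Nz; move: (q2 z) Nz; set q := _ * (_ + s z) => Q Nz.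
have E1 : q * pev z h = (pev z A * (z.1 - p.1) + q * (z.2 - p.2)) * (q * (z.1 - p.1) + pev z E * (z.2 - p.2)).
 rewrite Eh !pevE.
 transitivity (pev z A * q * (z.1 - p.1) ^+ 2 + (pev z A * pev z E + q ^+ 2) * (z.1 - p.1) * (z.2 - p.2) + q * pev z E * (z.2 - p.2) ^+ 2); last by ring.
 by rewrite Q; ring.
split=> [H|H].
 by move: E1; rewrite H mulr0 => /esym/eqP; rewrite mulf_eq0 => /orP[/eqP|/eqP]; [left|right].
have : q * pev z h = 0 by rewrite E1; case: H => ->; rewrite ?mul0r ?mulr0.
by move/eqP; rewrite mulf_eq0 (negPf Nz) => /eqP.
Qed.

Lemma node_equations h p : algnode h p -> exists f1 f2 : PL -> C,
 [/\ [/\ \forall z \near p, differentiable f1 z, f1 p = 0 & exists v, 'd f1 p v != 0],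
  [/\ \forall z \near p, differentiable f2 z, f2 p = 0 & exists v, 'd f2 p v != 0],
  forall v, 'd f1 p v = 0 -> 'd f2 p v = 0 -> v = 0 &
  \forall z \near p, pev z h = 0 <-> f1 z = 0 \/ f2 z = 0].
Proof.
move=> /node_branches[a [q [e [H Nq Nd Hz]]]].
have H1 : \forall z \near p, differentiable a z /\ differentiable q z by apply: nearS H => z [].
have H2 : \forall z \near p, differentiable q z /\ differentiable e z by apply: nearS H => z [].
have [D1 Z1 L1] := branch_equation H1; have [D2 Z2 L2] := branch_equation H2.
exists (fun z => a z * (z.1 - p.1) + q z * (z.2 - p.2)), (fun z => q z * (z.1 - p.1) + e z * (z.2 - p.2)).
split=> //; rewrite ?L1 ?L2.
- by split=> //; exists (0, 1); rewrite /lf mulr0 mulr1 add0r.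
- by split=> //; exists (1, 0); rewrite /lf mulr0 mulr1 addr0.
move=> v; exact: lf_indep.
Qed.

Lemma bra_scaled (G W U : P2) p : pev p W = 0 -> pev p U = 0 ->
 pev p (bra (G * W) (- (G * U))) = pev p G ^+ 2 * (pev p (dy W) * pev p (dx U) - pev p (dx W) * pev p (dy U)).
Proof. by move=> W0 U0; rewrite pev_bra !dE !pevE W0 U0; ring. Qed.

(* A h = W^2 + U^3 G with W = A V + B U^2 / 2 and G = A E - U B^2 / 4. *)
Lemma cusp_coordinates (h : P2) p : algcusp h p -> exists F1 F2, [/\ Fm F1 F2 p = 0, pev p (bra F1 F2) != 0 &
 \forall z \near p, pev z h = 0 <-> pev z F1 ^+ 2 = pev z F2 ^+ 3].
Proof.
move=> [l1 [l2 [k1 [k2 [A [B [E]]]]]]]; set U := _ + cst l2 * _; set V := _ + cst k2 * _ => -[N Eh NA NE].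
have Up : pev p U = 0 by rewrite !pevE !subrr !mulr0 addr0.
have Vp : pev p V = 0 by rewrite !pevE !subrr !mulr0 addr0.
have dU : pev p (dx U) = l1 /\ pev p (dy U) = l2 by rewrite !dE !pevE; split; ring.
have dV : pev p (dx V) = k1 /\ pev p (dy V) = k2 by rewrite !dE !pevE; split; ring.
move: U V Eh Up Vp dU dV => U V Eh Up Vp dU dV.
pose W := A * V + cst 2^-1 * U ^+ 2 * B; pose G := A * E - cst 4^-1 * U * B ^+ 2.
have Wp : pev p W = 0 by rewrite !pevE Up Vp; ring.
have Gp : pev p G = pev p A * pev p E by rewrite !pevE Up; ring.
have NG : pev p G != 0 by rewrite Gp mulf_neq0.
have dW : pev p (dx W) = pev p A * k1 /\ pev p (dy W) = pev p A * k2.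
 by rewrite /W expr2; move: dV => [<- <-]; rewrite !dE !pevE Up Vp; split; ring.
(* Multiplying W^2 = - G U^3 by G^2 gives (G W)^2 = (- G U)^3. *)
exists (G * W), (- (G * U)); split.
- by rewrite /Fm pevN !pevM Wp Up !mulr0 oppr0.
- rewrite bra_scaled // dU.1 dU.2 dW.1 dW.2 (_ : pev p A * k2 * l1 - pev p A * k1 * l2 = pev p A * (l1 * k2 - l2 * k1)); last by ring.
 by rewrite !mulf_neq0.
have Cw v : {for p, continuous (fun z => pev z v)} by apply: cts_pev; exact: cvg_id.
apply: nearS (nearI (cts_neq0 NA (Cw A)) (cts_neq0 NG (Cw G))) => z [NAz NGz].
have key : pev z (G * W) ^+ 2 - pev z (- (G * U)) ^+ 3 = pev z G ^+ 2 * pev z A * pev z h.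
 by rewrite Eh /W /G; field.
have Nk : pev z G ^+ 2 * pev z A != 0 by rewrite mulf_neq0 ?expf_neq0.
split=> [H|H]; first by apply: subr0_eq; rewrite key H mulr0.
by move: key; rewrite H subrr => /esym/eqP; rewrite mulf_eq0 (negPf Nk) => /eqP.
Qed.
End Estimates.

Section PositiveClassification.
Variable R : realType.
Local Notation C := (Cplx R).
Variables (h : mpoly 2 C) (X : set (plane R)) (p : plane R).
Hypothesis EX : X = [set p | pev p h = 0].

Lemma smooth_equationI (f : plane R -> C) : (\forall z \near p, differentiable f z) -> f p = 0 ->
 (exists v : plane R, 'd f p v != 0) -> smooth_equation [set z | f z = 0] p f.
Proof. by move=> D Z N; split; [exact: D|exact: Z|exact: N|apply: near_all => z; split]. Qed.

Lemma alg_node : algnode h p -> node X p.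
Proof.
move=> /node_equations[f1 [f2 [[D1 Z1 N1] [D2 Z2 N2] N H]]].
exists [set z | f1 z = 0], [set z | f2 z = 0], f1, f2; rewrite EX.
by split; [exact: smooth_equationI D1 Z1 N1|exact: smooth_equationI D2 Z2 N2|exact: N|exact: H].
Qed.

Lemma alg_cusp : algcusp h p -> cusp X p.
Proof.
move=> /cusp_coordinates[F1 [F2 [F0 Nb HX]]]; have [psi [P1 P2 P3 P4 P5]] := inverse_map Nb.
rewrite F0 in P1 P2 P4 P5; exists (Fm F1 F2), psi; split=> //.
- by split=> //; apply: near_all => z; exact: diff_Fm.
by rewrite EX.
Qed.
End PositiveClassification.

(** * Square roots along loops and isolated zeros *)

Section Parity.
Variable R : realType.
Definition ctson (T : topologicalType) (b : R) (S : R -> T) := forall t, 0 <= t <= b -> {for t, continuous S}.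

(** Connectedness of [0, b]: a locally constant property gives a continuous function with values 1
    and -1, to which the intermediate value theorem applies. *)
Lemma loc_const (P : R -> Prop) (b : R) : 0 <= b ->
 (forall t, 0 <= t <= b -> \forall s \near t, 0 <= s <= b -> (P s <-> P t)) -> P 0 -> P b.
Proof.
move=> b0 H Pa; pose chi t : R := if `[< P t >] then 1 else -1.
have Cchi : {within `[0, b], continuous chi}.
 apply/subspace_continuousP => t /=; rewrite in_itv /= => Ht; apply: cvg_near_cst.
 rewrite near_withinE; apply: nearS (H t Ht) => s Hs; rewrite /= => /Hs E.
 by rewrite /chi; congr (if _ then _ else _); apply/asbool_equiv_eq.
case: (pselect (P b)) => // nP.
have c0 : chi 0 = 1 by rewrite /chi asboolT.
have c1 : chi b = -1 by rewrite /chi asboolF.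
have Hv : Num.min (chi 0) (chi b) <= 0 <= Num.max (chi 0) (chi b).
 by rewrite c0 c1 ge_min le_max ler01 lerN10 orbT.
have [c _] := IVT b0 Cchi Hv; rewrite /chi; case: ifP => _ /eqP; by rewrite ?oppr_eq0 oner_eq0.
Qed.

Variable C : cField.
Lemma sig_comp (T : topologicalType) (f : T -> C) t : {for t, continuous f} -> `|f t - 1| < 1 ->
 {for t, continuous (fun y => sig (f y))}.
Proof. by move=> Cf H; apply: cts_comp; [exact: Cf|exact: sig_cts]. Qed.
Lemma sq_le (x y : C) : 0 <= x -> 0 <= y -> x ^+ 2 <= y ^+ 2 -> x <= y.
Proof. by move=> x0 y0; rewrite ler_pXn2r. Qed.
Lemma same_sign (b : R) (S1 S2 : R -> C) : 0 <= b -> ctson b S1 -> ctson b S2 ->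
 (forall t, 0 <= t <= b -> S1 t ^+ 2 = S2 t ^+ 2) -> (forall t, 0 <= t <= b -> S2 t != 0) -> S1 0 = S2 0 -> S1 b = S2 b.
Proof.
move=> b0 C1 C2 E N; apply: (@loc_const (fun t => S1 t = S2 t)) => // t Ht.
have alt s : 0 <= s <= b -> S1 s = S2 s \/ S1 s = - S2 s.
 by move=> /E/eqP; rewrite eqf_sqr => /orP[/eqP|/eqP]; [left|right].
have N2 : S2 t + S2 t != 0 by rewrite -mulr2n mulrn_eq0 N.
case: (alt t Ht) => E0.
 have Cs : {for t, continuous (fun s => S1 s + S2 s)} by apply: ctsD; [exact: C1|exact: C2].
 have Ns : S1 t + S2 t != 0 by rewrite E0.
 apply: nearS (cts_neq0 (f := fun s => S1 s + S2 s) Ns Cs) => s Hs Is; split=> // _.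
 by case: (alt s Is) => // Es; move: Hs; rewrite Es addNr eqxx.
have Cs : {for t, continuous (fun s => S1 s - S2 s)} by apply: ctsB; [exact: C1|exact: C2].
have Ns : S1 t - S2 t != 0 by rewrite E0 -opprD oppr_eq0.
apply: nearS (cts_neq0 (f := fun s => S1 s - S2 s) Ns Cs) => s Hs Is; split=> E1.
 by move: Hs; rewrite E1 subrr eqxx.
by move: Ns; rewrite E1 subrr eqxx.
Qed.

Variables (e : R -> C) (b : R).
Hypotheses (b0 : 0 <= b) (Ce : continuous e) (e0 : e 0 = 1) (eb : e b = -1) (e1 : forall t, `|e t| = 1).

Lemma e_neq0 t : e t != 0. Proof. by rewrite -normr_eq0 e1. Qed.
Lemma e_ends : (0 : R) <= 0 <= b /\ 0 <= b <= b. Proof. by rewrite !lexx b0. Qed.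

(* A loop close to t |-> c e(t)^2 winds once around 0, so it has no closed square root. *)
Lemma no_closed_root (S : R -> C) (c : C) : ctson b S -> S 0 = S b -> c != 0 ->
 (forall t, 0 <= t <= b -> `|S t ^+ 2 - c * e t ^+ 2| < `|c|) -> False.
Proof.
move=> CS ES c0 H; pose y t := S t ^+ 2 * (c * e t ^+ 2)^-1.
have d0 t : c * e t ^+ 2 != 0 by rewrite mulf_neq0 ?expf_neq0 ?e_neq0.
have Hy t : 0 <= t <= b -> `|y t - 1| < 1.
 move=> /H Ht; have -> : y t - 1 = (S t ^+ 2 - c * e t ^+ 2) * (c * e t ^+ 2)^-1 by rewrite mulrBl divff.
 by rewrite normrM normfV normrM normrX e1 expr1n mulr1 ltr_pdivrMr ?normr_gt0 // mul1r.
have Ce2 t : {for t, continuous (fun t => c * e t ^+ 2)}.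
 apply: (ctsM (g := fun t => e t * e t)); first exact: ctsC.
 by apply: ctsM; exact: Ce.
have Cy : ctson b y.
 move=> t Ht; apply: (ctsM (f := fun t => S t * S t) (g := fun t => (c * e t ^+ 2)^-1)).
  by apply: ctsM; exact: CS.
 by apply: ctsV.
have [I0 Ib] := e_ends.
have main r : r ^+ 2 = c -> S 0 = r * e 0 * sig (y 0) -> False.
 move=> rc E; have rN : r != 0 by apply: contraNneq c0 => Z; rewrite -rc Z expr0n.
 have Sb : S b = r * e b * sig (y b).
  apply: (same_sign (S2 := fun t => r * e t * sig (y t)) b0 CS) => //.
  - move=> t Ht; apply: (ctsM (f := fun t => r * e t) (g := fun t => sig (y t))).
    by apply: ctsM; [exact: ctsC|exact: Ce].
   have Cyt : {for t, continuous y} by exact: Cy.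
   by apply: sig_comp; [exact: Cyt|exact: Hy].
  - by move=> t Ht; rewrite !exprMn sig_sq rc mulrC divfK.
  by move=> t Ht; rewrite !mulf_neq0 ?e_neq0 // sig_neq0 // Hy.
 have yb : y b = y 0 by rewrite /y ES e0 eb sqrrN.
 have : S 0 + S 0 = 0 by rewrite {2}ES E Sb yb e0 eb; ring.
 rewrite E e0 -mulr2n => /eqP; rewrite mulrn_eq0 mulr1 mulf_eq0 (negPf rN) /=.
 by rewrite (negPf (sig_neq0 (Hy 0 I0))).
have rc := sqrtCK c.
have : S 0 ^+ 2 = (sqrtC c * e 0 * sig (y 0)) ^+ 2.
 by rewrite !exprMn sig_sq rc mulrC divfK.
move/eqP; rewrite eqf_sqr => /orP[/eqP E|/eqP E]; first exact: (main _ rc E).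
by apply: (main (- sqrtC c)); [rewrite sqrrN|rewrite E; ring].
Qed.

(** Having a closed square root is locally constant in the homotopy parameter: the quotient of two
    close loops stays in the unit disc around 1, where [sig] gives a root. The loop at parameter 0
    is constant. *)
Lemma homotopy_root (G : R * R -> C) (h : R) : 0 <= h -> continuous G -> (forall x, G x != 0) ->
 (forall t, G (t, 0) = G (t, b)) -> (forall t, G (0, t) = G (0, 0)) ->
 exists S : R -> C, [/\ ctson b S, forall t, 0 <= t <= b -> S t ^+ 2 = G (h, t) & S 0 = S b].
Proof.
move=> h0 CG NG Gp Gc; have [I0 Ib] := e_ends.
pose E s := exists S : R -> C, [/\ ctson b S, forall t, 0 <= t <= b -> S t ^+ 2 = G (s, t) & S 0 = S b].
apply: (@loc_const E) => //; last first.
 by exists (fun=> sqrtC (G (0, 0))); split=> // [t _|t _]; [exact: ctsC|rewrite sqrtCK].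
have row s : continuous (fun t : R => G (s, t)).
 move=> t; apply: (cts_comp (f := fun t => (s, t))); last exact: CG.
 by apply: cts_pair; [exact: cvg_cst|exact: cvg_id].
move=> s _.
have step : \forall s' \near s, forall t, 0 <= t <= b -> `|G (s', t) * (G (s, t))^-1 - 1| < 1.
 have K := (compact_near_coveringP `[0, b]%classic).1 (@segment_compact R 0 b) R (nbhs s)
  (fun s' t => `|G (s', t) * (G (s, t))^-1 - 1| < 1) _.
 have H : \forall s' \near s, `[0, b]%classic `<=` (fun t => `|G (s', t) * (G (s, t))^-1 - 1| < 1).
  apply: K => t _; pose r x := G (x.2, x.1) * (G (s, x.1))^-1.
  have C1 : {for (t, s), continuous (fun x => x.1)} by exact: cvg_fst.
  have C2 : {for (t, s), continuous (fun x => x.2)} by exact: cvg_snd.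
  have Cr : {for (t, s), continuous r}.
   apply: (ctsM (f := fun x : R * R => G (x.2, x.1)) (g := fun x : R * R => (G (s, x.1))^-1)).
    apply: (cts_comp (f := fun x : R * R => (x.2, x.1))); last exact: CG.
    exact: (cts_pair (f := fun x => x.2) (g := fun x => x.1)).
   apply: (ctsV (f := fun x : R * R => G (s, x.1))) => //.
   by apply: (cts_comp (f := fun x => x.1) (g := fun t => G (s, t))) => //; exact: row.
  have r1 : r (t, s) = 1 by rewrite /r divff.
  have Hr := cts_dist Cr (@ltr01 C); rewrite r1 in Hr; exact: Hr.
 apply: nearS H => s' Hs t Ht; apply: Hs; by rewrite /=.
apply: nearS step => s' Hs _.
pose q t := sig (G (s', t) * (G (s, t))^-1).
have Cq : ctson b q.
 move=> t Ht; apply: (sig_comp (f := fun t => G (s', t) * (G (s, t))^-1)); last exact: Hs.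
 apply: (ctsM (g := fun t => (G (s, t))^-1)); first exact: row.
 by apply: ctsV => //; exact: row.
have Nq t : 0 <= t <= b -> q t != 0 by move=> /Hs; exact: sig_neq0.
have q2 t : q t ^+ 2 = G (s', t) * (G (s, t))^-1 by exact: sig_sq.
have qb : q 0 = q b by rewrite /q !Gp.
split=> -[S [CS ES SS]].
 exists (fun t => S t * (q t)^-1); split.
 - move=> t Ht; apply: (ctsM (g := fun t => (q t)^-1)); first exact: CS.
  by apply: ctsV; [exact: Nq|exact: Cq].
 - by move=> t Ht; rewrite exprMn exprVn ES // q2 invfM invrK mulrA divff // mul1r.
 by rewrite SS qb.
exists (fun t => S t * q t); split.
- by move=> t Ht; apply: ctsM; [exact: CS|exact: Cq].
- by move=> t Ht; rewrite exprMn ES // q2 mulrC divfK.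
by rewrite SS qb.
Qed.

Variables (co si : R -> C) (h : R).
Hypotheses (h0 : 0 <= h) (Cco : continuous co) (Csi : continuous si) (co0 : co 0 = 1) (si0 : si 0 = 0)
 (coh : co h = 0) (sih : si h = 1) (con : forall t, `|co t| <= 1) (sin_ : forall t, `|si t| <= 1)
 (cosi : forall t, co t = 0 -> si t = 0 -> False).
Local Notation PL := (C * C)%type.

(** If p were the only zero, f would not vanish on the points p + d (si e^2 u + co v). They deform
    the loop p + d e^2 u to a constant, so f along that loop would have a closed square root; but
    there f is close to d e^2 times 'd f p u, which [no_closed_root] excludes. *)
Lemma zero_not_isolated (f : PL -> C) (p u v : PL) : (\forall z \near p, differentiable f z) -> f p = 0 ->
 'd f p u != 0 -> u.1 * v.2 - u.2 * v.1 != 0 -> (\forall z \near p, f z = 0 -> z = p) -> False.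
Proof.
move=> Df fp Nu Nd Hz; set L := 'd f p u in Nu.
pose M := `|u.1| + `|u.2| + `|v.1| + `|v.2|.
have M0 : 0 <= M by rewrite !addr_ge0.
have M1 : 0 < M + 1 by rewrite ltr_wpDl.
have ep0 : 0 < `|L| / (M + 1) by rewrite divr_gt0 ?normr_gt0.
have [r r0 Hr] := near_radius (nearI (nearI Df Hz) (diff_small (nbhs_singleton Df) ep0)).
pose d := r / (M + 1); have d0 : 0 < d by rewrite divr_gt0.
have dM : d * M < r by rewrite mulrAC ltr_pdivrMr // ltr_pM2l // ltrDl.
pose w x : PL := (d * (si x.1 * e x.2 ^+ 2 * u.1 + co x.1 * v.1), d * (si x.1 * e x.2 ^+ 2 * u.2 + co x.1 * v.2)).
have bw x : `|w x| <= d * M.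
 have aux (a c : C) : `|a| + `|c| <= M -> `|d * (si x.1 * e x.2 ^+ 2 * a + co x.1 * c)| <= d * M.
  move=> H; rewrite normrM (gtr0_norm d0) ler_wpM2l ?(ltW d0) //; apply: le_trans H.
  rewrite (le_trans (ler_normD _ _)) // !normrM !e1 !mulr1; apply: lerD; rewrite ler_piMl //.
 have [X1 X2] : `|u.1| + `|v.1| <= M /\ `|u.2| + `|v.2| <= M.
  split; rewrite -subr_ge0.
   by rewrite (_ : M - _ = `|u.2| + `|v.2|) // /M; ring.
  by rewrite (_ : M - _ = `|u.1| + `|v.1|) // /M; ring.
 rewrite comparable_ge_max; last by apply: real_comparable; rewrite normr_real.
 by rewrite !aux.
pose z x : PL := (p.1 + (w x).1, p.2 + (w x).2).
have zp x : z x - p = w x by rewrite addrC addKr.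
have inr x : `|z x - p| < r by rewrite zp; exact: le_lt_trans (bw x) dM.
have Cz : continuous z.
 have aux (c0 a c : C) : continuous (fun x : R * R => c0 + d * (si x.1 * e x.2 ^+ 2 * a + co x.1 * c)).
  move=> x; have C1 : {for x, continuous (fun x => x.1)} by exact: cvg_fst.
  have C2 : {for x, continuous (fun x => x.2)} by exact: cvg_snd.
  have Ds : {for x, continuous (fun x : R * R => si x.1)} by apply: (cts_comp C1); exact: Csi.
  have Dc : {for x, continuous (fun x : R * R => co x.1)} by apply: (cts_comp C1); exact: Cco.
  have De : {for x, continuous (fun x : R * R => e x.2)} by apply: (cts_comp C2); exact: Ce.
  apply: (ctsD (g := fun x : R * R => d * (si x.1 * e x.2 ^+ 2 * a + co x.1 * c))); first exact: ctsC.
  apply: (ctsM (g := fun x : R * R => si x.1 * e x.2 ^+ 2 * a + co x.1 * c)); first exact: ctsC.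
  apply: (ctsD (f := fun x : R * R => si x.1 * e x.2 ^+ 2 * a) (g := fun x : R * R => co x.1 * c)).
   apply: (ctsM (f := fun x : R * R => si x.1 * e x.2 ^+ 2)); last exact: ctsC.
   by apply: (ctsM (f := fun x => si x.1) (g := fun x => e x.2 * e x.2)) => //; apply: ctsM.
  by apply: (ctsM (f := fun x => co x.1)) => //; exact: ctsC.
 move=> x; exact: (cts_pair (aux p.1 u.1 v.1 x) (aux p.2 u.2 v.2 x)).
pose G x := f (z x).
have CG : continuous G.
 move=> x; apply: (cts_comp (f := z)); first exact: Cz.
 have [[Dx _] _] := Hr _ (inr x); exact: differentiable_continuous.
have NG x : G x != 0.
 apply/eqP => Gx; have [[_ /(_ Gx) Zx] _] := Hr _ (inr x).
 have w0 : w x = 0 by rewrite -zp Zx subrr.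
 have Nd0 : d != 0 by rewrite gt_eqF.
 have /(mulfI Nd0) W1 : d * (si x.1 * e x.2 ^+ 2 * u.1 + co x.1 * v.1) = d * 0 by rewrite mulr0; exact: (congr1 fst w0).
 have /(mulfI Nd0) W2 : d * (si x.1 * e x.2 ^+ 2 * u.2 + co x.1 * v.2) = d * 0 by rewrite mulr0; exact: (congr1 snd w0).
 have /(mulfI Nd) K1 : (u.1 * v.2 - u.2 * v.1) * co x.1 = (u.1 * v.2 - u.2 * v.1) * 0.
  transitivity (u.1 * (si x.1 * e x.2 ^+ 2 * u.2 + co x.1 * v.2) - u.2 * (si x.1 * e x.2 ^+ 2 * u.1 + co x.1 * v.1)); first by ring.
  by rewrite W1 W2; ring.
 have /(mulfI Nd)/eqP : (u.1 * v.2 - u.2 * v.1) * (si x.1 * e x.2 ^+ 2) = (u.1 * v.2 - u.2 * v.1) * 0.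
  transitivity ((si x.1 * e x.2 ^+ 2 * u.1 + co x.1 * v.1) * v.2 - (si x.1 * e x.2 ^+ 2 * u.2 + co x.1 * v.2) * v.1); first by ring.
  by rewrite W1 W2; ring.
 rewrite mulf_eq0 expf_eq0 (negPf (e_neq0 _)) orbF => /eqP K2; exact: cosi K1 K2.
have e2 : e 0 ^+ 2 = e b ^+ 2 by rewrite e0 eb sqrrN.
have Gp t : G (t, 0) = G (t, b) by rewrite /G /z /w e2.
have Gc t : G (0, t) = G (0, 0) by rewrite /G /z /w si0 !mul0r.
have [S [CS ES SS]] := homotopy_root h0 CG NG Gp Gc.
have Nc : d * L != 0 by rewrite mulf_neq0 // gt_eqF.
apply: (no_closed_root CS SS Nc) => t Ht; rewrite ES //.
have [_] := Hr _ (inr (h, t)); rewrite fp subr0 zp.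
have -> : w (h, t) = (d * e t ^+ 2) *: u.
 rewrite [RHS]spair -[(_ *: u).1]/(d * e t ^+ 2 * u.1) -[(_ *: u).2]/(d * e t ^+ 2 * u.2).
 by rewrite /w sih coh; congr pair; ring.
rewrite linearZ /= -/L -/(G (h, t)) => K.
have -> : d * L * e t ^+ 2 = (d * e t ^+ 2) *: L by rewrite -[RHS]/(d * e t ^+ 2 * L); ring.
apply: le_lt_trans K _.
have nw : `|(d * e t ^+ 2) *: u| <= d * M.
 have := bw (h, t); congr (`|_| <= _); rewrite [RHS]spair -[(_ *: u).1]/(d * e t ^+ 2 * u.1) -[(_ *: u).2]/(d * e t ^+ 2 * u.2).
 by rewrite /w sih coh; congr pair; ring.
apply: (@le_lt_trans _ _ (`|L| / (M + 1) * (d * M))); first by rewrite ler_wpM2l // ltW.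
rewrite normrM (gtr0_norm d0) (_ : `|L| / (M + 1) * (d * M) = d * `|L| * (M / (M + 1))); last by ring.
have MM : M / (M + 1) < 1 by rewrite ltr_pdivrMr // mul1r ltrDl.
have dL : 0 < d * `|L| by rewrite mulr_gt0 // normr_gt0.
by rewrite gtr_pMr.
Qed.

Lemma linear_lf (d : {linear PL -> C}) w : d w = lf (d (1, 0)) (d (0, 1)) w.
Proof.
have E : w = w.1 *: ((1, 0) : PL) + w.2 *: ((0, 1) : PL).
 have E1 : w.1 * 1 + w.2 * 0 = w.1 by ring.
 have E2 : w.1 * 0 + w.2 * 1 = w.2 by ring.
 rewrite {1}[w]spair; exact: (f_equal2 pair (esym E1) (esym E2)).
rewrite {1}E linearD !linearZ /lf /=.
by congr (_ + _); exact: mulrC.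
Qed.

(** [lf a c] and 'd f p are independent linear forms, and both are small compared with |z - p| at
    the zeros of f near p, which leaves only p. *)
Lemma tangent_isolated (f : PL -> C) (p : PL) a c : differentiable f p -> f p = 0 ->
 a * 'd f p (0, 1) - c * 'd f p (1, 0) != 0 ->
 (forall eps : C, 0 < eps -> \forall z \near p, f z = 0 -> `|lf a c (z - p)| <= eps * `|z - p|) ->
 \forall z \near p, f z = 0 -> z = p.
Proof.
move=> Df fp; set c1 := 'd f p (0, 1); set a1 := 'd f p (1, 0); set D := _ - _ => ND H.
pose K := `|a| + `|c| + `|a1| + `|c1|.
have K0 : 0 <= K by rewrite !addr_ge0.
have K1 : 0 < K + 1 by rewrite ltr_wpDl.
have D0 : 0 < `|D| by rewrite normr_gt0.
pose eps := `|D| / (K + 1); have ep0 : 0 < eps by rewrite divr_gt0.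
apply: nearS (nearI (H _ ep0) (diff_small Df ep0)) => z [Hx Hy] fz.
move: (Hx fz) Hy; rewrite fz fp subrr sub0r normrN (linear_lf ('d f p)) -/c1 -/a1; set w := z - p => {}Hx Hy.
have bound (s t : C) : `|s| + `|t| <= K -> `|s * lf a c w - t * lf a1 c1 w| <= eps * K * `|w|.
 move=> Hst; rewrite (le_trans (ler_normB _ _)) // !normrM.
 apply: (@le_trans _ _ (`|s| * (eps * `|w|) + `|t| * (eps * `|w|))); first by apply: lerD; apply: ler_wpM2l.
 rewrite -mulrDl mulrA (mulrC (_ + _)) ler_wpM2r // ler_wpM2l // ltW //.
have W1 : `|D| * `|w.1| <= eps * K * `|w|.
 rewrite -normrM (_ : D * w.1 = c1 * lf a c w - c * lf a1 c1 w); last by rewrite /D /lf; ring.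
 by apply: bound; rewrite -subr_ge0 (_ : K - _ = `|a| + `|a1|) // /K; ring.
have W2 : `|D| * `|w.2| <= eps * K * `|w|.
 rewrite -normrM (_ : D * w.2 = - a1 * lf a c w - (- a) * lf a1 c1 w); last by rewrite /D /lf; ring.
 by apply: bound; rewrite !normrN -subr_ge0 (_ : K - _ = `|c| + `|c1|) // /K; ring.
have W : `|D| * `|w| <= eps * K * `|w| by rewrite {1}prod_normE /Order.max; case: ifP.
apply/eqP; rewrite -subr_eq0 -/w; apply: contraT => Nw.
move: W; rewrite ler_pM2r ?normr_gt0 // mulrAC -mulrA ler_pMr // ler_pdivlMr // mul1r => W.
by move: W; rewrite gerDl ler10.
Qed.

Lemma tangent_not_zero_set (f : PL -> C) (p : PL) a c : (\forall z \near p, differentiable f z) -> f p = 0 ->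
 a * 'd f p (0, 1) - c * 'd f p (1, 0) != 0 ->
 (forall eps : C, 0 < eps -> \forall z \near p, f z = 0 -> `|lf a c (z - p)| <= eps * `|z - p|) -> False.
Proof.
move=> Df fp N H; have Hz := tangent_isolated (nbhs_singleton Df) fp N H.
have [Z|N1] := eqVneq ('d f p (1, 0)) 0.
 have N2 : 'd f p (0, 1) != 0 by apply: contraNneq N => ->; rewrite Z !mulr0 subrr.
 by apply: (zero_not_isolated (v := (1, 0)) Df fp N2 _ Hz); rewrite /= mul0r sub0r oppr_eq0.
by apply: (zero_not_isolated (v := (0, 1)) Df fp N1 _ Hz); rewrite /= mul0r subr0.
Qed.

(** The zeros of a branch with nonzero differential are not isolated, so its differential must be
    proportional to the common tangent form. For both branches this contradicts transversality. *)
Lemma single_tangent (f1 f2 : PL -> C) (p : PL) (a c : C) : (a != 0) || (c != 0) ->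
 (\forall z \near p, differentiable f1 z) -> f1 p = 0 -> (\forall z \near p, differentiable f2 z) -> f2 p = 0 ->
 (forall v, 'd f1 p v = 0 -> 'd f2 p v = 0 -> v = 0) ->
 (forall eps : C, 0 < eps -> \forall z \near p, f1 z = 0 \/ f2 z = 0 -> `|lf a c (z - p)| <= eps * `|z - p|) -> False.
Proof.
move=> Nac D1 Z1 D2 Z2 N H.
have T1 := @tangent_not_zero_set f1 p a c D1 Z1; have T2 := @tangent_not_zero_set f2 p a c D2 Z2.
have [E1|N1] := eqVneq (a * 'd f1 p (0, 1) - c * 'd f1 p (1, 0)) 0; last first.
 by apply: T1 => // eps e0'; apply: nearS (H eps e0') => z K fz; apply: K; left.
have [E2|N2] := eqVneq (a * 'd f2 p (0, 1) - c * 'd f2 p (1, 0)) 0; last first.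
 by apply: T2 => // eps e0'; apply: nearS (H eps e0') => z K fz; apply: K; right.
have V : (- c, a) = 0 :> PL.
 by apply: N; rewrite linear_lf /lf /=; [rewrite -[RHS]E1|rewrite -[RHS]E2]; ring.
have /eqP := congr1 fst V; have /eqP := congr1 snd V; rewrite /= oppr_eq0 => /eqP a0 /eqP c0.
by move: Nac; rewrite a0 c0 eqxx.
Qed.

Lemma near_comp (T U : topologicalType) (f : T -> U) t P : {for t, continuous f} ->
 (\forall z \near f t, P z) -> \forall y \near t, P (f y).
Proof. by move=> Cf H; exact: Cf. Qed.

Lemma diff_proj1 (z : PL) : differentiable (fun y => y.1) z.
Proof.
rewrite (_ : (fun y => _) = (fun y => pev y (mx C))); first by have [] := diff_pev (mx C) z.
by apply/funext => y; rewrite pevx.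
Qed.
Lemma diff_proj2 (z : PL) : differentiable (fun y => y.2) z.
Proof.
rewrite (_ : (fun y => _) = (fun y => pev y (my C))); first by have [] := diff_pev (my C) z.
by apply/funext => y; rewrite pevy.
Qed.

Lemma norm_axis s : `|((s, 0) : PL)| = `|s|.
Proof. by rewrite prod_normE /= normr0 /Order.max; case: ifP => // /ltW; rewrite normr_le0 => /eqP ->; rewrite normr0. Qed.

(** On the cusp the first coordinate of phi is of order 3/2 in |z - p|, so its differential at p is
    the tangent form. If that were 0, the first coordinate of phi would vary too little along the
    image of the first axis under psi. *)
Lemma cusp_tangent (phi psi : PL -> PL) p : differentiable phi p -> differentiable psi 0 -> phi p = 0 -> psi 0 = p ->
 (\forall w \near (0 : PL), phi (psi w) = w) -> exists a c : C, (a != 0) || (c != 0) /\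
 forall eps : C, 0 < eps -> \forall z \near p, (phi z).1 ^+ 2 = (phi z).2 ^+ 3 -> `|lf a c (z - p)| <= eps * `|z - p|.
Proof.
move=> Dphi Dpsi phip psi0 Hinv; pose f z := (phi z).1.
have Df : differentiable f p by exact: (@differentiable_comp _ _ _ _ phi (fun y => y.1) p Dphi (diff_proj1 _)).
have fp : f p = 0 by rewrite /f phip.
exists ('d f p (1, 0)), ('d f p (0, 1)); split.
 apply: contraT; rewrite negb_or !negbK => /andP[/eqP Z1 /eqP Z2].
 have [k k0 Hk] := diff_lip Dpsi; pose eps := (2 * k)^-1.
 have ep0 : 0 < eps by rewrite invr_gt0 mulr_gt0.
 have S := diff_small Df ep0; rewrite -psi0 in S.
 have [r r0 Hr] := near_radius (nearI (nearI Hk Hinv) (near_comp (differentiable_continuous Dpsi) S)).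
 pose w : PL := (r / 2, 0).
 have r2 : 0 < r / 2 by rewrite divr_gt0.
 have nw : `|w| = r / 2 by rewrite norm_axis gtr0_norm.
 have [|[K1 K2]] := Hr w; first by rewrite subr0 nw ltr_pdivrMr // ltr_pMr // ltr1n.
 rewrite psi0 fp subr0 linear_lf Z1 Z2 /lf !mul0r addr0 subr0 /f K2 => K3.
 have : r / 2 <= eps * (k * (r / 2)).
  move: K1; rewrite subr0 psi0 nw => K1; move: K3; rewrite /= gtr0_norm // => K3.
  by apply: le_trans K3 _; rewrite ler_wpM2l // ltW.
 rewrite (mulrA eps) ler_pMl // (_ : (2 * k)^-1 * k = 2^-1); last by field; rewrite gt_eqF.
 by rewrite invf_ge1 // => /le_gtF; rewrite ltr1n.
move=> eps ep0; have ep2 : 0 < eps / 2 by rewrite divr_gt0.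
have [k k0 Hk] := diff_lip Dphi.
have k3 : 0 < k ^+ 3 by rewrite exprn_gt0.
have d0 : 0 < (eps / 2) ^+ 2 / k ^+ 3 by rewrite divr_gt0 ?exprn_gt0.
apply: nearS (nearI (nearI (diff_small Df ep2) Hk) (dist_near p d0)) => z [[K1 K2] K3] E.
rewrite -(linear_lf ('d f p)); have N1 : `|f z| <= eps / 2 * `|z - p|.
 apply: sq_le; [by []|by rewrite mulr_ge0 // ltW|rewrite -normrX E normrX].
 have [_ L2] := normPL (phi z); rewrite phip subr0 in K2.
 apply: (@le_trans _ _ ((k * `|z - p|) ^+ 3)).
  by rewrite lerXn2r ?nnegrE ?mulr_ge0 ?(ltW k0) // (le_trans L2).
 rewrite !exprMn mulrA ler_wpM2r // mulrC -ler_pdivlMr //.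
 by rewrite -exprMn; exact: ltW.
have -> : 'd f p (z - p) = f z - (f z - f p - 'd f p (z - p)) by rewrite fp; ring.
by rewrite (le_trans (ler_normB _ _)) // (splitr eps) mulrDl lerD.
Qed.

(** chi straightens the smooth curve to a horizontal line. If the second coordinate of phi has zero
    derivative along it, phi is too small there for its inverse to be Lipschitz. Otherwise that
    coordinate winds once around 0 over a small circle, and the quotient of the first by the second
    is a closed square root of it. *)
Lemma smooth_not_cusp (phi psi chi : PL -> PL) (p q : PL) : (\forall z \near p, differentiable phi z) -> differentiable psi 0 ->
 phi p = 0 -> psi 0 = p -> (\forall z \near p, psi (phi z) = z) ->
 (\forall w \near q, differentiable chi w) -> chi q = p ->
 (\forall w \near q, w.2 = q.2 -> (phi (chi w)).1 ^+ 2 = (phi (chi w)).2 ^+ 3) ->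
 (\forall w \near q, `|w.1 - q.1| <= `|chi w - p|) -> False.
Proof.
move=> Dphi Dpsi phip psi0 Hinv Dchi chiq Hcusp Hdist.
have Dphip := nbhs_singleton Dphi; have Dchiq := nbhs_singleton Dchi.
pose f w := (phi (chi w)).2.
have Df : differentiable f q.
 have Dphi' : differentiable phi (chi q) by rewrite chiq.
 have D2 := differentiable_comp Dchiq Dphi'.
 exact: (@differentiable_comp _ _ _ _ (phi \o chi) (fun y => y.2) q D2 (diff_proj2 _)).
have fq : f q = 0 by rewrite /f chiq phip.
have [k k0 Hk] := diff_lip Dpsi; have k1 : 0 < k + 1 by rewrite addr_gt0.
have B : \forall w \near q, `|chi w - p| <= k * `|phi (chi w)|.
 have B0 : \forall z \near p, `|psi (phi z) - p| <= k * `|phi z|.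
  have Hk' : \forall y \near phi p, `|psi y - p| <= k * `|y|.
   by rewrite phip; apply: nearS Hk => y; rewrite psi0 subr0.
  exact: (near_comp (differentiable_continuous Dphip) Hk').
 have B1 : \forall z \near chi q, `|z - p| <= k * `|phi z|.
  by rewrite chiq; apply: nearS (nearI B0 Hinv) => z [K E]; rewrite E in K.
 exact: (near_comp (differentiable_continuous Dchiq) B1).
have Cf : \forall w \near q, {for w, continuous (fun w => phi (chi w))}.
 have D1 : \forall z \near chi q, differentiable phi z by rewrite chiq.
 apply: nearS (nearI Dchi (near_comp (differentiable_continuous Dchiq) D1)) => w [X1 X2].
 by apply: cts_comp; exact: differentiable_continuous.
have facts := nearI (nearI B Cf) (nearI (nearI Hcusp Hdist) (dist_near q (@ltr01 C))).
pose W s : PL := (q.1 + s, q.2 + 0).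
have Wq s : W s - q = (s, 0) by rewrite -[X in X - _]/(q + (s, 0)) addrC addKr.
have Wn s : `|W s - q| = `|s| by rewrite Wq norm_axis.
have Wd s : 'd f q (W s - q) = s * 'd f q (1, 0) by rewrite Wq linear_lf /lf mulr0 addr0 mulrC.
have W2 s : (W s).2 = q.2 by rewrite /W addr0.
have W1 s : (W s).1 - q.1 = s by rewrite addrC addKr.
have [Z|N] := eqVneq ('d f q (1, 0)) 0.
 pose eps := (k + 1)^-1; have ep0 : 0 < eps by rewrite invr_gt0.
 have [r r0 Hr] := near_radius (nearI facts (diff_small Df ep0)).
 pose s := r / 2; have s0 : 0 < s by rewrite divr_gt0.
 have ns : `|s| = s by rewrite gtr0_norm.
 have [|[[K1 _] [[K2 K3] K4]] K5] := Hr (W s); first by rewrite Wn ns ltr_pdivrMr // ltr_pMr // ltr1n.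
 move: (K2 (W2 s)) K3 K4 K5; rewrite W1 Wn Wd Z mulr0 fq !subr0 ns => {}K2 K3 K4 K5.
 have ep1 : eps <= 1 by rewrite invf_le1 // lerDr ltW.
 have es0 : 0 <= eps * s by rewrite mulr_ge0 ?ltW.
 have es1 : eps * s <= 1 by rewrite (le_trans (ler_piMl (ltW s0) ep1)) // ltW.
 have N1 : `|(phi (chi (W s))).1| <= eps * s.
  apply: sq_le; [by []|by []|rewrite -normrX K2 normrX].
  apply: (@le_trans _ _ ((eps * s) ^+ 3)); first by rewrite lerXn2r.
  by rewrite exprS ler_piMl ?exprn_ge0.
 have N2 : `|phi (chi (W s))| <= eps * s by rewrite prod_normE /Order.max; case: ifP.
 have : s <= k * (eps * s) by apply: le_trans K3 _; apply: le_trans K1 _; rewrite ler_wpM2l // ltW.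
 rewrite mulrA ler_pMl // ler_pdivlMr // mul1r => L.
 by move: L; rewrite gerDl ler10.
set e' := 'd f q (1, 0) in N Wd; have n0 : 0 < `|e'| by rewrite normr_gt0.
have ep0 : 0 < `|e'| / 2 by rewrite divr_gt0.
have [r r0 Hr] := near_radius (nearI facts (diff_small Df ep0)).
pose d := r / 2; have d0 : 0 < d by rewrite divr_gt0.
pose s t := d * e t ^+ 2.
have ns t : `|s t| = d by rewrite normrM normrX e1 expr1n mulr1 gtr0_norm.
have Hs t : `|W (s t) - q| < r by rewrite Wn ns ltr_pdivrMr // ltr_pMr // ltr1n.
pose u t := phi (chi (W (s t))).
have Hu t : [/\ {for W (s t), continuous (fun w => phi (chi w))}, (u t).1 ^+ 2 = (u t).2 ^+ 3 & `|(u t).2 - s t * e'| <= `|e'| / 2 * d].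
 have [[[_ K1] [[K2 _] _]] K5] := Hr _ (Hs t); split=> //; first by apply: K2; rewrite W2.
 by move: K5; rewrite Wn Wd fq subr0 ns.
have half : `|e'| / 2 * d < `|d * e'| by rewrite normrM (gtr0_norm d0) mulrC ltr_pM2l // ltr_pdivrMr // ltr_pMr // ltr1n.
have Nu t : (u t).2 != 0.
 apply/eqP => Z; have [_ _] := Hu t; rewrite Z sub0r normrN => K.
 by move: (le_lt_trans K half); rewrite (normrM (s t)) ns (normrM d) (gtr0_norm d0) ltxx.
have Cu t : {for t, continuous u}.
 apply: (cts_comp (f := fun t => W (s t)) (g := fun w => phi (chi w))); last by have [] := Hu t.
 apply: (cts_pair (f := fun t => q.1 + s t)); last exact: ctsC.
 apply: ctsD; first exact: ctsC.
 apply: (ctsM (g := fun t => e t * e t)); first exact: ctsC.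
 by apply: ctsM; exact: Ce.
have Cu1 t : {for t, continuous (fun t => (u t).1)} by apply: (cts_comp (Cu t)); exact: cvg_fst.
have Cu2 t : {for t, continuous (fun t => (u t).2)} by apply: (cts_comp (Cu t)); exact: cvg_snd.
have Nc : d * e' != 0 by rewrite mulf_neq0 // gt_eqF.
apply: (@no_closed_root (fun t => (u t).1 * ((u t).2)^-1) (d * e')) => //.
- move=> t _; apply: (ctsM (g := fun t => ((u t).2)^-1)); first exact: Cu1.
 by apply: ctsV; [exact: Nu|exact: Cu2].
- by rewrite /u /s e0 eb sqrrN.
move=> t _; have [_ E K] := Hu t.
have -> : ((u t).1 * ((u t).2)^-1) ^+ 2 = (u t).2.
 by rewrite exprMn E exprVn exprSr mulrAC divff ?mul1r // expf_neq0.
have -> : d * e' * e t ^+ 2 = s t * e' by rewrite /s; ring.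
exact: le_lt_trans K half.
Qed.
End Parity.

(** * Tangents of plane curves and exclusion between local types *)

Section CurveTangents.
Variable C : cField.
Local Notation PL := (C * C)%type.
Local Notation P2 := (mpoly 2 C).

Lemma smooth_tangent h p : pev p h = 0 -> algsmooth h p -> exists a c : C, (a != 0) || (c != 0) /\
 forall eps : C, 0 < eps -> \forall z \near p, pev z h = 0 -> `|lf a c (z - p)| <= eps * `|z - p|.
Proof.
move=> hp Hs; have [D E] := diff_pev h p; exists (pev p (dx h)), (pev p (dy h)); split=> // eps e0.
apply: nearS (diff_small D e0) => z; rewrite E hp => H hz.
by move: H; rewrite hz subrr sub0r normrN.
Qed.

Lemma chart_facts l h (chi phi : PL -> PL) p : (forall z z', `|pev z l - pev z' l| <= `|z - z'|) ->
 pev p h = 0 -> {for Fm l h p, continuous chi} -> chi (Fm l h p) = p -> (\forall w \near Fm l h p, Fm l h (chi w) = w) ->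
 (\forall z \near p, pev z h = 0 <-> (phi z).1 ^+ 2 = (phi z).2 ^+ 3) ->
 (\forall w \near Fm l h p, w.2 = (Fm l h p).2 -> (phi (chi w)).1 ^+ 2 = (phi (chi w)).2 ^+ 3) /\
 (\forall w \near Fm l h p, `|w.1 - (Fm l h p).1| <= `|chi w - p|).
Proof.
move=> Hl hp Cchi chip Hinv HX; split.
 have HX' : \forall z \near chi (Fm l h p), pev z h = 0 <-> (phi z).1 ^+ 2 = (phi z).2 ^+ 3 by rewrite chip.
 apply: nearS (nearI Hinv (near_comp Cchi HX')) => w [E K] W; apply/K.
 by have := congr1 snd E; rewrite W /= hp.
apply: nearS Hinv => w E; have E1 : pev (chi w) l = w.1 by exact: (congr1 fst E).
by rewrite -E1; exact: Hl.
Qed.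
Lemma lip_x z z' : `|pev z (mx C) - pev z' (mx C)| <= `|z - z'|.
Proof. by rewrite !pevx; have [] := normPL (z - z'). Qed.
Lemma lip_y z z' : `|pev z (my C) - pev z' (my C)| <= `|z - z'|.
Proof. by rewrite !pevy; have [] := normPL (z - z'). Qed.
Lemma bra_x h p : pev p (bra (mx C) h) = pev p (dy h).
Proof. by rewrite /bra dxx dyx mul1r mul0r subr0. Qed.
Lemma bra_y h p : pev p (bra (my C) h) = - pev p (dx h).
Proof. by rewrite /bra dxy dyy mul1r mul0r sub0r pevN. Qed.

Lemma mcoeff_pol d (a : cidx d -> C) (m : cidx d) : mcoeff m (pol a) = a m.
Proof.
rewrite raddf_sum (bigD1 m) //= mcoeffZ mcoeffX eqxx mulr1 big1 ?addr0 // => k Hk.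
rewrite mcoeffZ mcoeffX; case: eqP => E; rewrite ?mulr0 //; case/eqP: Hk; exact: val_inj.
Qed.

Lemma coefs_pol d1 d2 (v : 'I_#|cix d1 d2| -> C) :
 @coefs C d1 d2 (pol (fun m => v (enum_rank (inl m : cix d1 d2)))) (pol (fun m => v (enum_rank (inr m : cix d1 d2)))) = v.
Proof.
apply/funext => i; rewrite /coefs; case E: (enum_val i) => [m|m]; rewrite mcoeff_pol -E enum_valK //.
Qed.
End CurveTangents.

Section Exclusion.
Variable R : realType.
Local Notation C := (Cplx R).
Local Notation P2 := (mpoly 2 C).
Definition circ (t : R) : C := mk (cos t) (sin t).
Definition ccos (t : R) : C := mk (cos t) 0.
Definition csin (t : R) : C := mk (sin t) 0.
Lemma circ_cts : continuous circ.
Proof. by move=> t; apply: mk_cts; [exact: continuous_cos|exact: continuous_sin]. Qed.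
Lemma ccos_cts : continuous ccos.
Proof. by move=> t; apply: mk_cts; [exact: continuous_cos|exact: cvg_cst]. Qed.
Lemma csin_cts : continuous csin.
Proof. by move=> t; apply: mk_cts; [exact: continuous_sin|exact: cvg_cst]. Qed.
Lemma circ0 : circ 0 = 1. Proof. by rewrite /circ cos0 sin0. Qed.
Lemma circpi : circ pi = -1.
Proof. by rewrite /circ cospi sinpi -[RHS](crN 1 : cr (-1) = - cr 1). Qed.
Lemma circ1 t : `|circ t| = 1.
Proof.
have H : `|circ t| ^+ 2 = 1 by rewrite -norm_sq cos2Dsin2.
by apply/eqP; rewrite -(@eqrXn2 _ 2) // expr1n; apply/eqP.
Qed.
Lemma csin0 : csin 0 = 0. Proof. by rewrite /csin sin0. Qed.
Lemma ccosh : ccos (pi / 2) = 0. Proof. by rewrite /ccos cos_pihalf. Qed.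
Lemma csinh : csin (pi / 2) = 1. Proof. by rewrite /csin sin_pihalf. Qed.
Lemma ccos_le1 t : `|ccos t| <= 1.
Proof. by rewrite norm_cr crle ler_norml cos_geN1 cos_le1. Qed.
Lemma csin_le1 t : `|csin t| <= 1.
Proof. by rewrite norm_cr crle ler_norml sin_geN1 sin_le1. Qed.
Lemma ccos_csin t : ccos t = 0 -> csin t = 0 -> False.
Proof.
move=> [E1] [E2]; have := cos2Dsin2 t; rewrite E1 E2 expr0n addr0 => /esym/eqP.
by rewrite oner_eq0.
Qed.
Lemma pih_ge0 : (0 : R) <= pi / 2. Proof. by rewrite divr_ge0 // pi_ge0. Qed.

Definition single_tangentR := @single_tangent R C circ pi (pi_ge0 R) circ_cts circ0 circpi circ1 ccos csin (pi / 2)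
 pih_ge0 ccos_cts csin_cts csin0 ccosh csinh ccos_le1 csin_le1 ccos_csin.
Definition smooth_not_cuspR := @smooth_not_cusp R C circ pi (pi_ge0 R) circ_cts circ0 circpi circ1.

Lemma tangent_not_node (X : set (plane R)) (p : plane R) (a c : C) : (a != 0) || (c != 0) ->
 (forall eps : C, 0 < eps -> \forall z \near p, X z -> `|lf a c (z - p)| <= eps * `|z - p|) -> ~ node X p.
Proof.
move=> Nac H [B1 [B2 [f1 [f2 [[D1 Z1 _ Y1] [D2 Z2 _ Y2] N HX]]]]].
apply: (@single_tangentR f1 f2 p a c Nac D1 Z1 D2 Z2 N) => eps e0.
apply: nearS (nearI (nearI (H eps e0) HX) (nearI Y1 Y2)) => z [[K1 K2] [K3 K4]] K5.
by apply: K1; apply/K2; case: K5 => K5; [left; apply/K3|right; apply/K4].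
Qed.

Lemma cusp_not_node (X : set (plane R)) p : cusp X p -> ~ node X p.
Proof.
move=> [phi [psi [[D1 D2] [E1 E2] I1 I2 HX]]].
have [a [c [Nac H]]] := cusp_tangent (nbhs_singleton D1) (nbhs_singleton D2) E1 E2 I2.
apply: (tangent_not_node Nac) => eps e0.
by apply: nearS (nearI (H eps e0) HX) => z [K1 K2] Xz; apply: K1; apply/K2.
Qed.

Section Curve.
Variables (h : P2) (X : set (plane R)) (p : plane R).
Hypothesis EX : X = [set p | pev p h = 0].

Lemma algsmooth_not_node : pev p h = 0 -> algsmooth h p -> ~ node X p.
Proof.
move=> hp Hs; have [a [c [Nac H]]] := smooth_tangent hp Hs; apply: (tangent_not_node Nac) => eps e0.
by rewrite EX; exact: H.
Qed.

Lemma algsmooth_not_cusp : pev p h = 0 -> algsmooth h p -> ~ cusp X p.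
Proof.
move=> hp Hs [phi [psi [[D1 D2] [E1 E2] I1 I2]]]; rewrite EX => HX.
(* l is a coordinate function independent of h at p, so (l, h) is a chart in which the curve is
   horizontal. *)
have main l : (forall z z', `|pev z l - pev z' l| <= `|z - z'|) -> pev p (bra l h) != 0 -> False.
 move=> Hl /inverse_map[chi [P1 P2 _ P4 P5]].
 have [F1 F2] := @chart_facts C l h chi phi p Hl hp P5 P1 P2 HX.
 exact: (@smooth_not_cuspR phi psi chi p (Fm l h p) D1 (nbhs_singleton D2) E1 E2 I1 P4 P1 F1 F2).
case/orP: Hs => N; [apply: (main (my C) (@lip_y C))|apply: (main (mx C) (@lip_x C))].
 by rewrite bra_y oppr_eq0.
by rewrite bra_x.
Qed.
End Curve.
End Exclusion.

Lemma card_uniq_seq (T : choiceType) (s : seq T) : uniq s -> ([set` s] #= `I_(size s))%card.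
Proof.
elim: s => [|x s IH] /=.
 by move=> _; rewrite (_ : [set` _] = set0) ?II0 //; apply/seteqP; split.
move=> /andP[xs Us]; apply/eq_cardSP; exists x; first exact: mem_head.
rewrite (_ : _ `\ x = [set` s]); first exact: IH.
apply/seteqP; split=> y /=; rewrite inE.
 by move=> [/orP[/eqP ->|//]] /(_ erefl).
by move=> ys; rewrite ys orbT; split=> // E; move: xs; rewrite -E ys.
Qed.

(** * From polynomial data to the geometry of the discriminant *)

Section CurveClassification.
Variable R : realType.
Local Notation C := (Cplx R).

Lemma near_mem (p : plane R) P : (\forall z \near p, P z) -> P p.
Proof. exact: nbhs_singleton. Qed.

Lemma node_mem (X : set (plane R)) p : node X p -> X p.
Proof.
move=> [B1 [B2 [f1 [f2 [[_ Z1 _ Y1] _ _ HX]]]]].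
by apply/(near_mem HX); left; apply/(near_mem Y1).
Qed.
Lemma cusp_mem (X : set (plane R)) p : cusp X p -> X p.
Proof.
move=> [phi [psi [_ [E1 _] _ _ HX]]]; apply/(near_mem HX); rewrite E1 /= !expr0n //.
Qed.

Variables (d1 d2 : nat) (F : polymap R).
Hypothesis HF : @discriminant_data C d1 d2 F.1 F.2.
Local Notation D := (discriminant F).

Lemma discriminant_geometry : [/\ plane_curve D,
 (forall p, D p -> ~ smooth_point D p -> cusp D p \/ node D p),
 (exists c, ([set p | cusp D p] #= `I_c)%card /\ (c%:R : rat) = cusp_number d1 d2) &
 (exists n, ([set p | node D p] #= `I_n)%card /\ (n%:R : rat) = node_number d1 d2)].
Proof.
have [h [cl [nl [[h0 HD Uc Un] [Sc Sn Hc Hn Hs]]]]] := HF.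
have ED : D = [set p | pev p h = 0].
 apply/seteqP; split=> P /=.
  by move=> [p Hp <-]; apply/HD; exists p.
 by move=> /HD[p Hp <-]; exists p.
have HC p : p \in cl -> cusp D p by move=> /Hc; exact: alg_cusp.
have HN p : p \in nl -> node D p by move=> /Hn; exact: alg_node.
have memD p : D p -> pev p h = 0 by rewrite ED.
(* The list is complete: a point of the curve outside it is a node or an algebraically smooth point,
   and neither is a cusp. *)
have EC : [set p | cusp D p] = [set` cl].
 apply/seteqP; split=> p /=; last exact: HC.
 move=> Cp; apply: contraT => Np; have hp := memD _ (cusp_mem Cp).
 have [pn|pn] := boolP (p \in nl); first by case: (cusp_not_node Cp (HN _ pn)).
 by case: (algsmooth_not_cusp ED hp (Hs _ hp Np pn) Cp).
have EN : [set p | node D p] = [set` nl].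
 apply/seteqP; split=> p /=; last exact: HN.
 move=> Cp; apply: contraT => Np; have hp := memD _ (node_mem Cp).
 have [pn|pn] := boolP (p \in cl); first by case: (cusp_not_node (HC _ pn) Cp).
 by case: (algsmooth_not_node ED hp (Hs _ hp pn Np) Cp).
split.
- by exists h; split.
- move=> p /memD hp Ns; have [pc|pc] := boolP (p \in cl); first by left; exact: HC.
 have [pn|pn] := boolP (p \in nl); first by right; exact: HN.
 by case: Ns; exact: (smooth_alg ED hp (Hs _ hp pc pn)).
- by exists (size cl); rewrite EC; split; [exact: card_uniq_seq|exact: Sc].
by exists (size nl); rewrite EN; split; [exact: card_uniq_seq|exact: Sn].
Qed.
End CurveClassification.

Theorem theorem4p8 (R : realType) (d1 d2 : nat) (hd1 : (1 <= d1)%N)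
    (hd2 : (1 <= d2)%N) :
  exists U : set (polymap R),
    [/\ zariski_open d1 d2 U,
        zariski_dense d1 d2 U &
        forall F : polymap R, U F ->
          [/\ plane_curve (discriminant F),
              (forall p, discriminant F p -> ~ smooth_point (discriminant F) p ->
                 cusp (discriminant F) p \/ node (discriminant F) p),
              (exists c : nat,
                 ([set p | cusp (discriminant F) p] #= `I_c)%card
                 /\ (c%:R : rat) = cusp_number d1 d2) &
              (exists n : nat,
                 ([set p | node (discriminant F) p] #= `I_n)%card
                 /\ (n%:R : rat) = node_number d1 d2)]].
Proof.
have [P P0 HP] := generic_discriminant (Cplx R) hd1 hd2.
pose cv F := @coef_vector R d1 d2 F.
exists [set F | Omega2 d1 d2 F /\ meval (cv F) P != 0]; split.
- split; first by move=> F [].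
 exists [set P]; apply/seteqP; split=> F /=.
  move=> [HF N]; split=> // Q ->; apply/eqP; apply: contraPT N => N; apply; split=> //.
 by move=> [HF N]; split=> // -[_]; rewrite N // eqxx.
- move=> W [WO [S ES]] [F0 WF0].
 have [Q SQ NQ] : exists2 Q, S Q & meval (cv F0) Q != 0.
  apply: contrapT => N; have : (Omega2 d1 d2 `\` W) F0.
   rewrite ES; split; first exact: WO.
   by move=> Q SQ; apply: contrapT => /eqP NQ; apply: N; exists Q.
  by case.
 have Q0 : Q != 0 by apply: contraNneq NQ => ->; rewrite meval0.
 (* A point where P Q does not vanish gives the coefficients of a mapping that lies in both open
    sets. *)
 have [v Nv] := mpoly_nonroot (mulf_neq0 P0 Q0).
 pose F : polymap R := (pol (fun m => v (enum_rank (inl m : cix d1 d2))), pol (fun m => v (enum_rank (inr m : cix d1 d2)))).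
 have EF : cv F = v by exact: coefs_pol.
 have OF : Omega2 d1 d2 F by split; apply/dgl_msize; exact: dgl_pol.
 move: Nv; rewrite -EF mevalM mulf_eq0 negb_or => /andP[NP NQ'].
 exists F; split; first by split.
 apply: contrapT => NW; have : (Omega2 d1 d2 `\` W) F by split.
 by rewrite ES => -[_ /(_ Q SQ)] Z; move: NQ'; rewrite Z eqxx.
move=> F [[Hf Hg] N]; apply: discriminant_geometry; apply: contrapT => NF.
move: N; rewrite (_ : meval _ _ = 0) ?eqxx //.
by apply: (HP F.1 F.2 _ _ NF); apply/dgl_msize.
Qed.
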